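(* Let $N$ be a lattice, $Y$ a normal semiprojective variety, and let $\mathcal{S}=\{\mathcal{D}^i;\ i\in I\}$ be a divisorial fan on $(Y,N)$. Put $X_i:=X(\mathcal{D}^i)$, let $\eta_{ij}\colon X(\mathcal{D}^i\cap\mathcal{D}^j)\to X_i$ and $\eta_{ji}\colon X(\mathcal{D}^i\cap\mathcal{D}^j)\to X_j$ be the canonical $T$-equivariant open embeddings, let $X_{ij}:=\eta_{ij}(X(\mathcal{D}^i\cap\mathcal{D}^j))\subseteq X_i$, and let $\varphi_{ij}:=\eta_{ji}\circ\eta_{ij}^{-1}\colon X_{ij}\to X_{ji}$. Then the affine $T$-varieties $X_i$ and the isomorphisms $\varphi_{ij}\colon X_{ij}\to X_{ji}$ are gluing data. The resulting space $$X:=X(\mathcal{S}):=\bigsqcup_{i\in I} X_i\big/\!\sim,\qquad\text{where } X_{ij}\ni x\sim\varphi_{ij}(x)\in X_{ji},$$ is a prevariety with affine diagonal $X\to X\times X$, and it comes with a (unique) $T$-action such that all canonical maps $X_i\to X$ are equivariant.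
   Context: Basic notions. $\mathbb{K}$ is an algebraically closed field; varieties are over $\mathbb{K}$, points are closed points. $N$ is a lattice (finitely generated free abelian group), $M=\mathrm{Hom}(N,\mathbb{Z})$, $N_{\mathbb{Q}}=\mathbb{Q}\otimes N$, $M_{\mathbb{Q}}=\mathbb{Q}\otimes M$, $T=\mathrm{Spec}\,\mathbb{K}[M]$. A variety is semiprojective if it is projective over some affine variety. For a pointed convex polyhedral cone $\sigma\subseteq N_{\mathbb{Q}}$, a $\sigma$-polyhedron is a convex polyhedron in $N_{\mathbb{Q}}$ with tail (recession) cone $\sigma$; these form a semigroup $\mathrm{Pol}^+_\sigma(N)$ under Minkowski addition (neutral element $\sigma$), with Grothendieck group $\mathrm{Pol}_\sigma(N)$. A polyhedral divisor on a normal variety $Y$ with tail cone $\sigma$ is an element of $\mathrm{Pol}_\sigma(N)\otimes_{\mathbb{Z}}\mathrm{WDiv}(Y)$. For $\mathcal{D}=\sum\Delta_D\otimes D$ with $D$ prime and $\Delta_D\in\mathrm{Pol}^+_\sigma(N)$ (all but finitely many $\Delta_D$ equal to $\sigma$), and $u\in\sigma^\vee\subseteq M_{\mathbb{Q}}$, set $\mathcal{D}(u)=\sum\min_{v\in\Delta_D}\langle u,v\rangle\,D\in\mathrm{WDiv}_{\mathbb{Q}}(Y)$. A pp-divisor is a polyhedral divisor $\mathcal{D}$ such that (1) $\mathcal{D}=\sum\Delta_D\otimes D$ for some effective divisors $D\in\mathrm{WDiv}_{\mathbb{Q}}(Y)$ and $\Delta_D\in\mathrm{Pol}_\sigma^+(N)$;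 (2) each $\mathcal{D}(u)$, $u\in\sigma^\vee$, is a semiample $\mathbb{Q}$-Cartier divisor (has a base point free multiple); (3) for $u$ in the relative interior of $\sigma^\vee$, some multiple of $\mathcal{D}(u)$ is big, i.e. admits a section with affine complement. $\mathrm{PPDiv}_{\mathbb{Q}}(Y,\sigma)$ is the set of pp-divisors with tail cone $\sigma$. Empty coefficients. $\emptyset$ is also allowed as a coefficient, with $\emptyset+\Delta:=\emptyset$, $0\cdot\emptyset:=\sigma$. In that case one requires that $\bigcup_{\Delta_D=\emptyset}\mathrm{supp}\,D$ is the support of an effective semiample divisor, and $\mathcal{D}\in\mathrm{PPDiv}_{\mathbb{Q}}(Y,\sigma)$ means that the restriction of $\mathcal{D}$ to $\mathrm{Loc}(\mathcal{D}):=Y\setminus\bigcup_{\Delta_D=\emptyset}\mathrm{supp}\,D$ is a pp-divisor on $\mathrm{Loc}(\mathcal{D})$; evaluations $\mathcal{D}(u)$ and linear systems are taken on $\mathrm{Loc}(\mathcal{D})$. Associated variety. $X(\mathcal{D}):=\mathrm{Spec}\,A$ with $A:=\bigoplus_{u\in M\cap\sigma^\vee}\Gamma(\mathrm{Loc}(\mathcal{D}),\mathcal{O}(\mathcal{D}(u)))$; it is a normal affine variety on which $T$ acts effectively via the grading. If $\mathcal{D}',\mathcal{D}$ are pp-divisors on $Y$ with $\Delta'_D\subseteq\Delta_D$ for all prime $D$, then $\mathcal{D}(u)\le\mathcal{D}'(u)$ on $\mathrm{Loc}(\mathcal{D}')\subseteq\mathrm{Loc}(\mathcal{D})$ for $u\in\sigma^\vee\subseteq(\sigma')^\vee$,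 which yields a graded inclusion of algebras and the canonical $T$-equivariant morphism $X(\mathcal{D}')\to X(\mathcal{D})$. Faces. For $y\in Y$ the fiber polyhedron is $\Delta_y:=\sum_{D\ni y}\Delta_D$ (Minkowski sum over prime divisors; $\sigma$ if the sum is empty). For a polyhedron $\Delta$ and $w\in\sigma^\vee$, $\mathrm{face}(\Delta,w):=\{v\in\Delta;\ \langle w,v\rangle\le\langle w,v'\rangle\ \forall v'\in\Delta\}$. For pp-divisors $\mathcal{D}'=\sum\Delta'_D\otimes D\in\mathrm{PPDiv}_{\mathbb{Q}}(Y,\sigma')$ and $\mathcal{D}=\sum\Delta_D\otimes D\in\mathrm{PPDiv}_{\mathbb{Q}}(Y,\sigma)$ on $Y$, $\mathcal{D}'$ is a face of $\mathcal{D}$ if $\Delta'_D\subseteq\Delta_D$ for all $D$ and for any $y\in\mathrm{Loc}(\mathcal{D}')$ there are $w_y\in\sigma^\vee\cap M$ and $D_y\in|\mathcal{D}(w_y)|$ (effective divisors $\mathrm{div}(f)+\mathcal{D}(w_y)$, $f$ a nonzero rational function) with (i) $y\notin\mathrm{supp}(D_y)$; (ii) $\Delta'_y=\mathrm{face}(\Delta_y,w_y)$; (iii) $\mathrm{face}(\Delta'_v,w_y)=\mathrm{face}(\Delta_v,w_y)$ for every $v\in Y\setminus\mathrm{supp}(D_y)$. In this case the canonical morphism $X(\mathcal{D}')\to X(\mathcal{D})$ is an open embedding. Divisorial fan. $\mathcal{D}'\cap\mathcal{D}:=\sum(\Delta'_D\cap\Delta_D)\otimes D$. A divisorial fan on $(Y,N)$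 is a set $\mathcal{S}$ of pp-divisors $\mathcal{D}\in\mathrm{PPDiv}_{\mathbb{Q}}(Y,\sigma_{\mathcal{D}})$ with tail cones $\sigma_{\mathcal{D}}\subseteq N_{\mathbb{Q}}$ such that for any two $\mathcal{D}',\mathcal{D}\in\mathcal{S}$ the intersection $\mathcal{D}'\cap\mathcal{D}$ is a face of both $\mathcal{D}'$ and $\mathcal{D}$ and belongs to $\mathcal{S}$. Being gluing data means $\varphi_{ij}(X_{ij}\cap X_{ik})=X_{ji}\cap X_{jk}$ and $\varphi_{ik}=\varphi_{jk}\circ\varphi_{ij}$ on $X_{ij}\cap X_{ik}$. *)

(* Defs.v *)
Set Warnings "-notation-overridden,-ambiguous-paths,-notation-incompatible-prefix".
From HB Require Import structures.
From Stdlib Require Import Relation_Operators.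
From mathcomp Require Import all_boot all_order all_algebra.
From mathcomp Require Import all_classical.
From mathcomp Require Import reals topology.
Set Implicit Arguments.
Unset Strict Implicit.
Unset Printing Implicit Defensive.
Import Order.TTheory GRing.Theory Num.Theory.
Local Open Scope classical_set_scope.
Local Open Scope ring_scope.

(* Spaces with functions (in the sense of Kempf, "Algebraic Varieties"): a      *)
(* topological space with a sheaf of K-algebras of K-valued functions such      *)
(* that the nonvanishing locus of a regular function is open and the inverse    *)
(* is regular there.  The functions regular on an open set U are represented    *)
(* by total functions whose values outside U are irrelevant.                    *)

Record is_sheaf (K : fieldType) (X : topologicalType)
    (reg : set X -> set (X -> K)) : Prop := IsSheaf {
  sheaf_glue : forall (U : set X) (f : X -> K), open U ->
    (forall x, U x -> exists V g, [/\ open V, V x, reg V g &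
                                forall y, U y -> V y -> f y = g y]) ->
    reg U f;
  sheaf_cst : forall (U : set X) (c : K), open U -> reg U (fun=> c);
  sheaf_add : forall (U : set X) (f g : X -> K), open U ->
    reg U f -> reg U g -> reg U (fun x => f x + g x);
  sheaf_mul : forall (U : set X) (f g : X -> K), open U ->
    reg U f -> reg U g -> reg U (fun x => f x * g x);
  sheaf_nz : forall (U : set X) (f : X -> K), open U ->
    reg U f -> open (U `&` [set x | f x != 0]);
  sheaf_inv : forall (U : set X) (f : X -> K), open U ->
    reg U f -> reg (U `&` [set x | f x != 0]) (fun x => (f x)^-1)
}.

Record fspace (K : fieldType) := Space {
  space_top :> topologicalType;
  reg : set space_top -> set (space_top -> K);
  space_sheaf : is_sheaf reg
}.
Arguments reg {K _}.

Section SheafTheory.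
Context (K : fieldType) (X : fspace K).
Implicit Types (U V : set X) (f g : X -> K).

Lemma reg_res U V f : open U -> open V -> U `<=` V -> reg V f -> reg U f.
Proof.
move=> oU oV UV rf; apply: (sheaf_glue (space_sheaf X)) => // x Ux.
by exists V, f; split=> //; exact: UV.
Qed.

Lemma reg_eq U f g : open U -> (forall x, U x -> f x = g x) ->
  reg U g -> reg U f.
Proof.
move=> oU fg rg; apply: (sheaf_glue (space_sheaf X)) => // x Ux.
by exists U, g; split=> // y Uy _; exact: fg.
Qed.

Lemma reg_opp U f : open U -> reg U f -> reg U (fun x => - f x).
Proof.
move=> oU rf; apply: (@reg_eq _ _ (fun x => -1 * f x)) => //.
  by move=> x _; rewrite mulN1r.
exact: (sheaf_mul (space_sheaf X) oU (sheaf_cst (space_sheaf X) (-1) oU) rf).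
Qed.

End SheafTheory.

(* The space on a set P generated by functions: [dom] is a family of subsets    *)
(* of P covering P and [gens W] are K-valued functions, considered on W.  Basic *)
(* open sets are the {x in W | b x != 0}, W in dom, b in the K-algebra generated *)
(* by gens W; the regular functions are locally fractions a / b of elements of  *)
(* such an algebra.                                                             *)

Inductive subalg (K : fieldType) (P : Type) (G : set (P -> K)) : set (P -> K) :=
| subalg_gen f of G f : subalg G f
| subalg_cst c : subalg G (fun=> c)
| subalg_add f g of subalg G f & subalg G g : subalg G (fun x => f x + g x)
| subalg_mul f g of subalg G f & subalg G g : subalg G (fun x => f x * g x).

Record gens_data (K : fieldType) (P : Type) := GensData {
  gdom : set (set P);
  gens : set P -> set (P -> K);
  gdom_cover : forall x, exists2 W, gdom W & W x;
  gdomI : forall W W', gdom W -> gdom W' -> gdom (W `&` W');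
  gensI : forall W W' f, gdom W -> gdom W' -> gens W f -> gens (W `&` W') f
}.

Definition gen_carrier (K : fieldType) (P : Type) (G : gens_data K P) : Type := P.

Section GenSpace.
Context (K : fieldType) (P : Type) (G : gens_data K P).
Local Notation alg W := (subalg (gens G W)).

Lemma algI W W' f : gdom G W -> gdom G W' -> alg W f -> alg (W `&` W') f.
Proof.
move=> dW dW'; elim=> [g gg|c|g h _ ag _ ah|g h _ ag _ ah].
- exact/subalg_gen/gensI.
- exact: subalg_cst.
- exact: subalg_add.
- exact: subalg_mul.
Qed.

Lemma algIr W W' f : gdom G W -> gdom G W' -> alg W' f -> alg (W `&` W') f.
Proof. by move=> dW dW'; rewrite setIC; exact: algI. Qed.

Definition gen_open : set (set P) := [set U | forall x, U x ->
  exists W b, [/\ gdom G W, alg W b, W x, b x != 0 &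
                  forall y, W y -> b y != 0 -> U y]].

Lemma gen_openT : gen_open setT.
Proof.
move=> x _; have [W dW Wx] := gdom_cover G x.
by exists W, (fun=> 1); split=> //; [exact: subalg_cst | exact: oner_neq0].
Qed.

Lemma gen_openI : setI_closed gen_open.
Proof.
move=> U V oU oV x [/oU[W [b [dW ab Wx bx WU]]] /oV[W' [b' [dW' ab' Wx' bx' WV]]]].
exists (W `&` W'), (fun y => b y * b' y); split=> //.
- exact: gdomI.
- by apply: subalg_mul; [exact: algI | exact: algIr].
- by rewrite mulf_neq0.
- move=> y [Wy W'y]; rewrite mulf_eq0 negb_or => /andP[by0 b'y0].
  by split; [exact: WU | exact: WV].
Qed.

Lemma gen_open_bigU (I : Type) (f : I -> set P) :
  (forall i, gen_open (f i)) -> gen_open (\bigcup_i f i).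
Proof.
move=> oF x [i _ /(oF i)[W [b [dW ab Wx bx WU]]]].
by exists W, b; split=> // y Wy by0; exists i => //; exact: WU.
Qed.

HB.instance Definition _ := gen_eqMixin (gen_carrier G).
HB.instance Definition _ := gen_choiceMixin (gen_carrier G).
HB.instance Definition _ := isOpenTopological.Build (gen_carrier G)
  gen_openT gen_openI gen_open_bigU.

Definition gen_reg (U : set (gen_carrier G)) : set (gen_carrier G -> K) :=
  [set f | forall x, U x -> exists W a b,
     [/\ gdom G W, alg W a, alg W b, W x & b x != 0 /\
         forall y, U y -> W y -> b y != 0 -> f y = a y / b y]].

Lemma gen_sheaf : is_sheaf gen_reg.
Proof.
split.
- move=> U f oU fP x Ux; have [V [g [oV Vx rg fg]]] := fP x Ux.
  have [W [a [b [dW aa ab Wx [bx gE]]]]] := rg x Vx.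
  have [W' [c [dW' ac W'x cx W'V]]] := oV x Vx.
  exists (W `&` W'), (fun y => a y * c y), (fun y => b y * c y); split.
  + exact: gdomI.
  + by apply: subalg_mul; [exact: algI | exact: algIr].
  + by apply: subalg_mul; [exact: algI | exact: algIr].
  + by split.
  + rewrite mulf_neq0//; split=> // y Uy [Wy W'y].
    rewrite mulf_eq0 negb_or => /andP[by0 cy0].
    have Vy : V y by exact: W'V.
    by rewrite fg// gE// -mulf_div divff// mulr1.
- move=> U c oU x Ux; have [W dW Wx] := gdom_cover G x.
  exists W, (fun=> c), (fun=> 1); split=> //; try exact: subalg_cst.
  by rewrite oner_neq0; split=> // y _ _ _; rewrite divr1.
- move=> U f g oU rf rg x Ux.
  have [W [a [b [dW aa ab Wx [bx fE]]]]] := rf x Ux.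
  have [W' [a' [b' [dW' aa' ab' W'x [b'x gE]]]]] := rg x Ux.
  exists (W `&` W'), (fun y => a y * b' y + a' y * b y), (fun y => b y * b' y).
  split.
  + exact: gdomI.
  + by apply: subalg_add; apply: subalg_mul; do ?[exact: algI | exact: algIr].
  + by apply: subalg_mul; [exact: algI | exact: algIr].
  + by split.
  + rewrite mulf_neq0//; split=> // y Uy [Wy W'y].
    rewrite mulf_eq0 negb_or => /andP[by0 b'y0].
    by rewrite fE// gE// addf_div.
- move=> U f g oU rf rg x Ux.
  have [W [a [b [dW aa ab Wx [bx fE]]]]] := rf x Ux.
  have [W' [a' [b' [dW' aa' ab' W'x [b'x gE]]]]] := rg x Ux.
  exists (W `&` W'), (fun y => a y * a' y), (fun y => b y * b' y).
  split.
  + exact: gdomI.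
  + by apply: subalg_mul; do ?[exact: algI | exact: algIr].
  + by apply: subalg_mul; [exact: algI | exact: algIr].
  + by split.
  + rewrite mulf_neq0//; split=> // y Uy [Wy W'y].
    rewrite mulf_eq0 negb_or => /andP[by0 b'y0].
    by rewrite fE// gE// mulf_div.
- move=> U f oU rf.
  suff : gen_open (U `&` [set x | f x != 0]) by [].
  move=> x [Ux /= fx].
  have [W [a [b [dW aa ab Wx [bx fE]]]]] := rf x Ux.
  have [W' [c [dW' ac W'x cx W'U]]] := oU x Ux.
  have ax : a x != 0.
    by move: fx; rewrite fE// mulf_eq0 negb_or => /andP[].
  exists (W `&` W'), (fun y => a y * b y * c y); split.
  + exact: gdomI.
  + by do 2?[apply: subalg_mul]; do ?[exact: algI | exact: algIr].
  + by split.
  + by rewrite !mulf_neq0.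
  + move=> y [Wy W'y]; rewrite !mulf_eq0 !negb_or => /andP[/andP[ay by0] cy].
    have Uy : U y by exact: W'U.
    by split=> //=; rewrite fE// mulf_neq0// invr_eq0.
- move=> U f oU rf x [Ux /= fx].
  have [W [a [b [dW aa ab Wx [bx fE]]]]] := rf x Ux.
  have ax : a x != 0.
    by move: fx; rewrite fE// mulf_eq0 negb_or => /andP[].
  exists W, (fun y => b y * b y), (fun y => a y * b y); split=> //.
  + exact: subalg_mul.
  + exact: subalg_mul.
  + rewrite mulf_neq0//; split=> // y [Uy _] Wy.
    rewrite mulf_eq0 negb_or => /andP[ay by0].
    by rewrite fE// invf_div -mulf_div divff// mulr1.
Qed.

Definition gen_space : fspace K := Space gen_sheaf.

End GenSpace.

(* The case where all functions are global: Zariski topology. *)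
Section Zariski.
Context (K : fieldType) (P : Type) (F : set (P -> K)).

Definition zariski_gens : gens_data K P.
Proof.
exists [set setT] (fun=> F).
- by move=> x; exists setT.
- by move=> W W' -> ->; rewrite setIT.
- by [].
Defined.

Definition zariski : fspace K := gen_space zariski_gens.

End Zariski.

Definition affsp (K : fieldType) (n : nat) : fspace K :=
  @zariski K 'rV[K]_n (range (fun (i : 'I_n) (x : 'rV[K]_n) => x 0 i)).

Section ProductSpace.
Context (K : fieldType) (X Y : fspace K).

Definition prod_gens : gens_data K (X * Y).
Proof.
exists [set W | exists U V, [/\ open U, open V & W = U `*` V]]
  (fun W => [set f | exists U V, [/\ open U, open V, W = U `*` V &
      (exists2 g, reg U g & f = g \o fst) \/
      (exists2 h, reg V h & f = h \o snd)]]).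
- move=> p; exists setT => //; exists setT, setT; split; try exact: openT.
  by rewrite setXTT.
- move=> _ _ [U [V [oU oV ->]]] [U' [V' [oU' oV' ->]]].
  by exists (U `&` U'), (V `&` V'); split; [exact: openI|exact: openI|rewrite setXI].
- move=> _ _ f _ [U' [V' [oU' oV' ->]]] [U [V [oU oV -> fP]]].
  exists (U `&` U'), (V `&` V').
  split; [exact: openI|exact: openI|by rewrite setXI|].
  case: fP => -[g rg ->]; [left|right]; exists g => //.
  + by apply: (reg_res _ oU) => //; exact: openI.
  + by apply: (reg_res _ oV) => //; exact: openI.
Defined.

Definition prod_space : fspace K := gen_space prod_gens.

Definition pr1 : prod_space -> X := fst.
Definition pr2 : prod_space -> Y := snd.

End ProductSpace.

Section Subspace.
Context (K : fieldType) (X : fspace K) (A : set X).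

Definition sub_reg (U : set A) : set (A -> K) :=
  [set f | forall x, U x -> exists V g,
     [/\ open V, V (val x), reg V g & forall y, U y -> V (val y) -> f y = g (val y)]].

Lemma sub_sheaf : is_sheaf sub_reg.
Proof.
split.
- move=> U f oU fP x Ux; have [V [g [oV Vx rg fg]]] := fP x Ux.
  have [W [h [oW Wx rh gh]]] := rg x Vx.
  case: oV Vx fg gh => V' oV' <- /= Vx fg gh.
  exists (W `&` V'), h; split=> //; first exact: openI.
    by apply: (reg_res _ oW) => //; exact: openI.
  by move=> y Uy [Wy Vy]; rewrite fg// gh.
- move=> U c oU x Ux; exists setT, (fun=> c); split=> //; first exact: openT.
  exact: (sheaf_cst (space_sheaf X) _ openT).
- move=> U f g oU rf rg x Ux.
  have [V [f' [oV Vx rf' fE]]] := rf x Ux.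
  have [W [g' [oW Wx rg' gE]]] := rg x Ux.
  have oVW : open (V `&` W) by exact: openI.
  exists (V `&` W), (fun x => f' x + g' x); split=> //.
    apply: (sheaf_add (space_sheaf X)) => //; first exact: reg_res rf'.
    exact: reg_res rg'.
  by move=> y Uy [Vy Wy]; rewrite fE// gE.
- move=> U f g oU rf rg x Ux.
  have [V [f' [oV Vx rf' fE]]] := rf x Ux.
  have [W [g' [oW Wx rg' gE]]] := rg x Ux.
  have oVW : open (V `&` W) by exact: openI.
  exists (V `&` W), (fun x => f' x * g' x); split=> //.
    apply: (sheaf_mul (space_sheaf X)) => //; first exact: reg_res rf'.
    exact: reg_res rg'.
  by move=> y Uy [Vy Wy]; rewrite fE// gE.
- move=> U f [U' oU' UE] rf; rewrite openE => x [Ux /= fx].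
  have [V [g [oV Vx rg fE]]] := rf x Ux.
  have oW := sheaf_nz (space_sheaf X) oV rg.
  rewrite /interior nbhsE /=.
  exists (val @^-1` (U' `&` (V `&` [set x | g x != 0]))).
    split; first by eexists; [apply: openI; [exact: oU'|exact: oW]|].
    split; first by move: Ux; rewrite -UE.
    by split=> //=; rewrite -fE.
  move=> y [/= U'y [Vy gy]].
  have Uy : U y by rewrite -UE.
  by split=> //=; rewrite fE.
- move=> U f oU rf x [Ux /= fx].
  have [V [g [oV Vx rg fE]]] := rf x Ux.
  have oW := sheaf_nz (space_sheaf X) oV rg.
  exists (V `&` [set x | g x != 0]), (fun x => (g x)^-1); split=> //.
  + by split=> //=; rewrite -fE.
  + exact: (sheaf_inv (space_sheaf X) oV rg).
  + by move=> y [Uy _] [Vy _]; rewrite fE.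
Qed.

Definition subsp : fspace K := Space sub_sheaf.

End Subspace.

Section Coproduct.
Context (K : fieldType) (I : Type) (X : I -> fspace K).

Definition coprod_carrier : topologicalType := {i : {classic I} & X i}.

Definition coprod_in (i : I) (x : X i) : coprod_carrier :=
  existT (fun i : {classic I} => X i : Type) i x.

Definition coprod_reg (U : set coprod_carrier) : set (coprod_carrier -> K) :=
  [set f : coprod_carrier -> K |
    forall i : I, reg (@coprod_in i @^-1` U) (f \o @coprod_in i)].

Lemma coprod_sheaf : is_sheaf coprod_reg.
Proof.
split.
- move=> U f /sigT_openP oU fP i; apply: (sheaf_glue (space_sheaf _)) => [|x Ux].
    exact: oU.
  have [V [g [/sigT_openP oV Vx rg fg]]] := fP _ Ux.
  exists (@coprod_in i @^-1` V), (g \o @coprod_in i).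
  by split=> // y Uy Vy; exact: fg.
- move=> U c /sigT_openP oU i; exact: (sheaf_cst (space_sheaf (X i))).
- move=> U f g /sigT_openP oU rf rg i.
  exact: (sheaf_add (space_sheaf (X i)) (oU i) (rf i) (rg i)).
- move=> U f g /sigT_openP oU rf rg i.
  exact: (sheaf_mul (space_sheaf (X i)) (oU i) (rf i) (rg i)).
- move=> U f /sigT_openP oU rf; apply/sigT_openP => i.
  exact: (sheaf_nz (space_sheaf (X i)) (oU i) (rf i)).
- move=> U f /sigT_openP oU rf i.
  exact: (sheaf_inv (space_sheaf (X i)) (oU i) (rf i)).
Qed.

Definition coprod : fspace K := Space coprod_sheaf.

End Coproduct.

(* Quotient by the equivalence relation generated by R. *)
Section Quotient.
Local Open Scope quotient_scope.
Context (K : fieldType) (X : fspace K) (R : X -> X -> Prop).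

Definition gen_equiv (x y : X) : bool := `[< clos_refl_sym_trans X R x y >].

Lemma gen_equivP : equiv_class_of gen_equiv.
Proof.
split=> [x|x y|y x z].
- exact/asboolP/rst_refl.
- by apply/asboolP/asboolP => ?; exact: rst_sym.
- by move=> /asboolP xy /asboolP yz; apply/asboolP; exact: rst_trans yz.
Qed.

Canonical gen_equiv_rel := EquivRelPack gen_equivP.

Definition quot_carrier : topologicalType :=
  quotient_topology {eq_quot gen_equiv_rel}.

Definition quot_pi : X -> quot_carrier := \pi_{eq_quot gen_equiv_rel}.

Definition quot_reg (U : set quot_carrier) : set (quot_carrier -> K) :=
  [set f : quot_carrier -> K | reg (quot_pi @^-1` U) (f \o quot_pi)].

Lemma quot_pi_surj (q : quot_carrier) : exists x, q = quot_pi x.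
Proof. by exists (repr q); rewrite /quot_pi reprK. Qed.

Lemma quot_sheaf : is_sheaf quot_reg.
Proof.
have S := space_sheaf X; split.
- move=> U f oU fP; apply: (sheaf_glue S) => // x Ux.
  have [V [g [oV Vx rg fg]]] := fP _ Ux.
  by exists (quot_pi @^-1` V), (g \o quot_pi); split=> // y Uy Vy; exact: fg.
- by move=> U c oU; exact: (sheaf_cst S).
- by move=> U f g oU rf rg; exact: (sheaf_add S oU rf rg).
- by move=> U f g oU rf rg; exact: (sheaf_mul S oU rf rg).
- by move=> U f oU rf; exact: (sheaf_nz S oU rf).
- by move=> U f oU rf; exact: (sheaf_inv S oU rf).
Qed.

Definition quot_space : fspace K := Space quot_sheaf.

End Quotient.

Definition fun_morphism (K : fieldType) (X Z : fspace K) (f : X -> Z) : Prop :=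
  continuous f /\
  forall (V : set Z) (g : Z -> K), open V -> reg V g -> reg (f @^-1` V) (g \o f).

Definition isomorphism (K : fieldType) (X Z : fspace K) (f : X -> Z) : Prop :=
  fun_morphism f /\ exists g : Z -> X, [/\ fun_morphism g, cancel f g & cancel g f].

Definition embedding (K : fieldType) (X Z : fspace K) (f : X -> Z) : Prop :=
  exists2 g : X -> subsp (range f), isomorphism g & forall x, val (g x) = f x.

Definition open_embedding (K : fieldType) (X Z : fspace K) (f : X -> Z) : Prop :=
  open (range f) /\ embedding f.

Definition closed_embedding (K : fieldType) (X Z : fspace K) (f : X -> Z) : Prop :=
  closed (range f) /\ embedding f.

Definition preirreducible (X : topologicalType) (A : set X) : Prop :=
  forall U V : set X, open U -> open V ->
    A `&` U !=set0 -> A `&` V !=set0 -> A `&` (U `&` V) !=set0.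

Definition irreducible (X : topologicalType) (A : set X) : Prop :=
  A !=set0 /\ preirreducible A.

(* Isomorphic to a closed subset of some affine space, possibly reducible or    *)
(* empty.                                                                       *)
Definition affine (K : fieldType) (X : fspace K) : Prop :=
  exists n (f : X -> affsp K n), closed_embedding f.

Definition affine_variety (K : fieldType) (X : fspace K) : Prop :=
  affine X /\ irreducible [set: X].

Definition affine_open (K : fieldType) (X : fspace K) (U : set X) : Prop :=
  open U /\ affine (subsp U).

(* No separation or finiteness condition; the empty space is allowed. *)
Definition prevariety (K : fieldType) (X : fspace K) : Prop :=
  preirreducible [set: X] /\
  forall x : X, exists2 U : set X, affine_open U & U x.

Definition separated_space (K : fieldType) (X : fspace K) : Prop :=
  closed [set p : prod_space X X | pr1 p = pr2 p].

Definition variety (K : fieldType) (X : fspace K) : Prop :=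
  [/\ prevariety X, [set: X] !=set0, compact [set: X] & separated_space X].

Definition affine_morphism (K : fieldType) (X Z : fspace K) (f : X -> Z) : Prop :=
  fun_morphism f /\ forall V : set Z, affine_open V -> affine (subsp (f @^-1` V)).

Definition diag_map (K : fieldType) (X : fspace K) : X -> prod_space X X :=
  fun x => (x, x).

Definition projsp (K : fieldType) (m : nat) : fspace K :=
  @quot_space K (subsp [set v : affsp K m.+1 | v != (0 : 'rV[K]_m.+1)])
    (fun v w => exists2 c : K, c != 0 & val v = c *: (val w : 'rV[K]_m.+1)).

Definition projective_morphism (K : fieldType) (X Z : fspace K) (f : X -> Z) : Prop :=
  fun_morphism f /\ exists m (g : X -> prod_space Z (projsp K m)),
    closed_embedding g /\ forall x, pr1 (g x) = f x.

Definition semiprojective (K : fieldType) (X : fspace K) : Prop :=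
  exists (Z : fspace K) (f : X -> Z), affine_variety Z /\ projective_morphism f.

(* The function field: regular functions on nonempty open subsets, two of them  *)
(* being identified when they agree on some nonempty open subset.               *)

Record integral_space (K : fieldType) := IntegralSpace {
  integral_sort :> fspace K;
  integral_irr : irreducible [set: integral_sort]
}.

Record rfun (K : fieldType) (X : integral_space K) := RFun {
  rdom : set X;
  rval : X -> K;
  rdom_open : open rdom;
  rdom_n0 : rdom !=set0;
  rval_reg : reg rdom rval
}.

Section FunctionField.
Local Open Scope quotient_scope.
Context (K : fieldType) (X : integral_space K).
Implicit Types (U V : set X) (f g h : rfun X).
Let S := space_sheaf X.

Lemma openI_n0 U V : open U -> open V -> U !=set0 -> V !=set0 ->
  U `&` V !=set0.
Proof.
move=> oU oV U0 V0; have := (integral_irr X).2 U V oU oV.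
by rewrite !setTI; exact.
Qed.

Definition rfun_eq f g := `[< exists W : set X, [/\ open W, W !=set0,
  W `<=` rdom f, W `<=` rdom g & forall x, W x -> rval f x = rval g x] >].

Lemma rfun_eqP : equiv_class_of rfun_eq.
Proof.
split=> [f|f g|g f h].
- apply/asboolP; exists (rdom f); split=> //; [exact: rdom_open|exact: rdom_n0].
- by apply/asboolP/asboolP => -[W [oW W0 Wf Wg fg]]; exists W;
    split=> // x Wx; rewrite fg.
- move=> /asboolP[W [oW W0 Wf Wg fg]] /asboolP[V [oV V0 Vg Vh gh]].
  apply/asboolP; exists (W `&` V); split.
  + exact: openI.
  + exact: openI_n0.
  + by move=> x [/Wf].
  + by move=> x [_ /Vh].
  + by move=> x [Wx Vx]; rewrite fg// gh.
Qed.

Canonical rfun_equiv : equiv_rel {classic rfun X} :=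
  @EquivRelPack {classic rfun X} rfun_eq rfun_eqP.

Definition funfield := {eq_quot rfun_equiv}.

HB.instance Definition _ := EqQuotient.on funfield.
HB.instance Definition _ := Choice.on funfield.

Definition rclass f : funfield := \pi_funfield (f : {classic rfun X}).

Lemma rclassP (a : funfield) : exists f, rclass f = a.
Proof. by exists (repr a); rewrite /rclass reprK. Qed.

Lemma rclassE f g : rclass f = rclass g <->
  forall x, rdom f x -> rdom g x -> rval f x = rval g x.
Proof.
split.
- move=> /eqmodP /= /asboolP[W [oW W0 Wf Wg fg]] x fx gx.
  apply: contrapT => /eqP nfg.
  pose U := rdom f `&` rdom g.
  have oU : open U by apply: openI; exact: rdom_open.
  have rf : reg U (rval f).
    by apply: (reg_res _ (rdom_open f)) => [//||]; [move=> y []|exact: rval_reg].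
  have rg : reg U (rval g).
    by apply: (reg_res _ (rdom_open g)) => [//||]; [move=> y []|exact: rval_reg].
  have := sheaf_nz S oU (sheaf_add S oU rf (reg_opp oU rg)).
  move=> /(@openI_n0 W _ oW)/(_ W0) [].
    by exists x; split; [split|rewrite /= subr_eq0].
  by move=> y [Wy [_ /=]]; rewrite subr_eq0 fg// eqxx.
- move=> fg; apply/eqmodP/asboolP; exists (rdom f `&` rdom g); split.
  + by apply: openI; exact: rdom_open.
  + by apply: openI_n0; [exact: rdom_open|exact: rdom_open|
                         exact: rdom_n0|exact: rdom_n0].
  + by move=> x [].
  + by move=> x [].
  + by move=> x [fx gx]; exact: fg.
Qed.

Definition rcst (c : K) : rfun X :=
  RFun openT (integral_irr X).1 (sheaf_cst S c openT).

Lemma rdomI_open f g : open (rdom f `&` rdom g).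
Proof. by apply: openI; exact: rdom_open. Qed.

Lemma rdomI_n0 f g : rdom f `&` rdom g !=set0.
Proof.
by apply: openI_n0; [exact: rdom_open|exact: rdom_open|exact: rdom_n0|
                     exact: rdom_n0].
Qed.

Lemma rregl f g : reg (rdom f `&` rdom g) (rval f).
Proof.
apply: (reg_res (rdomI_open f g) (rdom_open f)); last exact: rval_reg.
by move=> x [].
Qed.

Lemma rregr f g : reg (rdom f `&` rdom g) (rval g).
Proof.
apply: (reg_res (rdomI_open f g) (rdom_open g)); last exact: rval_reg.
by move=> x [].
Qed.

Definition radd f g : rfun X := RFun (rdomI_open f g) (rdomI_n0 f g)
  (sheaf_add S (rdomI_open f g) (rregl f g) (rregr f g)).

Definition rmul f g : rfun X := RFun (rdomI_open f g) (rdomI_n0 f g)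
  (sheaf_mul S (rdomI_open f g) (rregl f g) (rregr f g)).

Definition ropp f : rfun X := RFun (rdom_open f) (rdom_n0 f)
  (reg_opp (rdom_open f) (rval_reg f)).

Definition rinv f : rfun X :=
  match pselect (rdom f `&` [set x | rval f x != 0] !=set0) with
  | left n0 => RFun (sheaf_nz S (rdom_open f) (rval_reg f)) n0
                    (sheaf_inv S (rdom_open f) (rval_reg f))
  | right _ => rcst 0
  end.

Definition ff_cst (c : K) : funfield := rclass (rcst c).
Definition ff_add (a b : funfield) : funfield := rclass (radd (repr a) (repr b)).
Definition ff_mul (a b : funfield) : funfield := rclass (rmul (repr a) (repr b)).
Definition ff_opp (a : funfield) : funfield := rclass (ropp (repr a)).
Definition ff_inv (a : funfield) : funfield := rclass (rinv (repr a)).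

Lemma rclass_repr f : rclass (repr (rclass f)) = rclass f.
Proof. by rewrite /rclass reprK. Qed.

Lemma rclass2E f g f' g' (op : K -> K -> K) h h' :
  rclass f = rclass f' -> rclass g = rclass g' ->
  rdom h = rdom f `&` rdom g -> rdom h' = rdom f' `&` rdom g' ->
  (forall x, rval h x = op (rval f x) (rval g x)) ->
  (forall x, rval h' x = op (rval f' x) (rval g' x)) ->
  rclass h = rclass h'.
Proof.
move=> /rclassE ff' /rclassE gg' dh dh' vh vh'; apply/rclassE => x.
by rewrite dh dh' vh vh' => -[fx gx] [f'x g'x]; rewrite ff'// gg'.
Qed.

Lemma ff_addE f g : ff_add (rclass f) (rclass g) = rclass (radd f g).
Proof.
exact: (@rclass2E (repr (rclass f)) (repr (rclass g)) f g +%R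
  _ _ (rclass_repr f) (rclass_repr g)).
Qed.

Lemma ff_mulE f g : ff_mul (rclass f) (rclass g) = rclass (rmul f g).
Proof.
exact: (@rclass2E (repr (rclass f)) (repr (rclass g)) f g *%R
  _ _ (rclass_repr f) (rclass_repr g)).
Qed.

Lemma ff_oppE f : ff_opp (rclass f) = rclass (ropp f).
Proof.
apply/rclassE => x /= d1 d2; congr (- _); move: x d1 d2; apply/rclassE.
exact: rclass_repr.
Qed.

Lemma ff_addA : associative ff_add.
Proof.
move=> a b c; have [[f <-] [g <-] [h <-]] := And3 (rclassP a) (rclassP b) (rclassP c).
by rewrite !ff_addE; apply/rclassE => x _ _ /=; rewrite addrA.
Qed.

Lemma ff_addC : commutative ff_add.
Proof.
move=> a b; have [[f <-] [g <-]] := (conj (rclassP a) (rclassP b)).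
by rewrite !ff_addE; apply/rclassE => x _ _ /=; rewrite addrC.
Qed.

Lemma ff_add0 : left_id (ff_cst 0) ff_add.
Proof.
move=> a; have [f <-] := rclassP a.
by rewrite ff_addE; apply/rclassE => x _ _ /=; rewrite add0r.
Qed.

Lemma ff_addN : left_inverse (ff_cst 0) ff_opp ff_add.
Proof.
move=> a; have [f <-] := rclassP a.
by rewrite ff_oppE ff_addE; apply/rclassE => x _ _ /=; rewrite addNr.
Qed.

HB.instance Definition _ := GRing.isZmodule.Build funfield
  ff_addA ff_addC ff_add0 ff_addN.

Lemma ff_mulA : associative ff_mul.
Proof.
move=> a b c; have [[f <-] [g <-] [h <-]] := And3 (rclassP a) (rclassP b) (rclassP c).
by rewrite !ff_mulE; apply/rclassE => x _ _ /=; rewrite mulrA.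
Qed.

Lemma ff_mulC : commutative ff_mul.
Proof.
move=> a b; have [[f <-] [g <-]] := (conj (rclassP a) (rclassP b)).
by rewrite !ff_mulE; apply/rclassE => x _ _ /=; rewrite mulrC.
Qed.

Lemma ff_mul1 : left_id (ff_cst 1) ff_mul.
Proof.
move=> a; have [f <-] := rclassP a.
by rewrite ff_mulE; apply/rclassE => x _ _ /=; rewrite mul1r.
Qed.

Lemma ff_mulDl : left_distributive ff_mul ff_add.
Proof.
move=> a b c; have [[f <-] [g <-] [h <-]] := And3 (rclassP a) (rclassP b) (rclassP c).
rewrite ff_addE !ff_mulE ff_addE; apply/rclassE => x _ _ /=.
by rewrite mulrDl.
Qed.

Lemma ff_1_neq0 : ff_cst 1 != 0 :> funfield.
Proof.
apply/eqP => e; have [x _] := (integral_irr X).1.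
have /(_ x Logic.I Logic.I)/eqP := (rclassE (rcst 1) (rcst 0)).1 e.
by rewrite /= oner_eq0.
Qed.

HB.instance Definition _ := GRing.Zmodule_isComNzRing.Build funfield
  ff_mulA ff_mulC ff_mul1 ff_mulDl ff_1_neq0.

Lemma ff_mulV (a : funfield) : a != 0 -> ff_inv a * a = 1.
Proof.
move=> a0; rewrite -[in X in _ * X](reprK a) -/(rclass (repr a)).
rewrite [LHS]ff_mulE; apply/rclassE => x /= [] + ax _.
rewrite /rinv; case: pselect => /= [_ [_ /= ra]|n0]; first by rewrite mulVf.
exfalso; move/eqP : a0; apply; rewrite -(reprK a) -/(rclass (repr a)).
apply/rclassE => y ay _ /=; apply: contrapT => /eqP ya.
by apply: n0; exists y.
Qed.

Lemma ff_inv0 : ff_inv 0 = 0 :> funfield.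
Proof.
apply/rclassE => x; rewrite /rinv; case: pselect => //= -[y [ay /= /eqP yn0]].
exfalso; apply: yn0.
exact: ((rclassE (repr (rclass (rcst 0))) (rcst 0)).1 (rclass_repr _) y).
Qed.

HB.instance Definition _ := GRing.ComNzRing_isField.Build funfield
  ff_mulV ff_inv0.

End FunctionField.

(* For an irreducible closed subset Z of Y: the local ring of Y along Z, and    *)
(* its maximal ideal.                                                           *)

Definition local_ring (K : fieldType) (Y : integral_space K) (Z : set Y) :
    set (funfield Y) :=
  [set a | exists2 f, rclass f = a & rdom f `&` Z !=set0].

Definition local_ideal (K : fieldType) (Y : integral_space K) (Z : set Y) :
    set (funfield Y) :=
  [set a | exists f, [/\ rclass f = a, rdom f `&` Z !=set0 &
                         forall x, rdom f x -> Z x -> rval f x = 0]].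

Definition normal_variety (K : fieldType) (Y : integral_space K) : Prop :=
  forall (y : Y) (a : funfield Y),
    (exists p : {poly funfield Y},
       [/\ p \is monic, forall i, local_ring [set y] p`_i & root p a]) ->
    local_ring [set y] a.

(* Prime divisors: irreducible closed subsets of codimension one. *)
Definition is_prime_divisor (K : fieldType) (Y : integral_space K) (E : set Y) : Prop :=
  [/\ closed E, irreducible E, E <> setT &
      forall Z : set Y, closed Z -> irreducible Z -> E `<=` Z -> Z = E \/ Z = setT].

Definition prime_divisor (K : fieldType) (Y : integral_space K) : choiceType :=
  {E : set Y | `[< is_prime_divisor E >]}.

Section Order.
Context (K : fieldType) (Y : integral_space K).
Implicit Types (E : prime_divisor Y) (a b t : funfield Y).

Definition uniformizer E t : Prop :=
  [/\ t != 0, local_ideal (val E) t &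
      forall a, local_ideal (val E) a -> local_ring (val E) (a / t)].

(* The order of vanishing of a along E: a = t ^ ord E a * unit in the discrete  *)
(* valuation ring local_ring (val E) (Y being normal).                          *)
Definition ord E a : int :=
  xget 0 [set k | exists t, [/\ uniformizer E t,
    local_ring (val E) (a / t ^ k) & local_ring (val E) (t ^ k / a)]].

Lemma prime_irr E : irreducible (val E).
Proof. by have /asboolP[] := valP E. Qed.

Lemma local_ring1 E : local_ring (val E) 1.
Proof.
exists (rcst Y 1) => //; have [[x Ex] _] := prime_irr E.
by exists x.
Qed.

Lemma rclassM (f g : rfun Y) : rclass (rmul f g) = rclass f * rclass g.
Proof. by rewrite -ff_mulE. Qed.

Lemma local_ringM E a b : local_ring (val E) a -> local_ring (val E) b ->
  local_ring (val E) (a * b).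
Proof.
move=> [f <- f0] [g <- g0]; exists (rmul f g); first exact: rclassM.
have := (prime_irr E).2 _ _ (rdom_open f) (rdom_open g).
by rewrite ![val E `&` _]setIC; exact.
Qed.

Lemma local_idealM E a b : local_ideal (val E) a -> local_ring (val E) b ->
  local_ideal (val E) (a * b).
Proof.
move=> [f [<- f0 fE]] [g <- g0]; exists (rmul f g); split.
- exact: rclassM.
- have := (prime_irr E).2 _ _ (rdom_open f) (rdom_open g).
  by rewrite ![val E `&` _]setIC; exact.
- by move=> x [fx gx] Ex /=; rewrite fE// mul0r.
Qed.

Lemma local_ideal1 E : ~ local_ideal (val E) 1.
Proof.
move=> [f [f1 [x [fx Ex]] fE]].
have /(_ x fx Logic.I)/eqP := (rclassE f (rcst Y 1)).1 f1.
by rewrite /= fE// eq_sym oner_eq0.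
Qed.

Lemma local_ringX E a k : local_ring (val E) a -> local_ring (val E) (a ^+ k).
Proof.
move=> aE; elim: k => [|k IH]; first by rewrite expr0; exact: local_ring1.
by rewrite exprS; exact: local_ringM.
Qed.

Lemma local_idealW E a : local_ideal (val E) a -> local_ring (val E) a.
Proof. by move=> [f [<- f0 _]]; exists f. Qed.

Lemma uniformizer_unit E t k : uniformizer E t ->
  ~ local_ring (val E) (t ^+ k.+1)^-1.
Proof.
move=> [t0 tE _] tkE; apply: (@local_ideal1 E).
have -> : 1 = t * (t ^+ k * (t ^+ k.+1)^-1).
  by rewrite mulrA -exprS divff// expf_neq0.
apply: local_idealM => //; apply: local_ringM => //.
exact/local_ringX/local_idealW.
Qed.

Lemma ord_div1 E : ord E 1 = 0.
Proof.
rewrite /ord; case: xgetP => // k _ [t [tE]]; rewrite div1r divr1.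
case: k => [[|k]|k] //= h1 h2; exfalso.
- exact: (uniformizer_unit tE h1).
- exact: (uniformizer_unit tE h2).
Qed.

End Order.

(* Weil Q-divisors, given by their coefficients; on an open subset U of Y only  *)
(* the prime divisors meeting U are relevant.                                   *)

Definition qdiv (K : fieldType) (Y : integral_space K) := prime_divisor Y -> rat.

Section Divisors.
Context (K : fieldType) (Y : integral_space K) (U : set Y).
Implicit Types (G H : qdiv Y) (E : prime_divisor Y).

Definition meets_div E : Prop := val E `&` U !=set0.

Definition supp G : set Y :=
  [set y | exists E, [/\ meets_div E, G E != 0 & val E y]].

Definition effective G : Prop := forall E, meets_div E -> 0 <= G E.

Definition sections G : set (funfield Y) :=
  [set f | f = 0 \/ effective (fun E => (ord E f)%:~R + G E)].

Definition linear_system G : set (qdiv Y) :=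
  [set H | exists2 f, f != 0 /\ sections G f &
           H = fun E => (ord E f)%:~R + G E].

Definition Qcartier G : Prop := exists2 m : nat, (0 < m)%N &
  forall y, U y -> exists (V : set Y) (f : funfield Y),
    [/\ open V, V y, V `<=` U, f != 0 &
        forall E, val E `&` V !=set0 -> G E *+ m = (ord E f)%:~R].

Definition semiample G : Prop := exists2 m : nat, (0 < m)%N &
  forall y, U y ->
    exists2 H, linear_system (fun E => G E *+ m) H & ~ supp H y.

Definition multiple_big G : Prop := exists2 m : nat, (0 < m)%N &
  exists2 H, linear_system (fun E => G E *+ m) H & affine (subsp (U `\` supp H)).

End Divisors.

(* Polyhedra.  The lattice is N = Z^n, realized as row vectors, with dual       *)
(* lattice M realized as column vectors.                                        *)

Section Polyhedra.
Context (n : nat).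
Implicit Types (u w : 'cV[rat]_n) (v : 'rV[rat]_n) (A B sigma : set 'rV[rat]_n).

Definition pairing u v : rat := (v *m u) 0 0.

Definition minkowski A B : set 'rV[rat]_n := [set a + b | a in A & b in B].

(* the cone, resp. the polytope, spanned by the rows of s *)
Definition cone k (s : 'M[rat]_(k, n)) : set 'rV[rat]_n :=
  [set c *m s | c in [set c : 'rV[rat]_k | forall i, 0 <= c 0 i]].

Definition conv k (s : 'M[rat]_(k, n)) : set 'rV[rat]_n :=
  [set c *m s | c in [set c : 'rV[rat]_k |
                        (forall i, 0 <= c 0 i) /\ \sum_i c 0 i = 1]].

Definition pointed_cone sigma : Prop :=
  (exists k (s : 'M[rat]_(k, n)), sigma = cone s) /\
  forall v, sigma v -> sigma (- v) -> v = 0.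

(* A polyhedron is the Minkowski sum of a nonempty polytope and of its tail     *)
(* cone sigma.                                                                  *)
Definition sigma_polyhedron sigma A : Prop :=
  exists k (s : 'M[rat]_(k.+1, n)), A = minkowski (conv s) sigma.

Definition dual_cone sigma : set 'cV[rat]_n :=
  [set u | forall v, sigma v -> 0 <= pairing u v].

(* interior of C relative to its linear span C - C *)
Definition relint (C : set 'cV[rat]_n) : set 'cV[rat]_n :=
  [set u | C u /\ exists2 e : rat, 0 < e &
     forall c c', C c -> C c' -> (forall i, `|(c - c') i 0| < e) -> C (u + (c - c'))].

Definition face A u : set 'rV[rat]_n :=
  [set v | A v /\ forall v', A v' -> pairing u v <= pairing u v'].

Definition is_min A u (q : rat) : Prop :=
  (exists2 v, A v & pairing u v = q) /\ forall v, A v -> q <= pairing u v.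

(* min_{v in A} <u, v> *)
Definition min_on A u : rat := xget 0 [set q | is_min A u q].

Lemma pairingD u v v' : pairing u (v + v') = pairing u v + pairing u v'.
Proof. by rewrite /pairing mulmxDl mxE. Qed.

Lemma pairing_mul u k (c : 'rV[rat]_k) (s : 'M[rat]_(k, n)) :
  pairing u (c *m s) = \sum_i c 0 i * pairing u (row i s).
Proof.
rewrite /pairing -mulmxA mxE; apply: eq_bigr => i _; congr (_ * _).
by rewrite -row_mul [RHS]mxE.
Qed.

Lemma polyhedron_min sigma A u : pointed_cone sigma -> dual_cone sigma u ->
  sigma_polyhedron sigma A -> is_min A u (min_on A u).
Proof.
move=> [[l [r sE]] _] du [k [s AE]]; rewrite /min_on; apply: xgetPex.
case: (@Order.TotalTheory.arg_minP _ _ _ (ord0 : 'I_k.+1) xpredT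
         (fun i => pairing u (row i s)) isT) => i _ imin.
exists (pairing u (row i s)); split.
  exists (row i s) => //; rewrite AE; exists (row i s).
    exists (delta_mx 0 i); last by rewrite rowE.
    split=> [j|]; first by rewrite mxE eqxx ler0n.
    rewrite (bigD1 i)//= big1 ?mxE ?eqxx ?addr0// => j ji.
    by rewrite mxE (negbTE ji).
  by exists 0; rewrite ?addr0// sE; exists 0; rewrite ?mul0mx// => j; rewrite mxE.
move=> v; rewrite AE => -[_ [c [c0 c1] <-] [w sw <-]].
rewrite pairingD -[leLHS]addr0; apply: lerD; last exact: du.
rewrite pairing_mul -[leLHS]mul1r -c1 mulr_suml.
by apply: ler_sum => j _; apply: ler_wpM2l => //; exact: imin.
Qed.

Lemma min0 A : min_on A 0 = 0.
Proof.
rewrite /min_on; case: xgetP => // q _ [[v _ <-] _].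
by rewrite /pairing mulmx0 mxE.
Qed.

End Polyhedra.

(* Polyhedral divisors are given by their coefficients at all prime divisors:   *)
(* set0 is allowed, and almost all coefficients are equal to the tail cone.     *)

Record poldiv (K : fieldType) (Y : integral_space K) (n : nat) := PolDiv {
  tail : set 'rV[rat]_n;
  coef : prime_divisor Y -> set 'rV[rat]_n
}.

Section PolyhedralDivisors.
Context (K : fieldType) (Y : integral_space K) (n : nat).
Implicit Types (D : poldiv Y n) (u v : 'cV[int]_n) (f g : funfield Y).

Definition ratv u : 'cV[rat]_n := map_mx intr u.

Definition polyhedral_divisor D : Prop :=
  [/\ pointed_cone (tail D),
      forall E, coef D E = set0 \/ sigma_polyhedron (tail D) (coef D E) &
      finite_set [set E | coef D E <> tail D]].

Definition Loc D : set Y := [set y | forall E, coef D E = set0 -> ~ val E y].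

Definition evaluation D (w : 'cV[rat]_n) : qdiv Y := fun E => min_on (coef D E) w.

Definition ppdiv D : Prop :=
  [/\ polyhedral_divisor D,
      exists G : qdiv Y, [/\ finite_set [set E | G E <> 0], effective setT G,
        semiample setT G & ~` Loc D = supp setT G],
      forall w, dual_cone (tail D) w ->
        Qcartier (Loc D) (evaluation D w) /\ semiample (Loc D) (evaluation D w) &
      forall w, relint (dual_cone (tail D)) w -> multiple_big (Loc D) (evaluation D w)].

(* the degree u part of the M-graded algebra A; it is zero unless u is in the   *)
(* dual of the tail cone                                                        *)
Definition grpart D u : set (funfield Y) :=
  [set f | dual_cone (tail D) (ratv u) /\
           sections (Loc D) (evaluation D (ratv u)) f].

(* A K-algebra homomorphism A -> K, i.e., a closed point of Spec A, is a family *)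
(* of K-linear maps x u on the graded parts of A, compatible with products.     *)
(* The maps are extended by 0 outside of the graded parts.  (The graded parts   *)
(* are stable under the operations, so that the last premise of each condition  *)
(* is no restriction.)                                                          *)
Definition is_point D (x : 'cV[int]_n -> funfield Y -> K) : Prop :=
  [/\ x 0 1 = 1,
      forall u f g, grpart D u f -> grpart D u g -> grpart D u (f + g) ->
        x u (f + g) = x u f + x u g,
      forall u c f, grpart D u f -> grpart D u (ff_cst Y c * f) ->
        x u (ff_cst Y c * f) = c * x u f,
      forall u v f g, grpart D u f -> grpart D v g -> grpart D (u + v) (f * g) ->
        x (u + v) (f * g) = x u f * x v g &
      forall u f, ~ grpart D u f -> x u f = 0].

(* X(D) = Spec A; its regular functions are locally fractions of elements of A, *)
(* which is generated by its homogeneous elements *)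
Definition points D : set ('cV[int]_n -> funfield Y -> K) := [set x | is_point D x].

Definition ppspace D : fspace K :=
  @zariski K (points D)
    [set h | exists u f, grpart D u f /\ h = fun x : points D => val x u f].

Definition refines D' D : Prop :=
  [/\ polyhedral_divisor D', polyhedral_divisor D, tail D' `<=` tail D &
      forall E, coef D' E `<=` coef D E].

Lemma grpart_refines D' D u f : refines D' D -> grpart D u f -> grpart D' u f.
Proof.
move=> [[pD' cD' _] [pD cD _] tD'D cD'D] [du [->|fD]].
  by split; [move=> v /tD'D; exact: du | left].
have du' : dual_cone (tail D') (ratv u) by move=> v /tD'D; exact: du.
split=> //; right => E [y [Ey Ly]].
have ne' : coef D' E <> set0 by move=> /Ly/(_ Ey).
have ne : coef D E <> set0.
  by move=> e; apply: ne'; apply/seteqP; split=> // v /cD'D; rewrite e.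
have [//|pE] := cD E; have [//|pE'] := cD' E.
have /le_trans : 0 <= (ord E f)%:~R + evaluation D (ratv u) E.
  apply: fD; exists y; split=> // F eF; apply: Ly.
  by apply/seteqP; split=> // v /cD'D; rewrite eF.
apply; rewrite lerD2l /evaluation.
have [[v /cD'D Dv <-] _] := polyhedron_min pD' du' pE'.
by have [_] := polyhedron_min pD du pE; exact.
Qed.

Lemma grpart1 D : grpart D 0 1.
Proof.
have r0 : ratv 0 = 0 by apply/matrixP => i j; rewrite !mxE.
rewrite /grpart /= r0; split.
  by move=> v _; rewrite /pairing mulmx0 mxE.
by right => E _; rewrite ord_div1 add0r /evaluation min0.
Qed.

Lemma restrict_point D' D (x : points D') : refines D' D ->
  is_point D (fun u f => if `[< grpart D u f >] then val x u f else 0).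
Proof.
case: x => x /= /set_mem [x1 xD xZ xM xN] r.
have R u f := @grpart_refines D' D u f r.
split.
- by rewrite asboolT//; exact: grpart1.
- by move=> u f g Df Dg Dfg; rewrite !asboolT// xD//; exact: R.
- by move=> u c f Df Dcf; rewrite !asboolT// xZ//; exact: R.
- by move=> u v f g Df Dg Dfg; rewrite !asboolT// xM//; exact: R.
- by move=> u f nDf; rewrite asboolF.
Qed.

(* The canonical morphism X(D') -> X(D), i.e., the restriction of homomorphisms *)
(* to a subalgebra                                                              *)
Definition canonical_map D' D (r : refines D' D) (x : ppspace D') : ppspace D :=
  exist (fun y => y \in points D) _ (mem_set (restrict_point x r)).

Definition fiber_poly D (y : Y) : set 'rV[rat]_n :=
  \big[@minkowski n/tail D]_(E \in [set E : prime_divisor Y | val E y]) coef D E.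

Definition face_of D' D : Prop :=
  (forall E, coef D' E `<=` coef D E) /\
  forall y, Loc D' y -> exists u Dy,
    [/\ dual_cone (tail D) (ratv u), linear_system (Loc D) (evaluation D (ratv u)) Dy,
        ~ supp (Loc D) Dy y,
        fiber_poly D' y = face (fiber_poly D y) (ratv u) &
        forall z, ~ supp (Loc D) Dy z ->
          face (fiber_poly D' z) (ratv u) = face (fiber_poly D z) (ratv u)].

Definition cap D' D : poldiv Y n :=
  PolDiv (tail D' `&` tail D) (fun E => coef D' E `&` coef D E).

Definition divisorial_fan (I : Type) (D : I -> poldiv Y n) : Prop :=
  (forall i, ppdiv (D i)) /\
  forall i j, [/\ face_of (cap (D i) (D j)) (D i),
                  face_of (cap (D i) (D j)) (D j) &
                  exists k, D k = cap (D i) (D j)].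

End PolyhedralDivisors.

(* The torus T = Spec K[M] and its action on X(D): on the part of degree u the  *)
(* torus element t acts by the character t^u *)

Definition torus_set (K : fieldType) (n : nat) : set (affsp K n) :=
  [set t | forall i, (t : 'rV[K]_n) 0 i != 0].

Definition torus (K : fieldType) (n : nat) : fspace K := subsp (@torus_set K n).

Section Torus.
Context (K : fieldType) (n : nat).
Implicit Types (s t : torus K n) (u v : 'cV[int]_n).

Definition tcoord t : 'rV[K]_n := val t.

Lemma tcoord_neq0 t i : tcoord t 0 i != 0.
Proof. exact: (set_mem (valP t) i). Qed.

Lemma tone_subproof : torus_set (const_mx 1 : 'rV[K]_n).
Proof. by move=> i; rewrite mxE oner_neq0. Qed.
Definition tone : torus K n := exist (fun y => y \in @torus_set K n) _ (mem_set tone_subproof).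

Lemma tmul_subproof s t :
  torus_set (\row_i (tcoord s 0 i * tcoord t 0 i) : 'rV[K]_n).
Proof. by move=> i; rewrite mxE mulf_neq0// tcoord_neq0. Qed.
Definition tmul s t : torus K n := exist (fun y => y \in @torus_set K n) _ (mem_set (tmul_subproof s t)).

Definition tchar u t : K := \prod_i tcoord t 0 i ^ u i 0.

Lemma tchar0 t : tchar 0 t = 1.
Proof. by rewrite /tchar big1// => i _; rewrite mxE expr0z. Qed.

Lemma tcharD u v t : tchar (u + v) t = tchar u t * tchar v t.
Proof.
rewrite /tchar -big_split/=; apply: eq_bigr => i _.
by rewrite mxE expfzDr// tcoord_neq0.
Qed.

Lemma act_point (Y : integral_space K) (D : poldiv Y n) t
    (x : points D) :
  is_point D (fun u f => tchar u t * val x u f).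
Proof.
case: x => x /= /set_mem [x1 xD xZ xM xN]; split.
- by rewrite tchar0 x1 mulr1.
- by move=> *; rewrite xD// mulrDr.
- by move=> *; rewrite xZ// mulrCA.
- by move=> *; rewrite xM// tcharD mulrACA.
- by move=> *; rewrite xN// mulr0.
Qed.

Definition ppact (Y : integral_space K) (D : poldiv Y n) t (x : ppspace D) :
    ppspace D :=
  exist (fun y => y \in points D) _ (mem_set (act_point t x)).

Definition torus_action (X : fspace K) (act : torus K n -> X -> X) : Prop :=
  [/\ fun_morphism (fun p : prod_space (torus K n) X => act (pr1 p) (pr2 p)),
      forall x, act tone x = x &
      forall s t x, act (tmul s t) x = act s (act t x)].

End Torus.

Definition gluing_data (K : fieldType) (I : Type) (X : I -> fspace K)
    (U : forall i j, set (X i))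
    (phi : forall i j, subsp (U i j) -> subsp (U j i)) : Prop :=
  [/\ forall i j, open (U i j),
      forall i j, isomorphism (phi i j),
      forall i j k, (fun x => val (phi i j x)) @` [set x | U i k (val x)] =
                    U j i `&` U j k &
      forall i j k (x : subsp (U i j)) (y : subsp (U i k)) (z : subsp (U j k)),
        val x = val y -> val z = val (phi i j x) ->
        val (phi j k z) = val (phi i k y)].

(* the quotient of the disjoint union of the X i by x ~ phi i j x *)
Definition glued (K : fieldType) (I : Type) (X : I -> fspace K)
    (U : forall i j, set (X i))
    (phi : forall i j, subsp (U i j) -> subsp (U j i)) : fspace K :=
  @quot_space K (coprod X) (fun p q => exists i j (x : subsp (U i j)),
    p = coprod_in (val x) /\ q = coprod_in (val (phi i j x))).

Definition glued_in (K : fieldType) (I : Type) (X : I -> fspace K)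
    (U : forall i j, set (X i))
    (phi : forall i j, subsp (U i j) -> subsp (U j i)) (i : I) (x : X i) : glued phi :=
  quot_pi _ (coprod_in x : coprod X).

Section FanGluing.
Context (K : fieldType) (Y : integral_space K) (n : nat) (I : Type)
  (D : I -> poldiv Y n) (fanD : divisorial_fan D).

Lemma fan_refines_l i j : refines (cap (D i) (D j)) (D i).
Proof.
have [pp /(_ i j)[_ _ [k Dk]]] := fanD.
have [[pk _ _ _] [pi _ _ _]] := (pp k, pp i).
by rewrite -Dk; split=> // [|E]; rewrite Dk; [move=> v [] | move=> v []].
Qed.

Lemma fan_refines_r i j : refines (cap (D i) (D j)) (D j).
Proof.
have [pp /(_ i j)[_ _ [k Dk]]] := fanD.
have [[pk _ _ _] [pj _ _ _]] := (pp k, pp j).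
by rewrite -Dk; split=> // [|E]; rewrite Dk; [move=> v [] | move=> v []].
Qed.

(* eta_l i j is $\eta_{ij}$ and eta_r i j is $\eta_{ji}$, both defined on        *)
(* $X(D^i \cap D^j)$; fan_chart i j is $X_{ij}$.                                *)
Definition eta_l i j : ppspace (cap (D i) (D j)) -> ppspace (D i) :=
  canonical_map (fan_refines_l i j).
Definition eta_r i j : ppspace (cap (D i) (D j)) -> ppspace (D j) :=
  canonical_map (fan_refines_r i j).
Arguments eta_l : clear implicits.
Arguments eta_r : clear implicits.

Definition fan_chart i j : set (ppspace (D i)) := range (eta_l i j).
Arguments fan_chart : clear implicits.

Lemma capC (D1 D2 : poldiv Y n) : cap D1 D2 = cap D2 D1.
Proof.
by rewrite /cap setIC; congr PolDiv; apply/funext => E; rewrite setIC.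
Qed.

Lemma range_canon (D1 D2 D3 : poldiv Y n) (r1 : refines D1 D3) (r2 : refines D2 D3) :
  D1 = D2 -> range (canonical_map r1) = range (canonical_map r2).
Proof. by move=> e; subst D2; rewrite (Prop_irrelevance r1 r2). Qed.

Lemma eta_r_chart i j z : eta_r i j z \in fan_chart j i.
Proof.
apply/mem_set; rewrite /fan_chart /eta_l.
by rewrite -(range_canon (fan_refines_r i j) (fan_refines_l j i) (capC _ _)); exists z.
Qed.

(* $\varphi_{ij} = \eta_{ji} \circ \eta_{ij}^{-1}$ *)
Definition fan_phi i j (x : subsp (fan_chart i j)) : subsp (fan_chart j i) :=
  exist (fun y => y \in fan_chart j i) _
    (eta_r_chart (s2val (cid2 (set_mem (valP x))))).

Definition fan_space : fspace K := glued fan_phi.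

Definition fan_in i : ppspace (D i) -> fan_space := @glued_in _ _ _ _ fan_phi i.

End FanGluing.
Arguments eta_l {K Y n I D} fanD i j.
Arguments eta_r {K Y n I D} fanD i j.
Arguments fan_chart {K Y n I D} fanD i j.
Arguments fan_phi {K Y n I D} fanD i j.
Arguments fan_in {K Y n I D} fanD i.

(* Main.v *)
Require Import Defs.
Set Warnings "-notation-overridden,-ambiguous-paths,-notation-incompatible-prefix".
From HB Require Import structures.
From mathcomp Require Import all_boot all_order all_algebra.
From mathcomp Require Import perm.
From mathcomp Require Import all_classical.
From mathcomp Require Import reals topology.
From mathcomp Require Import zify ring lra.
Set Implicit Arguments.
Unset Strict Implicit.
Unset Printing Implicit Defensive.
Import Order.TTheory GRing.Theory Num.Theory.
Local Open Scope classical_set_scope.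
Local Open Scope ring_scope.

(* A point of X(D) is an algebra homomorphism A -> K. The algebra A is finitely generated: Loc(D)
   is again projective over an affine variety, so Serre's finiteness theorem applies to the
   modules of sections of the semiample divisors D(u), u running through the finitely many cones
   on which u |-> D(u) is linear. Hence X(D) has finitely many coordinates and, by the
   Nullstellensatz, is an affine variety.

   Let D' be a face of D and x a point of X(D'). In degree 0 it is the evaluation at a point y of
   Loc(D'). The face condition at y provides f in A_w such that every element of A' becomes an
   element of A after multiplication with a power of f; and since D'(-w) is semiample, some f^k h
   with h homogeneous in A' is a function not vanishing at y, whence f does not vanish at x. Thus
   A'_f = A_f, and X(D') -> X(D) is injective, has open image and is locally given by fractions
   in A.

   A product of such sections for two faces D', D'' of D is one for their intersection, hence the
   images of X(D^i n D^j) and X(D^i n D^k) in X_i meet in the image of X(D^i n D^j n D^k). Being in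
   a common X(D^i n D^j) is therefore an equivalence relation on the disjoint union of the X_i,
   which is the cocycle condition. In the glued space X_i and X_j meet in the affine variety
   X(D^i n D^j), so that the diagonal is affine. *)

(** * The Nullstellensatz *)

(** Affineness is handled through coordinates instead of spectra: an [affine_chart] is an open set
    with finitely many functions such that germs are fractions in them and every K-point of the
    coordinate ring is a point of the set. On Y the workhorse is normality: a rational function
    without poles along prime divisors is regular, so sections of D(u) are controlled by orders
    alone.

    Serre's theorem is proved without cohomology. The homogeneous coordinates receive a second
    degree, and an element f that is locally in a finitely generated module is shown to lie in x^-D
    times one fixed slice of a bigraded module, with D independent of f and of its degree u. One
    basis theorem, for rings graded by an arbitrary group, serves the affine coordinate rings, A
    itself and this bigraded ring.

    Irreducibility of X(D) is not read off from A being a domain: the points lying over general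
    points of Y are dense, two of them are moved to a common point of Y, and then to a common torus
    element.

    The index set may be infinite, so the glued space need not be quasi-compact; the affine diagonal
    is checked over an affine open subset of X x X, which is. *)

Section Ideals.
Context (A : comNzRingType).
Implicit Types (P J : set A).

Definition ideal J : Prop :=
  [/\ J 0, forall a b, J a -> J b -> J (a + b) & forall a b, J b -> J (a * b)].

Definition prime_ideal P : Prop :=
  [/\ ideal P, ~ P 1 & forall a b, P (a * b) -> P a \/ P b].

Lemma ideal_sub J a b : ideal J -> J a -> J b -> J (a - b).
Proof. by move=> [_ JD JM] Ja Jb; rewrite -mulN1r; apply: JD => //; exact: JM. Qed.

Lemma ideal_sum J (I : Type) (s : seq I) (p : pred I) (f : I -> A) :
  ideal J -> (forall i, p i -> J (f i)) -> J (\sum_(i <- s | p i) f i).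
Proof. by move=> [J0 JD _] h; apply: (big_ind J). Qed.

Lemma prime_exp P a k : prime_ideal P -> P (a ^+ k) -> P a.
Proof.
move=> [[_ _ PM] P1 Pp]; elim: k => [|k IH]; first by rewrite expr0.
by rewrite exprS => /Pp[].
Qed.

(** Zorn's lemma gives an ideal M maximal among the proper ideals containing J. If M contained a b
    but neither a nor b, then 1 would lie in M + (a) and in M + (b), hence, multiplying the two, in
    M. *)
Lemma ex_prime_ideal J : ideal J -> ~ J 1 ->
  exists P, prime_ideal P /\ J `<=` P.
Proof.
move=> iJ J1; pose Q (B : set A) := B = set0 \/ [/\ ideal B, J `<=` B & ~ B 1].
have [F FQ tF|M [QM maxM]] := @Zorn_bigcup A Q.
  have [[B [FB B0]]|noB] := pselect (exists B, F B /\ B <> set0); last first.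
    left; apply/seteqP; split=> // a [B FB Ba]; apply: noB; exists B; split=> // e.
    by rewrite e in Ba.
  have [//|[[Bz BD BM] JB _]] := FQ B FB.
  have FI C a : F C -> C a -> [/\ ideal C, J `<=` C & ~ C 1].
    by move=> FC Ca; case: (FQ C FC) => // e; rewrite e in Ca.
  right; split; last 2 first.
  - by move=> a Ja; exists B => //; exact: JB.
  - by move=> [C FC C1]; have [_ _] := FI _ _ FC C1.
  split; first by exists B.
  - move=> a b [C FC Ca] [C' FC' Cb].
    have [[_ CD _] _ _] := FI _ _ FC Ca; have [[_ CD' _] _ _] := FI _ _ FC' Cb.
    have [s|s] := tF _ _ FC FC'; [exists C' => //|exists C => //].
      by apply: CD' => //; exact: s.
    by apply: CD => //; exact: s.
  - move=> a b [C FC Cb]; have [[_ _ CM] _ _] := FI _ _ FC Cb.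
    by exists C => //; exact: CM.
have [Me|[iM JM M1]] := QM.
  exfalso; apply: (maxM J); last by right; split.
  by rewrite Me; split=> // /(_ 0); apply; case: iJ.
exists M; split=> //; split=> // a b Mab; apply: contrapT => /not_orP[Ma Mb].
have [M0 MD MM] := iM.
pose N c := [set x | exists m y, M m /\ x = m + c * y].
have N1 c : ~ M c -> exists m y, M m /\ 1 = m + c * y.
  move=> Mc; apply: contrapT => nN1; apply: (maxM (N c)).
    split; first by move=> m Mm; exists m, 0; rewrite mulr0 addr0.
    by move=> /(_ c) NM; apply/Mc/NM; exists 0, 1; rewrite mulr1 add0r.
  right; split=> //; last by move=> m /JM Mm; exists m, 0; rewrite mulr0 addr0.
  split; first by exists 0, 0; rewrite mulr0 addr0.
  - move=> _ _ [m [y [Mm ->]]] [m' [y' [Mm' ->]]]; exists (m + m'), (y + y').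
    by split; [exact: MD|rewrite mulrDr addrACA].
  - move=> x _ [m [y [Mm ->]]]; exists (x * m), (x * y).
    by split; [exact: MM|rewrite mulrDr mulrCA].
have [m [y [Mm e]]] := N1 _ Ma; have [m' [y' [Mm' e']]] := N1 _ Mb.
apply: M1; rewrite -[1]mulr1 [X in X * _]e [X in _ * X]e'.
have -> : (m + a * y) * (m' + b * y') = (m' + b * y') * m + (a * y * m' + (y * y') * (a * b)).
  by ring.
by apply: (MD); [exact: MM|apply: (MD); exact: MM].
Qed.

End Ideals.

Lemma size_strip (A : nzRingType) (q : {poly A}) : q != 0 ->
  (size (q - lead_coef q *: 'X^((size q).-1))%R < size q)%N.
Proof.
move=> q0; rewrite -[X in (_ < X)%N]prednK ?size_poly_gt0 // ltnS.
apply/leq_sizeP => j jq; rewrite coefB coefZ coefXn.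
case: eqP => [->|ne]; first by rewrite mulr1 subrr.
rewrite mulr0 subr0 nth_default // -[size q]prednK ?size_poly_gt0 //.
by rewrite ltn_neqAle jq andbT eq_sym; apply/eqP.
Qed.

(** Division over a ring needs a power of the leading coefficient as a factor. The bound on the size
    of the quotient is used to compare it with a polynomial of minimal size in a prime ideal. *)
Lemma poly_pseudo_div (A : comNzRingType) (r p : {poly A}) : r != 0 ->
  exists k w q, [/\ (lead_coef r ^+ k) *: p = w * r + q, (size q < size r)%N &
                    (size w <= (size p).+1 - size r)%N].
Proof.
move=> r0; have [m] := ubnP (size p); elim: m p => // m IH p pm.
have [pr|rp] := ltnP (size p) (size r).
  by exists 0, 0, p; rewrite expr0 scale1r mul0r add0r size_poly0.
pose d := (size p - size r)%N.
pose p' := lead_coef r *: p - (lead_coef p *: 'X^d) * r.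
have sr : (0 < size r)%N by rewrite size_poly_gt0.
have sp' : (size p' < size p)%N.
  have sp : (0 < size p)%N by apply: leq_trans rp.
  rewrite -(prednK sp) ltnS; apply/leq_sizeP => i ip.
  rewrite coefB coefZ -scalerAl coefZ coefXnM.
  have -> : (i < d)%N = false by apply/negbTE; rewrite -leqNgt; move: ip sr; rewrite /d; lia.
  have [->|ne] := eqVneq i (size p).-1.
    have -> : ((size p).-1 - d = (size r).-1)%N by rewrite /d; lia.
    by rewrite /lead_coef mulrC subrr.
  have ip' : (size p <= i)%N by rewrite -(prednK sp) ltn_neqAle eq_sym ne ip.
  have ir : (size r <= i - d)%N.
    rewrite /d; lia.
  by rewrite !nth_default ?mulr0 ?subr0.
have [|k [w [q [e sq sw]]]] := IH p'; first exact: leq_trans sp' _.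
exists k.+1, (w + (lead_coef r ^+ k * lead_coef p) *: 'X^d), q; split=> //.
- rewrite exprSr -scalerA; have -> : lead_coef r *: p = p' + (lead_coef p *: 'X^d) * r.
    by rewrite subrK.
  rewrite scalerDr e mulrDl addrAC; congr (_ + _ + _).
  by rewrite -!scalerAl scalerA.
- apply: leq_trans (size_polyD _ _) _; rewrite geq_max; apply/andP; split.
    by apply: leq_trans sw _; apply: leq_sub2r; rewrite ltnS ltnW.
  apply: leq_trans (size_scale_leq _ _) _; rewrite size_polyXn /d; lia.
Qed.

Section Nullstellensatz.
Context (K : closedFieldType).

(** The Nullstellensatz for A in the form that passes to A[X]: the point can be chosen off a
    prescribed s, which allows finitely many denominators to be inverted before the induction
    hypothesis is applied. *)
Definition has_points (A : comNzRingType) (i : K -> A) : Prop :=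
  forall P s, prime_ideal P -> ~ P s ->
  exists f : {rmorphism A -> K},
    [/\ forall c, f (i c) = c, forall p, P p -> f p = 0 & f s != 0].

(** Let p0 be the contraction of P to A. Either P = p0[X], and a point of p0 at which a coefficient
    of s survives is completed by a value of X that is not a root; or X is algebraic modulo P, by a
    polynomial p of minimal size with leading coefficient outside p0. In the second case some
    multiple of s is congruent to a constant a outside p0, and X is sent to a root of p at a point
    where a and the leading coefficient of p do not vanish. *)
Lemma has_points_poly (A : comNzRingType) (i : K -> A) :
  has_points i -> has_points (fun c => (i c)%:P).
Proof.
move=> hA P s pP; have [[P0 PD PM] P1 Pp] := pP; move=> Ps.
have iP : ideal P by [].
pose p0 := [set a : A | P a%:P].
have pp0 : prime_ideal p0.
  split; [split=> [|a b|a b]|by []|]; rewrite /p0 /= ?polyCD ?polyCM; first by [].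
  - exact: PD.
  - exact: PM.
  - by move=> a b; rewrite /= polyCM => /Pp.
have coefP (q : {poly A}) : (forall j, p0 q`_j) -> P q.
  move=> h; rewrite -[q]coefK poly_def; apply: ideal_sum => // j _.
  by rewrite -mul_polyC mulrC; apply: PM; exact: h.
have ext (f : {rmorphism A -> K}) (x : K) : exists g : {rmorphism {poly A} -> K},
    forall q, g q = (map_poly f q).[x].
  by exists [the {rmorphism {poly A} -> K} of horner_eval x \o map_poly f].
have [alg|] := pselect (exists q, P q /\ ~ (forall j, p0 q`_j)); last first.
  move=> /forallNP nalg.
  have Pc q : P q -> forall j, p0 q`_j.
    by move=> Pq; apply: contrapT => h; apply: (nalg q).
  have [j sj] : exists j, ~ p0 s`_j by apply/existsNP => /coefP.
  have [f [fi fP fs]] := hA p0 _ pp0 sj.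
  have : map_poly f s != 0.
    by apply: contraNneq fs => e; rewrite -coef_map e coef0.
  move=> /closed_nonrootP[x sx]; have [g gE] := ext f x.
  exists g; split=> [c|p Pq|]; rewrite gE.
  - by rewrite map_polyC hornerC /= fi.
  - suff -> : map_poly f p = 0 by rewrite horner0.
    by apply/polyP => k; rewrite coef_map coef0 /= fP //; exact: Pc.
  - exact: sx.
have good : exists n q, [/\ P q, ~ p0 (lead_coef q) & size q = n].
  have [q [Pq nq]] := alg; have [m] := ubnP (size q).
  elim: m q Pq nq => // m IH q Pq nq qm.
  have [lq|lq] := pselect (p0 (lead_coef q)); last by exists (size q), q.
  have q0 : q != 0 by apply/eqP => e; apply: nq => j; rewrite e coef0.
  apply: (IH (q - lead_coef q *: 'X^((size q).-1))).
  - by apply: ideal_sub => //; rewrite -mul_polyC mulrC; exact: PM.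
  - move=> h; apply: nq => j; have := h j; rewrite coefB coefZ coefXn.
    case: eqP => [->|_]; last by rewrite mulr0 subr0.
    by move=> _.
  - by rewrite -ltnS; apply: leq_trans qm; rewrite ltnS size_strip.
have /ex_minnP[n /asboolP[p [Pp' lp pn]] nmin] :
    exists n, `[< exists q, [/\ P q, ~ p0 (lead_coef q) & size q = n] >].
  by have [n [q h]] := good; exists n; apply/asboolP; exists q.
(* By minimality of p the leading coefficient of q is in p0; removing its leading term keeps q in P
   and makes it shorter. *)
have small q : P q -> (size q < n)%N -> forall j, p0 q`_j.
  have [m] := ubnP (size q); elim: m q => // m IH q qm Pq qn.
  have lq : p0 (lead_coef q).
    apply: contrapT => nlq; have : (n <= size q)%N by apply/nmin/asboolP; exists q.
    by rewrite leqNgt qn.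
  have [q0|q0] := eqVneq q 0; first by move=> j; rewrite q0 coef0.
  pose q' := q - lead_coef q *: 'X^((size q).-1).
  have sq' : (size q' < size q)%N by exact: size_strip.
  have Pq' : P q' by apply: ideal_sub => //; rewrite -mul_polyC mulrC; exact: PM.
  move=> j; have := IH q' _ Pq' _ j; rewrite coefB coefZ coefXn.
  case: eqP => [->|_]; first by move=> _.
  by rewrite mulr0 subr0; apply; [exact: leq_trans sq' _|exact: ltn_trans sq' _].
have n1 : (1 < n)%N.
  rewrite ltnNge; apply/negP => n1; apply: lp.
  have := Pp'; rewrite (size1_polyC (leq_trans (eq_leq pn) n1)) lead_coefC.
  by [].
have p00 : p0 0 by rewrite /p0 /= polyC0.
have nP0 a q : ~ p0 a -> ~ P q -> ~ P (a *: q) by rewrite -mul_polyC => ? ? /Pp[].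
have np0X a k : ~ p0 a -> ~ p0 (a ^+ k) by move=> na /(prime_exp pp0).
(* Euclid's algorithm modulo P. Dividing p by r leaves a remainder q outside P: otherwise w r, hence
   w, is in P; w and q are shorter than p, so their coefficients are in p0, and lead_coef r ^+ k *
   lead_coef p would be in p0. *)
have inv (r : {poly A}) : (size r < n)%N -> ~ P r -> exists w a, ~ p0 a /\ P (w * r - a%:P).
  have [m] := ubnP (size r); elim: m r => // m IH r rm rn Pr.
  have r0 : r != 0 by apply: contra_notN Pr => /eqP ->.
  have [lr|lr] := pselect (p0 (lead_coef r)).
    pose r' := r - lead_coef r *: 'X^((size r).-1).
    have sr' : (size r' < size r)%N by exact: size_strip.
    have PlX : P (lead_coef r *: 'X^((size r).-1)) by rewrite -mul_polyC mulrC; exact: PM.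
    have [||w [a [pa wa]]] := IH r' _ (ltn_trans sr' rn).
    - exact: leq_trans sr' _.
    - by move=> Pr'; apply: Pr; rewrite -[r](subrK (lead_coef r *: 'X^((size r).-1))); exact: PD.
    exists w, a; split=> //; have := PD _ _ wa (PM w _ PlX); rewrite /r'; congr P.
    by ring.
  have [r1|r1] := leqP (size r) 1.
    exists 1, r`_0; rewrite mul1r -size1_polyC // subrr; split=> //.
    by move: Pr; rewrite {1}(size1_polyC r1).
  have [k [w [q [e sq sw]]]] := poly_pseudo_div p r0.
  have nq : ~ P q.
    move=> Pq.
    have Pw : P w.
      have : P (w * r) by rewrite -[w * r](addrK q) -e; apply: ideal_sub => //; rewrite -mul_polyC; exact: PM.
      by move=> /Pp[].
    have sw' : (size w < n)%N.
      by apply: leq_ltn_trans sw _; move: rn r1 n1; rewrite pn; lia.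
    have Pc j : p0 ((lead_coef r ^+ k *: p)`_j).
      rewrite e coefD; have [[_ pD pM] _ _] := pp0; apply: pD.
        rewrite coefM; apply: ideal_sum; first by case: pp0.
        by move=> l _; rewrite mulrC; apply: pM; exact: small.
      by apply: small => //; exact: ltn_trans sq rn.
    have := Pc (size p).-1; rewrite coefZ -lead_coefE.
    by have [_ _ h] := pp0; move=> /h[]; [exact: np0X|].
  have [||w' [a [pa wa]]] := IH q _ _ nq.
  - exact: leq_trans sq _.
  - exact: ltn_trans sq rn.
  exists (- (w' * w)), a; split=> //.
  have -> : - (w' * w) * r - a%:P = (w' * q - a%:P) - w' * (lead_coef r ^+ k *: p).
    by rewrite e; ring.
  by apply: ideal_sub => //; apply: (PM); rewrite -mul_polyC; exact: PM.
have p_n0 : p != 0 by rewrite -size_poly_gt0 pn ltnW.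
have [W [a [pa Wa]]] : exists W a, ~ p0 a /\ P (W * s - a%:P).
  have [k [w [q [e sq _]]]] := poly_pseudo_div s p_n0.
  have nq : ~ P q.
    move=> Pq; apply: (nP0 (lead_coef p ^+ k) s) => //; first exact: np0X.
    by rewrite e; apply: PD => //; exact: PM.
  have [|w' [a [pa wa]]] := inv q _ nq; first by rewrite -pn.
  exists (w' * (lead_coef p ^+ k)%:P), a; split=> //.
  have -> : w' * (lead_coef p ^+ k)%:P * s - a%:P = (w' * q - a%:P) + (w' * w) * p.
    by rewrite -mulrA mul_polyC e; ring.
  by apply: PD => //; exact: PM.
(* The factor a keeps s from vanishing; the factor [lead_coef p] keeps the degree of p, so that its
   image still has a root. *)
have nal : ~ p0 (a * lead_coef p) by case: pp0 => _ _ h /h[].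
have [f [fi fP]] := hA p0 _ pp0 nal; rewrite rmorphM mulf_eq0 negb_or => /andP[fa flp].
have smp : size (map_poly f p) = n by rewrite size_map_poly_id0.
have [|x /rootP px] := closed_rootP (map_poly f p) _.
  by rewrite smp; move: n1; case: (n) => [|[]].
have [g gE] := ext f x.
have gP q : P q -> g q = 0.
  move=> Pq; have [k [w [q' [e sq _]]]] := poly_pseudo_div q p_n0.
  have Pq' : P q'.
    rewrite -[q'](addKr (w * p)) -e addrC; apply: ideal_sub => //; last exact: PM.
    by rewrite -mul_polyC; exact: PM.
  have gq' : g q' = 0.
    rewrite gE; suff -> : map_poly f q' = 0 by rewrite horner0.
    apply/polyP => j; rewrite coef_map coef0 /= fP //; apply: small => //.
    by rewrite -pn.
  have : g (lead_coef p ^+ k *: q) = 0.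
    by rewrite e rmorphD rmorphM gq' addr0 [g p]gE px mulr0.
  rewrite -mul_polyC rmorphM gE map_polyC hornerC /= rmorphXn => /eqP.
  by rewrite mulf_eq0 expf_eq0 (negbTE flp) andbF => /eqP.
exists g; split=> // [c|]; first by rewrite gE map_polyC hornerC /=.
have /eqP := gP _ Wa; rewrite rmorphB rmorphM subr_eq0 => /eqP e.
apply: contraNneq fa => gs; move: e; rewrite gs mulr0 gE map_polyC hornerC /=.
by move=> <-.
Qed.

Fixpoint polyn n : comNzRingType := if n is m.+1 then {poly (polyn m)} else K.

Fixpoint polyn_cst n : K -> polyn n :=
  if n is m.+1 then fun c => (polyn_cst m c)%:P else id.

Lemma has_points_polyn n : has_points (@polyn_cst n).
Proof.
elim: n => [|n IH]; last exact: has_points_poly.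
move=> P s [[P0 PD PM] P1 _] Ps; exists idfun; split=> //=.
  move=> p Pp; apply: contrapT => /eqP p0; apply: P1.
  by rewrite -[1](mulVf p0); exact: PM.
by apply: contra_notN Ps => /eqP ->.
Qed.

End Nullstellensatz.

(** Syntactic polynomials in infinitely many variables: the same expression is evaluated at
    functions, at elements of the function field and at elements of K, and no number of variables
    has to be carried along. Charts with n coordinates put 0 for the variables from n on. *)
Inductive pexp (K : Type) :=
| PC of K | PV of nat | PA of pexp K & pexp K | PM of pexp K & pexp K.
Arguments PV {K}.

Fixpoint pev (K : Type) (B : pzRingType) (j : K -> B) (r : nat -> B) (e : pexp K) : B :=
  match e with
  | PC c => j c
  | PV i => r i
  | PA a b => pev j r a + pev j r b
  | PM a b => pev j r a * pev j r b
  end.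

Fixpoint psub (K : Type) (s : nat -> pexp K) (e : pexp K) : pexp K :=
  match e with
  | PC c => PC c
  | PV i => s i
  | PA a b => PA (psub s a) (psub s b)
  | PM a b => PM (psub s a) (psub s b)
  end.

Lemma pev_sub (K : Type) (B : pzRingType) (j : K -> B) r s e :
  pev j r (psub s e) = pev j (fun i => pev j r (s i)) e.
Proof. by elim: e => //= a -> b ->. Qed.

Lemma pev_ext (K : Type) (B : pzRingType) (j : K -> B) r r' e :
  r =1 r' -> pev j r e = pev j r' e.
Proof. by move=> rr'; elim: e => //= a -> b ->. Qed.

Lemma pev_morph (K : Type) (B C : pzRingType) (j : K -> B) (f : {rmorphism B -> C}) r e :
  f (pev j r e) = pev (f \o j) (f \o r) e.
Proof. by elim: e => //= a <- b <-; rewrite (rmorphD, rmorphM). Qed.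

Section PolynomialExpressions.
Context (K : closedFieldType).
Implicit Types (e : pexp K) (n : nat).

Fixpoint polyn_var n (i : nat) : polyn K n :=
  if n is m.+1 then if i == m then 'X else (polyn_var m i)%:P else 0.

Definition polyn_of n e : polyn K n := pev (@polyn_cst K n) (@polyn_var n) e.

Section Evaluation.
Context (B : comNzRingType) (j : {rmorphism K -> B}) (r : nat -> B).

Lemma polyn_eval_subproof n : exists f : {rmorphism polyn K n -> B},
  [/\ forall c, f (polyn_cst n c) = j c &
      forall i, f (polyn_var n i) = if (i < n)%N then r i else 0].
Proof.
elim: n => [|n [f [fc fv]]].
  by exists j; split=> //= i; rewrite rmorph0.
exists [the {rmorphism {poly (polyn K n)} -> B} of horner_eval (r n) \o map_poly f].
split=> [c|i] /=; rewrite /horner_eval; first by rewrite map_polyC hornerC /= fc.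
have [->|ne] := eqVneq i n; first by rewrite map_polyX hornerX ltnSn.
by rewrite map_polyC hornerC /= fv ltnS [in RHS]leq_eqVlt (negbTE ne).
Qed.

Definition polyn_eval n := projT1 (cid (polyn_eval_subproof n)).

Lemma polyn_evalE n e : (forall i, (n <= i)%N -> r i = 0) ->
  polyn_eval n (polyn_of n e) = pev j r e.
Proof.
move=> r0; rewrite /polyn_eval; case: cid => f [fc fv] /=.
rewrite /polyn_of; elim: e => //= [i|a <- b <-|a <- b <-]; last 2 first.
- by rewrite rmorphD.
- by rewrite rmorphM.
by rewrite fv; case: ltnP => // /r0.
Qed.

End Evaluation.

Lemma polyn_ofA n a b : polyn_of n (PA a b) = polyn_of n a + polyn_of n b.
Proof. by []. Qed.

Lemma polyn_ofM n a b : polyn_of n (PM a b) = polyn_of n a * polyn_of n b.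
Proof. by []. Qed.

Lemma polyn_of_surj n (p : polyn K n) : exists e, polyn_of n e = p.
Proof.
elim: n p => [|n IH] p; first by exists (PC p).
elim/poly_ind: p => [|p c [e ep]]; first by exists (PC 0); rewrite /polyn_of /=; elim: (n) => //= m ->; rewrite polyC0.
have [d dc] := IH c.
have lift : forall d : pexp K, exists d', polyn_of n.+1 d' = (polyn_of n d)%:P.
  elim=> [k|i|a [a' ea] b [b' eb]|a [a' ea] b [b' eb]].
  - by exists (PC k).
  - have [->|ne] := eqVneq i n; last by exists (PV i); rewrite /polyn_of /= (negbTE ne).
    exists (PC 0); rewrite /polyn_of /=.
    have c0 m : polyn_cst m 0 = 0 :> polyn K m by elim: m => //= m ->.
    have v0 m k : (m <= k)%N -> polyn_var m k = 0.
      elim: m => //= m IHm mk; rewrite IHm ?polyC0 1?ltnW //.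
      by case: eqP mk => // ->; rewrite ltnn.
    by rewrite c0 v0.
  - by exists (PA a' b'); rewrite polyn_ofA ea eb; exact: esym (polyCD _ _).
  - by exists (PM a' b'); rewrite polyn_ofM ea eb; exact: esym (polyCM _ _).
have [d' ed'] := lift d.
by exists (PA (PM e (PV n)) d'); rewrite polyn_ofA polyn_ofM ep ed' dc /polyn_of /= eqxx.
Qed.

Lemma polyn_of_eq n e e' : polyn_of n e = polyn_of n e' ->
  forall (B : comNzRingType) (j : {rmorphism K -> B}) r,
  (forall i, (n <= i)%N -> r i = 0) -> pev j r e = pev j r e'.
Proof. by move=> ee' B j r r0; rewrite -!(polyn_evalE _ _ r0) ee'. Qed.

Lemma polyn_hom n (f : {rmorphism polyn K n -> K}) e :
  (forall c, f (polyn_cst n c) = c) ->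
  f (polyn_of n e) = pev id (f \o @polyn_var n) e.
Proof.
move=> fc; rewrite /polyn_of pev_morph; by elim: e => //= a -> b ->.
Qed.

(** J is the preimage of an ideal of the polynomial ring in n variables, which contains it in a
    prime ideal with a K-point; stating it for expressions hides the iterated polynomial ring from
    the applications. *)
Lemma nullstellensatz n (J : set (pexp K)) :
  (forall e e', polyn_of n e = polyn_of n e' -> J e -> J e') ->
  (forall a b, J a -> J b -> J (PA a b)) -> (forall a b, J b -> J (PM a b)) ->
  J (PC 0) -> ~ J (PC 1) ->
  exists x : nat -> K, (forall i, (n <= i)%N -> x i = 0) /\ forall e, J e -> pev id x e = 0.
Proof.
move=> Je JA JM J0 J1; pose I : set (polyn K n) := [set p | exists2 e, polyn_of n e = p & J e].
have c0 m : polyn_cst m 0 = 0 :> polyn K m by elim: m => //= m ->.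
have c1 m : polyn_cst m 1 = 1 :> polyn K m by elim: m => //= m ->.
have v0 m k : (m <= k)%N -> polyn_var m k = 0.
  elim: m => //= m IHm mk; rewrite IHm ?polyC0 1?ltnW //.
  by case: eqP mk => // ->; rewrite ltnn.
have iI : ideal I.
  split=> [|_ _ [a <- Ja] [b <- Jb]|a _ [b <- Jb]].
  - by exists (PC 0) => //; rewrite /polyn_of /= c0.
  - by exists (PA a b) => //; exact: JA.
  - by have [d <-] := polyn_of_surj a; exists (PM d b) => //; exact: JM.
have I1 : ~ I 1.
  by move=> [e e1 Je1]; apply: J1; apply: Je Je1; rewrite e1 /polyn_of /= c1.
have [P [pP IP]] := ex_prime_ideal iI I1; have [_ P1 _] := pP.
have [f [fc fP _]] := has_points_polyn pP P1.
exists (f \o @polyn_var n); split=> [i ni /=|e Jep]; first by rewrite v0 // rmorph0.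
by rewrite -polyn_hom // fP //; apply: IP; exists e.
Qed.

Section PrimeNullstellensatz.
Context (B : comNzRingType) (j : {rmorphism K -> B}) (r : nat -> B).
Local Notation R := [set f | exists e, f = pev j r e].

(** P is pulled back to the polynomial ring along the evaluation at r. It has to be a prime ideal of
    the subring K[r] only, so the closure conditions are restricted to that subring. *)
Lemma nullstellensatz_prime n (P : set B) s : (forall i, (n <= i)%N -> r i = 0) ->
  P 0 -> (forall a b, R a -> R b -> P a -> P b -> P (a + b)) ->
  (forall a b, R a -> R b -> P b -> P (a * b)) -> ~ P 1 ->
  (forall a b, R a -> R b -> P (a * b) -> P a \/ P b) -> R s -> ~ P s ->
  exists x : nat -> K, (forall e, P (pev j r e) -> pev id x e = 0) /\
    forall e, pev j r e = s -> pev id x e != 0.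
Proof.
move=> r0 P0 PD PM P1 Pp [t st] Ps; pose f := @polyn_eval B j r n.
have fR p : R (f p).
  by have [e <-] := polyn_of_surj p; exists e; rewrite /f polyn_evalE.
have pQ : prime_ideal [set p | P (f p)].
  split; [split=> [|a b|a b]|by rewrite /= rmorph1|] => /=.
  - by rewrite rmorph0.
  - by move=> Pa Pb; rewrite rmorphD; exact: PD.
  - by move=> Pb; rewrite rmorphM; exact: PM.
  - by move=> a b; rewrite rmorphM => /Pp; apply.
have [|g [gc gP gs]] := has_points_polyn pQ (s := polyn_of n t).
  by rewrite /= /f polyn_evalE // -st.
exists (g \o @polyn_var n); split=> e; rewrite -polyn_hom //.
  by move=> Pe; apply: gP; rewrite /= /f polyn_evalE.
move=> es; apply: contraNneq gs => ge.
suff h : g (polyn_of n t - polyn_of n e) = 0.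
  by move: h; rewrite rmorphB ge subr0 => ->.
by apply: gP; rewrite /= /f rmorphB !polyn_evalE // es -st subrr.
Qed.

End PrimeNullstellensatz.
End PolynomialExpressions.

Lemma dependent_choice_seq (T : Type) (Q : seq T -> T -> Prop) :
  (forall s, exists x, Q s x) -> exists u : nat -> T, forall n, Q (mkseq u n) (u n).
Proof.
move=> /choice[f fQ].
pose L := fix L n := if n is m.+1 then rcons (L m) (f (L m)) else [::].
exists (fun n => f (L n)) => n.
suff -> : mkseq (fun n => f (L n)) n = L n by [].
by elim: n => // n IH; rewrite mkseqS IH.
Qed.

(** * Noetherian rings graded by a group *)

Section GradedHilbert.
Context (F : comNzRingType) (G : zmodType).
Implicit Types (B M N : G -> set F) (s : seq (G * F)) (g h : G).

(* A G-graded subring of F[G], given by the coefficients of its homogeneous elements. *)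
Definition gring B : Prop :=
  [/\ B 0 (-1), forall g, B g 0, forall g a b, B g a -> B g b -> B g (a + b) &
      forall g h a b, B g a -> B h b -> B (g + h) (a * b)].

Definition gmod B M : Prop :=
  [/\ forall g, M g 0, forall g a b, M g a -> M g b -> M g (a + b) &
      forall g h a b, B g a -> M h b -> M (g + h) (a * b)].

Fixpoint gspan B s h : set F :=
  if s is x :: s' then
    [set f | exists c d, [/\ B (h - x.1) c, gspan B s' h d & f = c * x.2 + d]]
  else [set 0].

Definition gfg B M : Prop := exists s,
  (forall x, x \in s -> M x.1 x.2) /\ forall h, M h `<=` gspan B s h.

Definition gnoeth B M : Prop :=
  forall N, gmod B N -> (forall h, N h `<=` M h) -> gfg B N.

Lemma gring_mod B : gring B -> gmod B B.
Proof. by move=> [_ B0 BD BM]; split. Qed.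

Lemma gring1 B : gring B -> B 0 1.
Proof. by move=> [B1 _ _ BM]; have := BM _ _ _ _ B1 B1; rewrite addr0 mulrNN mulr1. Qed.

Lemma gringN B g a : gring B -> B g a -> B g (- a).
Proof.
by move=> [B1 _ _ BM] Ba; have := BM _ _ _ _ B1 Ba; rewrite add0r mulN1r.
Qed.

Lemma gmodN B M g a : gring B -> gmod B M -> M g a -> M g (- a).
Proof.
by move=> [B1 _ _ _] [_ _ MM] Ma; have := MM _ _ _ _ B1 Ma; rewrite add0r mulN1r.
Qed.

Lemma gmod_in B M g h a b : gmod B M -> B (g - h) a -> M h b -> M g (a * b).
Proof. by move=> [_ _ MM] Ba Mb; have := MM _ _ _ _ Ba Mb; rewrite subrK. Qed.

Lemma gspan_mod B s : gring B -> gmod B (gspan B s).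
Proof.
move=> [_ B0 BD BM]; elim: s => [|x s [S0 SD SM]] /=.
  split=> // [g a b -> ->|g h a b _ ->]; first by rewrite addr0.
  by rewrite mulr0.
split=> [g|g _ _ [c [d [Bc Sd ->]]] [c' [d' [Bc' Sd' ->]]]|g h a _ Ba [c [d [Bc Sd ->]]]].
- by exists 0, 0; rewrite mul0r addr0.
- exists (c + c'), (d + d'); split; [exact: BD|exact: SD|].
  by rewrite mulrDl addrACA.
- exists (a * c), (a * d); split; last by rewrite mulrDr mulrA.
    by rewrite -addrA; exact: BM.
  exact: SM.
Qed.

Lemma gspan_min B M s : gmod B M -> (forall x, x \in s -> M x.1 x.2) ->
  forall h, gspan B s h `<=` M h.
Proof.
move=> mM; have [M0 MD MM] := mM; elim: s => [|x s IH] sM h f /=; first by move=> ->.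
move=> [c [d [Bc Sd ->]]]; apply: MD; last first.
  by apply: IH Sd => y ys; apply: sM; rewrite inE ys orbT.
by apply: gmod_in mM Bc _; apply: sM; rewrite mem_head.
Qed.

Lemma gspan_in B s x : gring B -> x \in s -> gspan B s x.1 x.2.
Proof.
move=> rB; have [_ B0 _ _] := rB; elim: s => //= y s IH; rewrite inE => /predU1P[->|xs].
  exists 1, 0; rewrite mul1r addr0 subrr; split=> //; first exact: gring1.
  by have [] := gspan_mod s rB.
by exists 0, x.2; rewrite mul0r add0r; split=> //; exact: IH.
Qed.

Lemma gspan_sub B s s' : gring B -> {subset s <= s'} ->
  forall h, gspan B s h `<=` gspan B s' h.
Proof.
by move=> rB ss'; apply: gspan_min (gspan_mod _ rB) _ => x /ss'; exact: gspan_in.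
Qed.

Lemma mem_mkseq (T : eqType) (u : nat -> T) n x :
  reflect (exists2 i, (i < n)%N & x = u i) (x \in mkseq u n).
Proof.
apply: (iffP mapP) => -[i]; rewrite ?mem_iota; first by move=> ? ->; exists i.
by move=> ? ->; exists i; rewrite ?mem_iota.
Qed.

(** The ascending chain condition: the union of the spans of the initial segments is finitely
    generated, and its generators already lie in one of these spans. *)
Lemma gnoeth_seq B (u : nat -> G * F) : gring B -> gnoeth B B ->
  (forall n, B (u n).1 (u n).2) ->
  exists n, gspan B (mkseq u n) (u n).1 (u n).2.
Proof.
move=> rB nB uB.
have mono m n h : (m <= n)%N -> gspan B (mkseq u m) h `<=` gspan B (mkseq u n) h.
  move=> mn; apply: gspan_sub => // x /mem_mkseq[i im ->]; apply/mem_mkseq.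
  by exists i => //; exact: leq_trans im mn.
pose M h : set F := [set f | exists n, gspan B (mkseq u n) h f].
have mM : gmod B M.
  split=> [g|g a b [m ma] [n nb]|g h a b Ba [n nb]].
  - by exists 0.
  - exists (maxn m n); have [_ SD _] := gspan_mod (mkseq u (maxn m n)) rB.
    by apply: SD; [apply: mono ma|apply: mono nb]; rewrite ?leq_maxl ?leq_maxr.
  - by exists n; have [_ _ SM] := gspan_mod (mkseq u n) rB; exact: SM.
have [|s [sM Ms]] := nB M mM.
  by move=> h f [n]; apply: gspan_min => //; [exact: gring_mod|move=> x /mem_mkseq[i _ ->]].
have [n sn] : exists n, forall x, x \in s -> gspan B (mkseq u n) x.1 x.2.
  elim: s sM {Ms} => [|x s IH] sM; first by exists 0.
  have [|N1 h1] := IH; first by move=> y ys; apply: sM; rewrite inE ys orbT.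
  have [N2 h2] := sM x (mem_head _ _).
  exists (maxn N1 N2) => y; rewrite inE => /predU1P[->|ys].
    by apply: mono h2; rewrite leq_maxr.
  by apply: mono (h1 _ ys); rewrite leq_maxl.
exists n; apply: (@gspan_min B _ s); [exact: gspan_mod|exact: sn|].
apply: Ms; exists n.+1; apply: gspan_in => //; apply/mem_mkseq.
by exists n.
Qed.

(** Induction on the generators. The coefficients of the first generator e in elements of N form an
    ideal J of B; lifts to N of generators of J, together with generators of the part of N in the
    span of the others, generate N. *)
Lemma gnoeth_span B s : gring B -> gnoeth B B -> gnoeth B (gspan B s).
Proof.
move=> rB nB; have [B1 B0 BD BM] := rB; elim: s => [|[g e] s IH] N mN Ns.
  exists [::]; split=> // h f /Ns /=; exact.
have [N0 ND NM] := mN; have mS := gspan_mod s rB; have [S0 SD SM] := mS.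
(* Degrees are shifted by g, the degree of e, so that J is a graded ideal of B. *)
pose J k : set F := [set c | B k c /\ exists2 f, gspan B s (k + g) f & N (k + g) (c * e + f)].
have [||t [tJ Jt]] := nB J.
- split=> [k|k a b [Ba [f Sf Nf]] [Bb [f' Sf' Nf']]|k k' a b Ba [Bb [f Sf Nf]]].
  + by split=> //; exists 0; rewrite ?mul0r ?addr0.
  + split; first exact: BD.
    exists (f + f'); first exact: SD.
    by have := ND _ _ _ Nf Nf'; rewrite mulrDl addrACA.
  + split; first exact: BM.
    rewrite -addrA; exists (a * f); first exact: SM.
    by have := NM _ _ _ _ Ba Nf; rewrite mulrDr mulrA.
- by move=> h c [].
have [tf tfP] : exists tf : G * F -> F, forall x, x \in t ->
    gspan B s (x.1 + g) (tf x) /\ N (x.1 + g) (x.2 * e + tf x).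
  have /choice[tf tfP] : forall x, exists f, x \in t ->
    gspan B s (x.1 + g) f /\ N (x.1 + g) (x.2 * e + f).
    move=> x; case: (boolP (x \in t)) => [xt|_]; last by exists 0.
    by have [_ [f Sf Nf]] := tJ _ xt; exists f.
  by exists tf.
have [||t' [t'N Nt']] := IH (fun h => N h `&` gspan B s h).
- split=> [k|k a b [Na Sa] [Nb Sb]|k k' a b Ba [Nb Sb]]; split => //.
  + exact: ND.
  + exact: SD.
  + exact: NM.
  + exact: SM.
- by move=> h f [].
pose t1 := [seq (x.1 + g, x.2 * e + tf x) | x <- t].
exists (t1 ++ t'); split.
  move=> x; rewrite mem_cat => /orP[/mapP[y yt ->]|/t'N[] //].
  by have [] := tfP _ yt.
have key k c : gspan B t k c -> exists2 f, gspan B s (k + g) f & gspan B t1 (k + g) (c * e + f).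
  rewrite /t1; elim: (t) tfP k c => [|x t2 IHt] xP k c /=.
    by move=> ->; exists 0 => //; rewrite mul0r addr0.
  move=> [a [d [Ba Sd ->]]].
  have xP2 y : y \in t2 -> _ := fun yt => xP y (@mem_behead _ (x :: t2) _ yt).
  have [f Sf Tf] := IHt xP2 _ _ Sd.
  have [Sx Nx] := xP x (mem_head _ _).
  exists (a * tf x + f).
    by apply: SD => //; apply: gmod_in mS _ Sx; rewrite opprD addrACA subrr addr0.
  exists a, (d * e + f); split=> //; first by rewrite opprD addrACA subrr addr0.
  by rewrite mulrDr mulrDl mulrA addrACA.
move=> h f Nf; have [c [d [Bc Sd fE]]] := Ns _ _ Nf.
have [|f' Sf' Tf'] := key (h - g) c.
  by apply: Jt; split=> //; rewrite subrK; exists d => //; rewrite -fE.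
rewrite subrK in Sf' Tf'.
have [_ TD _] := gspan_mod (t1 ++ t') rB.
have -> : f = (c * e + f') + (f - (c * e + f')) by rewrite addrC subrK.
have T1 : gspan B (t1 ++ t') h (c * e + f').
  by apply: gspan_sub Tf' => // x xt; rewrite mem_cat xt.
apply: TD => //; apply: (@gspan_sub B t') => // [x xt|]; first by rewrite mem_cat xt orbT.
apply: Nt'; split.
  apply: ND => //; apply: (gmodN rB mN).
  apply: (gspan_min mN) Tf' => x /mapP[y yt ->]; by have [] := tfP _ yt.
rewrite fE opprD addrACA subrr add0r; apply: SD => //.
exact: (gmodN rB mS).
Qed.

(** The part of degree h of B[a], with a placed in degree g. The element a need not be
    transcendental over B, so the polynomial representing f is not unique. *)
Definition gadj B g (a : F) h : set F :=
  [set f | exists p : {poly F}, (forall i, B (h - g *+ i) p`_i) /\ f = p.[a]].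

Lemma gring_sum B g (I : Type) (r : seq I) (P : pred I) (f : I -> F) : gring B ->
  (forall i, P i -> B g (f i)) -> B g (\sum_(i <- r | P i) f i).
Proof. by move=> [_ B0 BD _] h; apply: (big_ind (B g)) => // a b; exact: BD. Qed.

Lemma gadj_ring B g a : gring B -> gring (gadj B g a).
Proof.
move=> rB; have [B1 B0 BD BM] := rB; split.
- exists (-1); split; last by rewrite hornerN hornerC.
  move=> i; rewrite coefN coef1; case: i => [|i] /=; first by rewrite mulr0n subr0.
  by rewrite oppr0.
- by move=> h; exists 0; split; [move=> i; rewrite coef0|rewrite horner0].
- move=> h _ _ [p [pB ->]] [q [qB ->]]; exists (p + q); rewrite hornerD; split=> // i.
  by rewrite coefD; exact: BD.
- move=> h h' _ _ [p [pB ->]] [q [qB ->]]; exists (p * q); rewrite hornerM; split=> // i.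
  rewrite coefM; apply: gring_sum => // j _.
  have := BM _ _ _ _ (pB j) (qB (i - j)%N); congr (B _ _).
  by rewrite addrACA -opprD -mulrnDr subnKC // -ltnS.
Qed.

Lemma gadj_sub B g a h : gring B -> B h `<=` gadj B g a h.
Proof.
move=> [_ B0 _ _] c Bc; exists c%:P; rewrite hornerC; split=> // i.
by rewrite coefC; case: i => //=; rewrite mulr0n subr0.
Qed.

Lemma gadj_gen B g a : gring B -> gadj B g a g a.
Proof.
move=> rB; have [_ B0 _ _] := rB; exists 'X; rewrite hornerX; split=> // i.
rewrite coefX; case: i => [|[|i]] //=; rewrite mulr1n subrr.
exact: gring1.
Qed.

Lemma gring_exp B g a n : gring B -> B g a -> B (g *+ n) (a ^+ n).
Proof.
move=> rB Ba; have [_ _ _ BM] := rB; elim: n => [|n IH]; first exact: gring1.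
by rewrite mulrS exprS; exact: BM.
Qed.

Lemma gadj_min B B' g a : gring B' -> (forall h, B h `<=` B' h) -> B' g a ->
  forall h, gadj B g a h `<=` B' h.
Proof.
move=> rB' BB' B'a h _ [p [pB ->]]; have [_ _ _ BM] := rB'.
rewrite horner_coef; apply: gring_sum => // i _.
by rewrite -[h](subrK (g *+ i)); apply: BM; [exact/BB'|exact: gring_exp].
Qed.

(** Hilbert's basis theorem. If N is not finitely generated, choose successively elements of N
    outside the span of the previous ones, each represented by a polynomial of minimal size. By
    [gnoeth_seq] some leading coefficient is a combination of the earlier ones, and subtracting the
    matching combination gives a shorter polynomial outside the span. *)
Lemma gnoeth_adj B g a : gring B -> gnoeth B B -> gnoeth (gadj B g a) (gadj B g a).
Proof.
move=> rB nB N mN NB'; have rB' := gadj_ring g a rB; set B' := gadj B g a in rB' mN NB' *.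
have [B1 B0 BD BM] := rB; have [N0 ND NM] := mN.
apply: contrapT => nfg.
pose good (x : G * {poly F}) := (forall i, B (x.1 - g *+ i) x.2`_i) /\ N x.1 x.2.[a].
pose ev (x : G * {poly F}) := (x.1, x.2.[a]).
pose out (s : seq (G * {poly F})) (x : G * {poly F}) := ~ gspan B' [seq ev y | y <- s] x.1 x.2.[a].
have [|u uP] := @dependent_choice_seq (G * {poly F})%type (fun (s : seq (G * {poly F})) x => (forall y, y \in s -> good y) ->
    [/\ good x, out s x & forall y, good y -> out s y -> (size x.2 <= size y.2)%N]).
  move=> s; have [sg|nsg] := pselect (forall y, y \in s -> good y); last by exists (0, 0).
  have [x [gx ox]] : exists x, good x /\ out s x.
    apply: contrapT => /forallNP nx; apply: nfg; exists [seq ev y | y <- s]; split.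
      by move=> _ /mapP[y ys ->]; have [] := sg _ ys.
    move=> h f Nf; have [p [pB fE]] := NB' _ _ Nf; apply: contrapT => nf.
    by apply: (nx (h, p)); split; rewrite /good /out /= -?fE.
  have /ex_minnP[n /asboolP[z [gz oz zn]] nmin] :
    exists n, `[< exists z, [/\ good z, out s z & size z.2 = n] >].
    by exists (size x.2); apply/asboolP; exists x.
  exists z => _; split=> // y gy oy; rewrite zn; apply/nmin/asboolP; by exists y.
have uQ n : [/\ good (u n), out (mkseq u n) (u n) &
    forall y, good y -> out (mkseq u n) y -> (size (u n).2 <= size y.2)%N].
  elim/ltn_ind: n => n IH; apply: uP => y /mem_mkseq[i /IH[gi _ _] ->] //.
have mono m n x : (m <= n)%N -> out (mkseq u n) x -> out (mkseq u m) x.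
  move=> mn ox sx; apply: ox; apply: gspan_sub sx => // _ /mapP[y /mem_mkseq[i im ->] ->].
  by apply: map_f; apply/mem_mkseq; exists i => //; exact: leq_trans im mn.
have un0 n : (0 < size (u n).2)%N.
  rewrite size_poly_gt0; apply/eqP => e; have [_ ou _] := uQ n; apply: ou.
  by rewrite e horner0; have [] := gspan_mod [seq ev y | y <- mkseq u n] rB'.
pose lc (x : G * {poly F}) := (x.1 - g *+ (size x.2).-1, lead_coef x.2).
have [|n Sn] := @gnoeth_seq B (fun n => lc (u n)) rB nB.
  by move=> n; have [[gn _] _ _] := uQ n; rewrite /= lead_coefE; exact: gn.
have [[gn Nn] on nmin] := uQ n.
pose D := (size (u n).2).-1; pose H := (u n).1.
(* A relation between leading coefficients lifts to polynomials: each y is multiplied by the power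
   of X that raises its degree to D, which also corrects the degree in G. *)
have : forall s : seq (G * {poly F}), (forall y, y \in s -> good y /\ (0 < size y.2 <= D.+1)%N) -> forall c,
    gspan B [seq lc y | y <- s] (H - g *+ D) c ->
    exists q : {poly F}, [/\ forall i, B (H - g *+ i) q`_i, (size q <= D.+1)%N, q`_D = c
      & gspan B' [seq ev y | y <- s] H q.[a]].
  elim=> [|y s IH] sP c /=.
    by move=> ->; exists 0; rewrite size_poly0 horner0 coef0; split=> // i; rewrite coef0.
  move=> [c1 [c2 [Bc1 Sc2 ->]]].
  have [q2 [q2B sq2 q2D q2S]] := IH (fun z zs => sP z (@mem_behead _ (y :: s) _ zs)) c2 Sc2.
  have [[yB yN] /andP[y0 yD]] := sP y (mem_head _ _).
  set dy := (size y.2).-1 in Bc1 *.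
  have De : (D = dy + (D - dy))%N by rewrite subnKC // -ltnS prednK.
  set e := (D - dy)%N in De.
  have cB i : B (H - g *+ i) (c1 *: 'X^e * y.2)`_i.
    rewrite -scalerAl coefZ coefXnM; case: ltnP => ie; first by rewrite mulr0.
    have := BM _ _ _ _ Bc1 (yB (i - e)%N); congr (B _ _).
    rewrite /= De mulrnDr -[in RHS](subnKC ie) mulrnDr; move: (g *+ dy) (g *+ e) (g *+ (i - e)) => X E J.
    rewrite opprB -addrA subrKA opprD (addrC (- X)) -addrA.
    by rewrite subrKA opprD.
  exists (c1 *: 'X^e * y.2 + q2); split.
  - by move=> i; rewrite coefD; exact: BD.
  - apply: leq_trans (size_polyD _ _) _; rewrite geq_max sq2 andbT.
    rewrite -scalerAl; apply: leq_trans (size_scale_leq _ _) _.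
    apply: leq_trans (size_polyMleq _ _) _; rewrite size_polyXn /= De.
    by rewrite -(prednK y0) addnS addnC.
  - rewrite coefD q2D -scalerAl coefZ coefXnM De ltnNge leq_addl /= addnK.
    by rewrite lead_coefE.
  - exists (c1 * a ^+ e), q2.[a]; split=> //; last first.
      by rewrite hornerD hornerM hornerZ hornerXn.
    exists (c1 *: 'X^e); rewrite hornerZ hornerXn; split=> // i.
    rewrite coefZ coefXn; case: eqP => [->|_]; last by rewrite mulr0.
    rewrite mulr1; move: Bc1; rewrite /= De mulrnDr; congr (B _ _).
    move: (g *+ dy) (g *+ e) => X E.
    by rewrite opprB [X + E]addrC opprD -addrA subrKA addrA addrAC.
have uok y : y \in mkseq u n -> good y /\ (0 < size y.2 <= D.+1)%N.
  move=> /mem_mkseq[i im ->]; have [gi _ imin] := uQ i; split=> //.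
  rewrite un0 /= /D prednK //; apply: imin.
    by have [] := uQ n.
  by apply: mono on; exact: ltnW.
have Sn' : gspan B [seq lc y | y <- mkseq u n] (H - g *+ D) (lead_coef (u n).2).
  by move: Sn; rewrite -map_comp.
move=> /(_ _ uok _ Sn')[q [qB sq qD qS]].
have qN : N H q.[a].
  by apply: (gspan_min mN) qS => _ /mapP[y /uok[[_ yN] _] ->].
have g1 : good (H, (u n).2 - q).
  split=> [i|] /=; last first.
    by rewrite hornerD hornerN; apply: ND => //; exact: (gmodN rB' mN).
  by rewrite coefB; apply: BD => //; exact: gringN.
have o1 : out (mkseq u n) (H, (u n).2 - q).
  move=> /= ou; apply: on; have [_ SD _] := gspan_mod [seq ev y | y <- mkseq u n] rB'.
  by have := SD _ _ _ ou qS; rewrite hornerD hornerN subrK.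
have := nmin _ g1 o1; apply/negP; rewrite -ltnNge /= -(prednK (un0 n)) ltnS.
apply/leq_sizeP => j jD; rewrite coefB.
have [->|ne] := eqVneq j D; first by rewrite qD lead_coefE subrr.
have Dj : (D < j)%N by rewrite ltn_neqAle eq_sym ne.
rewrite !nth_default ?subr0 //; first exact: leq_trans sq _.
by rewrite -(prednK (un0 n)).
Qed.

Section Generated.
Context (K : fieldType) (j : {rmorphism K -> F}).

Definition gconst h : set F := [set f | f = 0 \/ h = 0 /\ exists c, f = j c].

Lemma gconst_ring : gring gconst.
Proof.
split.
- by right; split=> //; exists (-1); rewrite rmorphN1.
- by left.
- move=> g a b [->|[-> [c ->]]]; first by rewrite add0r.
  move=> [->|[_ [d ->]]]; rewrite ?addr0; right; split=> //; first by exists c.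
  by exists (c + d); rewrite rmorphD.
- move=> g h a b [->|[-> [c ->]]]; first by rewrite mul0r; left.
  move=> [->|[-> [d ->]]]; rewrite ?mulr0; first by left.
  by right; rewrite addr0; split=> //; exists (c * d); rewrite rmorphM.
Qed.

Lemma gconst_noeth : gnoeth gconst gconst.
Proof.
move=> N mN NC.
have [[h [f [Nf f0]]]|nN] := pselect (exists h f, N h f /\ f != 0); last first.
  exists [::]; split=> // h f Nf /=; apply: contrapT => /eqP f0.
  by apply: nN; exists h, f.
have [e|[h0 [c fc]]] := NC _ _ Nf; first by rewrite e eqxx in f0.
have c0 : c != 0 by apply: contraNneq f0 => c0; rewrite fc c0 rmorph0.
exists [:: (0, f)]; split=> [x|h' f' Nf'] /=.
  by rewrite inE => /eqP -> /=; rewrite -h0.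
have [->|[-> [d ->]]] := NC _ _ Nf'.
  by exists 0, 0; rewrite mul0r addr0; split=> //; left.
exists (j (d / c)), 0; rewrite addr0 fc -rmorphM divfK // subr0; split=> //.
by right; split=> //; exists (d / c).
Qed.

Definition galg s : G -> set F := foldr (fun x B => gadj B x.1 x.2) gconst s.

Lemma galg_ring s : gring (galg s).
Proof. by elim: s => [|x s IH]; [exact: gconst_ring|exact: gadj_ring]. Qed.

Lemma galg_noeth s : gnoeth (galg s) (galg s).
Proof.
by elim: s => [|x s IH]; [exact: gconst_noeth|apply: gnoeth_adj IH; exact: galg_ring].
Qed.

Lemma galg_const s h : gconst h `<=` galg s h.
Proof.
elim: s => [//|x s IH] f fc /=; apply: gadj_sub; [exact: galg_ring|exact: IH].
Qed.

Lemma galg_cst s c : galg s 0 (j c).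
Proof. by apply: galg_const; right; split=> //; exists c. Qed.

Lemma galg_gen s x : x \in s -> galg s x.1 x.2.
Proof.
elim: s => //= y s IH; rewrite inE => /predU1P[->|xs].
  by apply: gadj_gen; exact: galg_ring.
by apply: gadj_sub; [exact: galg_ring|exact: IH].
Qed.

Lemma galg_min B s : gring B -> (forall c, B 0 (j c)) ->
  (forall x, x \in s -> B x.1 x.2) -> forall h, galg s h `<=` B h.
Proof.
move=> rB Bc; elim: s => [_ h f|x s IH sB] /=.
  by case=> [->|[-> [c ->]]]; [case: rB|].
apply: gadj_min => //; last by apply: sB; rewrite mem_head.
by apply: IH => y ys; apply: sB; rewrite inE ys orbT.
Qed.

End Generated.

End GradedHilbert.

(** * Normal Noetherian domains *)

Section SubringsOfFields.
Context (F : fieldType).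
Implicit Types (R J P Q : set F) (s : seq F).

Definition subring R : Prop :=
  [/\ R 1, forall a b, R a -> R b -> R (a - b) & forall a b, R a -> R b -> R (a * b)].

Section Subring.
Context (R : set F) (rR : subring R).

Lemma subring0 : R 0.
Proof. by have [R1 RB _] := rR; rewrite -(subrr 1); exact: RB. Qed.

Lemma subringN a : R a -> R (- a).
Proof. by have [_ RB _] := rR; rewrite -sub0r; apply: RB; exact: subring0. Qed.

Lemma subringD a b : R a -> R b -> R (a + b).
Proof. by have [_ RB _] := rR; move=> Ra /subringN Rb; have := RB _ _ Ra Rb; rewrite opprK. Qed.

Lemma subringX a n : R a -> R (a ^+ n).
Proof.
have [R1 _ RM] := rR => Ra; elim: n => [|n IH]; first by rewrite expr0.
by rewrite exprS; exact: RM.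
Qed.

Lemma subring_sum (I : Type) (r : seq I) (p : pred I) (f : I -> F) :
  (forall i, p i -> R (f i)) -> R (\sum_(i <- r | p i) f i).
Proof. by move=> h; apply: (big_ind R) => //; [exact: subring0|exact: subringD]. Qed.

Definition over (p : {poly F}) : Prop := forall i, R p`_i.

Lemma char_poly_over n (M : 'M[F]_n) : (forall i k, R (M i k)) -> over (char_poly M).
Proof.
have [R1 _ RM] := rR => MR.
have oD p q : over p -> over q -> over (p + q).
  by move=> op oq i; rewrite coefD; exact: subringD.
have oM p q : over p -> over q -> over (p * q).
  by move=> op oq i; rewrite coefM; apply: subring_sum => k _; exact: RM.
have o1 : over 1 by move=> i; rewrite coef1; case: eqP => _ //; exact: subring0.
have o0 : over 0 by move=> i; rewrite coef0; exact: subring0.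
apply: (big_ind over) => // p _; apply: (oM).
  rewrite -signr_odd; case: odd; rewrite ?expr1 ?expr0 // => i.
  by rewrite coefN; apply: subringN; exact: o1.
apply: (big_ind over) => // k _ i; rewrite !mxE coefB coefC.
apply: subringD; first by rewrite coefMn coefX; do 2 case: eqP => _ //=;
  rewrite ?mulr1n ?mulr0n //; exact: subring0.
by apply: subringN; case: eqP => // _; exact: subring0.
Qed.

(* Multiplication by g on the span of s is represented by a matrix over R; p is its
   characteristic polynomial. *)
Lemma det_trick s g : (exists2 x, x \in s & x != 0) ->
  (forall x, x \in s -> exists c : nat -> F, (forall i, R (c i)) /\
     g * x = \sum_(i < size s) c i * s`_i) ->
  exists p : {poly F}, [/\ p \is monic, over p & root p g].
Proof.
move=> [x xs x0] gs.
have /choice[c cP] : forall k : 'I_(size s), exists c : nat -> F,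
    (forall i, R (c i)) /\ g * s`_k = \sum_(i < size s) c i * s`_i.
  by move=> k; apply: gs; rewrite mem_nth.
pose M := \matrix_(i < size s, k < size s) c k i.
exists (char_poly M); split; [exact: char_poly_monic| |].
  by apply: char_poly_over => i k; rewrite mxE; have [] := cP k.
rewrite -eigenvalue_root_char; apply/eigenvalueP; exists (\row_i s`_i).
  apply/rowP => k; rewrite !mxE; have [_ ->] := cP k.
  by apply: eq_bigr => i _; rewrite !mxE mulrC.
apply/eqP => /rowP e; move: x0; have /(nthP 0)[i si <-] := xs.
by have := e (Ordinal si); rewrite !mxE /= => ->; rewrite eqxx.
Qed.

Definition rideal J : Prop :=
  [/\ J `<=` R, J 0, forall a b, J a -> J b -> J (a + b) &
      forall a b, R a -> J b -> J (a * b)].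

Definition rprime P : Prop :=
  [/\ rideal P, ~ P 1 & forall a b, R a -> R b -> P (a * b) -> P a \/ P b].

(** The vector s is killed by 1 - M for a matrix M over J, so det (1 - M) = 0; but this determinant
    is congruent to 1 modulo J. *)
Lemma nakayama J s : rideal J -> (exists2 x, x \in s & x != 0) ->
  (forall x, x \in s -> exists c : nat -> F, (forall i, J (c i)) /\
     x = \sum_(i < size s) c i * s`_i) -> J 1.
Proof.
move=> [JR J0 JD JM] [x xs x0] gs; have [R1 _ RM] := rR.
have /choice[c cP] : forall k : 'I_(size s), exists c : nat -> F,
    (forall i, J (c i)) /\ s`_k = \sum_(i < size s) c i * s`_i.
  by move=> k; apply: gs; rewrite mem_nth.
pose M := \matrix_(i < size s, k < size s) c k i.
have JN a : J a -> J (- a).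
  by move=> Ja; rewrite -mulN1r; apply: JM => //; exact: subringN.
pose C a b := [/\ R a, R b & J (a - b)].
have CD a b a' b' : C a b -> C a' b' -> C (a + a') (b + b').
  move=> [Ra Rb Jab] [Ra' Rb' Jab']; split; try exact: subringD.
  by rewrite opprD addrACA; exact: JD.
have CM a b a' b' : C a b -> C a' b' -> C (a * a') (b * b').
  move=> [Ra Rb Jab] [Ra' Rb' Jab']; split; try exact: RM.
  have -> : a * a' - b * b' = a * (a' - b') + b' * (a - b) by ring.
  by apply: JD; exact: JM.
have Cr a : R a -> C a a by split=> //; rewrite subrr.
have : C (\det (1%:M - M)) (\det (1%:M : 'M[F]_(size s))).
  apply: (big_ind2 C) => // [|p _]; first exact/Cr/subring0.
  apply: (CM).
    by apply: (Cr); rewrite -signr_odd; case: odd; rewrite ?expr1 ?expr0 //; exact: subringN.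
  apply: (big_ind2 C) => // [|k _]; first exact: Cr.
  have [cJ _] := cP (p k).
  have R1M : R ((1%:M : 'M[F]_(size s)) k (p k)).
    by rewrite mxE; case: eqP => _ //; exact: subring0.
  split=> //; rewrite mxE [(- M) _ _]mxE.
    by apply: subringD => //; apply: subringN; rewrite mxE; exact: JR.
  by rewrite addrAC subrr sub0r mxE; exact: JN.
have -> : \det (1%:M - M) = 0.
  apply/eqP/det0P; exists (\row_i s`_i).
    apply/eqP => /rowP e; move: x0; have /(nthP 0)[i si <-] := xs.
    by have := e (Ordinal si); rewrite !mxE /= => ->; rewrite eqxx.
  rewrite mulmxBr mulmx1; apply/rowP => k; rewrite !mxE.
  have [_ ->] := cP k; apply/eqP; rewrite subr_eq0; apply/eqP.
  by apply: eq_bigr => i _; rewrite !mxE mulrC.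
by rewrite det1 => -[_ _]; rewrite sub0r => /JN; rewrite opprK.
Qed.

End Subring.

Section NoetherianSubring.
Context (R : set F) (rR : subring R).
Let R_0 := subring0 rR.
Let rD := subringD rR.
Let rX := subringX rR.

Definition rnoeth : Prop := forall J, rideal R J -> exists s,
  (forall x, x \in s -> J x) /\
  forall f, J f -> exists c : nat -> F, (forall i, R (c i)) /\ f = \sum_(i < size s) c i * s`_i.

Lemma rideal_lin J s (c : nat -> F) : rideal R J -> (forall x, x \in s -> J x) ->
  (forall i, R (c i)) -> J (\sum_(i < size s) c i * s`_i).
Proof.
move=> [_ J0 JD JM] sJ cR; apply: (big_ind J) => // i _.
by apply: JM => //; apply: sJ; rewrite mem_nth.
Qed.

(** Without a maximal member there is a strictly increasing sequence of ideals in C; its union is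
    finitely generated, so the sequence stops. *)
Lemma noeth_maximal (C : set (set F)) J0 : rnoeth -> (forall J, C J -> rideal R J) -> C J0 ->
  exists2 J, C J & forall J', C J' -> J `<=` J' -> J' `<=` J.
Proof.
move=> nR Ci CJ0; apply: contrapT => nmax.
have /choice[f fP] : forall J : {J : set F | C J}, exists J' : {J : set F | C J},
    projT1 J `<=` projT1 J' /\ ~ projT1 J' `<=` projT1 J.
  move=> [J CJ]; apply: contrapT => /forallNP nJ; apply: nmax; exists J => // J' CJ' JJ'.
  by apply: contrapT => nJ'; apply: (nJ (exist _ J' CJ')).
pose u n := projT1 (iter n f (exist _ J0 CJ0)).
have uC n : C (u n) by exact: projT2 (iter n f _).
have uS n : u n `<=` u n.+1 by have [] := fP (iter n f (exist _ J0 CJ0)).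
have um m n : (m <= n)%N -> u m `<=` u n.
  by move=> /subnK <-; elim: (n - m)%N => // k IH; exact: subset_trans IH (uS _).
pose U : set F := [set x | exists n, u n x].
have iU : rideal R U.
  split.
  - by move=> x [n ux]; have [uR _ _ _] := Ci _ (uC n); exact: uR.
  - by exists 0; have [_ ? _ _] := Ci _ (uC 0).
  - move=> a b [m ua] [n ub]; exists (maxn m n); have [_ _ uD _] := Ci _ (uC (maxn m n)).
    by apply: uD; [apply: um ua|apply: um ub]; rewrite ?leq_maxl ?leq_maxr.
  - by move=> a b Ra [n ub]; exists n; have [_ _ _ uM] := Ci _ (uC n); exact: uM.
have [s [sU Us]] := nR U iU.
have [n sn] : exists n, forall x, x \in s -> u n x.
  elim: s sU {Us} => [|x s IH] sU; first by exists 0.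
  have [|m h1] := IH; first by move=> y ys; apply: sU; rewrite inE ys orbT.
  have [n h2] := sU x (mem_head _ _); exists (maxn m n) => y; rewrite inE => /predU1P[->|ys].
    by apply: um h2; rewrite leq_maxr.
  by apply: um (h1 _ ys); rewrite leq_maxl.
have [_] := fP (iter n f (exist _ J0 CJ0)); apply=> x ux.
have [c [cR ->]] := Us x (ex_intro _ n.+1 ux).
exact: rideal_lin (Ci _ (uC n)) sn cR.
Qed.

(** Noetherian induction: a maximal counterexample M is proper and not prime, and if a b is in M, a
    prime ideal containing M contains M + aR or M + bR, both of which satisfy the claim. *)
Lemma finite_minimal_primes J : rnoeth -> rideal R J -> exists Ps : seq (set F),
  (forall P, List.In P Ps -> rprime R P /\ J `<=` P) /\
  forall P, rprime R P -> J `<=` P -> exists2 Q, List.In Q Ps & Q `<=` P.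
Proof.
move=> nR iJ; apply: contrapT => nJ.
pose C : set (set F) := [set J | rideal R J /\ ~ exists Ps : seq (set F),
  (forall P, List.In P Ps -> rprime R P /\ J `<=` P) /\
  forall P, rprime R P -> J `<=` P -> exists2 Q, List.In Q Ps & Q `<=` P].
have [|//|M [iM nM] maxM] := @noeth_maximal C J nR; first by move=> B [].
have [MR M0 MD MM] := iM; have [R1 _ RM] := rR.
have [M1|M1] := pselect (M 1).
  by apply: nM; exists [::]; split=> // P [_ P1 _] MP; case: P1; exact: MP.
have [[a [b [Ra Rb Mab [Ma Mb]]]]|npM] :=
    pselect (exists a b, [/\ R a, R b, M (a * b) & ~ M a /\ ~ M b]); last first.
  apply: nM; exists [:: M]; split; last by move=> P _ MP; exists M => //; left.
  move=> P [<-|//]; split=> //; split=> // a b Ra Rb Mab.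
  by apply: contrapT => /not_orP[Ma Mb]; apply: npM; exists a, b.
pose N x : set F := [set y | exists m z, [/\ M m, R z & y = m + x * z]].
have iN x : R x -> rideal R (N x).
  move=> Rx; split.
  - by move=> _ [m [z [Mm Rz ->]]]; apply: (rD); [exact: MR|exact: RM].
  - by exists 0, 0; rewrite mulr0 addr0; split=> //; exact: (R_0).
  - move=> _ _ [m [z [Mm Rz ->]]] [m' [z' [Mm' Rz' ->]]]; exists (m + m'), (z + z').
    by split; [exact: MD|exact: (rD)|rewrite mulrDr addrACA].
  - move=> c _ Rc [m [z [Mm Rz ->]]]; exists (c * m), (c * z).
    by split; [exact: MM|exact: RM|rewrite mulrDr mulrCA].
have MN x : M `<=` N x.
  by move=> m Mm; exists m, 0; rewrite mulr0 addr0; split=> //; exact: (R_0).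
have Nx x : R x -> N x x by move=> Rx; exists 0, 1; rewrite mulr1 add0r.
have fN x : R x -> ~ M x -> exists Ps : seq (set F),
  (forall P, List.In P Ps -> rprime R P /\ N x `<=` P) /\
  forall P, rprime R P -> N x `<=` P -> exists2 Q, List.In Q Ps & Q `<=` P.
  move=> Rx Mx; apply: contrapT => nx; apply: Mx.
  by apply: (maxM (N x)); [split=> //; exact: iN|exact: MN|exact: Nx].
have [Ps [PsP PsM]] := fN a Ra Ma; have [Qs [QsP QsM]] := fN b Rb Mb.
apply: nM; exists (Ps ++ Qs); split.
  move=> P /List.in_app_iff[/PsP|/QsP] [pP NP]; split=> //; exact: subset_trans NP.
move=> P pP MP; have [[PR P0 PD PM] _ Pp] := pP.
have [Pa|Pb] := Pp a b Ra Rb (MP _ Mab).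
  have [|Q QPs QP] := PsM P pP.
    by move=> _ [m [z [Mm Rz ->]]]; apply: PD; [exact: MP|rewrite mulrC; exact: PM].
  by exists Q => //; apply/List.in_app_iff; left.
have [|Q QPs QP] := QsM P pP.
  by move=> _ [m [z [Mm Rz ->]]]; apply: PD; [exact: MP|rewrite mulrC; exact: PM].
by exists Q => //; apply/List.in_app_iff; right.
Qed.

Definition loc P : set F := [set f | exists a b, [/\ R a, R b, ~ P b & f = a / b]].

Definition integrally_closed (A : set F) : Prop :=
  forall (p : {poly F}) a, p \is monic -> (forall i, A p`_i) -> root p a -> A a.

Lemma loc_sub P : ~ P 1 -> R `<=` loc P.
Proof. by have [R1 _ _] := rR => P1 a Ra; exists a, 1; rewrite divr1. Qed.

Lemma loc_le P Q : P `<=` Q -> loc Q `<=` loc P.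
Proof. by move=> PQ f [a [b [Ra Rb Qb ->]]]; exists a, b; split=> // /PQ. Qed.

Section Localization.
Context (P : set F) (pP : rprime R P).

Lemma rprime_n0 b : ~ P b -> b != 0.
Proof. by have [[_ P0 _ _] _ _] := pP; apply: contra_notN => /eqP ->. Qed.

Lemma rprimeM a b : R a -> R b -> ~ P a -> ~ P b -> ~ P (a * b).
Proof. by have [_ _ Pp] := pP => Ra Rb Pa Pb /Pp[]. Qed.

Lemma loc_subring : subring (loc P).
Proof.
have [R1 RB RM] := rR; have [_ P1 _] := pP; split.
- exact: loc_sub.
- move=> _ _ [a [b [Ra Rb Pb ->]]] [c [d [Rc Rd Pd ->]]].
  exists (a * d - c * b), (b * d); split.
  + by apply: RB; exact: RM.
  + exact: RM.
  + exact: rprimeM.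
  + have := rprime_n0 Pb; have := rprime_n0 Pd => d0 b0.
    by rewrite -mulNr addf_div // mulNr.
- move=> _ _ [a [b [Ra Rb Pb ->]]] [c [d [Rc Rd Pd ->]]].
  exists (a * c), (b * d); split; try exact: RM; first exact: rprimeM.
  by rewrite mulf_div.
Qed.

(** If d is a common denominator of the monic equation p of a over R_Q, then d a is integral over R,
    hence lies in R_P, and d is a unit of R_Q. *)
Lemma loc_normal Q : rprime R Q -> Q `<=` P ->
  integrally_closed (loc P) -> integrally_closed (loc Q).
Proof.
move=> pQ QP nP p a mp pQi pa; have [R1 RB RM] := rR; have [_ Q1 _] := pQ.
have [d [Rd Qd dp]] : exists d, [/\ R d, ~ Q d & forall i, R (d * p`_i)].
  have [d [Rd Qd dp]] : exists d, [/\ R d, ~ Q d & forall i, (i < size p)%N -> R (d * p`_i)].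
    elim: (size p) => [|m [d [Rd Qd dm]]]; first by exists 1.
    have [x [y [Rx Ry Qy e]]] := pQi m; exists (d * y); split; [exact: RM| |].
      by case: pQ => _ _ h /h[].
    move=> i; rewrite ltnS leq_eqVlt => /predU1P[->|im].
      have y0 : y != 0 by case: pQ => -[_ Q0 _ _] _ _; apply: contra_notN Qy => /eqP ->.
      rewrite e (_ : d * y * (x / y) = d * x); [exact: RM|by field].
    by rewrite mulrAC; apply: RM => //; exact: dm.
  exists d; split=> // i; have [|ip] := ltnP i (size p); first exact: dp.
  by rewrite nth_default // mulr0; exact: (R_0).
have d0 : d != 0 by case: pQ => -[_ Q0 _ _] _ _; apply: contra_notN Qd => /eqP ->.
have sp : (0 < size p)%N by rewrite size_poly_gt0 monic_neq0.
(* The equation of d a: the coefficient of degree i is multiplied by d^(n - i), and d alone already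
   clears the denominator of each coefficient below the leading one. *)
pose n := (size p).-1; pose q := \poly_(i < n.+1) (p`_i * d ^+ (n - i)).
have lp : p`_n = 1 by have /eqP := mp; rewrite lead_coefE.
have qn : q`_n = 1 by rewrite coef_poly ltnSn lp subnn expr0 mulr1.
have sq : size q = n.+1.
  by apply/eqP; rewrite eqn_leq size_poly /= ltnNge; apply/negP => /leq_sizeP/(_ n (leqnn _))/eqP; rewrite qn oner_eq0.
have Rq i : R q`_i.
  rewrite coef_poly; case: ltnP => [|_]; last exact: (R_0).
  rewrite ltnS leq_eqVlt => /predU1P[->|im]; first by rewrite lp subnn expr0 mulr1.
  rewrite -(subnSK im) exprS mulrCA mulrA; apply: RM => //.
  exact: (rX).
have Pda : loc P (d * a).
  apply: (nP q).
  - by rewrite monicE lead_coefE sq /= qn.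
  - by move=> i; apply: loc_sub => //; case: pP.
  - rewrite rootE (horner_coef_wide _ (eq_leq sq)); apply/eqP.
    have e0 : d ^+ n * p.[a] = 0 by rewrite (rootP pa) mulr0.
    rewrite -[RHS]e0 (@horner_coef_wide _ n.+1) ?prednK // mulr_sumr.
    apply: eq_bigr => -[i /= im] _; have im' : (i < n.+1)%N by rewrite /n prednK.
    by rewrite coef_poly im' exprMn -[in RHS](subnK (im' : i <= n)%N) exprD; ring.
have [x [y [Rx Ry Py e]]] := Pda; exists x, (y * d); split=> //.
- exact: RM.
- by case: (pQ) => _ _ h Qyd; have [/QP|] := h y d Ry Rd Qyd.
- by rewrite -[LHS](mulKf d0) e invfM [RHS]mulrA [LHS]mulrC.
Qed.

End Localization.

(* The ideal (R : g) maximal among those of multiples g of f with g not in R_P is a prime Q; since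
   R_P is integrally closed, g Q is not contained in Q R_Q, so Q R_Q is principal. *)
Lemma hartogs_prime P f : rprime R P -> rnoeth -> integrally_closed (loc P) ->
  (exists a b, [/\ R a, R b, b != 0 & f = a / b]) -> ~ loc P f ->
  exists Q r, [/\ rprime R Q, Q `<=` P, ~ loc Q f, Q r /\ r != 0 &
    forall x, Q x -> loc Q (x / r)].
Proof.
move=> pP nR nP [fa [fb [Rfa Rfb fb0 fE]]] nf.
have [R1 RB RM] := rR; have [[PR P0 PD PM] P1 Pp] := pP; have [L1 LB LM] := loc_subring pP.
have RL : R `<=` loc P := loc_sub P1.
pose I g : set F := [set x | R x /\ loc P (x * g)].
pose C : set (set F) := [set J | exists2 x, R x & ~ loc P (x * f) /\ J = I (x * f)].
have iI g : rideal R (I g).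
  split.
  - by move=> x [].
  - by split; [exact: (R_0)|rewrite mul0r; exact/RL/(R_0)].
  - move=> x y [Rx Lx] [Ry Ly]; split; first exact: (rD).
    by rewrite mulrDl; exact: (subringD (loc_subring pP)).
  - by move=> x y Rx [Ry Ly]; split; [exact: RM|rewrite -mulrA; apply: LM => //; exact: RL].
have [||Q [x Rx [nx QE]] maxQ] := @noeth_maximal C (I (1 * f)) nR.
- by move=> J [x Rx [_ ->]].
- by exists 1; rewrite ?mul1r.
pose g := x * f; have gE : g = x * f by [].
have pQ : rprime R Q.
  rewrite QE; split; first exact: iI.
    by rewrite /I /= mul1r => -[].
  move=> a b Ra Rb [_ Lab]; have [La|nLa] := pselect (loc P (a * g)); first by left.
  right; have : I (a * x * f) `<=` Q.
    apply: maxQ; first by exists (a * x); [exact: RM|rewrite -mulrA].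
    rewrite QE => y [Ry Ly]; split=> //.
    rewrite -mulrA mulrCA; apply: LM => //; exact: RL.
  rewrite -QE; apply; split=> //.
  by rewrite -mulrA mulrA (mulrC b).
have QP : Q `<=` P.
  move=> y; rewrite QE => -[Ry Ly]; apply: contrapT => Py; apply: nx.
  rewrite -[_ * f](mulKf (rprime_n0 pP Py)); apply: LM => //.
  by exists 1, y; rewrite div1r.
have nQg : ~ loc Q g.
  move=> [a [b [Ra Rb Qb e]]]; apply: (Qb); rewrite QE; split=> //.
  by rewrite -gE e mulrC divfK ?(rprime_n0 pQ Qb) //; exact: RL.
have nQf : ~ loc Q f.
  move=> Lf; apply: nQg; have [_ _ LQM] := loc_subring pQ.
  by apply: LQM => //; apply: loc_sub => //; case: pQ.
have [Q0 [d Qd d0]] : Q 0 /\ exists2 b, Q b & b != 0.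
  have [[_ Q0 _ _] _ _] := pQ; split=> //.
  exists fb => //; rewrite QE; split=> //.
  by rewrite mulrCA fE (mulrC fb) divfK //; apply: RL; exact: RM.
(* The condition on r says that r g is not in Q R_Q. As r g is in R_Q, it is a unit there, and y / r
   = (y g) (r g)^-1 for all y in Q. If there is no such r, then g maps Q into Q R_Q and [det_trick]
   makes g integral over R_Q. *)
have [[r [Qr nr]]|nr] := pselect (exists r, Q r /\ forall a b, R a -> R b -> ~ Q b -> r * g = a / b -> ~ Q a).
  exists Q, r; split=> //.
    split=> //; apply/eqP => r0; apply: (nr 0 1); rewrite ?r0 ?mul0r //.
    by case: pQ.
  move=> y Qy; have [_ _ LQM] := loc_subring pQ.
  have LQ z : Q z -> loc Q (z * g).
    move=> Qz; have [Rz Lz] : I (x * f) z by rewrite -QE.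
    exact: (loc_le QP Lz).
  have [a [b [Ra Rb nQb e]]] := LQ _ Qr.
  have nQa := nr _ _ Ra Rb nQb e.
  have a0 := rprime_n0 pQ nQa; have b0 := rprime_n0 pQ nQb.
  have r0 : r != 0.
    by apply: contraNneq a0 => r0; move/eqP: e; rewrite r0 mul0r eq_sym mulf_eq0 invr_eq0 (negbTE b0) orbF.
  have g0 : g != 0.
    by apply: contraNneq a0 => g0; move/eqP: e; rewrite g0 mulr0 eq_sym mulf_eq0 invr_eq0 (negbTE b0) orbF.
  have -> : y / r = (y * g) * (b / a).
    have -> : b / a = (r * g)^-1 by rewrite e invf_div.
    by rewrite invfM mulrCA -mulrA divff // mulr1 mulrC.
  by apply: LQM; [exact: LQ|exists b, a].
exfalso; apply: nQg.
have [iQ _ _] := pQ; have [s [sQ Qs]] := nR Q iQ.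
have [[QR _ QD QM] Q1 Qp] := pQ.
have [p [mp op rp]] : exists p : {poly F}, [/\ p \is monic, forall i, loc Q p`_i & root p g].
  apply: (det_trick (loc_subring pQ) (s := s)).
    apply: contrapT => ns; move/eqP: d0; apply.
    have [c [_ ->]] := Qs _ Qd; rewrite big1 // => i _.
    apply/eqP; rewrite mulf_eq0; apply/orP; right; apply: contrapT => /negP si; apply: ns.
    by exists s`_i => //; rewrite mem_nth.
  move=> z /sQ Qz.
  have [a [b [Ra Rb nQb [e Qa]]]] : exists a b, [/\ R a, R b, ~ Q b & z * g = a / b /\ Q a].
    apply: contrapT => nz; apply: nr; exists z; split=> // a b Ra Rb nQb e Qa.
    by apply: nz; exists a, b.
  have [c [cR aE]] := Qs _ Qa; exists (fun i => c i / b); split=> [i|].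
    by exists (c i), b.
  rewrite mulrC e aE mulr_suml; apply: eq_bigr => i _; by rewrite mulrAC.
apply: (loc_normal pP pQ QP nP) mp op rp.
Qed.

Section Dvr.
Context (P : set F) (pP : rprime R P) (nR : rnoeth) (r : F) (Pr : P r) (rn0 : r != 0)
  (rgen : forall x, P x -> loc P (x / r)).

Lemma loc_invP a : loc P a -> a != 0 -> loc P a^-1 \/ loc P (a / r).
Proof.
move=> [x [y [Rx Ry Py ->]]] xy0; have [Px|Px] := pselect (P x).
  right; have [_ _ LM] := loc_subring pP; rewrite mulrAC; apply: LM; first exact: rgen.
  by have [[_ _ _ _] P1 _] := pP; exists 1, y; rewrite div1r; split=> //; case: rR.
by left; exists y, x; rewrite invf_div.
Qed.

Lemma loc_not_inv : ~ loc P r^-1.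
Proof.
move=> [a [b [Ra Rb Pb e]]]; apply: (Pb); have [[_ _ _ PM] _ _] := pP.
have b0 := rprime_n0 pP Pb.
have -> : b = a * r; last exact: PM.
by apply: (mulfI (invr_neq0 b0)); rewrite mulVf // mulrA (mulrC b^-1) -e mulVf.
Qed.

(** Krull's intersection theorem for a principal maximal ideal. One exponent n serves all generators
    of the ideal J of those x for which some x r^k / a is in R_P. Writing a / r^(n+1) = x / y gives
    x in J, so x r^n / a = y / r is in R_P although y is a unit and r is not. *)
Lemma loc_krull a : a != 0 -> ~ forall k, loc P (a / r ^+ k).
Proof.
move=> a0 ak; have [R1 RB RM] := rR; have [L1 LB LM] := loc_subring pP.
pose J : set F := [set x | R x /\ exists k, loc P (x * r ^+ k / a)].
have rL : loc P r by apply: loc_sub; [case: pP|case: pP => -[PR _ _ _] _ _; exact: PR].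
have rkL k : loc P (r ^+ k) by exact: (subringX (loc_subring pP) _ rL).
have Jm x k m : (k <= m)%N -> loc P (x * r ^+ k / a) -> loc P (x * r ^+ m / a).
  move=> /subnK e h; have := LM _ _ (rkL (m - k)%N) h; congr (loc P _).
  by rewrite -[in RHS]e exprD mulrA mulrCA.
have iJ : rideal R J.
  split.
  - by move=> x [].
  - by split; [exact: (R_0)|exists 0; rewrite !mul0r; exact: (subring0 (loc_subring pP))].
  - move=> x y [Rx [k Lx]] [Ry [m Ly]]; split; first exact: (rD).
    exists (maxn k m); rewrite !mulrDl; apply: (subringD (loc_subring pP)).
      by apply: Jm Lx; rewrite leq_maxl.
    by apply: Jm Ly; rewrite leq_maxr.
  - move=> x y Rx [Ry [k Ly]]; split; first exact: RM.
    exists k; rewrite -!mulrA; apply: LM; first by apply: loc_sub => //; case: pP.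
    by rewrite mulrA.
have [s [sJ Js]] := nR iJ.
have [n sn] : exists n, forall x, x \in s -> loc P (x * r ^+ n / a).
  elim: s sJ {Js} => [|x s IH] sJ; first by exists 0.
  have [|m h1] := IH; first by move=> y ys; apply: sJ; rewrite inE ys orbT.
  have [_ [k h2]] := sJ x (mem_head _ _); exists (maxn m k) => y; rewrite inE => /predU1P[->|ys].
    by apply: Jm h2; rewrite leq_maxr.
  by apply: Jm (h1 _ ys); rewrite leq_maxl.
have [x [y [Rx Ry Py e]]] := ak n.+1.
have x0 : x != 0.
  apply: contraNneq a0 => x0; move/eqP: e; rewrite x0 mul0r mulf_eq0 invr_eq0 expf_eq0 (negbTE rn0) andbF orbF.
  by move=> /eqP ->.
have y0 := rprime_n0 pP Py.
have yE : x * r ^+ n.+1 / a = y.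
  by rewrite -mulrA -[r ^+ _ / a]invf_div e invf_div mulrC divfK.
have Jx : J x.
  by split=> //; exists n.+1; rewrite yE; apply: loc_sub => //; case: pP.
have [c [cR xE]] := Js _ Jx.
have : loc P (x * r ^+ n / a).
  rewrite {1}xE !mulr_suml; apply: (subring_sum (loc_subring pP)) => i _.
  rewrite -!mulrA; apply: LM; first by apply: loc_sub => //; case: pP.
  by rewrite mulrA; apply: sn; rewrite mem_nth.
have -> : x * r ^+ n / a = y / r.
  by rewrite -yE exprSr mulrA [in RHS](mulrAC _ r) mulfK.
move=> Lyr; apply: loc_not_inv; rewrite -[r^-1](mulKf y0); apply: LM => //.
by exists 1, y; rewrite div1r; split.
Qed.

Lemma loc_valuation a : loc P a -> a != 0 ->
  exists k w, [/\ a = r ^+ k * w, loc P w & loc P w^-1].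
Proof.
move=> La a0.
have [[k [Lk nk]]|nk] := pselect (exists k, loc P (a / r ^+ k) /\ ~ loc P (a / r ^+ k.+1)).
  exists k, (a / r ^+ k); split=> //; first by rewrite mulrC divfK // expf_neq0.
  have [|//|Lr] := loc_invP Lk; first by rewrite mulf_neq0 // invr_neq0 // expf_neq0.
  by case: nk; rewrite exprS invfM mulrCA mulrC.
exfalso; apply: (loc_krull a0); elim=> [|k IH]; first by rewrite expr0 divr1.
by apply: contrapT => h; apply: nk; exists k.
Qed.

(** If r is in Q, then Q = P. Otherwise dividing an element of Q by r stays in Q R_P, so the
    elements of Q are divisible by all powers of r and vanish by [loc_krull]. *)
Lemma loc_height1 Q : rprime R Q -> Q `<=` P -> Q = P \/ Q `<=` [set 0].
Proof.
move=> pQ QP; have [[QR Q0 QD QM] Q1 Qp] := pQ; have [[PR P0 PD PM] P1 Pp] := pP.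
have [R1 RB RM] := rR.
have [Qr|Qr] := pselect (Q r).
  left; apply/seteqP; split=> // x Px; have [a [b [Ra Rb Pb e]]] := rgen Px.
  have b0 := rprime_n0 pP Pb.
  have : Q (b * x).
    have -> : b * x = a * r; last exact: QM.
    by rewrite -[x](divfK rn0) e mulrA (mulrC b) divfK.
  by move=> /Qp [||/QP|//] //; exact: PR.
right=> a Qa /=; apply: contrapT => /eqP a0; apply: (loc_krull a0).
suff h k : exists x y, [/\ Q x, R y, ~ P y & a / r ^+ k = x / y].
  by move=> k; have [x [y [Qx Ry Py ->]]] := h k; exists x, y; split=> //; exact: QR.
elim: k => [|k [x [y [Qx Ry Py e]]]]; first by exists a, 1; rewrite expr0.
have [c [d [Rc Rd Pd e']]] := rgen (QP _ Qx).
have y0 := rprime_n0 pP Py; have d0 := rprime_n0 pP Pd.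
exists c, (d * y); split=> //.
- have : Q (r * c).
    have -> : r * c = d * x; last exact: QM.
    by rewrite -[x](divfK rn0) e' mulrA (mulrC d) divfK // mulrC.
  by move=> /Qp [||//|//] //; exact: PR.
- exact: RM.
- by move=> /Pp[].
- by rewrite exprS invfM mulrCA e mulrA (mulrC r^-1) e' invfM mulrA.
Qed.

End Dvr.

End NoetherianSubring.

End SubringsOfFields.

(** * Affine charts *)

Section Charts.
Context (K : closedFieldType).
Implicit Types (X Z : fspace K) (e a b : pexp K).

Definition pv (v : nat -> K) e : K := pev id v e.

Lemma pv_ext v w e : v =1 w -> pv v e = pv w e.
Proof. exact: pev_ext. Qed.

Lemma pv_sub v s e : pv v (psub s e) = pv (fun i => pv v (s i)) e.
Proof. exact: pev_sub. Qed.

Section Germs.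
Context (X : fspace K) (A : set X) (k : X -> nat -> K).
Implicit Types (x y : X) (U : set X) (f g : X -> K).

Definition chart_nbhd x U : Prop :=
  exists2 b, pv (k x) b != 0 & forall y, A y -> pv (k y) b != 0 -> U y.

Definition chart_germ x f : Prop :=
  exists a b, pv (k x) b != 0 /\
    forall y, A y -> pv (k y) b != 0 -> f y = pv (k y) a / pv (k y) b.

Lemma chart_nbhdI x U V : chart_nbhd x U -> chart_nbhd x V -> chart_nbhd x (U `&` V).
Proof.
move=> [b bx bU] [c cx cV]; exists (PM b c); first by rewrite /pv /= mulf_neq0.
move=> y Ay; rewrite /pv /= mulf_eq0 negb_or => /andP[by0 cy0].
by split; [exact: bU|exact: cV].
Qed.

Lemma chart_nbhd_sub x U V : U `<=` V -> chart_nbhd x U -> chart_nbhd x V.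
Proof. by move=> UV [b bx bU]; exists b => // y Ay /(bU y Ay)/UV. Qed.

Lemma chart_germ_poly x e : chart_germ x (fun y => pv (k y) e).
Proof.
by exists e, (PC 1); rewrite /pv /= oner_neq0; split=> // y _ _; rewrite divr1.
Qed.

Lemma chart_germ_eq x f g : chart_nbhd x [set y | f y = g y] -> chart_germ x g ->
  chart_germ x f.
Proof.
move=> [c cx cfg] [a [b [bx bg]]]; exists (PM a c), (PM b c).
split=> [|y Ay]; first by rewrite /pv /= mulf_neq0.
rewrite /pv /= mulf_eq0 negb_or => /andP[by0 cy0].
by rewrite (cfg y Ay cy0) bg // -mulf_div divff // mulr1.
Qed.

Lemma chart_germ_add x f g : chart_germ x f -> chart_germ x g ->
  chart_germ x (fun y => f y + g y).
Proof.
move=> [a [b [bx bf]]] [c [d [dx dg]]]; exists (PA (PM a d) (PM c b)), (PM b d).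
split=> [|y Ay]; first by rewrite /pv /= mulf_neq0.
rewrite /pv /= mulf_eq0 negb_or => /andP[by0 dy0].
by rewrite bf // dg // addf_div.
Qed.

Lemma chart_germ_mul x f g : chart_germ x f -> chart_germ x g ->
  chart_germ x (fun y => f y * g y).
Proof.
move=> [a [b [bx bf]]] [c [d [dx dg]]]; exists (PM a c), (PM b d).
split=> [|y Ay]; first by rewrite /pv /= mulf_neq0.
rewrite /pv /= mulf_eq0 negb_or => /andP[by0 dy0].
by rewrite bf // dg // mulf_div.
Qed.

Lemma chart_germ_nz x f : A x -> chart_germ x f -> f x != 0 ->
  chart_nbhd x [set y | f y != 0].
Proof.
move=> Ax [a [b [bx bf]]] fx; exists (PM a b); rewrite /pv /=.
  by move: fx; rewrite bf // mulf_eq0 negb_or => /andP[? _]; rewrite mulf_neq0.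
move=> y Ay; rewrite mulf_eq0 negb_or => /andP[ay by0].
by rewrite /= bf // mulf_neq0 // invr_eq0.
Qed.

Lemma chart_germ_inv x f : A x -> chart_germ x f -> f x != 0 ->
  chart_germ x (fun y => (f y)^-1).
Proof.
move=> Ax [a [b [bx bf]]] fx; exists (PM b b), (PM a b); rewrite /pv /=.
split.
  by move: fx; rewrite bf // mulf_eq0 negb_or => /andP[? _]; rewrite mulf_neq0.
move=> y Ay; rewrite mulf_eq0 negb_or => /andP[ay by0].
by rewrite bf // invf_div -mulf_div divff // mulr1.
Qed.

(** The topology and the sheaf of X near the points of A are those generated by the coordinates
    k. *)
Definition local_fractions : Prop := forall x U, A x -> open U -> U x ->
  chart_nbhd x U /\ forall f, reg U f -> chart_germ x f.

(* Every K-point of the coordinate ring of A comes from a point of A. *)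
Definition full_chart : Prop := forall v : nat -> K,
  (forall e, (forall x, A x -> pv (k x) e = 0) -> pv v e = 0) ->
  exists2 x, A x & k x =1 v.

(** An affine open subset described by functions defined on all of X, which avoids passing to
    subspaces. Injectivity of the coordinates is a separate hypothesis wherever it is needed. *)
Definition affine_chart n : Prop :=
  [/\ open A, forall i, reg A (fun x => k x i), forall x i, (n <= i)%N -> k x i = 0,
      local_fractions & full_chart].

Lemma reg_pv e : open A -> (forall i, reg A (fun x => k x i)) -> reg A (fun x => pv (k x) e).
Proof.
move=> oA kr; have S := space_sheaf X; elim: e => //= [c|a IHa b IHb|a IHa b IHb].
- exact: (sheaf_cst S).
- exact: (sheaf_add S oA IHa IHb).
- exact: (sheaf_mul S oA IHa IHb).
Qed.

End Germs.

Lemma gen_openP (P : Type) (G : gens_data K P) (U : set (gen_space G)) :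
  open U <-> gen_open G U.
Proof. by []. Qed.

(** Fractions in the coordinates are stable under the operations that build regular functions from
    generators, so only the generators have to be checked. *)
Lemma local_fractions_gen (P : Type) (G : gens_data K P) (A : set (gen_space G)) k :
  (forall x W, A x -> gdom G W -> W x ->
    chart_nbhd A k x W /\ forall g, gens G W g -> chart_germ A k x g) ->
  local_fractions A k.
Proof.
move=> h x U Ax oU Ux.
have alg W f : gdom G W -> W x -> subalg (gens G W) f -> chart_germ A k x f.
  move=> dW Wx; have [_ hg] := h x W Ax dW Wx.
  elim=> [g /hg //|c|g g' _ hg1 _ hg2|g g' _ hg1 _ hg2].
  - exact: (chart_germ_poly A k x (PC c)).
  - exact: chart_germ_add.
  - exact: chart_germ_mul.
have nU : chart_nbhd A k x U.
  have [W [b [dW ab Wx bx WU]]] := oU x Ux.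
  have [hW _] := h x W Ax dW Wx.
  apply: chart_nbhd_sub (chart_nbhdI hW (chart_germ_nz Ax (alg W b dW Wx ab) bx)).
  by move=> y [Wy by0]; exact: WU.
split=> // f rf; have [W [a [b [dW aa ab Wx [bx fE]]]]] := rf x Ux.
have [hW _] := h x W Ax dW Wx.
have ga := alg _ _ dW Wx aa; have gb := alg _ _ dW Wx ab.
apply: (@chart_germ_eq (gen_space G) A k x f (fun y => a y * (b y)^-1)).
  apply: chart_nbhd_sub (chart_nbhdI nU (chart_nbhdI hW (chart_germ_nz Ax gb bx))).
  by move=> y [Uy [Wy by0]]; exact: fE.
by apply: chart_germ_mul => //; exact: chart_germ_inv.
Qed.

Definition rowf n (v : 'rV[K]_n) (i : nat) : K :=
  if insub i is Some j then v 0 j else 0.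

Lemma rowfE n (v : 'rV[K]_n) (i : 'I_n) : rowf v i = v 0 i.
Proof. by rewrite /rowf valK. Qed.

Lemma rowf0 n (v : 'rV[K]_n) i : (n <= i)%N -> rowf v i = 0.
Proof. by move=> ni; rewrite /rowf insubF // ltnNge ni. Qed.

Lemma affsp_chart n : affine_chart [set: affsp K n] (@rowf n) n.
Proof.
split=> [|i|x i|x U|].
- exact: openT.
- rewrite /rowf; case: insubP => [j _ _|_]; last exact: (sheaf_cst (space_sheaf (affsp K n)) 0 openT).
  move=> x _; exists setT, (fun y : 'rV[K]_n => y 0 j), (fun=> 1); split=> //.
  + by apply: subalg_gen; exists j.
  + exact: subalg_cst.
  + by rewrite oner_neq0; split=> // y _ _ _; rewrite divr1.
- exact: rowf0.
- apply: local_fractions_gen => {}x _ _ -> _; split.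
    by exists (PC 1); rewrite /pv /= ?oner_neq0.
  move=> _ [i _ <-]; have := @chart_germ_poly (affsp K n) setT (@rowf n) x (PV (nat_of_ord i)).
  by apply: chart_germ_eq; exists (PC 1); rewrite /pv /= ?oner_neq0 // => y _ _; rewrite rowfE.
- move=> v hv; exists (\row_i v i) => // i.
  have [ni|ni] := ltnP i n; first by have := rowfE (\row_i v i) (Ordinal ni); rewrite mxE.
  rewrite rowf0 //; symmetry; apply: (hv (PV i)) => x _.
  by rewrite /pv /= rowf0.
Qed.

Section Embeddings.
Context (X Z : fspace K) (f : X -> Z).

Lemma embedding_local (U : set X) h : embedding f -> open U -> forall x, U x ->
  exists V, [/\ open V, V (f x), (forall y, V (f y) -> U y) &
    reg U h -> exists V' g, [/\ open V', V' (f x), reg V' g &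
      forall y, U y -> V' (f y) -> h y = g (f y)]].
Proof.
move=> [g [[gc gr] [d [[dc dr] gK dK]]] gE] oU x Ux.
have oU' : open (d @^-1` U) by move/continuousP: dc; apply.
case: (oU') => V oV VE; exists V; split=> //.
- have : (d @^-1` U) (g x) by rewrite /= gK.
  by rewrite -VE -(gE x).
- move=> y Vy; have : (d @^-1` U) (g y) by rewrite -VE; move: Vy; rewrite -(gE y).
  by rewrite /= gK.
move=> rh; have [|V' [g' [oV' V'x rg' hE]]] := dr _ _ oU rh (g x); first by rewrite /= gK.
exists V', g'; split=> //; first by rewrite -gE.
by move=> y Uy Vy; have := hE (g y); rewrite /= gK gE; apply.
Qed.

Lemma embedding_morphism : embedding f -> fun_morphism f.
Proof.
move=> [g [[gc gr] [d [[dc dr] gK dK]]] gE].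
have fE : f = val \o g by apply/funext => x; rewrite /= gE.
split.
  rewrite fE; apply/continuousP => V oV; move/continuousP: gc => gc.
  by apply: (gc ((val : subsp (range f) -> Z) @^-1` V)); exists V.
move=> V h oV rh; rewrite fE.
have oW : open ((val : subsp (range f) -> Z) @^-1` V) by exists V.
have := gr _ (h \o val) oW; apply=> x Vx.
by exists V, h.
Qed.

(** The coordinates are restricted. A K-point of the smaller coordinate ring is a point of A; were
    it outside the closed image, some expression would vanish on the image and not at this point. *)
Lemma embedding_chart (A : set Z) k n : closed (range f) -> embedding f ->
  affine_chart A k n -> affine_chart (f @^-1` A) (k \o f) n.
Proof.
move=> cf ef [oA kr kn lA fA]; have [fc fr] := embedding_morphism ef; split.
- by move/continuousP: fc; apply.
- by move=> i; apply: (fr A (k^~ i)).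
- by move=> x i ni; exact: kn.
- move=> x U Ax oU Ux; have [V [oV Vx VU _]] := embedding_local 0 ef oU Ux.
  have nU : chart_nbhd (f @^-1` A) (k \o f) x U.
    have [[b bx bV] _] := lA _ _ Ax oV Vx.
    by exists b => // y Ay by0; apply/VU/bV.
  split=> // h rh; have [_ [_ _ _ /(_ rh)[V' [g [oV' V'x rg hE]]]]] := embedding_local h ef oU Ux.
  have [[c cx cV] /(_ _ rg)[a [b [bx bE]]]] := lA _ _ Ax oV' V'x.
  apply: (@chart_germ_eq _ _ _ _ _ (g \o f)).
    apply: chart_nbhd_sub (chart_nbhdI nU (_ : chart_nbhd _ _ _ (f @^-1` V'))).
      by move=> y [Uy Vy]; exact: hE.
    by exists c => // y Ay; exact: cV.
  by exists a, b; split=> // y Ay; exact: bE.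
- move=> v hv; have [|z Az kz] := fA v.
    by move=> e he; apply: hv => x Ax; exact: he.
  have [[x _ xz]|nz] := pselect (range f z).
    by exists x; rewrite /= xz.
  have [[b bz bU] _] := lA z (~` range f) Az (closed_openC cf) nz.
  have : pv v b = 0.
    apply: hv => x Ax; apply/eqP; apply: contrapT => /negP h.
    by apply: (bU _ Ax h); exists x.
  by rewrite -(pv_ext _ kz) => /eqP; rewrite (negbTE bz).
Qed.

End Embeddings.

Section Products.
Context (X Z : fspace K) (A : set X) (B : set Z) (k : X -> nat -> K) (l : Z -> nat -> K) (m n : nat).

Definition prod_coord (p : prod_space X Z) (i : nat) : K :=
  if (i < m)%N then k p.1 i else l p.2 (i - m)%N.

Lemma prod_chart : affine_chart A k m -> affine_chart B l n ->
  affine_chart (A `*` B : set (prod_space X Z)) prod_coord (m + n).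
Proof.
move=> cA cB; have [oA kr kn lA fA] := cA; have [oB lr ln lB fB] := cB.
pose C : set (prod_space X Z) := A `*` B.
(* From m on the coordinates of the first factor are 0, whereas those of the product belong to the
   second factor. *)
pose sl (i : nat) : pexp K := if (i < m)%N then PV i else PC 0.
pose sr (i : nat) : pexp K := PV (i + m)%N.
have slE p e : pv (prod_coord p) (psub sl e) = pv (k p.1) e.
  rewrite pv_sub; apply: pv_ext => i; rewrite /sl /prod_coord.
  by case: (ltnP i m) => im; rewrite /pv /= ?im // kn.
have srE p e : pv (prod_coord p) (psub sr e) = pv (l p.2) e.
  rewrite pv_sub; apply: pv_ext => i; rewrite /sr /prod_coord /pv /=.
  by rewrite ltnNge leq_addl /= addnK.
have gl p g : chart_germ A k p.1 g -> chart_germ C prod_coord p (g \o fst).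
  move=> [a [b [bx bE]]]; exists (psub sl a), (psub sl b); split; rewrite ?slE //.
  by move=> q [Aq _]; rewrite !slE; exact: bE.
have gr p g : chart_germ B l p.2 g -> chart_germ C prod_coord p (g \o snd).
  move=> [a [b [bx bE]]]; exists (psub sr a), (psub sr b); split; rewrite ?srE //.
  by move=> q [_ Bq]; rewrite !srE; exact: bE.
have box U V : open U -> open V -> open (U `*` V : set (prod_space X Z)).
  move=> oU oV; apply/gen_openP => p UVp; exists (U `*` V), (fun=> 1); split => //.
  - by exists U, V.
  - exact: subalg_cst.
  - exact: oner_neq0.
have fstr U g : open U -> reg U g -> forall V, open V -> reg (U `*` V : set (prod_space X Z)) (g \o fst).
  move=> oU rg V oV p UVp; exists (U `*` V), (g \o fst), (fun=> 1); split => //.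
  - by exists U, V.
  - by apply: subalg_gen; exists U, V; split=> //; left; exists g.
  - exact: subalg_cst.
  - by split=> [|q _ _ _]; rewrite ?oner_neq0 // divr1.
have sndr V g : open V -> reg V g -> forall U, open U -> reg (U `*` V : set (prod_space X Z)) (g \o snd).
  move=> oV rg U oU p UVp; exists (U `*` V), (g \o snd), (fun=> 1); split => //.
  - by exists U, V.
  - by apply: subalg_gen; exists U, V; split=> //; right; exists g.
  - exact: subalg_cst.
  - by split=> [|q _ _ _]; rewrite ?oner_neq0 // divr1.
split.
- exact: box.
- move=> i; rewrite /prod_coord; case: ltnP => _.
    exact: (fstr A (fun x => k x i)).
  exact: (sndr B (fun z => l z (i - m)%N)).
- move=> p i mi; rewrite /prod_coord ltnNge (leq_trans (leq_addr _ _) mi) /= ln //.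
  by rewrite leq_subRL // (leq_trans (leq_addr _ _) mi).
- apply: local_fractions_gen => p _ [Ap Bp] [U [V [oU oV ->]]] [Up Vp].
  have [[b bx bU] _] := lA _ _ Ap oU Up; have [[c cx cV] _] := lB _ _ Bp oV Vp.
  split.
    exists (PM (psub sl b) (psub sr c)).
      by rewrite /pv /= -!/(pv _ _) slE srE mulf_neq0.
    move=> q [Aq Bq]; rewrite /pv /= -!/(pv _ _) slE srE mulf_eq0 negb_or => /andP[bq cq].
    by split; [exact: bU|exact: cV].
  move=> g [U' [V' [oU' oV' UVE]]] gE.
  have [Up' Vp'] : (U' `*` V') p by rewrite -UVE.
  case: gE => -[h rh ->].
    by apply: gl; have [_] := lA _ _ Ap oU' Up'; exact.
  by apply: gr; have [_] := lB _ _ Bp oV' Vp'; exact.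
- move=> v hv.
  have [|x Ax kx] := fA (fun i => if (i < m)%N then v i else 0).
    move=> e he; have : pv v (psub sl e) = 0.
      by apply: hv => p [Ap _]; rewrite slE; exact: he.
    rewrite pv_sub => e0; rewrite -[RHS]e0; apply: pv_ext => i; rewrite /sl.
    by case: ifP.
  have [|z Bz lz] := fB (fun i => v (i + m)%N).
    move=> e he; have : pv v (psub sr e) = 0.
      by apply: hv => p [_ Bp]; rewrite srE; exact: he.
    by rewrite pv_sub.
  exists (x, z) => // i; rewrite /prod_coord /= kx lz.
  by case: ltnP => // im; rewrite subnK.
Qed.

End Products.

End Charts.

Lemma quot_piP (K : fieldType) (X : fspace K) (R : X -> X -> Prop) (x y : X) :
  quot_pi R x = quot_pi R y <-> Relation_Operators.clos_refl_sym_trans X R x y.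
Proof.
split; first by move=> /eqmodP /= /asboolP.
by move=> h; apply/eqmodP/asboolP.
Qed.

Lemma quot_openE (K : fieldType) (X : fspace K) (R : X -> X -> Prop) (U : set (quot_space R)) :
  open U = open (quot_pi R @^-1` U).
Proof. by []. Qed.

(** * Charts of projective space and of semiprojective varieties *)

Section ProjectiveSpace.
Context (K : closedFieldType) (m : nat).
Implicit Types (w : 'rV[K]_m.+1).

Local Notation nz := [set v : affsp K m.+1 | v != (0 : 'rV[K]_m.+1)].

Definition punctured := subsp nz.

Definition proj_rel (v w : punctured) : Prop :=
  exists2 c : K, c != 0 & val v = c *: (val w : 'rV[K]_m.+1).

Definition proj_pi (v : punctured) : projsp K m := quot_pi proj_rel v.

(* The equality of the space [affsp] is not convertible to the one of row vectors. *)
Lemma nzP w : nz w <-> w != 0.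
Proof. by split=> /eqP w0; apply/eqP. Qed.

Definition punct w (w0 : w != 0) : punctured :=
  exist (fun v => v \in nz) w (@mem_set _ nz w ((nzP w).2 w0)).

Lemma punct_neq0 (v : punctured) : (val v : 'rV[K]_m.+1) != 0.
Proof. by apply/nzP; exact: (@set_mem _ nz _ (valP v)). Qed.

Lemma proj_piP (v w : punctured) : proj_pi v = proj_pi w -> proj_rel v w.
Proof.
move=> /quot_piP; elim=> {v w} [v w //|v|v w _ [c c0 vw]|u v w _ [c c0 uv] _ [d d0 vw]].
- by exists 1; rewrite ?oner_neq0 // scale1r.
- by exists c^-1; rewrite ?invr_eq0 // vw scalerA mulVf // scale1r.
- by exists (c * d); rewrite ?mulf_neq0 // uv vw scalerA.
Qed.

Definition proj_rep (q : projsp K m) : punctured := projT1 (cid (quot_pi_surj q)).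

Lemma proj_repK q : proj_pi (proj_rep q) = q.
Proof. by rewrite /proj_rep; case: cid. Qed.

(** Coordinates of a chosen representative: not regular functions, but well defined up to a common
    nonzero factor, so that their quotients and zero sets make sense. *)
Definition hom_coord (q : projsp K m) : nat -> K := rowf (val (proj_rep q) : 'rV[K]_m.+1).

Lemma rowfZ n (c : K) (v : 'rV[K]_n) i : rowf (c *: v) i = c * rowf v i.
Proof. by rewrite /rowf; case: insubP => [j _ _|_]; rewrite ?mxE // mulr0. Qed.

Lemma hom_coord_pi v : exists2 c, c != 0 &
  forall i, hom_coord (proj_pi v) i = c * rowf (val v : 'rV[K]_m.+1) i.
Proof.
have [c c0 e] := proj_piP (proj_repK (proj_pi v)).
by exists c => // i; rewrite /hom_coord e rowfZ.
Qed.

Lemma hom_coord_neq0 q : exists2 k, (k < m.+1)%N & hom_coord q k != 0.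
Proof.
have /rV0Pn[k vk] := punct_neq0 (proj_rep q).
by exists k; rewrite // /hom_coord rowfE.
Qed.

Context (k : nat) (km : (k < m.+1)%N).

Definition proj_coord (q : projsp K m) (i : nat) : K := hom_coord q i / hom_coord q k.

Lemma proj_coord_pi v i :
  proj_coord (proj_pi v) i = rowf (val v : 'rV[K]_m.+1) i / rowf (val v : 'rV[K]_m.+1) k.
Proof.
have [c c0 h] := hom_coord_pi v.
by rewrite /proj_coord !h -mulf_div divff // mul1r.
Qed.

Lemma hom_coord_pi_neq0 v : (hom_coord (proj_pi v) k != 0) = (rowf (val v : 'rV[K]_m.+1) k != 0).
Proof. by have [c c0 h] := hom_coord_pi v; rewrite h mulf_eq0 (negbTE c0). Qed.

(** Each point has a representative whose k-th coordinate is 1; its coordinates in affine space are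
    then the chart coordinates, and germs are computed there. All m + 1 quotients are kept, the k-th
    one being constant. *)
Lemma proj_chart : affine_chart [set q | hom_coord q k != 0] proj_coord m.+1.
Proof.
have [_ rr r0 lr _] := affsp_chart K m.+1; have S := space_sheaf (affsp K m.+1).
have oV := sheaf_nz S openT (rr k).
set V := [set: affsp K m.+1] `&` _ in oV.
have norm q : hom_coord q k != 0 -> exists v : punctured,
    [/\ proj_pi v = q, rowf (val v : 'rV[K]_m.+1) =1 proj_coord q & rowf (val v : 'rV[K]_m.+1) k = 1].
  move=> qk; pose w : 'rV[K]_m.+1 := (hom_coord q k)^-1 *: val (proj_rep q).
  have w0 : w != 0 by rewrite scaler_eq0 invr_eq0 (negbTE qk) (negbTE (punct_neq0 _)).
  exists (punct w0); split.
  - rewrite -[RHS]proj_repK; apply/quot_piP/Relation_Operators.rst_step.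
    by exists (hom_coord q k)^-1; rewrite ?invr_eq0.
  - by move=> i /=; rewrite rowfZ mulrC.
  - by rewrite /= rowfZ mulVf.
split.
- suff : open (proj_pi @^-1` [set q | hom_coord q k != 0]) by [].
  exists V => //; apply/seteqP; split=> v /=; rewrite hom_coord_pi_neq0; last by split.
  by case.
- move=> i; suff : reg (proj_pi @^-1` [set q | hom_coord q k != 0])
      (fun v => proj_coord (proj_pi v) i) by [].
  move=> v /= vk; exists V, (fun w => rowf (w : 'rV[K]_m.+1) i * (rowf (w : 'rV[K]_m.+1) k)^-1); split=> //.
  + by split=> //=; rewrite -hom_coord_pi_neq0.
  + apply: (sheaf_mul S oV); last exact: (sheaf_inv S openT (rr k)).
    by apply: (reg_res oV openT) => //; exact: rr.
  + by move=> w _ _; rewrite proj_coord_pi.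
- by move=> q i mi; rewrite /proj_coord /hom_coord r0 // mul0r.
- move=> q U qk oU Uq; have [v [vq vc vk]] := norm q qk.
  have oU' : open (proj_pi @^-1` U) by rewrite quot_openE in oU.
  case: (oU') => V' oV' V'E.
  have V'v : V' (val v).
    have : (proj_pi @^-1` U) v by rewrite /= vq.
    by rewrite -V'E.
  have V'U (w : punctured) : V' (val w) -> U (proj_pi w).
    move=> V'w; have : (set_val @^-1` V') w by [].
    by rewrite V'E.
  have [[b bv bV'] _] := lr _ _ (Logic.I : [set: affsp K m.+1] _) oV' V'v.
  split.
    exists b; first by rewrite -(pv_ext _ vc).
    move=> q' q'k; have [v' [<- v'c _]] := norm q' q'k.
    rewrite -(pv_ext _ v'c) => bv'.
    by apply/V'U/bV'.
  move=> f rf; have rf' : reg (proj_pi @^-1` U) (f \o proj_pi) by [].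
  have [|W [g [oW Wv rg gE]]] := rf' v; first by rewrite /= vq.
  have [[c cv cW] /(_ _ rg)[a [d [dv dE]]]] := lr _ _ (Logic.I : [set: affsp K m.+1] _) oW Wv.
  exists (PM a (PM b c)), (PM d (PM b c)); rewrite /pv /= -!/(pv _ _) -!(pv_ext _ vc).
  split; first by rewrite !mulf_neq0.
  move=> q' q'k; have [v' [v'q v'c _]] := norm q' q'k.
  rewrite /pv /= -!/(pv _ _) -!(pv_ext _ v'c) !mulf_eq0 !negb_or => /and3P[dv' bv' cv'].
  rewrite -mulf_div divff ?mulr1 ?mulf_neq0 // -dE // -v'q; apply: gE; last exact: cW.
  by apply/V'U/bV'.
- move=> x hx.
  have xk : x k = 1.
    have := hx (PA (PV k) (PC (-1))); rewrite /pv /= => /(_ _)/eqP.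
    rewrite addr_eq0 opprK => /(_ _)/eqP; apply=> q qk.
    by rewrite /proj_coord divff // subrr.
  have x0 i : (m.+1 <= i)%N -> x i = 0.
    by move=> mi; apply: (hx (PV i)) => q _; rewrite /pv /= /proj_coord /hom_coord r0 // mul0r.
  pose w := \row_(i < m.+1) x i.
  have wx i : rowf w i = x i.
    have [im|im] := ltnP i m.+1; last by rewrite rowf0 // x0.
    by have := rowfE w (Ordinal im); rewrite mxE.
  have w0 : w != 0 by apply/rV0Pn; exists (Ordinal km); rewrite mxE /= xk oner_neq0.
  exists (proj_pi (punct w0)).
    by rewrite /= hom_coord_pi_neq0 /= wx xk oner_neq0.
  by move=> i; rewrite proj_coord_pi /= !wx xk divr1.
Qed.

End ProjectiveSpace.

(** X is closed in Z x P^m with Z closed in an affine space. The z are the affine coordinates and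
    the h the homogeneous ones, common to all charts. *)
Lemma semiprojective_charts (K : closedFieldType) (X : fspace K) : semiprojective X ->
  exists p m (z h : X -> nat -> K),
    (forall x, exists2 k, (k < m)%N & h x k != 0) /\
    forall k, (k < m)%N -> affine_chart [set x | h x k != 0]
      (fun x i => if (i < p)%N then z x i else h x (i - p)%N / h x k) (p + m).
Proof.
move=> [Z [f [[[p [c [clc emc]]] _] [_ [m [g [[clg emg] gf]]]]]]].
exists p, m.+1, (fun x => rowf (c (pr1 (g x)) : 'rV[K]_p)), (fun x => hom_coord (pr2 (g x))).
split=> [x|k km]; first exact: hom_coord_neq0.
have := embedding_chart clg emg (prod_chart (embedding_chart clc emc (affsp_chart K p)) (proj_chart K km)).
congr (affine_chart _ _ _); apply/seteqP; split=> x /=; last by split.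
by case.
Qed.

Lemma gspan_lin (F : fieldType) (G : zmodType) (B : G -> set F) (R : set F) (s : seq (G * F)) h f :
  subring R -> (forall g, B g `<=` R) -> gspan B s h f ->
  exists c : nat -> F, (forall i, R (c i)) /\ f = \sum_(i < size s) c i * (map snd s)`_i.
Proof.
move=> rR BR; elim: s h f => [|x s IH] h f /=.
  by move=> ->; exists (fun=> 0); rewrite big_ord0; split=> // _; exact: subring0.
move=> [c [d [Bc /IH[c' [c'R ->]] ->]]]; exists (fun i => if i is i'.+1 then c' i' else c).
split; first by case=> //; exact: BR Bc.
by rewrite big_ord_recl.
Qed.

(** * The function field and affine charts of Y *)

Section GeneratedSubring.
Context (K : fieldType) (F : fieldType) (j : {rmorphism K -> F}).

Definition gen_subring (r : nat -> F) : set F := [set f | exists e, f = pev j r e].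

Lemma gen_subringP r : subring (gen_subring r).
Proof.
split.
- by exists (PC 1); rewrite /= rmorph1.
- move=> _ _ [a ->] [b ->]; exists (PA a (PM (PC (-1)) b)).
  by rewrite /= rmorphN1 mulN1r.
- by move=> _ _ [a ->] [b ->]; exists (PM a b).
Qed.

Lemma gen_subring_gen r i : gen_subring r (r i).
Proof. by exists (PV i). Qed.

Lemma gen_subring_cst r c : gen_subring r (j c).
Proof. by exists (PC c). Qed.

(** The graded basis theorem for the grading by int concentrated in degree 0. *)
Lemma gen_subring_noeth r n : (forall i, (n <= i)%N -> r i = 0) -> rnoeth (gen_subring r).
Proof.
move=> r0 J [JR J0 JD JM].
pose s : seq (int * F) := [seq (0, r i) | i <- iota 0 n].
have rB := galg_ring j s; set B := galg j s in rB.
have [B1 B0 BD BM] := rB.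
have RB : gen_subring r `<=` B 0.
  move=> _ [e ->]; elim: e => /= [c|i|a IHa b IHb|a IHa b IHb].
  - exact: galg_cst.
  - have [ni|ni] := leqP n i; first by rewrite r0.
    by apply: (@galg_gen _ _ _ j s (0, r i)); apply/mapP; exists i; rewrite // mem_iota.
  - exact: BD.
  - by have := BM _ _ _ _ IHa IHb; rewrite addr0.
have rR := gen_subringP r; have [R1 _ RM] := rR.
have BR g f : B g f -> f = 0 \/ g = 0 /\ gen_subring r f.
  apply: (@galg_min _ _ _ j (fun g f => f = 0 \/ g = 0 /\ gen_subring r f)).
  - split.
    + by right; split=> //; apply: subringN.
    + by left.
    + move=> h a b [->|[-> Ra]]; first by rewrite add0r.
      by move=> [->|[_ Rb]]; rewrite ?addr0; right; split=> //; apply: subringD.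
    + move=> h h' a b [->|[-> Ra]]; first by rewrite mul0r; left.
      move=> [->|[-> Rb]]; first by rewrite mulr0; left.
      by right; rewrite addr0; split=> //; exact: RM.
  - by move=> c; right; split=> //; exact: gen_subring_cst.
  - by move=> _ /mapP[i _ ->]; right; split=> //; exact: gen_subring_gen.
pose N (h : int) : set F := [set f | f = 0 \/ h = 0 /\ J f].
have [||t [tN Nt]] := @galg_noeth _ _ _ j s N.
- split=> [g|g a b|g h a b Ba].
  + by left.
  + move=> [->|[-> Ja]]; first by rewrite add0r.
    by move=> [->|[_ Jb]]; rewrite ?addr0; right; split=> //; exact: JD.
  + move=> [->|[-> Jb]]; first by rewrite mulr0; left.
    have [->|[-> Ra]] := BR _ _ Ba; first by rewrite mul0r; left.
    by right; rewrite addr0; split=> //; exact: JM.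
- by move=> h f [->|[-> /JR/RB]]; [exact: B0|exact].
exists (map snd t); split.
  by move=> _ /mapP[x xt ->]; have [->|[_]] := tN x xt.
move=> f Jf; rewrite size_map; apply: (@gspan_lin _ _ B _ t 0) => //.
  by move=> g a /BR[->|[]]; [exact: subring0|].
by apply: Nt; right.
Qed.

End GeneratedSubring.

Section FunctionField.
Context (K : closedFieldType) (Y : integral_space K).
Local Notation F := (funfield Y).
Implicit Types (f g : rfun Y) (a b c : F) (x y z : Y) (U V A : set Y).

Lemma rclassD f g : rclass (radd f g) = rclass f + rclass g :> F.
Proof. by rewrite -ff_addE. Qed.

Lemma rclassN f : rclass (ropp f) = - rclass f :> F.
Proof. by rewrite -ff_oppE. Qed.

Lemma ff_cstB : {morph ff_cst Y : u v / u - v}.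
Proof.
move=> u v; rewrite -[ff_cst Y v]/(rclass (rcst Y v)) -rclassN -[ff_cst Y u]/(rclass (rcst Y u)) -rclassD.
by apply/rclassE.
Qed.

Lemma ff_cstM : monoid_morphism (ff_cst Y).
Proof.
split=> // u v; rewrite -[ff_cst Y u]/(rclass (rcst Y u)) -[ff_cst Y v]/(rclass (rcst Y v)) -rclassM.
by apply/rclassE.
Qed.

HB.instance Definition _ := GRing.isZmodMorphism.Build K F (ff_cst Y) ff_cstB.
HB.instance Definition _ := GRing.isMonoidMorphism.Build K F (ff_cst Y) ff_cstM.

Definition ffc : {rmorphism K -> F} := ff_cst Y.

Definition regular_at y : set F := local_ring [set y].

Lemma regular_atP y a : regular_at y a <-> exists2 f, rclass f = a & rdom f y.
Proof.
split=> [[f fa [z [fz zy]]]|[f fa fy]]; exists f => //; last by exists y.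
by rewrite -(zy : z = y).
Qed.

(** The value at y, well defined because representatives agree on the intersection of their domains;
    it is 0 where a is not regular. *)
Definition ev y a : K := xget 0 [set c | exists f, [/\ rclass f = a, rdom f y & rval f y = c]].

Lemma ev_rclass f y : rdom f y -> ev y (rclass f) = rval f y.
Proof.
move=> fy; rewrite /ev; case: xgetP => [c _ [g [gf gy <-]]|/(_ (rval f y))[]].
  exact: (rclassE g f).1.
by exists f.
Qed.

Lemma regular_at_cst y u : regular_at y (ffc u).
Proof. by apply/regular_atP; exists (rcst Y u). Qed.

Lemma ev_cst y u : ev y (ffc u) = u.
Proof. exact: (@ev_rclass (rcst Y u) y Logic.I). Qed.

Lemma ev0 y : ev y 0 = 0. Proof. exact: (ev_cst y 0). Qed.
Lemma ev1 y : ev y 1 = 1. Proof. exact: (ev_cst y 1). Qed.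

Lemma evD y a b : regular_at y a -> regular_at y b -> ev y (a + b) = ev y a + ev y b.
Proof.
move=> /regular_atP[f <- fy] /regular_atP[g <- gy].
by rewrite -rclassD !ev_rclass.
Qed.

Lemma evM y a b : regular_at y a -> regular_at y b -> ev y (a * b) = ev y a * ev y b.
Proof.
move=> /regular_atP[f <- fy] /regular_atP[g <- gy].
by rewrite -rclassM !ev_rclass.
Qed.

Lemma regular_atD y a b : regular_at y a -> regular_at y b -> regular_at y (a + b).
Proof.
move=> /regular_atP[f <- fy] /regular_atP[g <- gy].
by rewrite -rclassD; apply/regular_atP; exists (radd f g).
Qed.

Lemma regular_atM y a b : regular_at y a -> regular_at y b -> regular_at y (a * b).
Proof.
move=> /regular_atP[f <- fy] /regular_atP[g <- gy].
by rewrite -rclassM; apply/regular_atP; exists (rmul f g).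
Qed.

Lemma regular_atN y a : regular_at y a -> regular_at y (- a).
Proof.
move=> /regular_atP[f <- fy]; rewrite -rclassN.
by apply/regular_atP; exists (ropp f).
Qed.

Lemma regular_at_subring y : subring (regular_at y).
Proof.
split.
- exact: (regular_at_cst y 1).
- by move=> a b Oa Ob; apply: regular_atD => //; exact: regular_atN.
- exact: regular_atM.
Qed.

Lemma evX y a n : regular_at y a -> ev y (a ^+ n) = ev y a ^+ n.
Proof.
move=> Oa; elim: n => [|n IH]; first by rewrite !expr0 ev1.
by rewrite !exprS evM ?IH //; apply: subringX => //; exact: regular_at_subring.
Qed.

Lemma regular_atV y a : regular_at y a -> ev y a != 0 -> regular_at y a^-1.
Proof.
move=> /regular_atP[f fa fy]; rewrite -fa ev_rclass // => fy0.
apply/regular_atP; exists (rinv f).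
  have f0 : rclass f != 0.
    by apply: contraNneq fy0 => e; have := ev_rclass fy; rewrite e ev0 => <-.
  have e1 : rclass f * rclass (rinv f) = 1.
    rewrite -rclassM; apply/rclassE => z /= [fz]; rewrite /rinv; case: pselect => /= [_ [_ /= nz]|[]].
      by rewrite mulfV.
    by exists y.
  by rewrite -[RHS]mulr1 -e1 mulKf.
by rewrite /rinv; case: pselect => //= -[]; exists y.
Qed.

Lemma evV y a : regular_at y a -> ev y a != 0 -> ev y a^-1 = (ev y a)^-1.
Proof.
move=> Oa a0; have OV := regular_atV Oa a0; apply: (mulfI a0).
have an0 : a != 0 by apply: contraNneq a0 => ->; rewrite ev0.
by have := evM Oa OV; rewrite divff // ev1 => <-; rewrite divff.
Qed.

Lemma regular_open y a : regular_at y a ->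
  exists V, [/\ open V, V y & forall z, V z -> regular_at z a].
Proof.
move=> /regular_atP[f fa fy]; exists (rdom f); split=> //; first exact: rdom_open.
by move=> z fz; apply/regular_atP; exists f.
Qed.

Lemma nonvanishing_open a : open [set y | regular_at y a /\ ev y a != 0].
Proof.
rewrite openE => y [/regular_atP[f fa fy] ay]; rewrite /interior nbhsE /=.
exists (rdom f `&` [set z | rval f z != 0]).
  split; first exact: (sheaf_nz (space_sheaf Y) (rdom_open f) (rval_reg f)).
  by split=> //=; rewrite -ev_rclass // fa.
move=> z [fz /= fz0]; split; first by apply/regular_atP; exists f.
by rewrite -fa ev_rclass.
Qed.

Lemma ev_eq0 V a : open V -> V !=set0 -> (forall z, V z -> regular_at z a -> ev z a = 0) -> a = 0.
Proof.
move=> oV V0 Va; have [f fa] := rclassP a; rewrite -fa.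
have [z [fz Vz]] := openI_n0 (rdom_open f) oV (rdom_n0 f) V0.
have : rclass f = rclass (rcst Y 0); last by move=> ->.
apply/rclassE => x fx _ /=.
apply: contrapT => /eqP nx.
have oW := sheaf_nz (space_sheaf Y) (rdom_open f) (rval_reg f).
have [|w [[fw /= wn] Vw]] := openI_n0 oW oV _ V0; first by exists x.
move/eqP: wn; apply; rewrite -ev_rclass // fa; apply: Va => //.
by apply/regular_atP; exists f.
Qed.

Definition pf (r : nat -> F) (e : pexp K) : F := pev ffc r e.

Lemma ev_pf y r e : (forall i, regular_at y (r i)) ->
  regular_at y (pf r e) /\ ev y (pf r e) = pv (fun i => ev y (r i)) e.
Proof.
move=> ry; rewrite /pf /pv; elim: e => [c|i|a [Oa ea] b [Ob eb]|a [Oa ea] b [Ob eb]] /=.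
- by split; [exact: regular_at_cst|exact: ev_cst].
- by split.
- by split; [exact: regular_atD|rewrite evD // ea eb].
- by split; [exact: regular_atM|rewrite evM // ea eb].
Qed.

(* An affine open subset with coordinate ring K[r]; [fchart_pt] says that its points are the
   K-points of K[r]. *)
Record fchart A (r : nat -> F) (n : nat) : Prop := FChart {
  fchart_open : open A;
  fchart_reg : forall y i, A y -> regular_at y (r i);
  fchart_bound : forall i, (n <= i)%N -> r i = 0;
  fchart_loc : forall y a, A y -> regular_at y a ->
    exists p q, ev y (pf r q) != 0 /\ a = pf r p / pf r q;
  fchart_pt : forall v : nat -> K, (forall e, pf r e = 0 -> pv v e = 0) ->
    exists2 y, A y & forall i, ev y (r i) = v i;
  fchart_top : forall y U, A y -> open U -> U y ->
    exists2 q, ev y (pf r q) != 0 & forall z, A z -> ev z (pf r q) != 0 -> U z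
}.

(** The coordinate functions become elements of the function field. An identity between germs holds
    on a nonempty open set, hence in the function field by [ev_eq0]. *)
Lemma affine_fchart A k n : A !=set0 -> affine_chart A k n ->
  exists r, fchart A r n /\ forall y i, A y -> ev y (r i) = k y i.
Proof.
move=> A0 [oA kr kn lA fA]; pose R i := RFun oA A0 (kr i).
exists (fun i => rclass (R i)).
have rr y i : A y -> regular_at y (rclass (R i)) by move=> Ay; apply/regular_atP; exists (R i).
have rE y i : A y -> ev y (rclass (R i)) = k y i by move=> Ay; rewrite ev_rclass.
have pE y e : A y -> ev y (pf (fun i => rclass (R i)) e) = pv (k y) e.
  move=> Ay; rewrite (ev_pf e (fun i => rr y i Ay)).2.
  by apply: pv_ext => i; exact: rE.
split=> //; split=> //.
- move=> i ni; apply: (ev_eq0 oA A0) => y Ay _; by rewrite rE // kn.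
- move=> y a Ay /regular_atP[f fa fy].
  have [[c cy cU] /(_ _ (rval_reg f))[p [q [qy fE]]]] := lA y _ Ay (rdom_open f) fy.
  exists p, q; rewrite pE //; split=> //.
  set r := (fun i => rclass (R i)) in pE *.
  have Op z e : A z -> regular_at z (pf r e) by move=> Az; exact: (ev_pf e (fun i => rr z i Az)).1.
  have q0 : pf r q != 0 by apply: contraNneq qy => e; rewrite -pE // e ev0.
  apply: (mulIf q0); rewrite divfK //; apply/eqP; rewrite -subr_eq0; apply/eqP.
  apply: (@ev_eq0 (A `&` [set z | regular_at z (pf r (PM c q)) /\ ev z (pf r (PM c q)) != 0])).
  + by apply: openI => //; exact: nonvanishing_open.
  + exists y; split=> //; split; first exact: Op.
    by rewrite pE // /pv /= mulf_neq0.
  + move=> z [Az [_]]; rewrite pE // /pv /= mulf_eq0 negb_or => /andP[cz qz] _.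
    have fz : rdom f z by exact: cU.
    have Oa : regular_at z a by apply/regular_atP; exists f.
    rewrite evD ?evM //; last first.
    * by apply: regular_atN; exact: Op.
    * by apply: regular_atM => //; exact: Op.
    * exact: Op.
    rewrite -fa ev_rclass // fE // pE // divfK //.
    by rewrite -mulN1r -(rmorphN1 ffc) evM ?ev_cst ?pE ?mulN1r ?subrr //; [exact: regular_at_cst|exact: Op].
- move=> v hv; have [|y Ay kv] := fA v.
    move=> e he; apply: hv; apply: (ev_eq0 oA A0) => y Ay _.
    by rewrite pE // he.
  by exists y => // i; rewrite rE.
- move=> y U Ay oU Uy; have [[b by0 bU] _] := lA y U Ay oU Uy.
  by exists b => [|z Az]; rewrite pE // => /bU; exact.
Qed.

End FunctionField.

Section Irreducible.
Context (T : topologicalType).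
Implicit Types (W A U : set T).

Lemma preirreducible_closure W : preirreducible W -> preirreducible (closure W).
Proof.
move=> iW U V oU oV [x [cx Ux]] [y [cy Vy]].
have [||z [Wz UVz]] := iW U V oU oV.
- by have [z [Wz Uz]] := cx U (open_nbhs_nbhs (conj oU Ux)); exists z.
- by have [z [Wz Vz]] := cy V (open_nbhs_nbhs (conj oV Vy)); exists z.
by exists z; split=> //; exact: subset_closure.
Qed.

Lemma preirreducible_dense W A : preirreducible W -> open A -> W `&` A !=set0 ->
  W `<=` closure (W `&` A).
Proof.
move=> iW oA WA x Wx B; rewrite nbhsE => -[U [oU Ux] UB].
have [|z [Wz [Az Uz]]] := iW A U oA oU WA; first by exists x.
by exists z; split; [split|exact: UB].
Qed.

Lemma preirreducible_bigcap W (n : nat) (U : nat -> set T) : W !=set0 -> preirreducible W ->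
  (forall i, open (U i)) -> (forall i, W `&` U i !=set0) ->
  exists2 x, W x & forall i, (i < n)%N -> U i x.
Proof.
move=> W0 iW oU WU.
suff [V [oV WV VU]] : exists V, [/\ open V, W `&` V !=set0 &
    forall x, V x -> forall i, (i < n)%N -> U i x].
  by have [x [Wx Vx]] := WV; exists x => //; exact: VU.
elim: n => [|n [V [oV WV VU]]].
  by exists setT; split=> //; [exact: openT|rewrite setIT].
exists (V `&` U n); split; [exact: openI|exact: iW|].
by move=> x [Vx Ux] i; rewrite ltnS leq_eqVlt => /predU1P[->|]; [|exact: VU].
Qed.

End Irreducible.

Section ChartRing.
Context (K : closedFieldType) (Y : integral_space K).
Local Notation F := (funfield Y).
Implicit Types (a b : F) (x y z : Y) (W Z E : set Y).

Lemma local_ringP W a : local_ring W a <-> exists2 y, W y & regular_at y a.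
Proof.
split=> [[f fa [y [fy Wy]]]|[y Wy /regular_atP[f fa fy]]].
  by exists y => //; apply/regular_atP; exists f.
by exists f => //; exists y.
Qed.

Context (A : set Y) (r : nat -> F) (n : nat) (ch : fchart A r n).
Definition chart_ring : set F := gen_subring (ffc Y) r.
Local Notation R := chart_ring.
Let oA := fchart_open ch.

Lemma chart_ring_subring : subring R.
Proof. exact: gen_subringP. Qed.
Let rR := chart_ring_subring.

Lemma chart_ring_noeth : rnoeth R.
Proof. exact: gen_subring_noeth (fchart_bound ch). Qed.

Lemma chart_ring_reg a y : R a -> A y -> regular_at y a.
Proof. by move=> [e ->] Ay; exact: (ev_pf e (fun i => fchart_reg ch i Ay)).1. Qed.

Lemma chart_ev v y e : (forall i, ev y (r i) = v i) -> A y -> ev y (pf r e) = pv v e.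
Proof.
move=> yv Ay; rewrite (ev_pf e (fun i => fchart_reg ch i Ay)).2.
by apply: pv_ext => i; rewrite yv.
Qed.

Lemma chart_null_prime P s : rprime R P -> R s -> ~ P s ->
  exists y, [/\ A y, forall p, P p -> ev y p = 0 & ev y s != 0].
Proof.
move=> [[PR P0 PD PM] P1 Pp] Rs Ps.
have [||v [vP vs]] := nullstellensatz_prime (fchart_bound ch) P0 _ _ P1 Pp Rs Ps.
- by move=> a b _ _; exact: PD.
- by move=> a b Ra _; exact: PM.
have [|y Ay yv] := fchart_pt ch (v := v).
  by move=> e e0; apply: vP; rewrite -/(pf r e) e0.
exists y; split=> // [p Pp'|].
  have [e pe] := PR _ Pp'; rewrite pe -/(pf r e) (chart_ev _ yv) //.
  by apply: vP; rewrite -pe.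
by have [e se] := Rs; rewrite se -/(pf r e) (chart_ev _ yv) //; apply: vs.
Qed.

(** The local-to-global principle for charts: a property of functions whose carriers form an ideal
    of R holds for 1 as soon as every point has a function with this property that does not vanish
    there. *)
Lemma chart_null J : rideal R J -> (forall y, A y -> exists2 f, J f & ev y f != 0) -> J 1.
Proof.
move=> [JR J0 JD JM] hJ; apply: contrapT => J1.
pose I : set (pexp K) := [set e | J (pf r e)].
have [|||||v [v0 vI]] := @nullstellensatz K n I.
- move=> e e' ee'; rewrite /I /=; congr J.
  exact: (polyn_of_eq ee' (ffc Y) (fchart_bound ch)).
- by move=> a b; exact: JD.
- by move=> a b Ib; apply: JM => //; exists a.
- by rewrite /I /= /pf /= rmorph0.
- by rewrite /I /= /pf /= rmorph1.
have [|y Ay yv] := fchart_pt ch (v := v).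
  by move=> e e0; apply: vI; rewrite /I /= e0.
have [f Jf] := hJ y Ay; have [e fe] := JR _ Jf.
by rewrite fe -/(pf r e) (chart_ev _ yv) // /pv vI ?eqxx // /I /= /pf -fe.
Qed.

Definition van W : set F := [set f | R f /\ forall y, A y -> W y -> ev y f = 0].

Lemma van_ideal W : rideal R (van W).
Proof.
have [R1 RB RM] := rR; split.
- by move=> f [].
- by split=> [|y _ _]; [exact: subring0|rewrite ev0].
- move=> a b [Ra Wa] [Rb Wb]; split=> [|y Ay Wy]; first exact: subringD.
  by rewrite evD ?Wa ?Wb ?addr0 //; exact: chart_ring_reg.
- move=> a b Ra [Rb Wb]; split=> [|y Ay Wy]; first exact: RM.
  by rewrite evM ?Wb ?mulr0 //; exact: chart_ring_reg.
Qed.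

Lemma nonvanishing_meet W a b : preirreducible W ->
  (exists y, [/\ W y, regular_at y a & ev y a != 0]) ->
  (exists y, [/\ W y, regular_at y b & ev y b != 0]) ->
  exists y, [/\ W y, regular_at y a, ev y a != 0, regular_at y b & ev y b != 0].
Proof.
move=> iW [y [Wy Oa a0]] [z [Wz Ob b0]].
have [||x [Wx [[Oxa xa] [Oxb xb]]]] := iW _ _ (nonvanishing_open a) (nonvanishing_open b).
- by exists y.
- by exists z.
by exists x.
Qed.

Lemma notin_van W a : R a -> ~ van W a -> exists y, [/\ A y, W y & ev y a != 0].
Proof.
move=> Ra na; apply: contrapT => h; apply: na; split=> // y Ay Wy.
by apply/eqP; apply: contrapT => /negP ny; apply: h; exists y.
Qed.

Lemma preirreducibleI W U : preirreducible W -> open U -> preirreducible (W `&` U).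
Proof.
move=> iW oU V V' oV oV' [x [[Wx Ux] Vx]] [y [[Wy Uy] V'y]].
have [||z [Wz [[Vz Uz] [V'z _]]]] := iW _ _ (openI oV oU) (openI oV' oU).
- by exists x.
- by exists y.
by exists z.
Qed.

Lemma van_prime W : preirreducible W -> W `&` A !=set0 -> rprime R (van W).
Proof.
move=> iW [y [Wy Ay]]; split; first exact: van_ideal.
  by move=> [_ /(_ y Ay Wy)/eqP]; rewrite ev1 oner_eq0.
move=> a b Ra Rb [_ ab]; apply: contrapT => /not_orP[/(notin_van Ra)[u [Au Wu ua]] /(notin_van Rb)[v [Av Wv vb]]].
have [||z [[Wz Az] Oa a0 Ob b0]] := @nonvanishing_meet (W `&` A) a b (preirreducibleI iW oA).
- by exists u; split=> //; exact: chart_ring_reg.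
- by exists v; split=> //; exact: chart_ring_reg.
by have /eqP := ab z Az Wz; rewrite evM // mulf_eq0 (negbTE a0) (negbTE b0).
Qed.

(** A function regular at some point of W is a fraction at a point of W in A, by irreducibility of
    W, and the denominator does not vanish identically on W. *)
Lemma loc_van W : preirreducible W -> W `&` A !=set0 -> loc R (van W) = local_ring W.
Proof.
move=> iW WA; apply/seteqP; split=> f.
  move=> [a [b [Ra Rb nb ->]]]; have [y [Ay Wy b0]] := notin_van Rb nb.
  apply/local_ringP; exists y => //; apply: regular_atM; first exact: chart_ring_reg.
  by apply: regular_atV => //; exact: chart_ring_reg.
move=> /local_ringP[y Wy /regular_open[V [oV Vy Vf]]].
have [|z [Wz [Vz Az]]] := iW V A oV oA _ WA; first by exists y.
have [p [q [q0 ->]]] := fchart_loc ch Az (Vf z Vz).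
exists (pf r p), (pf r q); split=> //; [by exists p|by exists q|].
by move=> [_ /(_ z Az Wz)/eqP]; rewrite (negbTE q0).
Qed.

Lemma chart_frac a : A !=set0 -> exists p q, [/\ R p, R q, q != 0 & a = p / q].
Proof.
move=> A0; have [f <-] := rclassP a.
have [y [fy Ay]] := openI_n0 (rdom_open f) oA (rdom_n0 f) A0.
have [|p [q [q0 e]]] := fchart_loc ch Ay (a := rclass f).
  by apply/regular_atP; exists f.
exists (pf r p), (pf r q); split=> //; [by exists p|by exists q|].
by apply: contraNneq q0 => ->; rewrite ev0.
Qed.

Definition zeros (P : set F) : set Y := [set y | A y /\ forall p, P p -> ev y p = 0].

Lemma van_zeros P : rprime R P -> van (zeros P) = P.
Proof.
move=> pP; have [[PR _ _ _] _ _] := pP; apply/seteqP; split=> f.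
  move=> [Rf fz]; apply: contrapT => nf.
  have [y [Ay yP]] := chart_null_prime pP Rf nf.
  by rewrite fz ?eqxx.
by move=> Pf; split=> [|y Ay [_ yP]]; [exact: PR|exact: yP].
Qed.

Lemma zeros_neq0 P : rprime R P -> zeros P !=set0.
Proof.
move=> pP; have [_ P1 _] := pP; have [R1 _ _] := rR.
by have [y [Ay yP _]] := chart_null_prime pP R1 P1; exists y.
Qed.

Lemma zeros_irreducible P : rprime R P -> preirreducible (zeros P).
Proof.
move=> pP; have [_ _ Pp] := pP; have [_ _ RM] := rR.
move=> U V oU oV [x [[Ax xP] Ux]] [y [[Ay yP] Vy]].
have [q qx qU] := fchart_top ch Ax oU Ux; have [s sy sV] := fchart_top ch Ay oV Vy.
have [||z [Az zP]] := @chart_null_prime P (pf r q * pf r s) pP.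
- by apply: RM; [exists q|exists s].
- move=> /Pp[|||/yP/eqP]; [by exists q|by exists s|move=> /xP/eqP|]; by apply/negP.
rewrite evM ?mulf_eq0 ?negb_or; try (by apply: chart_ring_reg => //; eexists).
move=> /andP[zq zs]; exists z; split=> //; split; [exact: qU|exact: sV].
Qed.

Lemma closure_zeros P : P `<=` R -> closure (zeros P) `&` A = zeros P.
Proof.
move=> PR; apply/seteqP; split=> z; last by move=> [Az zP]; split=> //; exact: subset_closure.
move=> [cz Az]; split=> // p Pp; apply/eqP; apply: contrapT => /negP nz.
have Oz : [set y | regular_at y p /\ ev y p != 0] z.
  by split=> //; apply: chart_ring_reg => //; exact: PR.
have [y [[Ay yP] [_]]] := cz _ (open_nbhs_nbhs (conj (nonvanishing_open p) Oz)).
by rewrite yP ?eqxx.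
Qed.

Lemma zeros_van Z : closed Z -> zeros (van Z) = Z `&` A.
Proof.
move=> cZ; apply/seteqP; split=> y; last by move=> [Zy Ay]; split=> // p [_]; exact.
move=> [Ay yv]; split=> //; apply: contrapT => nZ.
have [q qy qZ] := fchart_top ch Ay (closed_openC cZ) nZ.
move/eqP: qy; apply; apply: yv; split; first by exists q.
move=> z Az Zz; apply/eqP; apply: contrapT => /negP /(qZ z Az).
exact.
Qed.

Lemma van_subset Z Z' : closed Z' -> preirreducible Z -> Z `&` A !=set0 ->
  closed Z -> van Z' `<=` van Z -> Z `<=` Z'.
Proof.
move=> cZ' iZ ZA cZ vv; rewrite [X in _ `<=` X](closure_id _).1 //.
apply: subset_trans (preirreducible_dense iZ oA ZA) _; apply: closure_subset => y.
by rewrite -zeros_van // => -[Ay yv]; have [] : (Z' `&` A) y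
  by rewrite -zeros_van //; split=> // p /vv/yv.
Qed.

Lemma van_inj Z Z' : closed Z' -> preirreducible Z -> Z `&` A !=set0 ->
  closed Z -> preirreducible Z' -> Z' `&` A !=set0 -> van Z = van Z' -> Z = Z'.
Proof.
move=> cZ' iZ ZA cZ iZ' Z'A e; apply/seteqP; split; apply: van_subset => //; by rewrite e.
Qed.

Lemma van_setT : A !=set0 -> van setT `<=` [set 0].
Proof. by move=> A0 f [Rf f0]; apply: (ev_eq0 oA A0) => y Ay _; exact: f0. Qed.

Lemma closure_chart : A !=set0 -> closure A = setT.
Proof.
move=> A0; apply/seteqP; split=> // x _.
have [_ iY] := integral_irr Y.
by have := preirreducible_dense iY oA; rewrite setTI => /(_ A0 x Logic.I).
Qed.

Lemma van_closure_zeros P : rprime R P -> van (closure (zeros P)) = P.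
Proof.
move=> pP; have [[PR _ _ _] _ _] := pP.
rewrite -[RHS](van_zeros pP); apply/seteqP; split=> f [Rf fz]; split=> // y Ay zy; apply: fz => //.
  exact: subset_closure.
by rewrite -(closure_zeros PR).
Qed.

(** The domain of f and the nonvanishing loci of numerator and denominator, if nonempty on W, meet
    on W by irreducibility; there a function vanishing on W has a vanishing numerator. *)
Lemma local_ideal_van W a : preirreducible W -> W `&` A !=set0 ->
  local_ideal W a <-> exists p q, [/\ van W p, R q, ~ van W q & a = p / q].
Proof.
move=> iW WA; split=> [[f [fa [y [fy Wy]] fW]]|[p [q [[Rp pW] Rq nq ->]]]].
  have [p [q [Rp Rq nq e]]] : loc R (van W) a.
    by rewrite loc_van //; exists f => //; exists y.
  exists p, q; split=> //; apply: contrapT => /(notin_van Rp)[u [Au Wu pu]].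
  have [v [Av Wv qv]] := notin_van Rq nq.
  have [||z [[[Wz Az] fz] Op p0 Oq q0]] :=
      @nonvanishing_meet (W `&` A `&` rdom f) p q (preirreducibleI (preirreducibleI iW oA) (rdom_open f)).
  - have [||w [[Ww Aw] [fw [Ow pw]]]] := preirreducibleI iW oA (rdom_open f) (nonvanishing_open p).
    + have [w [Ww [Aw fw]]] := iW _ _ oA (rdom_open f) WA (ex_intro _ y (conj Wy fy)).
      by exists w.
    + by exists u; split=> //; split=> //; exact: chart_ring_reg.
    by exists w.
  - have [||w [[Ww Aw] [fw [Ow pw]]]] := preirreducibleI iW oA (rdom_open f) (nonvanishing_open q).
    + have [w [Ww [Aw fw]]] := iW _ _ oA (rdom_open f) WA (ex_intro _ y (conj Wy fy)).
      by exists w.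
    + by exists v; split=> //; split=> //; exact: chart_ring_reg.
    by exists w.
  have : ev z a = 0 by rewrite -fa ev_rclass // fW.
  rewrite e evM // ?evV //; last exact: regular_atV.
  by move=> /eqP; rewrite mulf_eq0 invr_eq0 (negbTE p0) (negbTE q0).
have [v [Av Wv qv]] := notin_van Rq nq.
have Oa : regular_at v (p / q).
  by apply: regular_atM; [exact: chart_ring_reg|apply: regular_atV => //; exact: chart_ring_reg].
have /regular_atP[f fa fv] := Oa; exists f; split=> //; first by exists v.
move=> x fx Wx; apply/eqP; apply: contrapT => /negP nx.
have oN := sheaf_nz (space_sheaf Y) (rdom_open f) (rval_reg f).
have [||z [[Wz Az] [[fz /= fz0] [Oq qz]]]] := preirreducibleI iW oA oN (nonvanishing_open q).
- have [|z [Wz [Az fz]]] := iW A _ oA oN WA; first by exists x.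
  by exists z.
- by exists v; split=> //; split=> //; exact: chart_ring_reg.
move/eqP: fz0; apply; rewrite -ev_rclass // fa evM ?pW ?mul0r //.
  exact: chart_ring_reg.
exact: regular_atV.
Qed.

(** A height one prime of the chart ring gives a prime divisor of Y. The closure is taken because
    the zero set is closed in A only. *)
Lemma zeros_prime_divisor P t : rprime R P -> P t -> t != 0 ->
  (forall Q, rprime R Q -> Q `<=` P -> Q = P \/ Q `<=` [set 0]) ->
  is_prime_divisor (closure (zeros P)).
Proof.
move=> pP Pt t0 hP; have [[PR _ _ _] _ _] := pP.
have zP := zeros_neq0 pP; have A0 : A !=set0 by have [y [Ay _]] := zP; exists y.
have vP : van (closure (zeros P)) = P.
  exact: van_closure_zeros.
split.
- exact: closed_closure.
- split; last exact/preirreducible_closure/zeros_irreducible.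
  by have [y zy] := zP; exists y; exact: subset_closure.
- move=> e; move/eqP: t0; apply; apply: (van_setT A0).
  by rewrite -e vP.
- move=> Z cZ [Z0 iZ] EZ.
  have ZA : Z `&` A !=set0.
    by have [y zy] := zP; exists y; split; [apply/EZ/subset_closure|case: zy].
  have [||e|e] := hP (van Z); first exact: van_prime.
  + by rewrite -vP => f [Rf fz]; split=> // y Ay /EZ; exact: fz.
  + left; apply: van_inj => //; last by rewrite vP.
    * exact: closed_closure.
    * exact/preirreducible_closure/zeros_irreducible.
    * by have [y zy] := zP; exists y; split; [exact: subset_closure|case: zy].
  + right; apply/seteqP; split=> // x _.
    have : (closure A) x by rewrite closure_chart.
    rewrite [X in _ -> X x](closure_id _).1 //; apply: closure_subset => y Ay.
    suff : (Z `&` A) y by case.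
    by rewrite -zeros_van //; split=> // p /e ->; exact: ev0.
Qed.

End ChartRing.

Lemma frac_shift (F : fieldType) (p d s s' t : F) : s != 0 -> s' != 0 -> t != 0 -> d != 0 ->
  p / s / (d / s') * (s / s' / t) = p / d / t.
Proof. by move=> s0 s'0 t0 d0; field; rewrite s0 s'0 t0 d0. Qed.

Lemma frac_cancel (F : fieldType) (a b c d : F) : a != 0 -> b != 0 -> c != 0 -> d != 0 ->
  (a / b)^-1 * (a / d) * (d / c) = b / c.
Proof. by move=> a0 b0 c0 d0; field; rewrite a0 b0 c0 d0. Qed.

Lemma finite_inj_list (T S : Type) (D : set T) (f : T -> S) (s : seq S) :
  {in D &, injective f} -> finite_set [set x | D x /\ List.In (f x) s].
Proof.
move=> fi; elim: s => [|b s IH].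
  by rewrite (_ : [set _ | _] = set0) //; apply/seteqP; split=> // x [].
apply: (@sub_finite_set _ _ ([set x | D x /\ f x = b] `|` [set x | D x /\ List.In (f x) s])).
  by move=> x [Dx [e|xs]]; [left; split|right].
rewrite finite_setU; split=> //.
have [[x [Dx fx]]|n] := pselect (exists x, D x /\ f x = b).
  apply: (@sub_finite_set _ _ [set x]) => // z [Dz fz] /=.
  by apply: fi; rewrite ?inE // fz.
rewrite (_ : [set _ | _] = set0) //; apply/seteqP; split=> // x xP.
by apply: n; exists x.
Qed.

(** * Prime divisors *)

Section Valuations.
Context (K : closedFieldType) (Y : integral_space K) (nY : normal_variety Y).
Local Notation F := (funfield Y).
Context (cov : forall y : Y, exists A (r : nat -> F) n, fchart A r n /\ A y).
Implicit Types (a b t u : F) (x y z : Y) (W Z : set Y) (E : prime_divisor Y).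

Lemma regular_locus_open a : open [set y | regular_at y a].
Proof.
rewrite openE => y /regular_open[V [oV Vy Va]]; rewrite /interior nbhsE.
by exists V.
Qed.

(** The finitely many coefficients are regular at a common point of the irreducible set W, where
    normality of Y applies. *)
Lemma local_ring_normal W : W !=set0 -> preirreducible W -> integrally_closed (local_ring W).
Proof.
move=> W0 iW p a mp op ra.
have [|i|y Wy yp] := @preirreducible_bigcap _ W (size p) (fun i => [set y | regular_at y p`_i]) W0 iW.
- by move=> i; exact: regular_locus_open.
- by have /local_ringP[y Wy Oy] := op i; exists y.
apply/local_ringP; exists y => //; apply: nY; exists p; split=> // i.
have [ip|ip] := ltnP i (size p); first exact: yp.
by rewrite nth_default //; exact: (regular_at_cst y 0).
Qed.

Lemma prime_divisorP E : is_prime_divisor (val E).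
Proof. exact/asboolP/(valP E). Qed.

Definition mk_prime_divisor W (h : is_prime_divisor W) : prime_divisor Y :=
  exist (fun Z : set Y => `[< is_prime_divisor Z >]) W (asboolT h).

Lemma local_ring_subring E : subring (local_ring (val E)).
Proof.
have [_ [[y Ey] iE] _ _] := prime_divisorP E.
have [A [r [n [ch Ay]]]] := cov y.
have EA : val E `&` A !=set0 by exists y.
rewrite -(loc_van ch iE EA); apply: loc_subring; first exact: chart_ring_subring.
exact: van_prime ch _ iE EA.
Qed.

(** A function that is not regular along W has a polar divisor containing W: translation of
    [hartogs_prime] on a chart. The generator of the maximal ideal found there is the uniformizer
    t. *)
Lemma hartogs_divisor W a : W !=set0 -> preirreducible W -> ~ local_ring W a ->
  exists E t, [/\ uniformizer E t, W `<=` val E & ~ local_ring (val E) a].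
Proof.
move=> W0 iW na; have [y Wy] := W0; have [A [r [n [ch Ay]]]] := cov y.
have WA : W `&` A !=set0 by exists y.
have A0 : A !=set0 by exists y.
have rR := chart_ring_subring r; have nR := chart_ring_noeth ch.
have pP := van_prime ch iW WA; have lP := loc_van ch iW WA.
have [||Q [t [pQ QP nQ [Qt t0] Qg]]] := @hartogs_prime _ _ rR (van A r W) a pP nR _ (chart_frac ch a A0).
- by rewrite lP; exact: local_ring_normal.
- by rewrite lP.
have hQ := loc_height1 rR pQ nR Qt t0 Qg.
have pdE := zeros_prime_divisor ch pQ Qt t0 hQ.
pose E := mk_prime_divisor pdE.
have [cE [E0 iE] _ _] := pdE.
have EA : closure (zeros A Q) `&` A !=set0.
  by have [z zQ] := zeros_neq0 ch pQ; exists z; split; [exact: subset_closure|case: zQ].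
have vE := van_closure_zeros ch pQ.
have lE : loc (chart_ring r) Q = local_ring (val E) by rewrite -vE (loc_van ch iE EA).
exists E, t; split.
- split=> //.
    apply/(local_ideal_van ch _ iE EA); rewrite vE; exists t, 1; split=> //.
    + by case: rR.
    + by case: pQ.
    + by rewrite divr1.
  move=> b /(local_ideal_van ch _ iE EA); rewrite vE => -[p [q [Qp Rq nq ->]]].
  rewrite mulrAC; apply: (local_ringM (E := E)); rewrite -lE; first exact: Qg.
  by exists 1, q; rewrite div1r; split=> //; case: rR.
- apply: subset_trans (preirreducible_dense iW (fchart_open ch) WA) _.
  apply: closure_subset => z [Wz Az]; split=> // p /QP[_]; exact.
- by rewrite -lE.
Qed.

(** A nonzero b vanishing on E has an inverse that is not regular along E. The polar divisor of b^-1
    found by [hartogs_divisor] contains E, hence equals E, and comes with a uniformizer. *)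
Lemma prime_uniformizer E : exists t, uniformizer E t.
Proof.
have [cE [E0 iE] nE mE] := prime_divisorP E.
have [y Ey] := E0; have [A [r [n [ch Ay]]]] := cov y.
have EA : val E `&` A !=set0 by exists y.
have A0 : A !=set0 by exists y.
have [b [bE b0]] : exists b, van A r (val E) b /\ b != 0.
  apply: contrapT => h; apply: nE; apply/seteqP; split=> // x _.
  have : (closure A) x by rewrite (closure_chart ch A0).
  rewrite [X in _ -> X x](closure_id _).1 //; apply: closure_subset => z Az.
  suff : (val E `&` A) z by case.
  rewrite -(zeros_van ch cE); split=> // p pE.
  have [->|p0] := eqVneq p 0; first exact: ev0.
  by case: h; exists p.
have nb : ~ local_ring (val E) b^-1.
  move=> Eb; apply: (@local_ideal1 _ _ E); rewrite -(divff b0).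
  apply: local_idealM => //; apply/(local_ideal_van ch _ iE EA).
  have [R1 _ _] := chart_ring_subring r.
  exists b, 1; split=> //; last by rewrite divr1.
  by move=> [_ /(_ y Ay Ey)/eqP]; rewrite ev1 oner_eq0.
have [E' [t [tE EE' _]]] := hartogs_divisor E0 iE nb.
have [cE' iE' nE' mE'] := prime_divisorP E'.
have [e|e] := mE _ cE' iE' EE'; last by case: nE'.
by exists t; rewrite (_ : E = E') //; apply/val_inj.
Qed.

Definition lunit E u : Prop := local_ring (val E) u /\ local_ring (val E) u^-1.

Lemma lunitM E u v : lunit E u -> lunit E v -> lunit E (u * v).
Proof.
by move=> [Eu Eu'] [Ev Ev']; split; [exact: local_ringM|rewrite invfM; exact: local_ringM].
Qed.

Lemma lunitV E u : lunit E u -> lunit E u^-1.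
Proof. by move=> [Eu Eu']; split; rewrite ?invrK. Qed.

Lemma lunitX E u (k : int) : lunit E u -> lunit E (u ^ k).
Proof.
move=> Eu; have hX m : lunit E (u ^+ m).
  elim: m => [|m IH]; first by rewrite expr0; split; rewrite ?invr1; exact: local_ring1.
  by rewrite exprS; exact: lunitM.
by case: k => m; rewrite ?NegzE -?exprnN -?exprnP; [exact: hX|exact/lunitV/hX].
Qed.

Lemma uniformizer_lunit E t t' : uniformizer E t -> uniformizer E t' -> lunit E (t / t').
Proof.
move=> [t0 tE tG] [t'0 t'E t'G]; split; first exact: t'G.
by rewrite invf_div; exact: tG.
Qed.

Lemma uniformizer_exp_lunit E t (k : int) : uniformizer E t -> lunit E (t ^ k) -> k = 0.
Proof.
move=> tE; case: k => [[|k]|k] // [h1 h2]; exfalso.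
- exact: (uniformizer_unit tE h2).
- exact: (uniformizer_unit tE h1).
Qed.

(** The numerator of a uniformizer; it lies in the chart ring, as required by the results on
    discrete valuation rings. *)
Lemma chart_uniformizer E A (r : nat -> F) n : fchart A r n -> val E `&` A !=set0 ->
  exists s, [/\ van A r (val E) s, s != 0, uniformizer E s &
    forall p, van A r (val E) p -> loc (chart_ring r) (van A r (val E)) (p / s)].
Proof.
move=> ch EA; have [cE [E0 iE] _ _] := prime_divisorP E.
have [t tE] := prime_uniformizer E; have [t0 tI tG] := tE.
have rR := chart_ring_subring r; have [R1 _ _] := rR.
have pP := van_prime ch iE EA; have lP := loc_van ch iE EA; have [_ P1 _] := pP.
have /(local_ideal_van ch _ iE EA)[s [q [Ps Rq nq tsq]]] := tI.
have q0 := rprime_n0 pP nq.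
have s0 : s != 0 by apply: contraNneq t0 => e; rewrite tsq e mul0r.
have inI p : van A r (val E) p -> local_ideal (val E) p.
  move=> Pp; apply/(local_ideal_van ch _ iE EA); exists p, 1; rewrite divr1; split=> //.
have sG p : local_ideal (val E) p -> local_ring (val E) (p / s).
  move=> Pp; have -> : p / s = (p / t) * q^-1.
    by rewrite tsq invf_div mulrA -mulrA (mulrC s^-1) mulrA mulfK.
  apply: local_ringM; first exact: tG.
  by rewrite -lP; exists 1, q; rewrite div1r.
exists s; split=> //; first by split=> //; exact: inI.
by move=> p Pp; rewrite lP; apply/sG/inI.
Qed.

Lemma prime_chart E : exists A (r : nat -> F) n, fchart A r n /\ val E `&` A !=set0.
Proof.
have [_ [[y Ey] _] _ _] := prime_divisorP E; have [A [r [n [ch Ay]]]] := cov y.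
by exists A, r, n; split=> //; exists y.
Qed.

Lemma uniformizer_decomp E t a : uniformizer E t -> a != 0 -> exists k : int, lunit E (a / t ^ k).
Proof.
move=> tE a0; have [t0 tI tG] := tE.
have [cE [_ iE] _ _] := prime_divisorP E; have [A [r [n [ch EA]]]] := prime_chart E.
have A0 : A !=set0 by have [y []] := EA; exists y.
have rR := chart_ring_subring r; have nR := chart_ring_noeth ch.
have pP := van_prime ch iE EA; have lP := loc_van ch iE EA; have [_ P1 _] := pP.
have [s [Ps s0 sE sG]] := chart_uniformizer ch EA.
have dec p : chart_ring r p -> p != 0 -> exists k : nat, lunit E (p / s ^+ k).
  move=> Rp p0; have [|k [w [e Lw Lw']]] := loc_valuation rR pP nR Ps s0 sG _ p0.
    exact: loc_sub.
  by exists k; rewrite e mulrAC divff ?mul1r ?expf_neq0 //; split; rewrite -lP.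
have [p [d [Rp Rd d0 e]]] := chart_frac ch a A0.
have p0 : p != 0 by apply: contraNneq a0 => p0; rewrite e p0 mul0r.
have [k kP] := dec p Rp p0; have [l lD] := dec d Rd d0.
exists (k%:Z - l%:Z).
have := lunitM (lunitM kP (lunitV lD)) (lunitX (k%:Z - l%:Z) (uniformizer_lunit sE tE)).
congr (lunit E _); rewrite e expfzMl exprz_inv -invr_expz expfzDr // -invr_expz -!exprnP.
have sk : s ^+ k != 0 by rewrite expf_neq0.
have sl : s ^+ l != 0 by rewrite expf_neq0.
by rewrite frac_shift // expfz_neq0.
Qed.

(** [ord] chooses some exponent for some uniformizer t'. Since t / t' is a unit, comparing with k
    shows that a power of t with exponent k - k' is a unit, so the exponents agree. *)
Lemma ord_eq E t a (k : int) : uniformizer E t -> a != 0 -> lunit E (a / t ^ k) -> ord E a = k.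
Proof.
move=> tE a0 u; have [t0 _ _] := tE.
have [|t' [t'E h1 h2]] := @xgetPex _ 0 [set k : int | exists t, [/\ uniformizer E t,
    local_ring (val E) (a / t ^ k) & local_ring (val E) (t ^ k / a)]].
  by exists k, t; case: u => u1; rewrite invf_div.
rewrite -/(ord E a) in h1 h2; set k' := ord E a in h1 h2 *.
have [t'0 _ _] := t'E.
have u' : lunit E (a / t' ^ k') by split=> //; rewrite invf_div.
have := lunitM (lunitM (lunitV u) u') (lunitX k' (uniformizer_lunit t'E tE)).
rewrite expfzMl exprz_inv -invr_expz.
rewrite (_ : _ * _ = t ^ (k - k')).
  by move=> /(uniformizer_exp_lunit tE)/eqP; rewrite subr_eq0 => /eqP.
rewrite expfzDr // -invr_expz.
by rewrite frac_cancel // expfz_neq0.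
Qed.

Lemma ord_lunit E t a : uniformizer E t -> a != 0 -> lunit E (a / t ^ ord E a).
Proof.
by move=> tE a0; have [k u] := uniformizer_decomp tE a0; rewrite (ord_eq tE a0 u).
Qed.

Lemma ordM E a b : a != 0 -> b != 0 -> ord E (a * b) = ord E a + ord E b.
Proof.
move=> a0 b0; have [t tE] := prime_uniformizer E; have [t0 _ _] := tE.
apply: (ord_eq tE); first by rewrite mulf_neq0.
have := lunitM (ord_lunit tE a0) (ord_lunit tE b0); congr (lunit E _).
by rewrite expfzDr // invfM mulrACA.
Qed.

Lemma ordV E a : a != 0 -> ord E a^-1 = - ord E a.
Proof.
move=> a0; have a'0 : a^-1 != 0 by rewrite invr_eq0.
have := ordM E a0 a'0; rewrite divff // ord_div1 => /esym/eqP.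
by rewrite addrC addr_eq0 => /eqP.
Qed.

Lemma ordX E a n : a != 0 -> ord E (a ^+ n) = ord E a *+ n.
Proof.
move=> a0; elim: n => [|n IH]; first by rewrite expr0 ord_div1 mulr0n.
by rewrite exprS ordM ?expf_neq0 // IH mulrS.
Qed.

Lemma ord_uniformizer E t (k : int) : uniformizer E t -> ord E (t ^ k) = k.
Proof.
move=> tE; have [t0 _ _] := tE; apply: (ord_eq tE); first exact: expfz_neq0.
by rewrite divff ?expfz_neq0 //; split; rewrite ?invr1; exact: local_ring1.
Qed.

Lemma local_ring_ord E a : a != 0 -> local_ring (val E) a <-> 0 <= ord E a.
Proof.
move=> a0; have [t tE] := prime_uniformizer E; have [t0 tI _] := tE.
have u := ord_lunit tE a0; have aE : a = (a / t ^ ord E a) * t ^ ord E a.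
  by rewrite divfK // expfz_neq0.
split=> [Ea|].
  rewrite leNgt; apply/negP; case k : (ord E a) => [//|m] _.
  apply: (@uniformizer_unit _ _ E t m tE).
  have -> : (t ^+ m.+1)^-1 = a * (a / t ^ ord E a)^-1.
    by rewrite invf_div mulrCA divff // mulr1 k.
  by apply: local_ringM => //; case: u.
case k : (ord E a) => [m|//] _; rewrite aE; apply: local_ringM; first by case: u.
by rewrite k; apply/local_ringX/local_idealW.
Qed.

Lemma ord_cst E c : c != 0 -> ord E (ffc Y c) = 0.
Proof.
move=> c0; have [_ [[y Ey] _] _ _] := prime_divisorP E.
have reg d : local_ring (val E) (ffc Y d).
  by apply/local_ringP; exists y => //; exact: regular_at_cst.
apply/eqP; rewrite eq_le -oppr_ge0 -ordV ?fmorph_eq0 //.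
by apply/andP; split; apply/local_ring_ord; rewrite -?fmorphV ?fmorph_eq0 ?invr_eq0.
Qed.

Lemma ord_add E (m : int) a b : a != 0 -> b != 0 -> a + b != 0 ->
  m <= ord E a -> m <= ord E b -> m <= ord E (a + b).
Proof.
move=> a0 b0 ab0; have [t tE] := prime_uniformizer E; have [t0 _ _] := tE.
have tm : t ^ m != 0 by rewrite expfz_neq0.
have h c : c != 0 -> m <= ord E c <-> local_ring (val E) (c / t ^ m).
  move=> c0; rewrite local_ring_ord ?mulf_neq0 ?invr_eq0 //.
  by rewrite ordM ?invr_eq0 // ordV // ord_uniformizer // subr_ge0.
move=> /(h _ a0) la /(h _ b0) lb; apply/(h _ ab0); rewrite mulrDl.
exact: subringD (local_ring_subring E) _ _ la lb.
Qed.

Lemma regular_at_local_ring y E a : val E y -> regular_at y a -> local_ring (val E) a.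
Proof. by move=> Ey Oa; apply/local_ringP; exists y. Qed.

(** Algebraic Hartogs: [hartogs_divisor] for the irreducible set {y} yields a pole through y
    whenever a is not regular at y. *)
Lemma regular_at_ord y a : a != 0 -> regular_at y a <-> forall E, val E y -> 0 <= ord E a.
Proof.
move=> a0; split=> [Oa E Ey|h].
  by apply/local_ring_ord => //; exact: regular_at_local_ring Ey Oa.
apply: contrapT => na.
have [||E [t [tE yE nE]]] := @hartogs_divisor [set y] a _ _ na.
- by exists y.
- by move=> U V _ _ [z [-> Uy]] [_ [-> Vy]]; exists y.
by apply: nE; apply/local_ring_ord => //; apply: h; exact: yE.
Qed.

(** If no prime divisor through y has positive order, a^-1 is regular at y too, so a is a unit at
    y. *)
Lemma ev_eq0_ord y a : a != 0 -> regular_at y a ->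
  ev y a = 0 <-> exists2 E, val E y & 0 < ord E a.
Proof.
move=> a0 Oa; split=> [ya|[E Ey Ea]]; last first.
  apply/eqP; apply: contrapT => /negP ya.
  have /regular_at_ord := regular_atV Oa ya.
  by rewrite invr_eq0 => /(_ a0 E Ey); rewrite ordV // oppr_ge0 leNgt Ea.
apply: contrapT => h.
have Oa' : regular_at y a^-1.
  apply/regular_at_ord; first by rewrite invr_eq0.
  move=> E Ey; rewrite ordV // oppr_ge0 leNgt; apply/negP => Ea.
  by apply: h; exists E.
by have /eqP := evM Oa Oa'; rewrite divff // ev1 ya mul0r oner_eq0.
Qed.

(** The prime of such an E has height one and contains a, so it belongs to the finite list of primes
    that lie below all primes containing a; on a chart E is determined by its prime. *)
Lemma chart_ord_finite A (r : nat -> F) n a : fchart A r n -> chart_ring r a -> a != 0 ->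
  finite_set [set E : prime_divisor Y | val E `&` A !=set0 /\ 0 < ord E a].
Proof.
move=> ch Ra a0; have rR := chart_ring_subring r; have nR := chart_ring_noeth ch.
have [R1 RB RM] := rR.
pose J : set F := [set f | exists2 g, chart_ring r g & f = g * a].
have iJ : rideal (chart_ring r) J.
  split.
  - by move=> _ [g Rg ->]; exact: RM.
  - by exists 0; rewrite ?mul0r //; exact: subring0.
  - move=> _ _ [g Rg ->] [h Rh ->]; exists (g + h); rewrite ?mulrDl //.
    exact: subringD.
  - by move=> f _ Rf [g Rg ->]; exists (f * g); rewrite ?mulrA //; exact: RM.
have Ja : J a by exists 1; rewrite ?mul1r.
have [Ps [PsP PsM]] := finite_minimal_primes rR nR iJ.
have inj : {in [set E : prime_divisor Y | val E `&` A !=set0] &,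
    injective (fun E => van A r (val E))}.
  move=> E E'; rewrite !inE /= => EA EA' e; apply/val_inj.
  have [cE [_ iE] _ _] := prime_divisorP E; have [cE' [_ iE'] _ _] := prime_divisorP E'.
  exact: (van_inj ch cE' iE EA cE iE' EA' e).
apply: sub_finite_set (finite_inj_list Ps inj) => E [EA Ea]; split=> //.
have [cE [_ iE] _ _] := prime_divisorP E.
have pP := van_prime ch iE EA.
have aP : van A r (val E) a.
  split=> // y Ay Ey; apply/ev_eq0_ord => //; first exact: (chart_ring_reg ch).
  by exists E.
have [|Q QPs QP] := PsM _ pP.
  by move=> _ [g Rg ->]; have [[_ _ _ PM] _ _] := pP; exact: PM.
have [s [Ps' s0 _ sG]] := chart_uniformizer ch EA.
have [pQ JQ] := PsP _ QPs.
have [<- //|Q0] := loc_height1 rR pP nR Ps' s0 sG pQ QP.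
by move/eqP: a0; case; exact/Q0/JQ.
Qed.

End Valuations.

Lemma ord_finite (K : closedFieldType) (Y : integral_space K) (nY : normal_variety Y)
    (N : nat) (A : nat -> set Y) (r : nat -> nat -> funfield Y) (n : nat -> nat) (a : funfield Y) :
  (forall y, exists2 k, (k < N)%N & A k y) ->
  (forall k, (k < N)%N -> A k !=set0 -> fchart (A k) (r k) (n k)) -> a != 0 ->
  finite_set [set E : prime_divisor Y | ord E a != 0].
Proof.
move=> cA ch a0.
have cov y : exists A (r : nat -> funfield Y) n, fchart A r n /\ A y.
  have [k kN Aky] := cA y; exists (A k), (r k), (n k); split=> //; apply: ch => //.
  by exists y.
pose S k : set (prime_divisor Y) := [set E | val E `&` A k !=set0 /\ ord E a != 0].
apply: (@sub_finite_set _ _ (\bigcup_(k in `I_N) S k)).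
  move=> E Ea; have [_ [[y Ey] _] _ _] := prime_divisorP E.
  have [k kN Aky] := cA y; exists k => //; split=> //; by exists y.
apply: bigcup_finite => // k kN.
have [Ak0|nA] := pselect (A k !=set0); last first.
  rewrite (_ : S k = set0) //; apply/seteqP; split=> // E [[y [_ Ay]] _].
  by apply: nA; exists y.
have chk := ch k kN Ak0.
have [p [q [Rp Rq q0 e]]] := chart_frac chk a Ak0.
have p0 : p != 0 by apply: contraNneq a0 => p0; rewrite e p0 mul0r.
have fp := chart_ord_finite nY cov chk Rp p0; have fq := chart_ord_finite nY cov chk Rq q0.
apply: (@sub_finite_set _ _ (_ `|` _)); last by rewrite finite_setU; split; [exact: fp|exact: fq].
move=> E [EA Ea]; have [y [Ey Ay]] := EA.
have pos f : chart_ring (r k) f -> f != 0 -> 0 <= ord E f.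
  move=> Rf f0; apply/(local_ring_ord nY cov) => //.
  by apply: (regular_at_local_ring Ey); exact: chart_ring_reg chk _ _ Rf Ay.
have [Ep|Ep] := ltP 0 (ord E p); first by left.
have [Eq|Eq] := ltP 0 (ord E q); first by right.
have pz : ord E p = 0 by apply/eqP; rewrite eq_le Ep pos.
have qz : ord E q = 0 by apply/eqP; rewrite eq_le Eq pos.
by move: Ea; rewrite e (ordM nY cov) ?invr_eq0 // (ordV nY cov) // pz qz.
Qed.

(** * Semiprojective varieties *)

Section Monomials.
Context (F : fieldType) (m : nat) (t : nat -> F).

Definition mono (al : nat -> nat) : F := \prod_(k < m) t k ^+ al k.

Fixpoint monos (d : nat) : seq F :=
  if d is e.+1 then [seq t k * x | k <- iota 0 m, x <- monos e] else [:: 1].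

Lemma mono_incr al k : (k < m)%N -> mono (fun i => al i + (i == k))%N = t k * mono al.
Proof.
move=> km; rewrite /mono (bigD1 (Ordinal km)) //= [in RHS](bigD1 (Ordinal km)) //=.
rewrite eqxx addn1 exprS -mulrA; congr (_ * (_ * _)); apply: eq_bigr => i ik.
by rewrite (_ : (_ == k) = false) ?addn0 //; apply: contraNF ik => /eqP ik; apply/eqP/val_inj.
Qed.

Lemma sum_incr (al : nat -> nat) k : (k < m)%N ->
  (\sum_(i < m) (al i + (i == k :> nat)) = (\sum_(i < m) al i).+1)%N.
Proof.
move=> km; rewrite big_split /= -addn1; congr (_ + _)%N.
rewrite (bigD1 (Ordinal km)) //= eqxx big1 // => i ik.
by rewrite (_ : (_ == k) = false) //; apply: contraNF ik => /eqP ik; apply/eqP/val_inj.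
Qed.

Lemma monosP d x : x \in monos d <-> exists2 al : nat -> nat, (\sum_(k < m) al k)%N = d & x = mono al.
Proof.
elim: d x => [|d IH] x /=.
  rewrite inE; split=> [/eqP ->|[al al0 ->]].
    by exists (fun=> 0%N); [rewrite big1|rewrite /mono big1].
  rewrite /mono big1 // => i _; suff -> : al i = 0%N by rewrite expr0.
  by apply/eqP; rewrite -leqn0 -al0 (bigD1 i) //= leq_addr.
split=> [/allpairsPdep[k [y [km /IH[al ald ->] ->]]]|[al ald ->]].
  rewrite mem_iota in km; exists (fun i => al i + (i == k))%N; last by rewrite mono_incr.
  by rewrite sum_incr // ald.
have [k ak] : exists k : 'I_m, (0 < al k)%N.
  apply: contrapT => h; move: ald; rewrite big1 // => i _.
  by apply/eqP; rewrite -leqn0 leqNgt; apply/negP => ai; apply: h; exists i.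
pose be i := (al i - (i == k :> nat))%N.
have alE i : al i = (be i + (i == k :> nat))%N.
  by rewrite /be subnK //; case: eqP => // ->.
have -> : mono al = t k * mono be.
  by rewrite -mono_incr //; apply: eq_bigr => i _; rewrite alE.
apply/allpairsPdep; exists (nat_of_ord k), (mono be); split=> //; first by rewrite mem_iota add0n ltn_ord.
apply/IH; exists be => //; apply: succn_inj; rewrite -ald -(sum_incr be (ltn_ord k)).
by apply: eq_bigr => i _; rewrite -alE.
Qed.

Lemma monosM d e x y : x \in monos d -> y \in monos e -> x * y \in monos (d + e).
Proof.
move=> /monosP[al ald ->] /monosP[be bee ->]; apply/monosP.
exists (fun i => al i + be i)%N; first by rewrite big_split /= ald bee.
by rewrite /mono -big_split; apply: eq_bigr => i _; rewrite exprD.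
Qed.

Lemma monosX d k : (k < m)%N -> t k ^+ d \in monos d.
Proof.
move=> km; elim: d => [|d IH] /=; first by rewrite inE.
by apply/allpairsPdep; exists k, (t k ^+ d); rewrite mem_iota exprS.
Qed.

(** If all m exponents were smaller than N, the degree would be at most m N. *)
Lemma monos_pigeon d N x : (m * N < d)%N -> x \in monos d ->
  exists k y, [/\ (k < m)%N, y \in monos (d - N) & x = t k ^+ N * y].
Proof.
move=> dN /monosP[al ald ->].
have [k ak] : exists k : 'I_m, (N <= al k)%N.
  apply: contrapT => h; move: dN; rewrite -ald ltnNge => /negP; apply.
  rewrite -[X in (X * _)%N]card_ord -sum_nat_const; apply: leq_sum => i _.
  by rewrite ltnW // ltnNge; apply/negP => ai; apply: h; exists i.
pose be i := (al i - (if i == k :> nat then N else 0))%N.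
exists (nat_of_ord k), (mono be); split=> //.
  apply/monosP; exists be => //; rewrite -ald (bigD1 k) //= [in RHS](bigD1 k) //=.
  rewrite {1}/be eqxx addnBAC //; congr (_ - _)%N; congr (_ + _)%N; apply: eq_bigr => i ik.
  by rewrite /be (negbTE (_ : (i : nat) != k)) ?subn0 //; apply: contraNneq ik => /val_inj ->.
rewrite /mono (bigD1 k) //= [in RHS](bigD1 k) //= mulrA -exprD {1}/be eqxx subnKC //.
congr (_ * _); apply: eq_bigr => i ik.
by rewrite /be (negbTE (_ : (i : nat) != k)) ?subn0 //; apply: contraNneq ik => /val_inj ->.
Qed.

End Monomials.

Section LinearSpan.
Context (F : fieldType).
Implicit Types (J : set F) (s : seq F).

Definition lin J s : set F :=
  [set f | exists c : nat -> F, (forall i, J (c i)) /\ f = \sum_(i < size s) c i * s`_i].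

Lemma lin_mem J s c x : J 0 -> J c -> x \in s -> lin J s (c * x).
Proof.
move=> J0 Jc /(nthP 0)[i si <-]; exists (fun k => if k == i then c else 0).
split=> [k|]; first by case: ifP.
rewrite (bigD1 (Ordinal si)) //= eqxx big1 ?addr0 // => k ki.
by rewrite (_ : (_ == i) = false) ?mul0r //; apply: contraNF ki => /eqP ki; apply/eqP/val_inj.
Qed.

Lemma lin0 J s : J 0 -> lin J s 0.
Proof. by move=> J0; exists (fun=> 0); split=> //; rewrite big1 // => i _; rewrite mul0r. Qed.

Lemma linD J s f g : (forall a b, J a -> J b -> J (a + b)) ->
  lin J s f -> lin J s g -> lin J s (f + g).
Proof.
move=> JD [c [cJ ->]] [d [dJ ->]]; exists (fun i => c i + d i); split=> [i|].
  exact: JD.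
by rewrite -big_split; apply: eq_bigr => i _; rewrite mulrDl.
Qed.

Lemma lin_min J s (M : set F) : M 0 -> (forall a b, M a -> M b -> M (a + b)) ->
  (forall c x, J c -> x \in s -> M (c * x)) -> lin J s `<=` M.
Proof.
move=> M0 MD h _ [c [cJ ->]]; apply: (big_ind M) => // i _.
by apply: h => //; rewrite mem_nth.
Qed.

Lemma linM J J' J'' s s' s'' f g : J'' 0 -> (forall a b, J'' a -> J'' b -> J'' (a + b)) ->
  (forall a b, J a -> J' b -> J'' (a * b)) ->
  (forall x y, x \in s -> y \in s' -> x * y \in s'') ->
  lin J s f -> lin J' s' g -> lin J'' s'' (f * g).
Proof.
move=> J0 JD JJ ss lf lg.
apply: (@lin_min J s (fun f => lin J'' s'' (f * g))) f lf => /=.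
- by rewrite mul0r; exact: lin0.
- by move=> a b la lb; rewrite mulrDl; exact: linD.
move=> c x Jc xs; apply: (@lin_min J' s' (fun g => lin J'' s'' (c * x * g))) g lg => /=.
- by rewrite mulr0; exact: lin0.
- by move=> a b la lb; rewrite mulrDr; exact: linD.
move=> d y Jd ys; rewrite mulrACA; apply: lin_mem => //; [exact: JJ|exact: ss].
Qed.

End LinearSpan.

Section ProjectiveData.
Context (K : closedFieldType) (Y : integral_space K).
Local Notation F := (funfield Y).
Implicit Types (L : set Y) (A : nat -> set Y) (z t : nat -> F).

Definition proj_env p z t (k i : nat) : F := if (i < p)%N then z i else t (i - p)%N / t k.

Definition global L : set F := [set f | forall y, L y -> regular_at y f].

(* L is projective over an affine variety: t_0, ..., t_(m-1) are homogeneous coordinates, the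
   coordinate ring of {t_k <> 0} is generated by the global functions z_i and the t_j / t_k. *)
Record proj_data L p m z t A : Prop := ProjData {
  pd_open : open L;
  pd_global : forall i, global L (z i);
  pd_bound : forall i, (m <= i)%N -> t i = 0;
  pd_cover : forall y, L y -> exists2 k, (k < m)%N & A k y;
  pd_sub : forall k, (k < m)%N -> A k `<=` L;
  pd_chart : forall k, (k < m)%N -> A k !=set0 ->
    t k != 0 /\ fchart (A k) (proj_env p z t k) (p + m);
  pd_empty : forall k, (k < m)%N -> A k = set0 -> t k = 0
}.

(** The homogeneous coordinates are turned into rational functions by dividing by the one that
    defines a fixed nonempty chart k0. As two nonempty open sets meet, every other chart is then
    expressed through the same t. *)
Lemma semiprojective_data : semiprojective Y ->
  exists p m z t A, @proj_data setT p m z t A.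
Proof.
move=> /semiprojective_charts[p [m [z [h [hcov hch]]]]].
pose A k := [set y | h y k != 0].
have [y0 _] := (integral_irr Y).1; have [k0 k0m hk0] := hcov y0.
have A0 : A k0 !=set0 by exists y0.
have /choice[r rP] : forall k, exists r, (k < m)%N -> A k !=set0 -> fchart (A k) r (p + m) /\
    forall y i, A k y -> ev y (r i) = if (i < p)%N then z y i else h y (i - p)%N / h y k.
  move=> k; have [[km Ak]|n] := pselect ((k < m)%N /\ A k !=set0); last first.
    by exists (fun=> 0) => km Ak; case: n.
  by have [r rP] := affine_fchart Ak (hch k km); exists r.
have [ch0 ev0'] := rP k0 k0m A0.
(* In the chart k0 the coordinate with index p + j is h_j / h_k0. *)
pose tt j := r k0 (p + j)%N.
have evt y j : A k0 y -> ev y (tt j) = h y j / h y k0.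
  by move=> Ay; rewrite ev0' // ltnNge leq_addr /= addKn.
have eqA k a b : (k < m)%N -> A k !=set0 ->
    (forall y, A k y -> A k0 y -> [/\ regular_at y a, regular_at y b & ev y a = ev y b]) -> a = b.
  move=> km Ak hab; apply/eqP; rewrite -subr_eq0; apply/eqP.
  have [chk _] := rP k km Ak.
  apply: (ev_eq0 (openI (fchart_open chk) (fchart_open ch0))).
    exact: openI_n0 (fchart_open chk) (fchart_open ch0) Ak A0.
  move=> y [Ay A0y] _; have [Oa Ob e] := hab y Ay A0y.
  have := evD Oa (regular_atN Ob); rewrite e => ->.
  have := evD Ob (regular_atN Ob); rewrite subrr => <-.
  exact: ev0.
have t0 k : (k < m)%N -> A k !=set0 -> tt k != 0.
  move=> km Ak; have [chk _] := rP k km Ak.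
  have [y [Ay A0y]] := openI_n0 (fchart_open chk) (fchart_open ch0) Ak A0.
  apply/eqP => e; have := evt y k A0y; rewrite e ev0 => /esym/eqP.
  by rewrite mulf_eq0 invr_eq0 (negbTE (Ay : h y k != 0)) (negbTE (A0y : h y k0 != 0)).
have rE k : (k < m)%N -> A k !=set0 -> r k = proj_env p (r k0) tt k.
  move=> km Ak; have [chk evk] := rP k km Ak; apply/funext => i; rewrite /proj_env.
  have [ip|ip] := ltnP i p.
    apply: (eqA k) => // y Ay A0y; split; [exact: (fchart_reg chk)|exact: (fchart_reg ch0)|].
    by rewrite evk // ev0' // ip.
  apply: (eqA k) => // y Ay A0y.
  have Ok : regular_at y (tt k) by exact: (fchart_reg ch0).
  have Oi : regular_at y (tt (i - p)%N) by exact: (fchart_reg ch0).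
  have hk : h y k != 0 by [].
  have hk0' : h y k0 != 0 by [].
  have ek : ev y (tt k) != 0 by rewrite evt // mulf_neq0 // invr_eq0.
  split; first exact: (fchart_reg chk).
    by apply: regular_atM => //; exact: regular_atV.
  rewrite evM //; last exact: regular_atV.
  by rewrite evV // evk // !evt // ltnNge ip /= invf_div mulrA divfK.
exists p, m, (fun i => if (i < p)%N then r k0 i else 0), tt, A.
have envE k : proj_env p (fun i => if (i < p)%N then r k0 i else 0) tt k = proj_env p (r k0) tt k.
  by apply/funext => i; rewrite /proj_env; case: ltnP.
split.
- exact: openT.
- move=> i y _; case: ltnP => ip; last exact: (regular_at_cst y 0).
  have [k km Ak] := hcov y; have Ak' : A k !=set0 by exists y.
  have [chk _] := rP k km Ak'; have := fchart_reg chk i (Ak : A k y).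
  by rewrite (rE k) // /proj_env ip.
- by move=> i mi; apply: (fchart_bound ch0); rewrite leq_add2l.
- by move=> y _; have [k km hk] := hcov y; exists k.
- by [].
- by move=> k km Ak; rewrite envE -rE //; split; [exact: t0|case: (rP k km Ak)].
- move=> k km Ak; apply: (ev_eq0 (fchart_open ch0) A0) => y A0y _; rewrite evt //.
  suff -> : h y k = 0 by rewrite mul0r.
  apply/eqP; apply: contrapT => /negP hk.
  have : A k y by [].
  by rewrite Ak.
Qed.

(** A K-point v of the larger ring K[r'] restricts to a point y of A. Outside L the inverse of some
    r'_i vanishes at y, and the relation r'_i (r'_i)^-1 = 1 would become v_i * 0 = 1. *)
Lemma fchart_extend (A L : set Y) (r r' : nat -> F) n n' (sg : nat -> pexp K) :
  fchart A r n -> open L -> (forall i, r i = pf r' (sg i)) ->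
  (forall i, (n' <= i)%N -> r' i = 0) ->
  (forall y i, A y -> L y -> regular_at y (r' i)) ->
  (forall y, A y -> ~ L y -> exists i, [/\ r' i != 0, regular_at y (r' i)^-1 & ev y (r' i)^-1 = 0]) ->
  fchart (A `&` L) r' n'.
Proof.
move=> ch oL rs r'b r'reg r'inf.
have rpf e : pf r e = pf r' (psub sg e) by rewrite /pf pev_sub; apply: pev_ext.
split=> //.
- exact: openI (fchart_open ch) oL.
- by move=> y i [Ay Ly]; exact: r'reg.
- move=> y a [Ay Ly] Oa; have [p [q [q0 e]]] := fchart_loc ch Ay Oa.
  by exists (psub sg p), (psub sg q); rewrite -!rpf.
- move=> v hv; pose w i := pv v (sg i).
  have wE e : pv w e = pv v (psub sg e) by rewrite pv_sub.
  have [|y Ay yw] := fchart_pt ch (v := w).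
    by move=> e e0; rewrite wE; apply: hv; rewrite -rpf.
  have evw e : ev y (pf r e) = pv w e by exact: (chart_ev ch _ yw Ay).
  have rel i p q : pf r q * r' i = pf r p -> pv w q * v i = pv w p.
    move=> e; have : pv v (PA (PM (psub sg q) (PV i)) (PM (PC (-1)) (psub sg p))) = 0.
      apply: hv; rewrite /pf /= -!/(pf _ _) -!rpf e rmorphN1 mulN1r subrr.
      by [].
    by rewrite /pv /= -!/(pv _ _) -!wE mulN1r => /eqP; rewrite subr_eq0 => /eqP.
  have Ly : L y.
    apply: contrapT => nL; have [i [ri Oi ei]] := r'inf y Ay nL.
    have [p [q [q0 e]]] := fchart_loc ch Ay Oi.
    have qn0 : pf r q != 0 by apply: contraNneq q0 => ->; rewrite ev0.
    have Op := chart_ring_reg ch (ex_intro _ p erefl : chart_ring r (pf r p)) Ay.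
    have Oq := chart_ring_reg ch (ex_intro _ q erefl : chart_ring r (pf r q)) Ay.
    have pe : pf r p = (r' i)^-1 * pf r q by rewrite e divfK.
    have p0 : ev y (pf r p) = 0 by rewrite pe evM // ei mul0r.
    have pq : pf r p * r' i = pf r q by rewrite pe mulrAC mulVf // mul1r.
    have := rel i q p pq; rewrite -!evw p0 mul0r => q0'.
    by rewrite -q0' eqxx in q0.
  exists y => // i; have Oi := r'reg y i Ay Ly.
  have [p [q [q0 e]]] := fchart_loc ch Ay Oi.
  have qn0 : pf r q != 0 by apply: contraNneq q0 => ->; rewrite ev0.
  have Oq := chart_ring_reg ch (ex_intro _ q erefl : chart_ring r (pf r q)) Ay.
  apply: (mulfI q0); rewrite [in RHS]evw (rel i p q); last by rewrite e mulrC divfK.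
  by rewrite -evw -evM // e mulrC divfK.
- move=> y U [Ay Ly] oU Uy; have [q q0 qU] := fchart_top ch Ay oU Uy.
  by exists (psub sg q) => [|x [Ax Lx]]; rewrite -rpf // => /(qU x Ax).
Qed.

(** The denominators of f in R form an ideal, which has no common zero because f is a fraction at
    every point. *)
Lemma chart_ring_global (A : set Y) (r : nat -> F) n : fchart A r n -> chart_ring r = global A.
Proof.
move=> ch; apply/seteqP; split=> f; first by move=> Rf y Ay; exact: (chart_ring_reg ch Rf Ay).
move=> Of; have rR := chart_ring_subring r; have [R1 RB RM] := rR.
pose J : set F := [set a | chart_ring r a /\ chart_ring r (a * f)].
suff [_] : J 1 by rewrite mul1r.
apply: (chart_null ch) => [|y Ay].
  split.
  - by move=> a [].
  - by split; rewrite ?mul0r; exact: subring0.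
  - by move=> a b [Ra Raf] [Rb Rbf]; split; rewrite ?mulrDl; exact: subringD.
  - by move=> a b Ra [Rb Rbf]; split; rewrite -?mulrA; exact: RM.
have [p [q [q0 e]]] := fchart_loc ch Ay (Of y Ay).
have qn0 : pf r q != 0 by apply: contraNneq q0 => ->; rewrite ev0.
exists (pf r q) => //; split; first by exists q.
by rewrite e mulrC divfK //; exists p.
Qed.

(** Quasi-compactness: the functions whose nonvanishing locus has a finite subcover form an ideal
    without common zeros. *)
Lemma chart_compact (A : set Y) (r : nat -> F) n (I : Type) (U : I -> set Y) : fchart A r n ->
  (forall y, A y -> exists i, U i y /\ open (U i)) ->
  exists s : seq I, forall y, A y -> exists2 i, List.In i s & U i y.
Proof.
move=> ch hU; have rR := chart_ring_subring r; have [R1 RB RM] := rR.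
have Rreg a y := @chart_ring_reg _ _ _ _ _ ch a y.
pose J : set F := [set a | chart_ring r a /\ exists s : seq I, forall y, A y ->
  ev y a != 0 -> exists2 i, List.In i s & U i y].
suff [_ [s hs]] : J 1 by exists s => y Ay; apply: hs; rewrite // ev1 oner_neq0.
apply: (chart_null ch) => [|y Ay].
  split.
  - by move=> a [].
  - by split; [exact: subring0|exists [::] => y _; rewrite ev0 eqxx].
  - move=> a b [Ra [s hs]] [Rb [s' hs']]; split; first exact: subringD.
    exists (s ++ s') => y Ay; rewrite evD; try exact: Rreg.
    have [a0|a0] := eqVneq (ev y a) 0.
      rewrite a0 add0r => b0; have [i si Ui] := hs' y Ay b0.
      by exists i => //; apply/List.in_app_iff; right.
    by have [i si Ui] := hs y Ay a0; exists i => //; apply/List.in_app_iff; left.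
  - move=> a b Ra [Rb [s hs]]; split; first exact: RM.
    exists s => y Ay; rewrite evM; try exact: Rreg.
    by rewrite mulf_eq0 negb_or => /andP[_]; exact: hs.
have [i [Ui oU]] := hU y Ay; have [q q0 qU] := fchart_top ch Ay oU Ui.
exists (pf r q) => //; split; first by exists q.
by exists [:: i] => x Ax qx; exists i; [left|exact: qU].
Qed.

Lemma proj_compact L p m z t A (I : Type) (U : I -> set Y) : proj_data L p m z t A ->
  (forall y, L y -> exists i, U i y /\ open (U i)) ->
  exists s : seq I, forall y, L y -> exists2 i, List.In i s & U i y.
Proof.
move=> pd hU.
have [s hs] : exists s : seq I, forall k y, (k < m)%N -> A k y -> exists2 i, List.In i s & U i y.
  have : forall k, (k < m)%N -> A k `<=` L by exact: pd_sub pd.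
  have : forall k, (k < m)%N -> A k !=set0 -> fchart (A k) (proj_env p z t k) (p + m).
    by move=> k km /(pd_chart pd km)[].
  elim: {1 3 4}m => [|m' IH] hch AL; first by exists [::].
  have [k km|k km|s hs] := IH; first exact: (hch k (ltnW km)).
    exact: (AL k (ltnW km)).
  have [s' hs'] : exists s' : seq I, forall y, A m' y -> exists2 i, List.In i s' & U i y.
    have [A0|A0] := pselect (A m' !=set0); last first.
      by exists [::] => y Ay; case: A0; exists y.
    apply: (chart_compact (hch m' (ltnSn _) A0)) => y Ay.
    by apply: hU; exact: (AL m').
  exists (s ++ s') => k y; rewrite ltnS leq_eqVlt => /predU1P[->|km] Ay.
    by have [i si Ui] := hs' y Ay; exists i => //; apply/List.in_app_iff; right.
  by have [i si Ui] := hs k y km Ay; exists i => //; apply/List.in_app_iff; left.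
exists s => y Ly; have [k km Ay] := pd_cover pd Ly.
exact: hs Ay.
Qed.

End ProjectiveData.

Lemma lin_scale (F : fieldType) (J : set F) s s' c f : J 0 -> (forall a b, J a -> J b -> J (a + b)) ->
  (forall x, x \in s -> c * x \in s') -> lin J s f -> lin J s' (c * f).
Proof.
move=> J0 JD ss; apply: (@lin_min _ J s (fun f => lin J s' (c * f))) => /=.
- by rewrite mulr0; exact: lin0.
- by move=> a b la lb; rewrite mulrDr; exact: linD.
by move=> a x Ja /ss; rewrite mulrCA; exact: lin_mem.
Qed.

Lemma primes_avoid (K : closedFieldType) (Y : integral_space K) (P : prime_divisor Y -> Prop) :
  finite_set [set E | P E] ->
  open [set y | forall E, P E -> ~ val E y] /\ [set y | forall E, P E -> ~ val E y] !=set0.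
Proof.
move=> /finite_seqP[s sE].
have -> : [set y | forall E, P E -> ~ val E y] = [set y | forall E, E \in s -> ~ val E y].
  apply/seteqP; split=> y /= h E.
    by move=> Es; apply: h; have : [set` s] E by []; rewrite -sE.
  by move=> PE; apply: h; have : [set E | P E] E by []; rewrite sE.
elim: s {sE} => [|E s [IHo IHn]].
  rewrite (_ : [set _ | _] = setT); first by split; [exact: openT|exact: (integral_irr Y).1].
  by apply/seteqP; split.
have -> : [set y | forall E', E' \in E :: s -> ~ val E' y] =
    ~` val E `&` [set y | forall E', E' \in s -> ~ val E' y].
  apply/seteqP; split=> y /= h.
    split; first by apply: h; rewrite mem_head.
    by move=> E' E's; apply: h; rewrite inE E's orbT.
  by move=> E'; rewrite inE => /orP[/eqP ->|]; [case: h|exact: h.2].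
have [cE _ ET _] := prime_divisorP E.
have oE : open (~` val E) by exact: closed_openC.
split; first exact: openI.
apply: openI_n0 => //; apply: contrapT => h; apply: ET; apply/seteqP; split=> // y _.
by apply: contrapT => Ey; apply: h; exists y.
Qed.

Section Locus.
Context (K : closedFieldType) (Y : integral_space K) (nY : normal_variety Y).
Local Notation F := (funfield Y).
Context (cov : forall y : Y, exists A (r : nat -> F) n, fchart A r n /\ A y).
Context (ofin : forall a : F, a != 0 -> finite_set [set E : prime_divisor Y | ord E a != 0]).

(** Only finitely many prime divisors occur in G and div(f), so the complement of the support of
    div(f) + mG is open, and f generates on a neighbourhood of y. *)
Lemma semiample_avoid (L : set Y) (G : qdiv Y) : open L -> finite_set [set E | G E <> 0] ->
  semiample L G -> exists2 m : nat, (0 < m)%N & forall y, L y -> exists f U,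
  [/\ f != 0, sections L (fun E => G E *+ m) f, open U, U y &
      forall x E, U x -> val E x -> L x -> (ord E f)%:~R + G E *+ m = 0].
Proof.
move=> oL fG [m m0 bpf]; exists m => // y Ly.
have [_ [f [f0 sf] ->] yf] := bpf y Ly.
exists f, [set x | forall E, (ord E f)%:~R + G E *+ m != 0 -> ~ (val E x /\ meets_div L E)].
split=> //.
- pose P E := (ord E f)%:~R + G E *+ m != 0 /\ meets_div L E.
  have [|oP _] := @primes_avoid _ Y P.
    apply: (@sub_finite_set _ _ ([set E | G E <> 0] `|` [set E | ord E f != 0])).
      move=> E [/= h _]; have [e|] := eqVneq (ord E f) 0; last by right.
      by left=> g; move: h; rewrite e g mul0rn addr0 eqxx.
    by rewrite finite_setU; split=> //; exact: ofin.
  suff -> : [set x | forall E, (ord E f)%:~R + G E *+ m != 0 -> ~ (val E x /\ meets_div L E)] =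
    [set y | forall E, P E -> ~ val E y] by [].
  apply/seteqP; split=> x /= h E; first by move=> [PE mE] Ex; exact: (h E).
  by move=> PE [Ex mE]; exact: (h E).
- by move=> E h [Ey mE]; apply: yf; exists E.
- move=> x E Ux Ex Lx; apply/eqP; apply: contrapT => /negP h.
  by apply: (Ux E) => //; split=> //; exists x.
Qed.

(** Finitely many sections f of a multiple of G generate everywhere. They are regular on L, where G
    is 0, and have a pole at the points of the support of G at which they generate; adding them to
    the z makes L projective over an affine variety. *)
Lemma locus_data p m z t A (L : set Y) (G : qdiv Y) : @proj_data K Y setT p m z t A ->
  finite_set [set E | G E <> 0] -> effective setT G -> semiample setT G ->
  ~` L = supp setT G -> exists p' z' A', @proj_data K Y L p' m z' t A'.
Proof.
move=> pd fG eG sG LG.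
have Ly E y : L y -> val E y -> G E = 0.
  move=> Ly Ey; apply: contrapT => /eqP GE.
  by have : (~` L) y by rewrite LG; exists E; split=> //; exists y.
have [oL L0] : open L /\ L !=set0.
  have [o n0] := primes_avoid fG.
  suff -> : L = [set y | forall E, G E <> 0 -> ~ val E y] by [].
  apply/seteqP; split=> y /= h; first by move=> E GE Ey; apply: GE; exact: Ly Ey.
  apply: contrapT => nLy; have : (~` L) y by [].
  by rewrite LG => -[E [_ /eqP GE Ey]]; exact: (h E).
have [m0 m00 bpf] := semiample_avoid openT fG sG.
pose good f := f != 0 /\ sections setT (fun E => G E *+ m0) f.
pose U (f : F) := [set y | exists V, [/\ good f, open V, V y &
  forall x E, V x -> val E x -> (ord E f)%:~R + G E *+ m0 = 0]].
have [s hs] : exists s : seq F, forall y, setT y -> exists2 f, List.In f s & U f y.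
  apply: (proj_compact pd) => y _; have [f [V [f0 sf oV Vy h]]] := bpf y Logic.I.
  exists f; split; first by exists V; split=> // x E Vx Ex; exact: (h x E Vx Ex Logic.I).
  rewrite openE => x [W [gf oW Wx hW]]; rewrite /interior nbhsE /=.
  by exists W => // w Ww; exists W.
pose s' := [seq f <- s | `[< good f >]].
have s'good f : f \in s' -> good f by rewrite mem_filter => /andP[/asboolP].
have s'cov y : exists2 f, f \in s' & forall E, val E y -> (ord E f)%:~R + G E *+ m0 = 0.
  have [f fs [V [gf oV Vy hV]]] := hs y Logic.I.
  exists f => [|E Ey]; last exact: hV Ey.
  rewrite mem_filter; apply/andP; split; first exact/asboolP.
  by elim: s {hs s' s'good} fs => //= a s IH [->|/IH h]; rewrite inE ?eqxx ?h ?orbT.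
have regL f y : good f -> L y -> regular_at y f.
  move=> [f0 [e|sf]] Ly'; first by rewrite e eqxx in f0.
  apply/regular_at_ord => // E Ey.
  have := sf E; rewrite (Ly E y) // mul0rn addr0 ler0z; apply; exists y.
  by split.
pose z' i := if (i < p)%N then z i else s'`_(i - p).
pose p' := (p + size s')%N.
have envE k i : proj_env p z t k i =
    pf (proj_env p' z' t k) (if (i < p)%N then PV i else PV (i + size s')%N).
  rewrite /proj_env /p' /z'; case: (ltnP i p) => ip; rewrite /pf /=.
    by rewrite ip (ltn_addr _ ip).
  by rewrite ltn_add2r ltnNge ip /= subnDr.
exists p', z', (fun k => A k `&` L); split=> //.
- move=> i y Ly'; rewrite /z'; case: ifP => _; first exact: (pd_global pd).
  have [h|h] := ltnP (i - p) (size s'); last by rewrite nth_default //; exact: (regular_at_cst y 0).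
  by apply: regL => //; apply: s'good; rewrite mem_nth.
- exact: pd_bound pd.
- by move=> y Ly'; have [k km Ak] := pd_cover pd (Logic.I : setT y); exists k.
- move=> k km [y0 [Ay0 Ly0]].
  have [tk ch] := pd_chart pd km (ex_intro _ y0 Ay0); split=> //.
  apply: (fchart_extend ch oL (envE k)).
  + move=> i hi; rewrite /proj_env ltnNge (leq_trans _ hi) ?leq_addr //=.
    by rewrite (pd_bound pd) ?mul0r // leq_subRL ?(leq_trans _ hi) ?leq_addr.
  + move=> y i Ay Ly'; rewrite /proj_env; case: ltnP => hi.
      rewrite /z'; case: ifP => _; first exact: (pd_global pd).
      have [h|h] := ltnP (i - p) (size s'); last by rewrite nth_default //; exact: (regular_at_cst y 0).
      by apply: regL => //; apply: s'good; rewrite mem_nth.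
    have := fchart_reg ch (p + (i - p'))%N Ay.
    by rewrite /proj_env ltnNge leq_addr /= addKn.
  (* Along the prime divisors through y the order of f^-1 is m0 times the coefficient of G:
     nonnegative, and positive for one of them because y is in the support of G. *)
  + move=> y Ay nLy; have [f fs hf] := s'cov y; have [f0 _] := s'good f fs.
    have fi : (index f s' < size s')%N by rewrite index_mem.
    exists (p + index f s')%N.
    have -> : proj_env p' z' t k (p + index f s')%N = f.
      by rewrite /proj_env /p' /z' ltn_add2l fi ltnNge leq_addr /= addKn nth_index.
    have fV0 : f^-1 != 0 by rewrite invr_eq0.
    have pos E : val E y -> 0 <= ord E f^-1 /\ (G E != 0 -> 0 < ord E f^-1).
      move=> Ey; have GE : 0 <= G E by apply: eG; exists y.
      have := hf E Ey => /eqP; rewrite addrC addr_eq0 -rmorphN /= -(ordV nY cov) // => /eqP e.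
      split; first by rewrite -(ler0z rat) -e mulrn_wge0.
      by move=> GE0; rewrite -(ltr0z rat) -e pmulrn_lgt0 // lt0r GE0.
    have Of : regular_at y f^-1 by apply/(regular_at_ord nY cov) => // E /pos[].
    split=> //; apply/(ev_eq0_ord nY cov) => //.
    have : (~` L) y by [].
    by rewrite LG => -[E [_ GE Ey]]; exists E => //; apply: (pos E Ey).2.
- move=> k km AL; apply: (pd_empty pd) => //.
  apply: contrapT => /eqP/set0P Ak; have [_ ch] := pd_chart pd km Ak.
  by have [y] := openI_n0 (fchart_open ch) oL Ak L0; rewrite AL.
Qed.

End Locus.

(** * K-points of the ring of global functions *)

Section Surjectivity.
Context (K : closedFieldType) (Y : integral_space K).
Local Notation F := (funfield Y).
Context (L : set Y) (p m : nat) (z t : nat -> F) (A : nat -> set Y) (pd : proj_data L p m z t A).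
Local Notation O := (global L).
Local Notation monos := (monos m t).

Lemma global_subring : subring O.
Proof.
split=> [y _|a b Oa Ob y Ly|a b Oa Ob y Ly]; first exact: (regular_at_cst y 1).
  by apply: regular_atD; [exact: Oa|apply: regular_atN; exact: Ob].
by apply: regular_atM; [exact: Oa|exact: Ob].
Qed.

Lemma global_cst c : O (ffc Y c). Proof. by move=> y _; exact: regular_at_cst. Qed.

Lemma homogenize k a : (k < m)%N -> A k !=set0 -> chart_ring (proj_env p z t k) a ->
  exists e, lin O (monos e) (t k ^+ e * a).
Proof.
move=> km Ak; have [tk ch] := pd_chart pd km Ak; have rO := global_subring.
have O0 := subring0 rO; have OD := subringD rO; have [O1 _ OM] := rO.
have up e e' f : lin O (monos e) f -> lin O (monos (e' + e)) (t k ^+ e' * f).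
  by apply: lin_scale => // x; apply: monosM; exact: monosX.
move=> [e ->]; elim: e => [c|i|e1 [d1 h1] e2 [d2 h2]|e1 [d1 h1] e2 [d2 h2]] /=.
- by exists 0%N; rewrite expr0 mulrC; apply: lin_mem => //; [exact: global_cst|rewrite inE].
- rewrite /proj_env; case: ltnP => ip.
    by exists 0%N; rewrite expr0 mulrC; apply: lin_mem => //; [exact: (pd_global pd)|rewrite inE].
  exists 1%N; rewrite expr1 mulrC divfK //.
  have [im|im] := ltnP (i - p) m; last by rewrite (pd_bound pd) //; exact: lin0.
  rewrite -[X in lin _ _ X]mul1r; apply: lin_mem => //.
  by rewrite -[t _]expr1; exact: monosX.
- exists (d1 + d2)%N; rewrite mulrDr; apply: linD => //.
    by rewrite addnC exprD -mulrA; exact: up.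
  by rewrite exprD -mulrA; exact: up.
- exists (d1 + d2)%N; rewrite exprD mulrACA; apply: (linM O0 OD OM) h1 h2 => x y.
  exact: monosM.
Qed.

(** On each chart J generates the unit ideal, which after homogenizing puts a power of every t_k
    into the span of monomials over J. Hence all monomials of a large degree d lie in their own span
    over J, and Nakayama's lemma gives 1 in J. This replaces properness of L over the spectrum of
    O. *)
Lemma global_null J : L !=set0 -> rideal O J -> (forall y, L y -> exists2 f, J f & ev y f != 0) -> J 1.
Proof.
move=> [y0 Ly0] iJ nz; have rO := global_subring; have [JO J0 JD JM] := iJ.
have [O1 _ OM] := rO; have O0 := subring0 rO; have OD := subringD rO.
have up e e' k f : (k < m)%N -> lin J (monos e) f -> lin J (monos (e' + e)) (t k ^+ e' * f).
  by move=> km; apply: lin_scale => // x; apply: monosM; exact: monosX.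
have /choice[N hN] : forall k, exists N, (k < m)%N -> lin J (monos N) (t k ^+ N).
  move=> k; have [km|] := ltnP k m; last by exists 0%N.
  (* For an empty chart t_k is 0, and the exponent 1 will do. *)
  have [Ak|Ak] := eqVneq (A k) set0.
    by exists 1%N => _; rewrite (pd_empty pd km Ak) expr1; exact: lin0.
  have {}Ak : A k !=set0 by exact/set0P.
  have [tk ch] := pd_chart pd km Ak.
  have rR := chart_ring_subring (proj_env p z t k).
  pose J' := [set f | chart_ring (proj_env p z t k) f /\
                      exists N, lin J (monos N) (t k ^+ N * f)].
  suff [_ [N h]] : J' 1 by exists N => _; rewrite -[X in lin _ _ X]mulr1.
  apply: (chart_null ch) => [|y Ay].
    split.
    - by move=> f [].
    - by split; [exact: subring0|exists 0%N; rewrite mulr0; exact: lin0].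
    - move=> a b [Ra [d1 h1]] [Rb [d2 h2]]; split; first exact: subringD.
      exists (d1 + d2)%N; rewrite mulrDr; apply: linD => //.
        by rewrite addnC exprD -mulrA; exact: up.
      by rewrite exprD -mulrA; exact: up.
    - move=> a b Ra [Rb [d2 h2]]; split; first by have [_ _ RM] := rR; exact: RM.
      have [d1 h1] := homogenize km Ak Ra.
      exists (d1 + d2)%N; rewrite exprD mulrACA; apply: (linM J0 JD JM) h1 h2 => x x'.
      exact: monosM.
  have [f Jf yf] := nz y (pd_sub pd km Ay); exists f => //; split.
    by rewrite (chart_ring_global ch) => x Ax; apply: JO => //; exact: (pd_sub pd km).
  by exists 0%N; rewrite expr0 mulrC; apply: lin_mem => //; rewrite inE.
pose M := (\sum_(k < m) N k)%N.
have hM k : (k < m)%N -> lin J (monos M) (t k ^+ M).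
  move=> km; have NM : (N k <= M)%N by rewrite /M (bigD1 (Ordinal km)) //= leq_addr.
  by rewrite -(subnK NM) exprD; apply: up => //; exact: hN.
(* A monomial of degree greater than m M is divisible by some t_k^M. *)
pose d := (m * M).+1.
apply: (@nakayama _ _ rO J (monos d)) => //.
  have [k km Ak] := pd_cover pd Ly0; have [tk _] := pd_chart pd km (ex_intro _ y0 Ak).
  by exists (t k ^+ d); [exact: monosX|exact: expf_neq0].
move=> x xd; suff : lin J (monos d) x by [].
have [k [y [km yd ->]]] := monos_pigeon (ltnSn _ : (m * M < d)%N) xd.
have Md : (M <= d)%N by rewrite /d; case: (m) km => // m' _; rewrite mulSn -addnS leq_addr.
rewrite -{1}(subnKC Md); apply: (@linM _ J O J (monos M) (monos (d - M))) (hM k km) _ => //.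
- by move=> a b Ja Ob; rewrite mulrC; exact: JM.
- by move=> a b; exact: monosM.
by rewrite -[y]mul1r; apply: lin_mem.
Qed.

(** The kernel of x is a proper ideal, so it has a common zero y by [global_null]; as f - x(f) lies
    in the kernel, x is the evaluation at y. *)
Lemma global_point (x : F -> K) : L !=set0 -> x 1 = 1 ->
  (forall f g, O f -> O g -> x (f + g) = x f + x g) ->
  (forall c f, O f -> x (ffc Y c * f) = c * x f) ->
  (forall f g, O f -> O g -> x (f * g) = x f * x g) ->
  exists2 y, L y & forall f, O f -> ev y f = x f.
Proof.
move=> L0 x1 xD xZ xM; have rO := global_subring; have O0 := subring0 rO.
have [O1 _ OM] := rO; have OD := subringD rO.
have xc c : x (ffc Y c) = c by rewrite -[ffc Y c]mulr1 xZ // x1 mulr1.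
apply: contrapT => h.
suff [_] : [set f | O f /\ x f = 0] 1 by rewrite x1 => /eqP; rewrite oner_eq0.
apply: global_null => // [|y Ly].
  split.
  - by move=> f [].
  - by split=> //; rewrite -(rmorph0 (ffc Y)) xc.
  - by move=> a b [Oa xa] [Ob xb]; split; [exact: OD|rewrite xD // xa xb addr0].
  - by move=> a b Oa [Ob xb]; split; [exact: OM|rewrite xM // xb mulr0].
apply: contrapT => hy; apply: h; exists y => // f Of.
have Oc : O (ffc Y (- x f)) by exact: global_cst.
have /eqP : ev y (f + ffc Y (- x f)) = 0.
  apply/eqP; apply: contrapT => /negP e; apply: hy.
  by exists (f + ffc Y (- x f)) => //; split; [exact: OD|rewrite xD // xc subrr].
by rewrite evD; [rewrite ev_cst subr_eq0 => /eqP|exact: Of|exact: Oc].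
Qed.

End Surjectivity.

Lemma mulIf_eq (F : fieldType) (x a b : F) : x != 0 -> x * a = x * b -> a = b.
Proof. by move=> x0; apply: mulfI. Qed.

(** * Serre's finiteness theorem for graded modules *)

Section Vanishing.
Context (K : fieldType) (F : fieldType) (j : {rmorphism K -> F}) (G : zmodType).
Context (cs es : seq (G * F)) (m : nat) (t : nat -> F).
Local Notation C := (galg j cs).
Local Notation monos := (monos m t).

(** S is C with the t_k adjoined, C in degrees (u, 0) and t_k in degree (0, 1); E is the S-module
    generated by es in degrees (u, 0). The second degree is formal: the same element of the field
    may occur in several degrees. *)
Let cs' : seq ((G * int)%type * F) :=
  [seq ((x.1, 0), x.2) | x <- cs] ++ [seq ((0, 1), t k) | k <- iota 0 m].
Let S : (G * int)%type -> set F := galg j cs'.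
Let es' : seq ((G * int)%type * F) := [seq ((x.1, 0), x.2) | x <- es].
Let E : (G * int)%type -> set F := gspan S es'.

Let rS : gring S. Proof. exact: galg_ring. Qed.
Let rC : gring C. Proof. exact: galg_ring. Qed.
Let mE : gmod S E. Proof. exact: gspan_mod. Qed.

Lemma galg_bigraded u : C u `<=` S (u, 0).
Proof.
apply: (@galg_min _ _ _ j (fun u => S (u, 0)) cs); first have [S1 S0 SD SM] := rS.
- split; [exact: S1|by move=> g; exact: S0|by move=> g; exact: SD|].
  by move=> g h a b; exact: (SM (g, 0) (h, 0)).
- by move=> c; exact: galg_cst.
move=> x xs; have := @galg_gen _ _ _ j cs' ((x.1, 0), x.2); apply.
by rewrite mem_cat; apply/orP; left; apply/mapP; exists x.
Qed.

Lemma bigraded_mono d x : x \in monos d -> S (0, d%:Z) x.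
Proof.
elim: d x => [|d IH] x /=; first by rewrite inE => /eqP ->; exact: (gring1 rS).
move=> /allpairsPdep[k [y [km yd ->]]]; have [_ _ _ SM] := rS.
have Sk : S (0, 1) (t k).
  have := @galg_gen _ _ _ j cs' ((0, 1), t k); apply.
  by rewrite mem_cat; apply/orP; right; apply/mapP; exists k.
by have := SM _ _ _ _ Sk (IH y yd); rewrite (_ : (0, 1) + (0, d%:Z) = (0, d.+1%:Z)) //; congr pair; rewrite addr0.
Qed.

Lemma bigraded_lin u (e : int) c : S (u, e) c -> c = 0 \/ exists2 d : nat, e = d & lin (C u) (monos d) c.
Proof.
have [C1 C0 CD CM] := rC.
pose T (g : (G * int)%type) : set F :=
  [set c | c = 0 \/ exists2 d : nat, g.2 = d & lin (C g.1) (monos d) c].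
suff /(_ (u, e) c) : forall g, S g `<=` T g by [].
apply: galg_min => [|c'|x].
- split=> [|g|g a b|g h a b].
  + by right; exists 0%N => //; rewrite -[-1]mulr1; apply: lin_mem; rewrite ?inE.
  + by left.
  + move=> [->|[d gd la]]; first by rewrite add0r.
    move=> [->|[d' gd' lb]]; first by rewrite addr0; right; exists d.
    right; exists d => //; apply: linD => //; first exact: CD.
    by move: gd'; rewrite gd => -[->].
  + move=> [->|[d gd la]]; first by rewrite mul0r; left.
    move=> [->|[d' gd' lb]]; first by rewrite mulr0; left.
    right; exists (d + d')%N; first by rewrite /= gd gd'.
    apply: (@linM _ (C g.1) (C h.1)) la lb => //; [exact: CD|exact: CM|].
    by move=> x y; exact: monosM.
- right; exists 0%N => //; rewrite -[j c']mulr1; apply: lin_mem; rewrite ?inE //.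
  exact: galg_cst.
rewrite mem_cat => /orP[/mapP[y ys ->]|/mapP[k km ->]]; right.
  exists 0%N => //=; rewrite -[y.2]mulr1; apply: lin_mem; rewrite ?inE //.
  exact: galg_gen.
exists 1%N => //; rewrite -[X in lin _ _ X]mul1r; apply: lin_mem => //; first exact: gring1.
by rewrite -[(_, _).2]expr1; apply: monosX; rewrite mem_iota in km.
Qed.

Context (k0 : nat) (k0m : (k0 < m)%N) (x0 : t k0 != 0).
Local Notation x := (t k0).

(** The elements h of E such that h / x is, up to powers of each t_k, again in E with second degree
    one less: the numerators of local sections with denominator x. *)
Let Q (g : (G * int)%type) : set F := [set h | E g h /\ forall k, (k < m)%N ->
  exists (N : nat) f, E (g.1, g.2 - 1 + N%:Z) f /\ t k ^+ N * h = x * f].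

Lemma bigraded_tX k N : (k < m)%N -> S (0, N%:Z) (t k ^+ N).
Proof. by move=> km; apply: bigraded_mono; exact: monosX. Qed.

Lemma bigraded_act u d v e (d' : int) c f : S (u, d) c -> E (v, e) f -> d' = d + e -> E (u + v, d') (c * f).
Proof. by move=> Sc Ef ->; have [_ _ EM] := mE; exact: (EM _ _ _ _ Sc Ef). Qed.

Lemma bigraded_tXact k N v e d f : (k < m)%N -> E (v, e) f -> d = N%:Z + e -> E (v, d) (t k ^+ N * f).
Proof.
by move=> km Ef dE; rewrite -[v]add0r; apply: (bigraded_act (bigraded_tX N km) Ef dE).
Qed.

Lemma Q_mod : gmod S Q.
Proof.
have [E0 ED EM] := mE; split=> [g|g a b [Ea ha] [Eb hb]|g h a b Sa [Eb hb]].
- split=> // k km; exists 0%N, 0; split=> //; by rewrite !mulr0.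
- split=> [|k km]; first exact: ED.
  have [N [f [Ef ef]]] := ha k km; have [N' [f' [Ef' ef']]] := hb k km.
  exists (N + N')%N, (t k ^+ N' * f + t k ^+ N * f'); split.
    by apply: ED; apply: (bigraded_tXact km); [exact: Ef|rewrite PoszD; lia|exact: Ef'|rewrite PoszD; lia].
  rewrite mulrDr exprD -mulrA [t k ^+ N * _ * b]mulrAC.
  rewrite [t k ^+ N * (_ * a)]mulrCA ef mulrDr -[_ * b * _]mulrA [b * _]mulrC ef'.
  by congr (_ + _); rewrite mulrCA.
split=> [|k km]; first exact: EM.
have [N [f [Ef ef]]] := hb k km; exists N, (a * f); split.
  by case: g Sa => u d Sa; apply: (bigraded_act Sa Ef) => /=; lia.
by rewrite mulrCA ef mulrCA.
Qed.

(** In high degree a local section h / x lies in E itself. A cofactor of high degree of a generator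
    h of Q is a sum of multiples of high powers of the t_k, and t_k^N h is x times an element of
    E. *)
Lemma Q_divisible (hs : seq ((G * int)%type * F)) : (forall h, h \in hs -> Q h.1 h.2) ->
  exists D : nat, forall u (d : int) h, D%:Z <= d -> gspan S hs (u, d) h ->
    exists2 f, E (u, d - 1) f & h = x * f.
Proof.
have [E0 ED EM] := mE; elim: hs => [|[[v e] h] hs IH] hQ /=.
  by exists 0%N => u d h _ ->; exists 0; rewrite ?mulr0.
have [|D hD] := IH; first by move=> h' hs'; apply: hQ; rewrite inE hs' orbT.
have [/= _ /(_ _ _) hk] := hQ _ (mem_head _ _).
have /choice[N hN] : forall k, exists N : nat, (k < m)%N ->
    exists2 f, E (v, e - 1 + N%:Z) f & t k ^+ N * h = x * f.
  move=> k; have [km|] := ltnP k m; last by exists 0%N.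
  by have [N [f [Ef ef]]] := hk k km; exists N => _; exists f.
pose M := (\sum_(k < m) N k)%N.
(* The cofactor of h then has degree n = d - e > m M, so each of its monomials is divisible by some
   t_k^M; D is what the remaining generators require. *)
exists (D + m * M + 1 + absz e)%N => u d h' Dd [c [d' [Sc sd ->]]].
have [f' Ef' ->] := hD u d d' ltac:(lia) sd.
suff [f Ef ->] : exists2 f, E (u, d - 1) f & c * h = x * f.
  by exists (f + f'); [exact: ED|rewrite mulrDr].
have {Sc}Sc : S (u - v, d - e) c by [].
have [->|[n dn lc]] := bigraded_lin Sc; first by exists 0; rewrite ?mul0r ?mulr0.
have nM : (m * M < n)%N by lia.
clear Sc; apply: (@lin_min _ (C (u - v)) (monos n) (fun c => exists2 f, E (u, d - 1) f & c * h = x * f)) c lc => //.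
- by exists 0; rewrite ?mul0r ?mulr0.
- by move=> a b [f1 E1 e1] [f2 E2 e2]; exists (f1 + f2); rewrite ?mulrDl ?mulrDr ?e1 ?e2 //; exact: ED.
move=> c' y Cc yn; have [k [y' [km y'n ->]]] := monos_pigeon nM yn.
have [f Ef ef] := hN k km.
have NM : (N k <= M)%N by rewrite /M (bigD1 (Ordinal km)) //= leq_addr.
exists (c' * (y' * (t k ^+ (M - N k) * f))).
  rewrite (_ : u = (u - v) + v); last by rewrite subrK.
  apply: (bigraded_act (galg_bigraded Cc)); last by rewrite add0r.
  rewrite -[v]add0r; apply: (bigraded_act (bigraded_mono y'n)).
    by apply: (bigraded_tXact km Ef); reflexivity.
  have Mn : (M <= n)%N by case: (m) km nM => // m' _; nia.
  lia.
rewrite -(subnKC NM) exprD addKn.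
rewrite (_ : c' * (t k ^+ N k * t k ^+ (M - N k) * y') * h =
  c' * (y' * (t k ^+ (M - N k) * (t k ^+ N k * h)))); last first.
  by ring.
by rewrite ef ![_ * (x * _)]mulrCA.
Qed.

(** As Q is finitely generated, [Q_divisible] gives one D for all u and f. The element x^d f is in E
    for some large d, and d can be lowered by one as long as it exceeds D. *)
Lemma bigraded_stable : exists D : nat, forall u f,
  (forall k, (k < m)%N -> exists N : nat, E (u, N%:Z) (t k ^+ N * f)) -> E (u, D%:Z) (x ^+ D * f).
Proof.
have nE : gnoeth S E by apply: gnoeth_span => //; exact: galg_noeth.
have [|hs [hsQ Qhs]] := nE Q Q_mod; first by move=> g h [].
have [D hD] := Q_divisible hsQ; exists D => u f hf.
(* The element x^(d+1) f is in Q, because t_k^N times it is x times x^d (t_k^N f). In this degree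
   members of Q are divisible by x in E. *)
have step d : (D <= d)%N -> E (u, d.+1%:Z) (x ^+ d.+1 * f) -> E (u, d%:Z) (x ^+ d * f).
  move=> Dd Ed; have Qd : Q (u, d.+1%:Z) (x ^+ d.+1 * f).
    split=> // k km; have [N EN] := hf k km; exists N, (x ^+ d * (t k ^+ N * f)); split.
      by apply: (bigraded_tXact k0m EN) => /=; lia.
    by rewrite [x ^+ _]exprS -mulrA mulrCA [t k ^+ N * (_ * f)]mulrCA.
  have [f' Ef' e] := hD u d.+1%:Z _ ltac:(lia) (Qhs _ _ Qd).
  move: e; rewrite exprS -mulrA => /(mulIf_eq x0) ->.
  by have -> : d%:Z = d.+1%:Z - 1 by lia.
have [N EN] := hf k0 k0m.
have : E (u, (D + N)%N%:Z) (x ^+ (D + N) * f).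
  by rewrite exprD -mulrA; apply: (bigraded_tXact k0m EN); rewrite PoszD.
elim: N {EN} => [|N IH]; first by rewrite addn0.
by rewrite addnS => /(step _ (leq_addr _ _)).
Qed.

Lemma bigraded_slice d u : E (u, d%:Z) `<=` gspan C [seq (e.1, y * e.2) | e <- es, y <- monos d] u.
Proof.
rewrite /E /es'; set s := [seq _ | _ <- _, _ <- _] => f Ef.
have : forall e y, e \in es -> y \in monos d -> (e.1, y * e.2) \in s.
  by move=> e y ee yd; apply/allpairsPdep; exists e, y.
have mC := gspan_mod s rC; have [M0 MD MM] := mC.
elim: (es) f Ef => [|e l IH] f /=; first by move=> ->.
move=> [c [f' [Sc hf' ->]]] sub; apply: (MD); last first.
  by apply: IH hf' _ => e' y e'l; apply: sub; rewrite inE e'l orbT.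
have {Sc}Sc : S (u - e.1, d%:Z - 0) c by [].
rewrite subr0 in Sc.
have [->|[n [<-] lc]] := bigraded_lin Sc; first by rewrite mul0r.
clear Sc; apply: (@lin_min _ _ _ (fun c => gspan C s u (c * e.2))) c lc; first by rewrite mul0r.
  by move=> a b ha hb; rewrite mulrDl; exact: MD.
move=> c y Cc yd; rewrite -mulrA; apply: (gmod_in (h := e.1) mC Cc).
exact: (gspan_in rC (sub e y (mem_head _ _) yd)).
Qed.

(** A power of t_k clears the denominators of the t_i / t_k in the coefficients, raising the second
    degree by the same amount. *)
Lemma bigraded_homogenize k u f : (k < m)%N -> t k != 0 ->
  gspan (galg j (cs ++ [seq (0, t i / t k) | i <- iota 0 m])) es u f ->
  exists N : nat, E (u, N%:Z) (t k ^+ N * f).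
Proof.
move=> km tk.
have SX N u' e c : S (u', e) c -> S (u', N%:Z + e) (t k ^+ N * c).
  move=> Sc; have [_ _ _ SM] := rS.
  by have := SM _ _ _ _ (bigraded_tX N km) Sc; rewrite [_ + _](_ : _ = (0 + u', N%:Z + e)) // add0r.
have hC v c : galg j (cs ++ [seq (0, t i / t k) | i <- iota 0 m]) v c ->
    exists N : nat, S (v, N%:Z) (t k ^+ N * c).
  move: v c; apply: (@galg_min _ _ _ j (fun v => [set c | exists N : nat, S (v, N%:Z) (t k ^+ N * c)])).
  - have [S1 S0 SD SM] := rS; split=> [|g|g a b [N1 h1] [N2 h2]|g h a b [N1 h1] [N2 h2]].
    + by exists 0%N; rewrite mul1r.
    + by exists 0%N; rewrite mulr0; exact: S0.
    + exists (N1 + N2)%N; rewrite mulrDr; apply: SD.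
        by rewrite addnC exprD -mulrA PoszD; exact: SX.
      by rewrite exprD -mulrA PoszD; exact: SX.
    + exists (N1 + N2)%N; rewrite exprD mulrACA PoszD; exact: (SM _ _ _ _ h1 h2).
  - by move=> c; exists 0%N; rewrite mul1r; exact: galg_cst.
  move=> y; rewrite mem_cat => /orP[ys|/mapP[i im ->]].
    by exists 0%N; rewrite mul1r; apply: galg_bigraded; exact: galg_gen.
  exists 1%N; rewrite /= expr1 mulrC divfK //.
  have := @galg_gen _ _ _ j cs' ((0, 1), t i); apply.
  by rewrite mem_cat; apply/orP; right; apply/mapP; exists i.
rewrite /E /es'; have [S1 S0 SD SM] := rS.
elim: (es) f => [|e l IH] f /=; first by move=> ->; exists 0%N; rewrite mulr0.
move=> [c [f' [/hC[N1 h1] /IH[N2 h2] ->]]].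
have ml := gspan_mod [seq ((x.1, 0), x.2) | x <- l] rS; have [M0 MD MM] := ml.
exists (N1 + N2)%N, (t k ^+ (N2 + N1) * c), (t k ^+ (N1 + N2) * f'); split.
- rewrite exprD -mulrA [_ - _](_ : _ = (u - e.1, N2%:Z + N1%:Z)); first exact: SX.
  by congr pair; rewrite /= subr0 PoszD addrC.
- rewrite exprD -mulrA; have := MM _ _ _ _ (bigraded_tX N1 km) h2.
  by rewrite [_ + _](_ : _ = (0 + u, N1%:Z + N2%:Z)) // add0r -PoszD.
by rewrite mulrDr mulrA [(N2 + _)%N]addnC.
Qed.

End Vanishing.

(** Multiplication by x^D, with x = t_k0, embeds A into the slice of E of second degree D by
    [bigraded_stable]. This slice is a finitely generated module over the Noetherian ring C. For t_k
    = 0 there is no chart and no condition. *)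
Lemma graded_serre (K F : fieldType) (j : {rmorphism K -> F}) (G : zmodType) (cs es : seq (G * F))
    (m : nat) (t : nat -> F) (A : G -> set F) : (exists2 k, (k < m)%N & t k != 0) ->
  gmod (galg j cs) A ->
  (forall k u, (k < m)%N -> t k != 0 ->
     A u `<=` gspan (galg j (cs ++ [seq (0, t i / t k) | i <- iota 0 m])) es u) ->
  gfg (galg j cs) A.
Proof.
move=> [k0 k0m x0] mA hA; have rC := galg_ring j cs; have nC : gnoeth (galg j cs) (galg j cs) by exact: galg_noeth.
have [D hD] := bigraded_stable j cs es k0m x0.
pose s := [seq (e.1, y * e.2) | e <- es, y <- monos m t D].
have x0D : t k0 ^+ D != 0 by rewrite expf_neq0.
have AE u f : A u f -> gspan (galg j cs) s u (t k0 ^+ D * f).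
  move=> Af; apply: (@bigraded_slice _ _ j _ cs es m t D u); apply: (hD u f) => k km.
  have [tk|tk] := eqVneq (t k) 0; last by apply: bigraded_homogenize => //; exact: hA Af.
  by exists 1%N; rewrite tk expr1 mul0r; have [] := gspan_mod [seq ((x.1, 0%:Z), x.2) | x <- es] (galg_ring j ([seq ((x.1, 0%:Z), x.2) | x <- cs] ++ [seq ((0, 1%:Z), t k) | k <- iota 0 m])).
pose A' u : set F := [set f | A u (f / t k0 ^+ D)].
have mA' : gmod (galg j cs) A'.
  have [A0 AD AM] := mA; split=> [g|g a b Aa Ab|g h a b Ca Ab]; rewrite /A' /=.
  - by rewrite mul0r.
  - by rewrite mulrDl; exact: AD.
  - by rewrite -mulrA; exact: AM.
have [|hs [hsA Ahs]] := gnoeth_span rC nC (s := s) mA'.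
  by move=> u f Af; have := AE _ _ Af; rewrite mulrC divfK.
exists [seq (h.1, h.2 / t k0 ^+ D) | h <- hs]; split=> [_ /mapP[h hh ->]|u f Af].
  by have := hsA h hh.
have {Af} : gspan (galg j cs) hs u (f * t k0 ^+ D) by apply: Ahs; rewrite /A' /= mulfK.
rewrite -{2}(mulfK x0D f); elim: hs (f * _) {hsA Ahs} => [|h hs IH] g /=; first by move=> ->; rewrite mul0r.
move=> [c [d [Cc /IH hd ->]]]; exists c, (d / t k0 ^+ D); split=> //.
by rewrite mulrDl mulrA.
Qed.

Lemma finite_bound (T : eqType) (s : seq T) (P : T -> nat -> Prop) :
  (forall x, x \in s -> exists N, P x N) -> (forall x N N', (N <= N')%N -> P x N -> P x N') ->
  exists N, forall x, x \in s -> P x N.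
Proof.
move=> ex up; elim: s ex => [|x s IH] ex; first by exists 0%N.
have [|N hN] := IH; first by move=> y ys; apply: ex; rewrite inE ys orbT.
have [N' hN'] := ex x (mem_head _ _); exists (N + N')%N => y.
rewrite inE => /predU1P[->|ys]; first by apply: up hN'; exact: leq_addl.
by apply: up (hN y ys); exact: leq_addr.
Qed.

(** * Finite generation of the algebra A *)

Section Sections.
Context (K : closedFieldType) (Y : integral_space K) (nY : normal_variety Y).
Local Notation F := (funfield Y).
Context (cov : forall y : Y, exists A (r : nat -> F) n, fchart A r n /\ A y).
Context (ofin : forall a : F, a != 0 -> finite_set [set E : prime_divisor Y | ord E a != 0]).
Implicit Types (L : set Y) (H : qdiv Y) (E : prime_divisor Y) (f g a b : F).

Lemma sections_add L H f g : sections L H f -> sections L H g -> sections L H (f + g).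
Proof.
move=> [->|sf]; first by rewrite add0r.
move=> [->|sg]; first by rewrite addr0; right.
have [->|fg0] := eqVneq (f + g) 0; first by left.
have [f0|f0] := eqVneq f 0; first by rewrite f0 add0r; right.
have [g0|g0] := eqVneq g 0; first by rewrite g0 addr0; right.
right=> E mE; have := @ord_add _ _ nY cov E (Order.min (ord E f) (ord E g)) f g f0 g0 fg0.
rewrite !ge_min !lexx /= orbT => /(_ isT isT)/orP[h|h].
  by apply: le_trans (sf E mE) _; rewrite lerD2r ler_int.
by apply: le_trans (sg E mE) _; rewrite lerD2r ler_int.
Qed.

Lemma sections_mul L H H' H'' f g : (forall E, meets_div L E -> H E + H' E <= H'' E) ->
  sections L H f -> sections L H' g -> sections L H'' (f * g).
Proof.
move=> HH [->|sf]; first by rewrite mul0r; left.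
move=> [->|sg]; first by rewrite mulr0; left.
have [f0|f0] := eqVneq f 0; first by rewrite f0 mul0r; left.
have [g0|g0] := eqVneq g 0; first by rewrite g0 mulr0; left.
right=> E mE; rewrite (ordM nY cov) // rmorphD /=.
apply: le_trans (_ : 0 <= (ord E f)%:~R + H E + ((ord E g)%:~R + H' E)) _.
  by apply: addr_ge0; [exact: sf|exact: sg].
by rewrite addrACA lerD2l; exact: HH.
Qed.

Lemma global_sections L a : global L a -> sections L (fun=> 0) a.
Proof.
move=> Oa; have [->|a0] := eqVneq a 0; first by left.
right=> E [y [Ey Ly]]; rewrite addr0 ler0z.
by have /(regular_at_ord nY cov y a0) := Oa y Ly; exact.
Qed.

Lemma sections_global L a : sections L (fun=> 0) a -> global L a.
Proof.
move=> sa y Ly; have [->|a0] := eqVneq a 0; first exact: (regular_at_cst y 0).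
apply/(regular_at_ord nY cov y a0) => E Ey; case: sa => [e|sa]; first by rewrite e eqxx in a0.
by have := sa E; rewrite addr0 ler0z; apply; exists y.
Qed.

Lemma sections_sub L L' H f : L' `<=` L -> sections L H f -> sections L' H f.
Proof. by move=> LL [->|sf]; [left|right=> E [y [Ey /LL Ly]]; apply: sf; exists y]. Qed.

Section Chart.
Context (A : set Y) (r : nat -> F) (n : nat) (ch : fchart A r n).
Local Notation R := (chart_ring r).

Lemma vanishing_ord E a : val E `&` A !=set0 -> R a -> a != 0 ->
  (forall x, val E x -> A x -> ev x a = 0) -> 0 < ord E a.
Proof.
move=> EA Ra a0 va; rewrite ltNge; apply/negP => oa.
have : local_ring (val E) a^-1.
  by apply/(local_ring_ord nY cov); rewrite ?invr_eq0 // (ordV nY cov) // oppr_ge0.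
move=> /local_ringP[y Ey Oy].
have [_ Eirr _ _] := prime_divisorP E.
have [|x [Ex [Ax Ox]]] := Eirr.2 _ _ (fchart_open ch) (regular_locus_open a^-1) EA.
  by exists y.
have := evM (chart_ring_reg ch Ra Ax) Ox; rewrite va // mul0r divff // ev1.
by move/eqP; rewrite oner_eq0.
Qed.

(** Only finitely many prime divisors violate the inequality and none of them passes through y. A
    function b that vanishes along them but not at y has a power making up for the negative
    coefficients. *)
Lemma clear_denominator H g y : finite_set [set E | H E != 0] -> A y -> g != 0 ->
  (forall E, val E y -> 0 <= (ord E g)%:~R + H E) ->
  exists a, [/\ R a, ev y a != 0 & sections A H (a * g)].
Proof.
move=> fH Ay g0 gy; pose P E := (ord E g)%:~R + H E < 0.
have fP : finite_set [set E | P E].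
  apply: (@sub_finite_set _ _ ([set E | H E != 0] `|` [set E | ord E g != 0])).
    move=> E; rewrite /P /=; have [e|] := eqVneq (ord E g) 0; last by right.
    by left; move: H0; rewrite e add0r; apply: contraTneq => ->; rewrite ltxx.
  by rewrite finite_setU; split=> //; exact: ofin.
have [oU _] := primes_avoid fP.
have [|q qy qU] := fchart_top ch Ay oU.
  by move=> E PE Ey; move: (gy E Ey); rewrite leNgt => /negP; apply.
pose b := pf r q; have Rb : R b by exists q.
have b0 : b != 0 by apply: contraNneq qy => e; rewrite -/b e ev0.
have bpos E : P E -> val E `&` A !=set0 -> 0 < ord E b.
  move=> PE EA; apply: vanishing_ord => // x Ex Ax; apply/eqP; apply: contrapT => /negP bx.
  exact: (qU x Ax bx E PE Ex).
move/finite_seqP: fP => [s sE].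
have [N hN] : exists N : nat, forall E, E \in s -> - ((ord E g)%:~R + H E) <= N%:R.
  apply: finite_bound => [E _|E N N' NN h]; last by apply: le_trans h _; rewrite ler_nat.
  exists (Num.bound `|- ((ord E g)%:~R + H E)|); apply: le_trans (ler_norm _) _.
  by apply/ltW/archi_boundP; exact: normr_ge0.
have bN0 : b ^+ N != 0 by rewrite expf_neq0.
exists (b ^+ N); split.
- exact: (subringX (chart_ring_subring r)).
- by rewrite evX ?expf_neq0 //; exact: (chart_ring_reg ch Rb Ay).
right=> E mE; rewrite (ordM nY cov) // (ordX nY cov) // rmorphD /= rmorphMn /= -addrA.
have [PE|] := ltP ((ord E g)%:~R + H E) 0; last first.
  move=> h; apply: addr_ge0 => //; apply: mulrn_wge0; rewrite ler0z.
  case: mE => x [Ex Ax].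
  by have /(regular_at_ord nY cov x b0) := chart_ring_reg ch Rb Ax; apply.
have Es : E \in s by have : [set E | P E] E by []; rewrite sE.
rewrite -[X in 0 <= _ + X]opprK subr_ge0; apply: le_trans (hN E Es) _.
by rewrite lerMn2r (ler_int rat 1); have := bpos E PE mE; rewrite -gtz0_ge1 orbC => ->.
Qed.

Lemma sections_module H a f : R a -> sections A H f -> sections A H (a * f).
Proof.
move=> Ra; apply: (@sections_mul A (fun=> 0) H); first by move=> E _; rewrite add0r.
by apply: global_sections => y; exact: (chart_ring_reg ch Ra).
Qed.

(** A nonzero section c of -H, obtained by clearing the denominators of 1 at a point off the support
    of H, maps the sections of H isomorphically onto an ideal of the Noetherian ring R. *)
Lemma sections_finite H : A !=set0 -> finite_set [set E | H E != 0] ->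
  exists s, forall f, sections A H f -> lin R s f.
Proof.
move=> [y0 Ay0] fH; have rR := chart_ring_subring r; have [R1 RB RM] := rR.
have [y Ay yH] : exists2 y, A y & forall E, H E != 0 -> ~ val E y.
  have [oU U0] := primes_avoid fH.
  by have [|y [Ay Uy]] := openI_n0 (fchart_open ch) oU _ U0; [exists y0|exists y].
have fNH : finite_set [set E | - H E != 0].
  by rewrite (_ : [set E | _] = [set E | H E != 0]) //; apply/seteqP; split=> E /=; rewrite oppr_eq0.
have [|c [Rc c0' sc]] := clear_denominator fNH Ay (oner_neq0 _).
  move=> E Ey; rewrite ord_div1 add0r oppr_ge0 le_eqVlt; apply/orP; left; apply/eqP.
  by apply: contrapT => /eqP HE; exact: (yH E HE).
have c0 : c != 0 by apply: contraNneq c0' => ->; rewrite ev0.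
rewrite mulr1 in sc.
pose J : set F := [set a | R a /\ sections A H (a / c)].
have RH f : sections A H f -> R (c * f).
  move=> sf; rewrite (chart_ring_global ch); apply: sections_global.
  by apply: sections_mul sc sf => E _; rewrite addNr.
have [|s [sJ Js]] := chart_ring_noeth ch (J := J).
  split.
  - by move=> a [].
  - by split; [exact: subring0|left; rewrite mul0r].
  - by move=> a b [Ra sa] [Rb sb]; split; [exact: subringD|rewrite mulrDl; exact: sections_add].
  - by move=> a b Ra [Rb sb]; split; [exact: RM|rewrite -mulrA; exact: sections_module].
exists [seq a / c | a <- s] => f sf.
have [|d [dR e]] := Js (c * f); first by split; [exact: RH|rewrite mulrAC divff // mul1r].
exists d; split=> //; rewrite size_map; apply: (mulfI c0); rewrite e mulr_sumr.
apply: eq_bigr => i _; rewrite (nth_map 0) // mulrCA; congr (_ * _).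
by rewrite mulrC divfK.
Qed.

(** The a in R for which a f is such a combination form an ideal. At y a section s generates H', so
    f / s is a section of H near y, and clearing its denominator yields an a that does not vanish at
    y. *)
Lemma sections_factor H H' (ss : seq F) f : finite_set [set E | H E != 0] ->
  (forall s, s \in ss -> s != 0) ->
  (forall y, A y -> exists2 s, s \in ss & forall E, val E y -> (ord E s)%:~R + H' E = 0) ->
  sections A (fun E => H E + H' E) f -> lin (sections A H) ss f.
Proof.
move=> fH ss0 cs sf; have rR := chart_ring_subring r; have [R1 RB RM] := rR.
have S0 : sections A H 0 by left.
pose J : set F := [set a | R a /\ lin (sections A H) ss (a * f)].
suff [_] : J 1 by rewrite mul1r.
apply: (chart_null ch) => [|y Ay].
  split.
  - by move=> a [].
  - by split; [exact: subring0|rewrite mul0r; exact: lin0].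
  - move=> a b [Ra sa] [Rb sb]; split; first exact: subringD.
    by rewrite mulrDl; apply: linD sa sb => x x'; exact: sections_add.
  - move=> a b Ra [Rb [d [dS e]]]; split; first exact: RM.
    rewrite -mulrA e; exists (fun i => a * d i); split=> [i|]; first exact: sections_module.
    by rewrite mulr_sumr; apply: eq_bigr => i _; rewrite mulrA.
have [f0|f0] := eqVneq f 0.
  by exists 1; rewrite ?ev1 ?oner_neq0 //; split=> //; rewrite f0 mulr0; exact: lin0.
have [s sss sy] := cs y Ay; have s0 := ss0 s sss.
have [||a [Ra ya sa]] := @clear_denominator H (f / s) y fH Ay.
- by rewrite mulf_neq0 // invr_eq0.
- move=> E Ey; rewrite (ordM nY cov) ?invr_eq0 // (ordV nY cov) // rmorphB /=.
  have /eqP := sy E Ey; rewrite addr_eq0 => /eqP ->; rewrite opprK -addrA [H' E + _]addrC.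
  by case: sf => [e|]; [rewrite e eqxx in f0|apply; exists y].
exists a => //; split=> //; rewrite -(divfK s0 f) mulrA.
exact: lin_mem.
Qed.

End Chart.

Section ConeGenerators.
Context (L : set Y) (p m : nat) (z t : nat -> F) (A : nat -> set Y) (pd : proj_data L p m z t A).
Context (G : zmodType) (c : nat) (us : nat -> G) (H : G -> qdiv Y).
Local Notation wt e := (\sum_(i < c) us i *+ (e : nat -> nat) i).
Context (HE : forall (e : nat -> nat) E, H (wt e) E = \sum_(i < c) H (us i) E *+ e i).
Context (fH : forall i, finite_set [set E | H (us i) E != 0]).
Context (bH : forall i, (i < c)%N -> semiample L (H (us i))).

Lemma finite_weight (e : nat -> nat) : finite_set [set E | H (wt e) E != 0].
Proof.
apply: (@sub_finite_set _ _ (\bigcup_(i in `I_c) [set E | H (us i) E != 0])).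
  move=> E /=; rewrite HE => h; apply: contrapT => nE; move/eqP: h; apply.
  rewrite big1 // => i _; rewrite (_ : H (us i) E = 0) ?mul0rn //.
  by apply/eqP; apply: contrapT => /negP hi; apply: nE; exists i => //=.
by apply: bigcup_finite => [|i _]; [exact: finite_II|exact: fH].
Qed.

Lemma bpf_sections : exists (M : nat -> nat) (ss : nat -> seq F), forall i, (i < c)%N ->
  [/\ (0 < M i)%N, forall s, s \in ss i -> s != 0 /\ sections L (fun E => H (us i) E *+ M i) s &
      forall y, L y -> exists2 s, s \in ss i &
        forall E, val E y -> (ord E s)%:~R + H (us i) E *+ M i = 0].
Proof.
suff h : forall i, exists M (ss : seq F), (i < c)%N ->
  [/\ (0 < M)%N, forall s, s \in ss -> s != 0 /\ sections L (fun E => H (us i) E *+ M) s &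
      forall y, L y -> exists2 s, s \in ss &
        forall E, val E y -> (ord E s)%:~R + H (us i) E *+ M = 0].
  by have [M /choice[ss hM]] := choice h; exists M, ss.
move=> i; have [ic|] := ltnP i c; last by exists 0%N, [::].
have [|M M0 h] := semiample_avoid ofin (pd_open pd) _ (bH ic).
  by apply: sub_finite_set (fH i) => E /= /eqP.
pose U (f : F) := [set y | exists V, [/\ f != 0, sections L (fun E => H (us i) E *+ M) f, open V, V y &
  forall x E, V x -> val E x -> L x -> (ord E f)%:~R + H (us i) E *+ M = 0]].
have [s hs] : exists s : seq F, forall y, L y -> exists2 f, List.In f s & U f y.
  apply: (proj_compact pd) => y Ly; have [f [V [f0 sf oV Vy hV]]] := h y Ly.
  exists f; split; first by exists V.
  rewrite openE => x [W [_ _ oW Wx hW]]; rewrite /interior nbhsE /=.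
  by exists W => // w Ww; exists W.
exists M, [seq f <- s | `[< f != 0 /\ sections L (fun E => H (us i) E *+ M) f >]] => _; split=> //.
  by move=> f; rewrite mem_filter => /andP[/asboolP].
move=> y Ly; have [f fs [V [f0 sf oV Vy hV]]] := hs y Ly.
exists f => [|E Ey]; last exact: (hV y).
rewrite mem_filter; apply/andP; split; first exact/asboolP.
by elim: s {hs} fs => //= a s IH [->|/IH fs]; rewrite inE ?eqxx ?fs ?orbT.
Qed.

(** If some e_i is at least M_i, then M_i copies of us_i are split off by [sections_factor], at the
    cost of the sections ss_i, which belong to B. This leaves the finitely many weights with all e_i
    < M_i, whose sections are finitely generated over the chart ring. *)
Lemma local_generation (M : nat -> nat) (ss : nat -> seq F) k : (forall i, (i < c)%N -> [/\ (0 < M i)%N,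
      forall s, s \in ss i -> s != 0 /\ sections L (fun E => H (us i) E *+ M i) s &
      forall y, L y -> exists2 s, s \in ss i &
        forall E, val E y -> (ord E s)%:~R + H (us i) E *+ M i = 0]) ->
  (k < m)%N -> A k !=set0 -> forall B : G -> set F, gring B ->
  (forall a, chart_ring (proj_env p z t k) a -> B 0 a) ->
  (forall i s, (i < c)%N -> s \in ss i -> B (us i *+ M i) s) ->
  exists es, forall e f, sections (A k) (H (wt e)) f -> gspan B es (wt e) f.
Proof.
move=> hM km Ak B rB BR Bs; have [_ ch] := pd_chart pd km Ak.
(* A common bound, so that the small exponents range over a finite function type. *)
pose X := (\max_(i < c) M i)%N.
have hX i : (i < c)%N -> (M i <= X)%N by move=> ic; exact: (leq_bigmax (Ordinal ic)).
pose low (e : {ffun 'I_c -> 'I_X.+1}) i := if insub i is Some i' then e i' : nat else 0%N.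
have /choice[gs hgs] : forall e : {ffun 'I_c -> 'I_X.+1}, exists s : seq F, forall f,
    sections (A k) (H (wt (low e))) f -> lin (chart_ring (proj_env p z t k)) s f.
  by move=> e; apply: (sections_finite ch) => //; exact: finite_weight.
pose es := [seq (wt (low e), g) | e <- enum {ffun 'I_c -> 'I_X.+1}, g <- gs e].
exists es; have mB := gspan_mod es rB; have [M0 MD MM] := mB.
have base (e : nat -> nat) f : (forall i, (i < c)%N -> (e i < M i)%N) ->
    sections (A k) (H (wt e)) f -> gspan B es (wt e) f.
  move=> eM; pose e' : {ffun 'I_c -> 'I_X.+1} := [ffun i : 'I_c => inord (e i)].
  have -> : wt e = wt (low e').
    apply: eq_bigr => i _; congr (_ *+ _); rewrite /low valK ffunE inordK //.
    by rewrite ltnS (leq_trans (ltnW (eM i (ltn_ord i)))) // hX.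
  move=> /hgs; apply: lin_min => [||a g Ra gg]; [exact: M0|exact: MD|].
  apply: (gmod_in (h := wt (low e')) mB); first by rewrite subrr; exact: BR.
  apply: (@gspan_in _ _ B es (wt (low e'), g)) => //.
  by apply/allpairsPdep; exists e', g; rewrite mem_enum.
move=> e f; move: {2}(\sum_(i < c) e i)%N (leqnn (\sum_(i < c) e i)%N) => n.
elim: n e f => [|n IH] e f en.
  apply: base => i ic; have [Mi _ _] := hM i ic.
  suff -> : e i = 0%N by [].
  by apply/eqP; rewrite -leqn0 (leq_trans _ en) // (bigD1 (Ordinal ic)) //= leq_addr.
have [eM|] := pselect (forall i, (i < c)%N -> (e i < M i)%N); first exact: base.
move=> /existsNP[i /not_implyP[ic /negP]]; rewrite -leqNgt => Me.
have [Mi ssi ssc] := hM i ic.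
pose e' j := (e j - (if j == i then M i else 0))%N.
have eE j : e j = (e' j + (if j == i then M i else 0))%N.
  by rewrite /e' subnK //; case: eqP => // ->.
have wtE (V : zmodType) (v : nat -> V) : \sum_(j < c) v j *+ e j = \sum_(j < c) v j *+ e' j + v i *+ M i.
  rewrite (eq_bigr (fun j : 'I_c => v j *+ e' j + v j *+ (if (j : nat) == i then M i else 0))); last first.
    by move=> j _; rewrite {1}eE mulrnDr.
  rewrite big_split; congr (_ + _) => /=; rewrite (bigD1 (Ordinal ic)) //= eqxx big1 ?addr0 // => j ji.
  by rewrite (_ : (_ == i) = false) //; apply: contraNF ji => /eqP ji; apply/eqP/val_inj.
move=> sf; rewrite wtE.
have sf' : sections (A k) (fun E => H (wt e') E + H (us i) E *+ M i) f.
  by case: sf => [->|sf]; [left|right=> E mE; rewrite HE -(wtE _ (fun j => H (us j) E)) -HE; exact: sf].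
have e'n : (\sum_(j < c) e' j <= n)%N.
  rewrite -ltnS (leq_trans _ en) //; rewrite (bigD1 (Ordinal ic)) //= [ltnRHS](bigD1 (Ordinal ic)) //=.
  rewrite -addSn; apply: leq_add; first by rewrite eE eqxx -addn1 leq_add2l.
  by apply: leq_sum => j _; rewrite eE leq_addr.
have := sections_factor ch (finite_weight e') _ _ sf' => /(_ (ss i)) hs.
apply: (@lin_min _ _ _ _ _ _ _ f (hs _ _)) => [||a s sa si|s si|y Ay].
- exact: M0.
- exact: MD.
- rewrite mulrC addrC; apply: MM; first exact: Bs.
  exact: IH.
- exact: (ssi s si).1.
- exact: (ssc y (pd_sub pd km Ay)).
Qed.

(** [graded_serre] over the algebra generated by the z and the sections ss_i: on each chart, where
    the t_i / t_k are available too, the hypothesis is [local_generation]. *)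
Lemma cone_generation : L !=set0 -> exists gl : seq (G * F),
  (forall x, x \in gl -> (exists e, x.1 = wt e) /\ sections L (H x.1) x.2) /\
  forall e f, sections L (H (wt e)) f -> galg (ffc Y) gl (wt e) f.
Proof.
move=> [y0 Ly0]; have [M [ss hM]] := bpf_sections.
pose B u : set F := [set f | f = 0 \/ (exists e, u = wt e) /\ sections L (H u) f].
have H0 E : H 0 E = 0.
  have := HE (fun=> 0%N) E; rewrite !big1 //.
have wtD e e' : wt e + wt e' = wt (fun i => e i + e' i)%N.
  by rewrite -big_split; apply: eq_bigr => i _; rewrite mulrnDr.
have HD e e' E : H (wt e + wt e') E = H (wt e) E + H (wt e') E.
  rewrite wtD (HE (fun i => e i + e' i)%N) (HE e) (HE e').
  by under eq_bigr do rewrite mulrnDr; rewrite big_split.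
have rB : gring B.
  split=> [|u|u f g [->|[[e ->] sf]]|u v f g [->|[[e ->] sf]]].
  - right; split; first by exists (fun=> 0%N); rewrite big1.
    by right=> E _; rewrite H0 addr0 -(rmorphN1 (ffc Y)) (ord_cst nY cov) // oppr_eq0 oner_neq0.
  - by left.
  - by rewrite add0r.
  - move=> [->|[_ sg]]; first by rewrite addr0; right; split=> //; exists e.
    by right; split; [exists e|exact: sections_add].
  - by rewrite mul0r; left.
  - move=> [->|[[e' ->] sg]]; first by rewrite mulr0; left.
    right; split; first by exists (fun i => e i + e' i)%N; rewrite wtD.
    by apply: sections_mul sf sg => E _; rewrite HD.
pose cs := [seq (0, z i) | i <- iota 0 p] ++
  flatten [seq [seq (us i *+ M i, s) | s <- ss i] | i <- iota 0 c].
have sHM i : (i < c)%N -> exists2 e, us i *+ M i = wt e & forall E, H (us i *+ M i) E = H (us i) E *+ M i.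
  move=> ic; pose e (j : nat) := if j == i then M i else 0%N.
  have sE (V : zmodType) (v : nat -> V) : \sum_(j < c) v j *+ e j = v i *+ M i.
    rewrite (bigD1 (Ordinal ic)) //= /e eqxx big1 ?addr0 // => j ji.
    by rewrite (_ : (_ == i) = false) //; apply: contraNF ji => /eqP ji; apply/eqP/val_inj.
  exists e => [|E]; first exact/esym/sE.
  by rewrite -[X in H X](sE _ us) HE (sE _ (fun j => H (us j) E)).
have csB x : x \in cs -> B x.1 x.2.
  rewrite mem_cat => /orP[/mapP[i _ ->]|/flatten_mapP[i]].
    right; split; first by exists (fun=> 0%N); rewrite big1.
    have := global_sections (pd_global pd i) => -[->|sz]; first by left.
    by right=> E mE; rewrite /= H0; exact: sz.
  rewrite mem_iota => ic /mapP[s si ->]; have [_ /(_ s si)[s0 sM] _] := hM i ic.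
  right; split=> /=.
    by have [e eE _] := sHM i ic; exists e.
  case: sM => [->|sM]; first by left.
  by right=> E mE; have [e _ ->] := sHM i ic; exact: sM.
have BC u : galg (ffc Y) cs u `<=` B u.
  apply: galg_min => // c'.
  have [->|c0] := eqVneq c' 0; first by left; rewrite rmorph0.
  right; split; first by exists (fun=> 0%N); rewrite big1.
  by right=> E _; rewrite H0 addr0 (ord_cst nY cov).
have mB : gmod (galg (ffc Y) cs) B.
  have [_ B0 BD BM] := rB; split=> // u v a b /BC; exact: BM.
have tn0 : exists2 k, (k < m)%N & t k != 0.
  have [k km Ak] := pd_cover pd Ly0; exists k => //.
  by have [] := pd_chart pd km (ex_intro _ y0 Ak).
pose Ck k := galg (ffc Y) (cs ++ [seq (0, t i / t k) | i <- iota 0 m]).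
have rC k : gring (Ck k) by exact: galg_ring.
have /choice[es hes] : forall k, exists es : seq (G * F), (k < m)%N -> t k != 0 ->
    forall e f, sections (A k) (H (wt e)) f -> gspan (Ck k) es (wt e) f.
  move=> k; have [km|] := ltnP k m; last by exists [::].
  have [tk|tk] := eqVneq (t k) 0; first by exists [::].
  have Ak : A k !=set0 by apply/set0P; apply: contraNneq tk => /(pd_empty pd km) ->.
  have [||es hes] := local_generation hM km Ak (rC k); last by exists es.
    move=> _ [e ->]; have [C1 C0 CD CM] := rC k.
    elim: e => [a|i|e1 IH1 e2 IH2|e1 IH1 e2 IH2] /=.
    - exact: galg_cst.
    - rewrite /proj_env; case: ltnP => ip.
        have := @galg_gen _ _ _ (ffc Y) (cs ++ [seq (0, t i / t k) | i <- iota 0 m]) (0, z i); apply.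
        by rewrite !mem_cat; apply/orP; left; apply/orP; left; apply/mapP; exists i; rewrite ?mem_iota.
      have [im|im] := ltnP (i - p) m; last by rewrite (pd_bound pd) // mul0r.
      have := @galg_gen _ _ _ (ffc Y) (cs ++ [seq (0, t i / t k) | i <- iota 0 m]) (0, t (i - p)%N / t k); apply.
      by rewrite mem_cat; apply/orP; right; apply/mapP; exists (i - p)%N; rewrite ?mem_iota.
    - exact: CD.
    - by rewrite -[0]addr0; exact: CM.
  move=> i s ic si.
  have := @galg_gen _ _ _ (ffc Y) (cs ++ [seq (0, t i / t k) | i <- iota 0 m]) (us i *+ M i, s); apply.
  rewrite !mem_cat; apply/orP; left; apply/orP; right; apply/flatten_mapP; exists i; first by rewrite mem_iota.
  by apply/mapP; exists s.
have [|gl [glB hgl]] := graded_serre (es := flatten [seq es k | k <- iota 0 m]) tn0 mB.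
  move=> k u km tk f [->|[[e ->] sf]].
    by have [] := gspan_mod (flatten [seq es k | k <- iota 0 m]) (rC k).
  apply: (@gspan_sub _ _ (Ck k) (es k)) => //.
    by move=> x xk; apply/flatten_mapP; exists k; rewrite ?mem_iota.
  by apply: hes => //; apply: sections_sub sf; exact: (pd_sub pd).
have B0' x : B x.1 x.2 -> x.2 != 0 -> (exists e, x.1 = wt e) /\ sections L (H x.1) x.2.
  by move=> [->|//]; rewrite eqxx.
(* Generators equal to 0 may sit in degrees outside the monoid and are dropped. *)
exists [seq x <- cs ++ gl | x.2 != 0]; split=> [x|e f sf].
  rewrite mem_filter mem_cat => /andP[x0 /orP[/csB|/glB]] /B0'; exact.
have rg := galg_ring (ffc Y) [seq x <- cs ++ gl | x.2 != 0].
have gen x : x \in cs ++ gl -> galg (ffc Y) [seq x <- cs ++ gl | x.2 != 0] x.1 x.2.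
  move=> xs; have [->|x0] := eqVneq x.2 0; first by have [] := rg.
  by apply: galg_gen; rewrite mem_filter x0.
have : gspan (galg (ffc Y) cs) gl (wt e) f by apply: hgl; right; split=> //; exists e.
apply: (gspan_min (M := galg (ffc Y) [seq x <- cs ++ gl | x.2 != 0])).
  have [_ R0 RD RM] := rg; split=> // u v a b Ca Rb; apply: RM => //.
  move: Ca; apply: galg_min => //; first by move=> c'; exact: galg_cst.
  by move=> x xs; apply: gen; rewrite mem_cat xs.
by move=> x xs; apply: gen; rewrite mem_cat xs orbT.
Qed.

End ConeGenerators.

End Sections.

(** * Dickson's lemma, Gordan's lemma and cones of linearity *)

Lemma dickson (T : eqType) (f : T -> nat -> nat) k (P : set T) : exists s : seq T,
  (forall x, x \in s -> P x) /\
  forall x, P x -> exists2 y, y \in s & forall i, (i < k)%N -> (f y i <= f x i)%N.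
Proof.
elim: k P => [|k IH] P.
  have [[x Px]|n] := pselect (exists x, P x); last first.
    by exists [::]; split=> // x Px; case: n; exists x.
  by exists [:: x]; split=> [y|y _]; [rewrite inE => /eqP ->|exists x; rewrite ?mem_head].
have [s [sP hs]] := IH P.
(* Elements whose last value is at least N lie above a member of s. The finitely many last values
   below N are treated separately by the induction hypothesis. *)
pose N := (\max_(y <- s) f y k)%N.
have hN y : y \in s -> (f y k <= N)%N by move=> ys; apply: leq_bigmax_seq.
have /choice[ss hss] : forall c, exists s : seq T, (forall x, x \in s -> P x /\ f x k = c) /\
    forall x, P x /\ f x k = c -> exists2 y, y \in s & forall i, (i < k)%N -> (f y i <= f x i)%N.
  by move=> c; have [s' [h1 h2]] := IH [set x | P x /\ f x k = c]; exists s'.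
exists (s ++ flatten [seq ss c | c <- iota 0 N]); split=> x.
  by rewrite mem_cat => /orP[/sP //|/flatten_mapP[c _ /(hss c).1 []]].
move=> Px; have [xN|Nx] := ltnP (f x k) N.
  have [y ys hy] := (hss (f x k)).2 x (conj Px erefl); exists y.
    by rewrite mem_cat; apply/orP; right; apply/flatten_mapP; exists (f x k); rewrite ?mem_iota.
  move=> i; rewrite ltnS leq_eqVlt => /predU1P[->|]; last exact: hy.
  by rewrite (((hss (f x k)).1 y ys).2).
have [y ys hy] := hs x Px; exists y; first by rewrite mem_cat ys.
move=> i; rewrite ltnS leq_eqVlt => /predU1P[->|]; last exact: hy.
exact: leq_trans (hN y ys) Nx.
Qed.

Lemma seq_argmin (T : eqType) (f : T -> rat) (s : seq T) : s <> [::] ->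
  exists2 w, w \in s & forall w', w' \in s -> f w <= f w'.
Proof.
elim: s => // w l IHl _; have [->|] := eqVneq l [::].
  by exists w => [|w']; rewrite ?mem_head // inE => /eqP ->.
move=> /eqP /IHl[w1 w1l hw1]; have [ww1|ww1] := leP (f w) (f w1).
  exists w => [|w']; rewrite ?mem_head // inE => /predU1P[->//|/hw1].
  exact: le_trans.
by exists w1 => [|w']; rewrite inE ?w1l ?orbT // => /predU1P[->|/hw1 //]; exact: ltW.
Qed.

Section Gordan.
Context (n : nat).
Implicit Types (u v w : 'cV[int]_n) (b : 'rV[rat]_n) (c : 'rV[int]_n).

Lemma ratvD u v : ratv (u + v) = ratv u + ratv v.
Proof. by apply/matrixP => i j; rewrite !mxE rmorphD. Qed.

Lemma ratv0 : ratv (0 : 'cV[int]_n) = 0.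
Proof. by apply/matrixP => i j; rewrite !mxE. Qed.

Lemma ratvN u : ratv (- u) = - ratv u.
Proof. by apply/matrixP => i j; rewrite !mxE rmorphN. Qed.

Lemma ratvMn u k : ratv (u *+ k) = ratv u *+ k.
Proof. by elim: k => [|k IH]; rewrite ?mulr0n ?ratv0 // !mulrS ratvD IH. Qed.

Lemma pairingDl (u v : 'cV[rat]_n) b : pairing (u + v) b = pairing u b + pairing v b.
Proof. by rewrite /pairing mulmxDr mxE. Qed.

Lemma pairingMnl (u : 'cV[rat]_n) b k : pairing (u *+ k) b = pairing u b *+ k.
Proof.
elim: k => [|k IH]; first by rewrite !mulr0n /pairing mulmx0 mxE.
by rewrite !mulrS pairingDl IH.
Qed.

Lemma pairingN (u : 'cV[rat]_n) b : pairing u (- b) = - pairing u b.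
Proof. by rewrite /pairing mulNmx mxE. Qed.

Lemma integral_form b : exists c, forall u, (0 <= pairing (ratv u) b) = (0 <= (c *m u) 0 0).
Proof.
pose d := \prod_i denq (b 0 i).
have d0 : 0 < d by apply: prodr_gt0 => i _; exact: denq_gt0.
exists (\row_i (numq (b 0 i) * \prod_(k | k != i) denq (b 0 k))) => u.
rewrite -(ler0z rat) -(pmulr_rge0 _ (_ : 0 < d%:~R :> rat)) ?ltr0z //; congr (_ <= _).
rewrite /pairing !mxE mulr_sumr rmorph_sum; apply: eq_bigr => i _.
rewrite !mxE rmorphM /= mulrA; congr (_ * _).
have frac (a x y : rat) : a != 0 -> a * x * (y / a) = y * x by move=> a0; field.
rewrite -{1}[b 0 i]divq_num_den rmorphM /= /d (bigD1 i) //= rmorphM /= frac //.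
by rewrite intr_eq0 denq_eq0.
Qed.

Definition satisfies (bs : seq 'rV[rat]_n) u : Prop := forall b, b \in bs -> 0 <= pairing (ratv u) b.

Lemma satisfiesD bs u v : satisfies bs u -> satisfies bs v -> satisfies bs (u + v).
Proof. by move=> hu hv b hb; rewrite ratvD pairingDl addr_ge0 ?hu ?hv. Qed.

Lemma satisfies0 bs : satisfies bs 0.
Proof. by move=> b _; rewrite ratv0 /pairing mulmx0 mxE. Qed.

(* Dickson's lemma for the positive and negative parts of the coordinates and the values of the
   linear forms: a smaller element of the cone can be subtracted. *)
Lemma gordan (bs : seq 'rV[rat]_n) : exists us : seq 'cV[int]_n,
  (forall u, u \in us -> satisfies bs u) /\
  forall u, satisfies bs u -> exists e : nat -> nat, u = \sum_(i < size us) us`_i *+ e i.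
Proof.
have /choice[c cP] := integral_form.
pose enc u i : nat := if (i < n)%N then
    (if insub i is Some k then (if 0 <= u k 0 then absz (u k 0) else 0%N) else 0%N)
  else if (i < n + n)%N then
    (if insub (i - n)%N is Some k then (if 0 <= u k 0 then 0%N else absz (u k 0)) else 0%N)
  else absz ((c bs`_(i - (n + n)) *m u) 0 0).
have [us [usP hus]] := dickson enc (n + n + size bs) [set u | u != 0 /\ satisfies bs u].
exists us; split=> [u /usP[]//|u].
pose sz u := (\sum_i absz (u i 0%R))%N.
move: {2}(sz u) (leqnn (sz u)) => N; elim: N u => [|N IH] u uN hu.
  suff -> : u = 0 by exists (fun=> 0%N); rewrite big1.
  apply/matrixP => i j; rewrite (ord1 j) mxE; apply/eqP; rewrite -absz_eq0 -leqn0.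
  by rewrite (leq_trans _ uN) // /sz (bigD1 i) //= leq_addr.
have [->|u0] := eqVneq u 0; first by exists (fun=> 0%N); rewrite big1.
have [v vs le_vu] := hus u (conj u0 hu); have [v0 hv] := usP v vs.
have cmp (k : 'I_n) : (absz (u k 0 - v k 0)%R + absz (v k 0%R) = absz (u k 0%R))%N.
  have := le_vu k; rewrite /enc ltn_ord (valK k) => /(_ ltac:(by rewrite -addnA ltn_addr)).
  have := le_vu (n + k)%N; have nk : (n + k < n)%N = false by rewrite ltnNge leq_addr.
  rewrite /enc nk ltn_add2l ltn_ord addKn (valK k).
  move=> /(_ ltac:(by rewrite ltn_addr // ltn_add2l)).
  move: (u k 0) (v k 0) => a b.
  by have [b0|b0] := leP 0 b; have [a0|a0] := leP 0 a; lia.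
have subE (k : 'I_n) : (u - v) k 0 = u k 0 - v k 0 by rewrite mxE [X in _ + X]mxE.
have [||e ue] := IH (u - v).
- rewrite -ltnS; apply: leq_trans uN; rewrite /sz.
  have [k vk] : exists k, v k 0 != 0.
    apply: contrapT => h; move/eqP: v0; apply; apply/matrixP => i j; rewrite (ord1 j) mxE.
    by apply/eqP; apply: contrapT => /negP hi; apply: h; exists i.
  rewrite (bigD1 k) //= [ltnRHS](bigD1 k) //= -addSn; apply: leq_add.
    by rewrite subE; have := cmp k; move: (u k 0) (v k 0) vk => a b; lia.
  by apply: leq_sum => i _; rewrite subE; have := cmp i; lia.
- move=> b hb; rewrite cP mulmxBr mxE [X in _ + X]mxE.
  have ib : (index b bs < size bs)%N by rewrite index_mem.
  have := le_vu (n + n + index b bs)%N; rewrite ltn_add2l ib => /(_ isT).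
  rewrite /enc !ltnNge -addnA leq_addr /= addnA leq_addr /= addKn nth_index //.
  move: (hu b hb) (hv b hb); rewrite !cP.
  by move: ((c b *m u) 0 0) ((c b *m v) 0 0) => x y; lia.
have vi : (index v us < size us)%N by rewrite index_mem.
exists (fun i => e i + (i == index v us))%N; rewrite -[LHS](subrK v) ue.
rewrite [in RHS](eq_bigr (fun i : 'I_(size us) => us`_i *+ e i + us`_i *+ (i == index v us :> nat))).
  rewrite big_split /=; congr (_ + _); rewrite (bigD1 (Ordinal vi)) //= eqxx nth_index // big1 ?addr0 // => i.
  by move=> iv; rewrite (_ : (_ == _) = false) //; apply: contraNF iv => /eqP iv; apply/eqP/val_inj.
by move=> i _; rewrite mulrnDr.
Qed.

End Gordan.

Section Minima.
Context (n : nat) (sigma : set 'rV[rat]_n).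
Context (psigma : pointed_cone sigma).
Implicit Types (u : 'cV[rat]_n) (B : set 'rV[rat]_n).

Lemma is_min_uniq B u p q : is_min B u p -> is_min B u q -> p = q.
Proof.
by move=> [[v Bv <-] hp] [[w Bw <-] hq]; apply/le_anti; rewrite hp ?hq.
Qed.

Lemma min_onE B u q : is_min B u q -> min_on B u = q.
Proof.
move=> h; apply: is_min_uniq (h); rewrite /min_on.
by case: xgetP => [p _ //|nq]; case: (nq q).
Qed.

Lemma cone0 : sigma 0.
Proof.
have [[k [s ->]] _] := psigma; exists 0; last by rewrite mul0mx.
by move=> i; rewrite mxE.
Qed.

Lemma min_on_tail u : dual_cone sigma u -> min_on sigma u = 0.
Proof.
move=> du; apply: min_onE; split; last exact: du.
by exists 0; [exact: cone0|rewrite /pairing mul0mx mxE].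
Qed.

Lemma min_on_set0 u : min_on set0 u = 0.
Proof. by rewrite /min_on; case: xgetP => // q _ [[v []]]. Qed.

(** The generators of a polytope part of B, not necessarily all vertices. They suffice to compute
    minima, because u is nonnegative on the tail cone. *)
Lemma polyhedron_vertices B : sigma_polyhedron sigma B -> exists vs : seq 'rV[rat]_n,
  [/\ vs <> [::], forall v, v \in vs -> B v & forall u v, dual_cone sigma u -> v \in vs ->
    (forall w, w \in vs -> pairing u v <= pairing u w) -> is_min B u (pairing u v)].
Proof.
move=> [k [s ->]]; exists [seq row i s | i <- enum 'I_k.+1]; split.
- by move=> /(congr1 size); rewrite size_map size_enum_ord.
- move=> _ /mapP[i _ ->]; exists (row i s); last by exists 0; [exact: cone0|rewrite addr0].
  exists (delta_mx 0 i); last by rewrite -rowE.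
  split=> [j|]; first by rewrite mxE eqxx ler0n.
  rewrite (bigD1 i) //= big1 ?mxE ?eqxx ?addr0 // => j ji.
  by rewrite mxE (negbTE ji).
move=> u v du /mapP[i _ ->] hmin; split.
  exists (row i s) => //; exists (row i s); last by exists 0; [exact: cone0|rewrite addr0].
  exists (delta_mx 0 i); last by rewrite -rowE.
  split=> [j|]; first by rewrite mxE eqxx ler0n.
  rewrite (bigD1 i) //= big1 ?mxE ?eqxx ?addr0 // => j ji.
  by rewrite mxE (negbTE ji).
move=> _ [_ [c [c0 c1] <-] [w sw <-]].
rewrite pairingD -[leLHS]addr0; apply: lerD; last exact: du.
rewrite pairing_mul -[leLHS]mul1r -c1 mulr_suml.
by apply: ler_sum => j _; apply: ler_wpM2l => //; apply: hmin; apply/mapP; exists j; rewrite ?mem_enum.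
Qed.

Lemma dual_cone_gens : exists vs : seq 'rV[rat]_n, (forall v, v \in vs -> sigma v) /\
  forall u, (forall v, v \in vs -> 0 <= pairing u v) -> dual_cone sigma u.
Proof.
have [[k [s ->]] _] := psigma; exists [seq row i s | i <- enum 'I_k]; split.
  move=> _ /mapP[i _ ->]; exists (delta_mx 0 i); last by rewrite -rowE.
  by move=> j; rewrite mxE ler0n.
move=> u hu _ [c c0 <-]; rewrite pairing_mul; apply: sumr_ge0 => i _.
by apply: mulr_ge0 => //; apply: hu; apply/mapP; exists i; rewrite ?mem_enum.
Qed.

(** A cone is given by choosing for every polyhedron a generator w at which the minimum is attained,
    that is, by the inequalities u(w' - w) >= 0. There min is the linear form w. *)
Lemma linearity_cones (T : eqType) (s : seq T) (B : T -> set 'rV[rat]_n) :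
  (forall E, E \in s -> B E = set0 \/ sigma_polyhedron sigma (B E)) ->
  exists bss : seq (seq 'rV[rat]_n),
    [/\ forall u : 'cV[int]_n, dual_cone sigma (ratv u) -> exists2 bs, bs \in bss & satisfies bs u,
        forall bs (u : 'cV[int]_n), bs \in bss -> satisfies bs u -> dual_cone sigma (ratv u) &
        forall bs (u v : 'cV[int]_n) E, bs \in bss -> satisfies bs u -> satisfies bs v -> E \in s ->
          min_on (B E) (ratv (u + v)) = min_on (B E) (ratv u) + min_on (B E) (ratv v)].
Proof.
have [vs [vsS hvs]] := dual_cone_gens.
elim: s => [|E s IH] hB.
  exists [:: vs]; split=> [u du|bs u|//].
    by exists vs; [rewrite mem_head|move=> v /vsS; exact: du].
  by rewrite inE => /eqP -> hu; exact: hvs.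
have [|bss [h1 h2 h3]] := IH; first by move=> E' E's; apply: hB; rewrite inE E's orbT.
have [E0|pE] := hB E (mem_head _ _).
  exists bss; split=> // bs u v E' hbs hu hv; rewrite inE => /predU1P[->|]; last exact: (h3 bs).
  by rewrite E0 !min_on_set0 addr0.
have [ws [ws0 wsB hws]] := polyhedron_vertices pE.
exists [seq bs ++ [seq w' - w | w' <- ws] | bs <- bss, w <- ws]; split.
- move=> u du; have [bs hbs hu] := h1 u du.
  have [w ww wmin] := seq_argmin (pairing (ratv u)) ws0.
  exists (bs ++ [seq w' - w | w' <- ws]); first by apply/allpairsPdep; exists bs, w.
  move=> b; rewrite mem_cat => /orP[/hu //|/mapP[w' w's ->]].
  by rewrite pairingD pairingN subr_ge0 wmin.
- move=> _ u /allpairsPdep[bs [w [hbs ww ->]]] hu; apply: (h2 bs) => // b hb.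
  by apply: hu; rewrite mem_cat hb.
move=> _ u v E' /allpairsPdep[bs [w [hbs ww ->]]] hu hv.
have su : satisfies bs u by move=> b hb; apply: hu; rewrite mem_cat hb.
have sv : satisfies bs v by move=> b hb; apply: hv; rewrite mem_cat hb.
rewrite inE => /predU1P[->|]; last exact: (h3 bs).
have minE x : satisfies (bs ++ [seq w' - w | w' <- ws]) x -> min_on (B E) (ratv x) = pairing (ratv x) w.
  move=> hx; apply: min_onE; apply: hws => //.
    by apply: (h2 bs) => // b hb; apply: hx; rewrite mem_cat hb.
  move=> w' w's; rewrite -subr_ge0 -pairingN -pairingD; apply: hx.
  by rewrite mem_cat; apply/orP; right; apply/mapP; exists w'.
rewrite !minE //; last exact: satisfiesD.
by rewrite ratvD pairingDl.
Qed.

End Minima.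

Section Generators.
Context (K : closedFieldType) (Y : integral_space K) (nY : normal_variety Y).
Local Notation F := (funfield Y).
Context (cov : forall y : Y, exists A (r : nat -> F) n, fchart A r n /\ A y).
Context (ofin : forall a : F, a != 0 -> finite_set [set E : prime_divisor Y | ord E a != 0]).
Context (n : nat) (D : poldiv Y n) (ppD : ppdiv D).
Context (p m : nat) (z t : nat -> F) (A : nat -> set Y) (pd : proj_data (Loc D) p m z t A).

Lemma evaluation_finite (u : 'cV[rat]_n) : dual_cone (tail D) u ->
  finite_set [set E | evaluation D u E != 0].
Proof.
have [[pt _ fD] _ _ _] := ppD => du; apply: sub_finite_set fD => E /=.
by move=> h e; move: h; rewrite /evaluation e (min_on_tail pt du) eqxx.
Qed.

Lemma grpart_generated : Loc D !=set0 -> exists gl : seq ('cV[int]_n * F),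
  (forall x, x \in gl -> grpart D x.1 x.2) /\
  forall u f, grpart D u f -> galg (ffc Y) gl u f.
Proof.
move=> L0; have [[pt cD fD] _ saD _] := ppD.
have /finite_seqP[s sE] := fD.
have [|bss [h1 h2 h3]] := @linearity_cones n (tail D) pt (prime_divisor Y) s (coef D).
  by move=> E _; exact: cD.
pose H (u : 'cV[int]_n) := evaluation D (ratv u).
(* Outside s the coefficient is the tail cone, where the minimum is 0. *)
have Hadd bs u v E : bs \in bss -> satisfies bs u -> satisfies bs v -> H (u + v) E = H u E + H v E.
  move=> hbs su sv; have [Es|Es] := boolP (E \in s); first exact: (h3 bs).
  have cE : coef D E = tail D.
    apply: contrapT => ne; have : [set E | coef D E <> tail D] E by [].
    by rewrite sE /= (negbTE Es).
  rewrite /H /evaluation cE !(min_on_tail pt) ?addr0 //; apply: (h2 bs) => //.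
  exact: satisfiesD.
have one bs : bs \in bss -> exists gl : seq ('cV[int]_n * F),
    (forall x, x \in gl -> grpart D x.1 x.2) /\
    forall u f, satisfies bs u -> grpart D u f -> galg (ffc Y) gl u f.
  move=> hbs; have [us [ush husE]] := gordan bs.
  have su i : satisfies bs us`_i.
    have [iu|iu] := ltnP i (size us); first by apply: ush; rewrite mem_nth.
    by rewrite nth_default //; exact: satisfies0.
  have sw (e : nat -> nat) (I : seq 'I_(size us)) : satisfies bs (\sum_(i <- I) us`_i *+ e i) /\
      forall E, H (\sum_(i <- I) us`_i *+ e i) E = \sum_(i <- I) H us`_i E *+ e i.
    have sx i k : satisfies bs (us`_i *+ k) /\ forall E, H (us`_i *+ k) E = H us`_i E *+ k.
      elim: k => [|k [IH1 IH2]]; first split=> [|E]; first exact: satisfies0.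
        by rewrite !mulr0n /H /evaluation ratv0 min0.
      split=> [|E]; rewrite !mulrS; first exact: satisfiesD.
      by rewrite (Hadd bs) // IH2.
    elim: I => [|i I [IH1 IH2]]; first split=> [|E]; rewrite ?big_nil; first exact: satisfies0.
      by rewrite /H /evaluation ratv0 min0.
    have [s1 s2] := sx i (e i).
    split=> [|E]; rewrite !big_cons; first exact: satisfiesD.
    by rewrite (Hadd bs) // IH2 s2.
  have [|||gl [glP hgl]] := @cone_generation _ _ nY cov ofin (Loc D) p m z t A pd _ (size us) (nth 0 us) H _ _ _ L0.
  - by move=> e E; exact: (sw e _).2.
  - by move=> i; apply: evaluation_finite; apply: (h2 bs) => //.
  - by move=> i _; apply: (saD _ _).2; apply: (h2 bs).
  exists gl; split=> [x /glP[[e xe] sx]|u f hu [_ sf]].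
    split=> //; rewrite xe; apply: (h2 bs) => //; exact: (sw e _).1.
  have [e ue] := husE u hu; rewrite ue; apply: hgl; rewrite -ue.
  by case: sf => [->|sf]; [left|right].
have [gl [glP hgl]] : exists gl : seq ('cV[int]_n * F),
    (forall x, x \in gl -> grpart D x.1 x.2) /\
    forall bs u f, bs \in bss -> satisfies bs u -> grpart D u f -> galg (ffc Y) gl u f.
  elim: (bss) one => [|bs l IH] one; first by exists [::].
  have [gl1 [g1 k1]] := one bs (mem_head _ _).
  have [|gl2 [g2 k2]] := IH; first by move=> b bl; apply: one; rewrite inE bl orbT.
  exists (gl1 ++ gl2); split=> [x|b u f].
    by rewrite mem_cat => /orP[/g1|/g2].
  have sub (l1 : seq ('cV[int]_n * F)) : {subset l1 <= gl1 ++ gl2} ->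
      galg (ffc Y) l1 u `<=` galg (ffc Y) (gl1 ++ gl2) u.
    move=> hl; apply: galg_min; [exact: galg_ring|by move=> c; exact: galg_cst|].
    by move=> x /hl; exact: galg_gen.
  rewrite inE => /predU1P[->|bl] su gf.
    by apply: (sub gl1); [move=> x xl; rewrite mem_cat xl|exact: k1].
  by apply: (sub gl2); [move=> x xl; rewrite mem_cat xl orbT|exact: (k2 b)].
exists gl; split=> // u f gf; have [bs hbs su] := h1 u gf.1.
exact: (hgl bs).
Qed.

End Generators.

(** * The affine variety X(D) *)

Section TorusPolynomials.
Context (K : closedFieldType) (n : nat).
Implicit Types (t s : torus K n) (u : 'cV[int]_n) (e : pexp K).

Lemma nonroot (p : {poly K}) : p != 0 -> exists2 x, x != 0 & p.[x] != 0.
Proof.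
move=> p0; have /closed_nonrootP[x] : p * 'X != 0 by rewrite mulf_neq0 // polyX_eq0.
rewrite /root hornerM hornerX mulf_eq0 negb_or => /andP[px x0].
by exists x.
Qed.

Definition tupd_def t (i : 'I_n) (c : K) : 'rV[K]_n := \row_k (if k == i then c else tcoord t 0 k).

Lemma tupd_subproof t i c : c != 0 -> torus_set (tupd_def t i c).
Proof. by move=> c0 k; rewrite mxE; case: ifP => // _; exact: tcoord_neq0. Qed.

Definition tupd t i c (c0 : c != 0) : torus K n :=
  exist (fun y => y \in @torus_set K n) _ (mem_set (tupd_subproof t i c0)).

Lemma tupdE t i c (c0 : c != 0) k : tcoord (tupd t i c0) 0 k = if k == i then c else tcoord t 0 k.
Proof. by rewrite /tcoord /= mxE. Qed.

Lemma tupd_id t i : tupd t i (tcoord_neq0 t i) = t.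
Proof.
apply: val_inj; apply/rowP => k; have := tupdE t i (tcoord_neq0 t i) k; rewrite /tcoord /= => ->.
by case: eqP => // ->.
Qed.

(** As a function of one torus coordinate a character is a Laurent monomial; the power c^N clears a
    negative exponent. *)
Lemma tchar_polynomial u t i : exists (N : nat) (q : {poly K}), forall c (c0 : c != 0),
  c ^+ N * tchar u (tupd t i c0) = q.[c].
Proof.
pose b := \prod_(k | k != i) tcoord t 0 k ^ u k 0.
have tE c (c0 : c != 0) : tchar u (tupd t i c0) = c ^ u i 0 * b.
  rewrite /tchar (bigD1 i) //= tupdE eqxx; congr (_ * _).
  by apply: eq_bigr => k ki; rewrite tupdE (negbTE ki).
exists (absz (u i 0)), (if 0 <= u i 0 then b *: 'X^(absz (u i 0) + absz (u i 0)) else b%:P) => c c0.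
rewrite tE mulrA exprnP -expfzDr //.
case: (lerP 0 (u i 0)) => ui; last first.
  by rewrite hornerC (_ : _ + _ = 0) ?expr0z ?mul1r // ltz0_abs // addNr.
by rewrite hornerZ hornerXn mulrC exprnP; congr (_ * _ ^ _); rewrite PoszD gez0_abs.
Qed.

Lemma torus_polynomial (us : nat -> 'cV[int]_n) (a : nat -> K) e t i :
  exists (N : nat) (q : {poly K}), forall c (c0 : c != 0),
    c ^+ N * pv (fun k => tchar (us k) (tupd t i c0) * a k) e = q.[c].
Proof.
elim: e => [x|k|e1 [N1 [q1 h1]] e2 [N2 [q2 h2]]|e1 [N1 [q1 h1]] e2 [N2 [q2 h2]]].
- by exists 0%N, x%:P => c c0; rewrite mul1r hornerC.
- have [N [q h]] := tchar_polynomial (us k) t i.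
  by exists N, (a k *: q) => c c0; rewrite hornerZ -(h c c0) /pv /= mulrA mulrC.
- exists (N1 + N2)%N, ('X^N2 * q1 + 'X^N1 * q2) => c c0.
  by rewrite hornerD !hornerM !hornerXn -(h1 c c0) -(h2 c c0) exprD /pv /=; ring.
- exists (N1 + N2)%N, (q1 * q2) => c c0.
  by rewrite hornerM -(h1 c c0) -(h2 c c0) exprD mulrACA.
Qed.

(* The torus is irreducible: the coordinates of the two elements are made equal one by one. *)
Lemma torus_irreducible (us : nat -> 'cV[int]_n) (a : nat -> K) e1 e2 t1 t2 :
  pv (fun k => tchar (us k) t1 * a k) e1 != 0 -> pv (fun k => tchar (us k) t2 * a k) e2 != 0 ->
  exists t, pv (fun k => tchar (us k) t * a k) e1 != 0 /\ pv (fun k => tchar (us k) t * a k) e2 != 0.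
Proof.
move=> h1 h2.
suff tt : forall j, (j <= n)%N -> exists t t',
    [/\ pv (fun k => tchar (us k) t * a k) e1 != 0, pv (fun k => tchar (us k) t' * a k) e2 != 0 &
    forall k : 'I_n, (k < j)%N -> tcoord t 0 k = tcoord t' 0 k].
  have [t [t' [ht ht' tt']]] := tt n (leqnn n).
  exists t; split=> //; suff -> : t = t' by [].
  by apply: val_inj; apply/rowP => k; exact: tt'.
elim=> [|j IH] jn; first by exists t1, t2.
have [t [t' [ht ht' tt']]] := IH (ltnW jn).
pose i := Ordinal jn.
have [N [q hq]] := torus_polynomial us a e1 t i; have [N' [q' hq']] := torus_polynomial us a e2 t' i.
have q0 : q != 0.
  apply: contraNneq ht => q0; have := hq _ (tcoord_neq0 t i).
  by rewrite tupd_id q0 horner0 => /eqP; rewrite mulf_eq0 expf_eq0 (negbTE (tcoord_neq0 t i)) andbF.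
have q'0 : q' != 0.
  apply: contraNneq ht' => q0'; have := hq' _ (tcoord_neq0 t' i).
  by rewrite tupd_id q0' horner0 => /eqP; rewrite mulf_eq0 expf_eq0 (negbTE (tcoord_neq0 t' i)) andbF.
have [c c0] : exists2 c, c != 0 & (q * q').[c] != 0 by apply: nonroot; rewrite mulf_neq0.
rewrite hornerM mulf_eq0 negb_or -(hq c c0) -(hq' c c0) !mulf_eq0 !negb_or.
move=> /andP[/andP[_ h] /andP[_ h']].
exists (tupd t i c0), (tupd t' i c0); split=> // k; rewrite ltnS leq_eqVlt !tupdE.
have [->|ki] := eqVneq k i; first by [].
by move=> /predU1P[kj|kj]; [move/eqP: ki; case; apply: val_inj|exact: tt'].
Qed.

Lemma tchar_separates u v : u != v -> exists t, tchar u t != tchar v t.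
Proof.
move=> uv; have [i ui] : exists i, u i 0 != v i 0.
  apply: contrapT => h; move/eqP: uv; apply; apply/colP => i.
  by apply/eqP; apply: contrapT => /negP ui; apply: h; exists i.
have d0 : (0 < absz (u i 0 - v i 0)%R)%N by rewrite absz_gt0 subr_eq0.
have [c c0] : exists2 c : K, c != 0 & ('X^(absz (u i 0 - v i 0)%R) - 1).[c] != 0.
  by apply: nonroot; rewrite monic_neq0 // monic_Xn_sub_1.
rewrite hornerD hornerN hornerXn hornerC subr_eq0 => cd.
exists (tupd (tone K n) i c0).
have tE w : tchar w (tupd (tone K n) i c0) = c ^ w i 0.
  rewrite /tchar (bigD1 i) //= tupdE eqxx big1 ?mulr1 // => k ki.
  by rewrite tupdE (negbTE ki) /tcoord /= mxE exp1rz.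
rewrite !tE; apply: contraNneq cd => e.
have e1 : c ^ (u i 0 - v i 0) = 1 by rewrite expfzDr // e -expfzDr // subrr.
case: (lerP 0 (u i 0 - v i 0)) => h; first by rewrite exprnP gez0_abs // e1.
by rewrite exprnP ltz0_abs // -invr_expz e1 invr1.
Qed.

End TorusPolynomials.

Section PPSpace.
Context (K : closedFieldType) (Y : integral_space K) (nY : normal_variety Y).
Local Notation F := (funfield Y).
Context (cov : forall y : Y, exists A (r : nat -> F) n, fchart A r n /\ A y).
Context (n : nat) (D : poldiv Y n) (ppD : ppdiv D).
Implicit Types (u v w : 'cV[int]_n) (f g h : F) (y : Y) (x : ppspace D).

Lemma evaluation_superadd (u v : 'cV[rat]_n) E : dual_cone (tail D) u -> dual_cone (tail D) v ->
  evaluation D u E + evaluation D v E <= evaluation D (u + v) E.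
Proof.
have [[pt cD _] _ _ _] := ppD => du dv; rewrite /evaluation.
have [->|pE] := cD E; first by rewrite !min_on_set0 addr0.
have duv : dual_cone (tail D) (u + v) by move=> a ta; rewrite pairingDl addr_ge0 ?du ?dv.
have [_ hu] := polyhedron_min pt du pE; have [_ hv] := polyhedron_min pt dv pE.
have [[a Ba <-] _] := polyhedron_min pt duv pE.
by rewrite pairingDl lerD ?hu ?hv.
Qed.

Lemma dual_coneD (s : set 'rV[rat]_n) (u v : 'cV[rat]_n) :
  dual_cone s u -> dual_cone s v -> dual_cone s (u + v).
Proof. by move=> du dv a sa; rewrite pairingDl addr_ge0 ?du ?dv. Qed.

Lemma grpartM u v f g : grpart D u f -> grpart D v g -> grpart D (u + v) (f * g).
Proof.
move=> [du sf] [dv sg]; split; first by rewrite ratvD; exact: dual_coneD.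
by apply: (sections_mul nY cov) sf sg => E _; rewrite ratvD evaluation_superadd.
Qed.

Lemma grpartD u f g : grpart D u f -> grpart D u g -> grpart D u (f + g).
Proof. by move=> [du sf] [_ sg]; split; [exact: du|exact: (sections_add nY cov sf sg)]. Qed.

Lemma grpart_cst c : grpart D 0 (ffc Y c).
Proof.
have [->|c0] := eqVneq c 0.
  by rewrite rmorph0; split; [move=> a _; rewrite ratv0 /pairing mulmx0 mxE|left].
split; first by move=> a _; rewrite ratv0 /pairing mulmx0 mxE.
by right=> E _; rewrite (ord_cst nY cov) // add0r ratv0 /evaluation min0.
Qed.

Lemma grpartZ u c f : grpart D u f -> grpart D u (ffc Y c * f).
Proof. by move=> gf; rewrite -[u]add0r; apply: grpartM => //; exact: grpart_cst. Qed.

Lemma grpart0 u : dual_cone (tail D) (ratv u) -> grpart D u 0.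
Proof. by move=> du; split=> //; left. Qed.

Lemma grpartX u f k : grpart D u f -> grpart D (u *+ k) (f ^+ k).
Proof.
move=> gf; elim: k => [|k IH]; first exact: (grpart_cst 1).
by rewrite mulrS exprS; exact: grpartM.
Qed.

Lemma point1 x : val x 0 1 = 1.
Proof. by case: x => x /= /set_mem[]. Qed.

Lemma pointD x u f g : grpart D u f -> grpart D u g -> val x u (f + g) = val x u f + val x u g.
Proof. by case: x => x /= /set_mem[_ xD _ _ _] gf gg; exact: (xD _ _ _ gf gg (grpartD gf gg)). Qed.

Lemma pointZ x u c f : grpart D u f -> val x u (ffc Y c * f) = c * val x u f.
Proof. by case: x => x /= /set_mem[_ _ xZ _ _] gf; apply: xZ => //; exact: grpartZ. Qed.

Lemma pointM x u v f g : grpart D u f -> grpart D v g ->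
  val x (u + v) (f * g) = val x u f * val x v g.
Proof. by case: x => x /= /set_mem[_ _ _ xM _] gf gg; apply: xM => //; exact: grpartM. Qed.

Lemma point_out x u f : ~ grpart D u f -> val x u f = 0.
Proof. by case: x => x /= /set_mem[_ _ _ _]; exact. Qed.

Lemma point0 x u : val x u 0 = 0.
Proof.
have [g0|/point_out //] := pselect (grpart D u 0).
by have := pointZ x 0 g0; rewrite rmorph0 mul0r mul0r.
Qed.

Lemma point_cst x c : val x 0 (ffc Y c) = c.
Proof. by rewrite -[ffc Y c]mulr1 pointZ ?point1 ?mulr1 //; exact: (grpart_cst 1). Qed.

Lemma pointX x u f k : grpart D u f -> val x (u *+ k) (f ^+ k) = val x u f ^+ k.
Proof.
move=> gf; elim: k => [|k IH]; first exact: point1.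
by rewrite mulrS !exprS pointM ?IH //; exact: grpartX.
Qed.

Lemma point_ext x x' : (forall u f, grpart D u f -> val x u f = val x' u f) -> x = x'.
Proof.
move=> h; apply: val_inj; apply/funext => u; apply/funext => f.
by have [/h //|nf] := pselect (grpart D u f); rewrite !point_out.
Qed.

Lemma point_reg u f U : open U -> reg U (fun x : ppspace D => val x u f).
Proof.
move=> oU x Ux; have [gf|nf] := pselect (grpart D u f).
  exists setT, (fun x : ppspace D => val x u f), (fun=> 1); split=> //.
  - by apply: subalg_gen; exists u, f.
  - exact: subalg_cst.
  - by split=> [|z _ _ _]; rewrite ?oner_neq0 // divr1.
exists setT, (fun=> 0), (fun=> 1); split=> //; try exact: subalg_cst.
by split=> [|z _ _ _]; rewrite ?oner_neq0 // point_out // mul0r.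
Qed.

Section Coordinates.
Context (gl : seq ('cV[int]_n * F)).
Context (glP : forall p, p \in gl -> grpart D p.1 p.2).
Context (glG : forall u f, grpart D u f -> galg (ffc Y) gl u f).

Definition pp_coord x i : K := val x (nth (0, 0) gl i).1 (nth (0, 0) gl i).2.

Lemma pp_coord_poly u f : exists e, forall x, val x u f = pv (pp_coord x) e.
Proof.
have [/glG gf|nf] := pselect (grpart D u f); last by exists (PC 0) => x; rewrite point_out.
pose B u : set F := [set f | f = 0 \/ grpart D u f /\ exists e, forall x, val x u f = pv (pp_coord x) e].
have : B u f.
  apply: (@galg_min _ _ _ (ffc Y) B gl) gf => [|c|g ggl].
  - split=> [|v|v a b|v w a b].
    + right; rewrite -(rmorphN1 (ffc Y)); split; first exact: grpart_cst.
      by exists (PC (-1)) => x; rewrite point_cst.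
    + by left.
    + move=> [->|[ga [e1 h1]]]; first by rewrite add0r.
      move=> [->|[gb [e2 h2]]]; first by rewrite addr0; right; split=> //; exists e1.
      right; split; first exact: grpartD.
      by exists (PA e1 e2) => x; rewrite pointD // h1 h2.
    + move=> [->|[ga [e1 h1]]]; first by rewrite mul0r; left.
      move=> [->|[gb [e2 h2]]]; first by rewrite mulr0; left.
      right; split; first exact: grpartM.
      by exists (PM e1 e2) => x; rewrite pointM // h1 h2.
  - right; split; first exact: grpart_cst.
    by exists (PC c) => x; rewrite point_cst.
  right; split; first exact: glP.
  by exists (PV (index g gl)) => x; rewrite /pv /= /pp_coord nth_index.
by move=> [->|[_ //]]; exists (PC 0) => x; rewrite point0.
Qed.

Lemma pp_coord_inj x x' : pp_coord x =1 pp_coord x' -> x = x'.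
Proof.
move=> e; apply: point_ext => u f _; have [p hp] := pp_coord_poly u f.
by rewrite !hp; exact: pv_ext.
Qed.

(** Germs are fractions in the generators by definition of X(D). A K-point v of the coordinate ring
    defines an algebra homomorphism by evaluating at v an expression that represents the given
    element; [rel] shows that the choice of expression does not matter. *)
Lemma pp_chart : affine_chart [set: ppspace D] pp_coord (size gl).
Proof.
split=> [|i|x i gi|x U|v hv].
- exact: openT.
- exact/point_reg/openT.
- by rewrite /pp_coord nth_default // point0.
- apply: local_fractions_gen => {}x _ _ -> _; split.
    by exists (PC 1); rewrite /pv /= ?oner_neq0.
  move=> _ [u [f [_ ->]]]; have [e he] := pp_coord_poly u f.
  have := @chart_germ_poly _ (ppspace D) setT pp_coord x e.
  by apply: chart_germ_eq; exists (PC 1); rewrite /pv /= ?oner_neq0 // => y _ _; exact: he.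
have /choice[e he] : forall p : 'cV[int]_n * F, exists e, forall x, val x p.1 p.2 = pv (pp_coord x) e.
  by move=> [u f]; exact: pp_coord_poly.
have {}he x u f : val x u f = pv (pp_coord x) (e (u, f)) by exact: (he (u, f) x).
have rel e1 e2 : (forall x, pv (pp_coord x) e1 = pv (pp_coord x) e2) -> pv v e1 = pv v e2.
  move=> h; have := hv (PA e1 (PM (PC (-1)) e2)).
  rewrite /pv /= -!/(pv _ _) !mulN1r => hh; apply/eqP; rewrite -subr_eq0; apply/eqP.
  by apply: hh => x _; rewrite mulN1r -!/(pv _ _) h subrr.
pose X u f := if `[< grpart D u f >] then pv v (e (u, f)) else 0.
have isX : is_point D X.
  rewrite /X; split.
  - rewrite asboolT; last exact: grpart1.
    by rewrite (rel _ (PC 1)) // => x; rewrite -he point1.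
  - move=> u f g gf gg gfg; rewrite !asboolT //.
    by rewrite (rel _ (PA (e (u, f)) (e (u, g)))) // => x; rewrite -he pointD // !he.
  - move=> u c f gf gcf; rewrite !asboolT //.
    by rewrite (rel _ (PM (PC c) (e (u, f)))) // => x; rewrite -he (pointZ x c gf) !he.
  - move=> u w f g gf gg gfg; rewrite !asboolT //.
    by rewrite (rel _ (PM (e (u, f)) (e (w, g)))) // => x; rewrite -he pointM // !he.
  - by move=> u f nf; rewrite asboolF.
exists (exist (fun z => z \in points D) X (mem_set isX)) => // i.
rewrite /pp_coord /= /X; case: asboolP => [_|ng].
  by rewrite (rel _ (PV i)) // => x; rewrite -he.
have [gi|gi] := ltnP i (size gl); first by case: ng; apply: glP; rewrite mem_nth.
by rewrite -[RHS](rel (PC 0) (PV i)) // => x; rewrite /pv /= /pp_coord nth_default // point0.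
Qed.

End Coordinates.

(** Over these points every D(u) is trivial, so evaluation at y is defined on all of A and gives a
    point of X(D). *)
Definition general : set Y := [set y | forall E, coef D E <> tail D -> ~ val E y].

Lemma general_open : open general /\ general !=set0.
Proof. by have [[_ _ fD] _ _ _] := ppD; exact: primes_avoid. Qed.

Lemma coef_tail_neq0 E : coef D E = set0 -> coef D E <> tail D.
Proof. by move=> -> e; have [[pt _ _] _ _ _] := ppD; have := cone0 pt; rewrite -e. Qed.

Lemma general_Loc : general `<=` Loc D.
Proof. by move=> y gy E E0; apply: gy; exact: coef_tail_neq0. Qed.

Lemma Loc_open : open (Loc D) /\ Loc D !=set0.
Proof.
have [[_ _ fD] _ _ _] := ppD; apply: primes_avoid.
by apply: sub_finite_set fD => E; exact: coef_tail_neq0.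
Qed.

Lemma grpart_general u f y : general y -> grpart D u f -> regular_at y f.
Proof.
have [[pt _ _] _ _ _] := ppD => gy [du].
move=> [->|sf]; first exact: (regular_at_cst y 0).
have [->|f0] := eqVneq f 0; first exact: (regular_at_cst y 0).
apply/(regular_at_ord nY cov) => // E Ey.
have cE : coef D E = tail D by apply: contrapT => /gy/(_ Ey).
have := sf E; rewrite /evaluation cE (min_on_tail pt du) addr0 ler0z; apply.
by exists y; split=> //; exact: general_Loc.
Qed.

Lemma general_point_subproof y : general y ->
  is_point D (fun u f => if `[< grpart D u f >] then ev y f else 0).
Proof.
move=> gy; split.
- by rewrite asboolT ?ev1 //; exact: grpart1.
- by move=> u f g gf gg gfg; rewrite !asboolT // evD //; [exact: (grpart_general gy gf)|exact: (grpart_general gy gg)].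
- move=> u c f gf gcf; rewrite !asboolT // evM; last exact: (grpart_general gy gf).
    by rewrite (ev_cst y c).
  exact: (regular_at_cst y c).
- move=> u w f g gf gg gfg; rewrite !asboolT // evM //.
    exact: (grpart_general gy gf).
  exact: (grpart_general gy gg).
- by move=> u f nf; rewrite asboolF.
Qed.

Definition general_point y (gy : general y) : ppspace D :=
  exist (fun z => z \in points D) _ (mem_set (general_point_subproof gy)).

Lemma general_pointE y (gy : general y) u f : grpart D u f -> val (general_point gy) u f = ev y f.
Proof. by move=> gf; rewrite /= asboolT. Qed.

Lemma ppspace_neq0 : [set: ppspace D] !=set0.
Proof. by have [_ [y gy]] := general_open; exists (general_point gy). Qed.

Lemma homogeneous_sum (gl : seq ('cV[int]_n * F)) e : (forall p, p \in gl -> grpart D p.1 p.2) ->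
  exists l : seq ('cV[int]_n * F), (forall p, p \in l -> grpart D p.1 p.2) /\
    forall x, pv (pp_coord gl x) e = \sum_(p <- l) val x p.1 p.2.
Proof.
move=> glP; elim: e => [c|k|e1 [l1 [g1 h1]] e2 [l2 [g2 h2]]|e1 [l1 [g1 h1]] e2 [l2 [g2 h2]]].
- exists [:: (0, ffc Y c)]; split=> [p|x]; first by rewrite inE => /eqP ->; exact: grpart_cst.
  by rewrite big_seq1 point_cst.
- have [kl|kl] := ltnP k (size gl); last first.
    by exists [::]; split=> // x; rewrite big_nil /pv /= /pp_coord nth_default // point0.
  exists [:: nth (0, 0) gl k]; split=> [p|x]; last by rewrite big_seq1.
  by rewrite inE => /eqP ->; apply: glP; rewrite mem_nth.
- exists (l1 ++ l2); split=> [p|x]; first by rewrite mem_cat => /orP[/g1|/g2].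
  by rewrite big_cat /= -h1 -h2.
- exists [seq (p.1 + q.1, p.2 * q.2) | p <- l1, q <- l2]; split.
    by move=> _ /allpairsPdep[p [q [pl ql ->]]]; apply: grpartM; [exact: g1|exact: g2].
  move=> x; rewrite big_allpairs_dep /= /pv /= -/(pv _ _) -/(pv _ _) h1 h2 mulr_suml.
  rewrite big_seq [RHS]big_seq; apply: eq_bigr => p pl; rewrite mulr_sumr.
  rewrite big_seq [RHS]big_seq; apply: eq_bigr => q ql.
  by rewrite pointM //; [exact: g1|exact: g2].
Qed.

(* Dedekind's independence of characters: the points over the general points of Y are dense. *)
Lemma general_points_dense (l : seq ('cV[int]_n * F)) : (forall p, p \in l -> grpart D p.1 p.2) ->
  (forall y (gy : general y) (t : torus K n),
    \sum_(p <- l) tchar p.1 t * val (general_point gy) p.1 p.2 = 0) ->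
  forall x, \sum_(p <- l) val x p.1 p.2 = 0.
Proof.
move: {2}(size l).+1 (ltnSn (size l)) => N; elim: N l => // N IH l lN lP h x.
have [[u [v [uv ul vl]]]|nuv] := pselect (exists u v, [/\ u != v, u \in map fst l & v \in map fst l]).
  have [s suv] := tchar_separates K uv.
  (* Applying s and subtracting the character of weight w kills the terms of weight w, so the
     relation becomes shorter. *)
  have key w x' : w \in map fst l ->
      \sum_(p <- l) (tchar p.1 s - tchar w s) * val x' p.1 p.2 = 0.
    move=> wl; pose l' := [seq (p.1, ffc Y (tchar p.1 s - tchar w s) * p.2) |
      p <- l & tchar p.1 s != tchar w s].
    have l'E x'' (c : 'cV[int]_n -> K) : \sum_(p <- l') c p.1 * val x'' p.1 p.2 =
        \sum_(p <- l) c p.1 * ((tchar p.1 s - tchar w s) * val x'' p.1 p.2).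
      rewrite big_map big_filter [RHS](bigID (fun p => tchar p.1 s != tchar w s)) /=.
      rewrite [X in _ = _ + X]big1 ?addr0 => [|p]; last first.
        by rewrite negbK => /eqP ->; rewrite subrr mul0r mulr0.
      rewrite big_seq_cond [RHS]big_seq_cond; apply: eq_bigr => p /andP[pl _].
      by rewrite pointZ //; exact: lP.
    have <- : \sum_(p <- l') val x' p.1 p.2 = \sum_(p <- l) (tchar p.1 s - tchar w s) * val x' p.1 p.2.
      transitivity (\sum_(p <- l') 1 * val x' p.1 p.2); first by apply: eq_bigr => p _; rewrite mul1r.
      by rewrite (l'E x' (fun=> 1)); apply: eq_bigr => p _; rewrite mul1r.
    apply: IH.
    - rewrite size_map size_filter -ltnS (leq_trans _ lN) // ltnS -[ltnRHS](count_predC (fun p => tchar p.1 s != tchar w s)).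
      rewrite -addn1 leq_add2l -has_count; case/mapP: wl => p pl ->.
      by apply/hasP; exists p; rewrite //= negbK.
    - move=> _ /mapP[p + ->]; rewrite mem_filter => /andP[_ pl]; apply: grpartZ; exact: (lP p pl).
    move=> y gy t; rewrite (l'E _ (fun w => tchar w t)).
    have := h y gy (tmul t s); have := h y gy t => h1 h2.
    rewrite (eq_bigr (fun p => tchar p.1 (tmul t s) * val (general_point gy) p.1 p.2 -
       tchar w s * (tchar p.1 t * val (general_point gy) p.1 p.2))).
      by rewrite sumrB h2 -mulr_sumr h1 mulr0 subr0.
    move=> p _; rewrite (_ : tchar p.1 (tmul t s) = tchar p.1 t * tchar p.1 s); first by ring.
    by rewrite /tchar -big_split; apply: eq_bigr => i _; rewrite /tcoord /= mxE expfzMl.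
  have := key u x ul; have := key v x vl.
  have E w : \sum_(p <- l) (tchar p.1 s - tchar w s) * val x p.1 p.2 =
      \sum_(p <- l) tchar p.1 s * val x p.1 p.2 - tchar w s * \sum_(p <- l) val x p.1 p.2.
    by rewrite mulr_sumr -sumrB; apply: eq_bigr => p _; rewrite mulrBl.
  rewrite !E => /eqP; rewrite subr_eq0 => /eqP ->; rewrite -mulrBl => /eqP.
  by rewrite mulf_eq0 subr_eq0 eq_sym (negbTE suv) => /eqP.
(* Only one weight is left: the sum is a single element of A that vanishes at all general points,
   hence is 0. *)
case: l lN lP h nuv => [|[w f0] l] lN lP h nuv; first by rewrite big_nil.
have lw p : p \in (w, f0) :: l -> p.1 = w.
  move=> pl; apply/eqP; apply: contrapT => /negP pw; apply: nuv; exists p.1, w; split=> //.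
    by apply/mapP; exists p.
  by rewrite mem_head.
have dw : dual_cone (tail D) (ratv w) by have [] := lP (w, f0) (mem_head _ _).
have gp x' : \sum_(p <- (w, f0) :: l) val x' p.1 p.2 = val x' w (\sum_(p <- (w, f0) :: l) p.2) /\
    grpart D w (\sum_(p <- (w, f0) :: l) p.2).
  elim: (_ :: l) lw lP => [|p l' IHl] lw lP'.
    by rewrite !big_nil point0; split=> //; exact: grpart0.
  have [||e g] := IHl; first by move=> q ql; apply: lw; rewrite inE ql orbT.
    by move=> q ql; apply: lP'; rewrite inE ql orbT.
  have gpp := lP' p (mem_head _ _); rewrite (lw p (mem_head _ _)) in gpp.
  rewrite !big_cons e (lw p (mem_head _ _)); split; last exact: grpartD.
  by rewrite pointD.
rewrite (gp x).1 (_ : \sum_(p <- _) p.2 = 0) ?point0 //.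
have [og g0] := general_open; apply: (ev_eq0 og g0) => y gy _.
rewrite -(general_pointE gy (gp x).2) -(gp _).1.
rewrite -[RHS](h y gy (tone K n)); apply: eq_bigr => p _.
by rewrite /tchar big1 ?mul1r // => i _; rewrite /tcoord /= mxE exp1rz.
Qed.

(** By density each of two nonempty open sets contains a torus translate of a general point. For
    fixed torus elements the condition on y is open and nonempty, so irreducibility of Y gives a
    common y; then [torus_irreducible] gives a common torus element. *)
Lemma ppspace_irreducible gl : (forall p, p \in gl -> grpart D p.1 p.2) ->
  (forall u f, grpart D u f -> galg (ffc Y) gl u f) -> irreducible [set: ppspace D].
Proof.
move=> glP glG; split; first exact: ppspace_neq0.
have [_ _ _ lf _] := pp_chart glP glG.
have glk k : grpart D (nth (0, 0) gl k).1 (nth (0, 0) gl k).2.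
  have [kl|kl] := ltnP k (size gl); first by apply: glP; rewrite mem_nth.
  by rewrite nth_default //= -(rmorph0 (ffc Y)); exact: grpart_cst.
pose a k := (nth (0, 0) gl k).2; pose us k := (nth (0, 0) gl k).1.
have coordE y (gy : general y) t k : pp_coord gl (ppact t (general_point gy)) k = tchar (us k) t * ev y (a k).
  by rewrite /pp_coord /= -/(us k) asboolT //; exact: glk.
have meet U x : open U -> U x -> exists y (gy : general y) t e,
    pv (pp_coord gl (ppact t (general_point gy))) e != 0 /\ forall x', pv (pp_coord gl x') e != 0 -> U x'.
  move=> oU Ux; have [[e ex eU] _] := lf x U Logic.I oU Ux.
  have [l [lP lE]] := homogeneous_sum e glP.
  apply: contrapT => h; move/eqP: ex; apply; rewrite lE.
  apply: general_points_dense => // y gy t; apply/eqP; apply: contrapT => /negP ne; apply: h.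
  by exists y, gy, t, e; split=> [|x']; [rewrite lE|exact: eU].
move=> U V oU oV [x1 [_ Ux]] [x2 [_ Vx]].
have [y1 [g1 [t1 [e1 [h1 eU]]]]] := meet U x1 oU Ux.
have [y2 [g2 [t2 [e2 [h2 eV]]]]] := meet V x2 oV Vx.
have [og _] := general_open.
pose ct t k := ffc Y (tchar (us k) t) * a k.
have evct y (gy : general y) t e : regular_at y (pf (ct t) e) /\
    ev y (pf (ct t) e) = pv (fun k => tchar (us k) t * ev y (a k)) e.
  have Oa k : regular_at y (a k) by exact: (grpart_general gy (glk k)).
  have Oc k : regular_at y (ct t k) by apply: regular_atM (Oa k); exact: regular_at_cst.
  have [O1 O2] := ev_pf e Oc; split=> //; rewrite O2; apply: pv_ext => k.
  by rewrite evM ?ev_cst //; exact: regular_at_cst.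
have [y [[gy [Oy yU]] [_ [_ yV]]]] : (general `&` [set y | regular_at y (pf (ct t1) e1) /\ ev y (pf (ct t1) e1) != 0]) `&`
    (general `&` [set y | regular_at y (pf (ct t2) e2) /\ ev y (pf (ct t2) e2) != 0]) !=set0.
  apply: openI_n0; try by [apply: openI => //; exact: nonvanishing_open].
    exists y1; split=> //; have [O1 E1] := evct y1 g1 t1 e1; split=> //; rewrite E1.
    by rewrite (pv_ext _ (w := pp_coord gl (ppact t1 (general_point g1)))) // => k; rewrite coordE.
  exists y2; split=> //; have [O1 E1] := evct y2 g2 t2 e2; split=> //; rewrite E1.
  by rewrite (pv_ext _ (w := pp_coord gl (ppact t2 (general_point g2)))) // => k; rewrite coordE.
rewrite (evct y gy t1 e1).2 in yU; rewrite (evct y gy t2 e2).2 in yV.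
have [t [tU tV]] := torus_irreducible yU yV.
exists (ppact t (general_point gy)); split=> //; split; [apply: eU|apply: eV].
  by rewrite (pv_ext _ (coordE y gy t)).
by rewrite (pv_ext _ (coordE y gy t)).
Qed.

End PPSpace.

(** * Morphisms between charts *)

Section AffineCharts.
Context (K : closedFieldType).
Implicit Types (X Z : fspace K).

Lemma open_near X (U : set X) : (forall x, U x -> exists V, [/\ open V, V x & V `<=` U]) -> open U.
Proof.
move=> h; rewrite openE => x /h[V [oV Vx VU]]; rewrite /interior nbhsE /=.
by exists V.
Qed.

Lemma pv_neq0_open X (A : set X) k e : open A -> (forall i, reg A (fun x => k x i)) ->
  open (A `&` [set x | pv (k x) e != 0]).
Proof. by move=> oA kr; apply: (sheaf_nz (space_sheaf X) oA); exact: reg_pv. Qed.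

Lemma affine_null X (A : set X) k n (J : set (pexp K)) : affine_chart A k n ->
  (forall e e', (forall x, A x -> pv (k x) e = pv (k x) e') -> J e -> J e') ->
  (forall a b, J a -> J b -> J (PA a b)) -> (forall a b, J b -> J (PM a b)) -> J (PC 0) ->
  (forall x, A x -> exists2 e, J e & pv (k x) e != 0) -> J (PC 1).
Proof.
move=> [_ _ kn _ fA] JE JD JM J0 nz; apply: contrapT => J1.
have [|v [v0 vJ]] := nullstellensatz (n := n) _ JD JM J0 J1.
  move=> e e' ee'; apply: JE => x _; exact: (polyn_of_eq ee' idfun (kn x)).
have [|x Ax kx] := fA v.
  by move=> e e0; apply: vJ; apply: JE J0 => x Ax; rewrite e0.
by have [e /vJ] := nz x Ax; rewrite (pv_ext e kx) /pv => ->; rewrite eqxx.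
Qed.

(* Clearing denominators in e(num_0 / d^M_0, num_1 / d^M_1, ...). *)
Lemma clear_denominators (num : nat -> pexp K) (M : nat -> nat) (d e : pexp K) : exists N E,
  forall u, pv u d != 0 -> pv (fun l => pv u (num l) / pv u d ^+ M l) e * pv u d ^+ N = pv u E.
Proof.
have px j a u : pv u (iter j (PM d) a) = pv u d ^+ j * pv u a.
  by elim: j => [|j IH]; rewrite ?mul1r //= /pv /= -!/(pv _ _) IH exprS mulrA.
elim: e => [c|l|e1 [N1 [E1 h1]] e2 [N2 [E2 h2]]|e1 [N1 [E1 h1]] e2 [N2 [E2 h2]]].
- by exists 0%N, (PC c) => u _; rewrite mulr1.
- by exists (M l), (num l) => u du; rewrite /pv /= divfK // expf_neq0.
- exists (N1 + N2)%N, (PA (iter N2 (PM d) E1) (iter N1 (PM d) E2)) => u du.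
  by rewrite /pv /= -!/(pv _ _) !px -h1 // -h2 // exprD; ring.
- exists (N1 + N2)%N, (PM E1 E2) => u du.
  by rewrite /pv /= -!/(pv _ _) -h1 // -h2 // exprD mulrACA.
Qed.

(** The ideal of denominators of f has no common zero. The square of b is used because f b^2 = a b
    also holds where b vanishes. *)
Lemma chart_reg_poly X (A : set X) k n f : affine_chart A k n -> reg A f ->
  exists e, forall x, A x -> f x = pv (k x) e.
Proof.
move=> ch rf; have [oA kr kn lA fA] := ch.
pose J : set (pexp K) := [set e | exists a, forall x, A x -> f x * pv (k x) e = pv (k x) a].
suff [a h] : J (PC 1) by exists a => x Ax; rewrite -h // mulr1.
apply: (affine_null ch) => [e e' ee' [a h]|a b [a' ha] [b' hb]|a b [b' hb]||x Ax].
- by exists a => x Ax; rewrite -ee' // h.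
- by exists (PA a' b') => x Ax; rewrite /pv /= -!/(pv _ _) mulrDr ha // hb.
- by exists (PM a b') => x Ax; rewrite /pv /= -!/(pv _ _) mulrCA hb.
- by exists (PC 0) => x Ax; rewrite /pv /= mulr0.
have [_ /(_ f rf)[a [b [bx fE]]]] := lA x A Ax oA Ax.
exists (PM b b); last by rewrite /pv /= mulf_neq0.
exists (PM a b) => y Ay; rewrite /pv /= -!/(pv _ _).
have [->|by0] := eqVneq (pv (k y) b) 0; first by rewrite !mulr0.
by rewrite fE // mulrA divfK.
Qed.

(** The coordinates k of a chart vanish from n on, those of a chart extending k do not; truncation
    lets an expression in k be read in the larger chart. *)
Definition trunc n (i : nat) : pexp K := if (i < n)%N then PV i else PC 0.

Lemma pv_trunc n (u v : nat -> K) e : (forall i, (i < n)%N -> u i = v i) ->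
  (forall i, (n <= i)%N -> v i = 0) -> pv u (psub (trunc n) e) = pv v e.
Proof.
by move=> h1 h2; rewrite pv_sub; apply: pv_ext => i; rewrite /trunc; case: ltnP => ?; [exact: h1|rewrite h2].
Qed.

Lemma chart_refine X (A A' : set X) k k' n : affine_chart A k n -> A' `<=` A ->
  (forall x i, (i < n)%N -> k' x i = k x i) -> local_fractions A' k'.
Proof.
move=> [oA kr kn lA fA] AA' kk' x U Ax oU Ux; have [[b bx bU] gU] := lA x U (AA' _ Ax) oU Ux.
have kE y e : pv (k' y) (psub (trunc n) e) = pv (k y) e.
  by apply: pv_trunc => i; [exact: kk'|exact: kn].
split; first by exists (psub (trunc n) b) => [|y /AA' Ay]; rewrite kE //; exact: bU.
move=> f /gU[a [c [cx fE]]]; exists (psub (trunc n) a), (psub (trunc n) c).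
by split=> [|y /AA' Ay]; rewrite !kE //; exact: fE.
Qed.

Lemma chart_refine_full X (A : set X) (A' : set X) k k' n v : affine_chart A k n -> A' `<=` A ->
  (forall x i, (i < n)%N -> k' x i = k x i) ->
  (forall e, (forall x, A' x -> pv (k' x) e = 0) -> pv v e = 0) ->
  exists2 x, A x & forall i, (i < n)%N -> k x i = v i.
Proof.
move=> [oA kr kn lA fA] AA' kk' hv.
have [|x Ax kx] := fA (fun i => if (i < n)%N then v i else 0).
  move=> e he; rewrite -(@pv_trunc n v) => [|i ->//|i]; last by rewrite ltnNge => ->.
  apply: hv => y /AA' Ay; rewrite (@pv_trunc n _ (k y)) => [|i|i]; first exact: he.
    exact: kk'.
  exact: kn.
by exists x => // i ni; rewrite kx ni.
Qed.

Definition inv_coord X (k : X -> nat -> K) n b (x : X) (i : nat) : K :=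
  if (i < n)%N then k x i else if i == n then (pv (k x) b)^-1 else 0.

(** Rabinowitsch's trick: the inverse of b is added as the coordinate with index n, and the relation
    between the two forces b to be nonzero at every K-point. *)
Lemma principal_chart X (A : set X) k n b : affine_chart A k n ->
  affine_chart (A `&` [set x | pv (k x) b != 0]) (inv_coord k n b) n.+1.
Proof.
move=> ch; have [oA kr kn lA fA] := ch; have S := space_sheaf X.
have oA' := pv_neq0_open b oA kr; have AA' : A `&` [set x | pv (k x) b != 0] `<=` A by move=> x [].
have kk' x i : (i < n)%N -> inv_coord k n b x i = k x i by rewrite /inv_coord => ->.
split=> //.
- move=> i; rewrite /inv_coord; case: (i < n)%N; first exact: (reg_res oA' oA AA' (kr i)).
  case: (i == n); last exact: (sheaf_cst S).
  by apply: (sheaf_inv S oA); exact: reg_pv.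
- by move=> x i ni; rewrite /inv_coord ltnNge (ltnW ni) /= gtn_eqF.
- exact: chart_refine ch AA' kk'.
move=> v hv; have [x Ax kx] := chart_refine_full ch AA' kk' hv.
have bE : pv v (psub (trunc n) b) = pv (k x) b by apply: pv_trunc => i ni; [rewrite kx|rewrite kn].
have vn : pv (k x) b * v n = 1.
  have := hv (PA (PM (psub (trunc n) b) (PV n)) (PC (-1))).
  rewrite /pv /= -!/(pv _ _) bE => h; apply/eqP; rewrite -subr_eq0; apply/eqP; apply: h => y [Ay yb].
  rewrite -!/(pv _ _) (@pv_trunc n _ (k y)); [|by move=> i; exact: kk'|by move=> i; exact: kn].
  by rewrite /inv_coord ltnn eqxx divff // subrr.
have bx : pv (k x) b != 0 by apply/eqP => e; move/eqP: vn; rewrite e mul0r eq_sym oner_eq0.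
exists x => // i; rewrite /inv_coord; case: (ltngtP i n) => [ni|ni|->]; first exact: kx.
  by symmetry; apply: (hv (PV i)) => y _; rewrite /pv /= /inv_coord ltnNge (ltnW ni) /= gtn_eqF.
by apply: (mulfI bx); rewrite vn divff.
Qed.

Lemma chart_reg_fraction X (A : set X) k n b f : affine_chart A k n ->
  reg (A `&` [set x | pv (k x) b != 0]) f -> exists N e, forall x, A x -> pv (k x) b != 0 ->
    f x * pv (k x) b ^+ N = pv (k x) e.
Proof.
move=> ch rf; have [e he] := chart_reg_poly (principal_chart b ch) rf.
pose num i : pexp K := if (i < n)%N then PV i else if i == n then PC 1 else PC 0.
have [N [E hE]] := clear_denominators num (fun i => if i == n then 1 else 0)%N b e.
exists N, E => x Ax bx; rewrite he // -hE //; congr (_ * _); apply: pv_ext => i.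
rewrite /inv_coord /num; case: ltngtP => ni; rewrite /pv /= ?divr1 //.
by rewrite expr1 div1r.
Qed.

(** The intersection is the graph of d inside U x V. A K-point gives x in U and z in V, and d x = z
    is tested with the coordinates c of B, which separate points: they are polynomials both in those
    of U, via d, and in those of V, and these agree on the graph. *)
Lemma graph_chart X Z (d : X -> Z) (U : set X) k n (B V : set Z) c N l m : fun_morphism d ->
  affine_chart U k n -> affine_chart B c N -> (forall z z', B z -> B z' -> c z =1 c z' -> z = z') ->
  (forall x, U x -> B (d x)) -> affine_chart V l m -> V `<=` B ->
  affine_chart (U `&` d @^-1` V) (fun x i => if (i < n)%N then k x i else l (d x) (i - n)%N) (n + m).
Proof.
move=> [cd rd] chU chB injB UB chV VB.
have [oU kr kn lU fU] := chU; have [oB cr cN lB fB] := chB; have [oV lr lm lV fV] := chV.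
have oP : open (d @^-1` V) by move/continuousP: cd; apply.
have oA' : open (U `&` d @^-1` V) by exact: openI.
set k' := (X in affine_chart _ X _).
have kk' x i : (i < n)%N -> k' x i = k x i by rewrite /k' => ->.
have AA' : U `&` d @^-1` V `<=` U by move=> x [].
split=> //.
- move=> i; rewrite /k'; case: (i < n)%N; first exact: (reg_res oA' oU AA' (kr i)).
  by apply: (reg_res oA' oP) => [x []//|]; exact: (rd V (l^~ _)).
- move=> x i nmi; rewrite /k' ltnNge (leq_trans (leq_addr _ _) nmi) /= lm // leq_subRL //.
  exact: leq_trans (leq_addr _ _) nmi.
- exact: chart_refine chU AA' kk'.
move=> v hv; have [x Ux kx] := chart_refine_full chU AA' kk' hv.
pose sr i : pexp K := PV (i + n)%N.
have srE y e : pv (k' y) (psub sr e) = pv (l (d y)) e.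
  by rewrite pv_sub; apply: pv_ext => i; rewrite /sr /pv /= /k' ltnNge leq_addl /= addnK.
have [|z Vz lz] := fV (fun i => v (i + n)%N).
  move=> e he; rewrite -[LHS](_ : pv v (psub sr e) = _); last by rewrite pv_sub.
  by apply: hv => y [_ Vy]; rewrite srE; exact: he.
have dx : d x = z.
  apply: injB; [exact: UB|exact: VB|move=> i].
  have rU : reg U (fun x => c (d x) i).
    apply: (reg_res oU (_ : open (d @^-1` B))) => [||]; [by move/continuousP: cd; apply|by move=> y /UB|].
    exact: (rd B (c^~ i)).
  have [p pE] := chart_reg_poly chU rU.
  have [q qE] := chart_reg_poly chV (reg_res oV oB VB (cr i)).
  rewrite pE // qE //; have := hv (PA (psub (trunc n) p) (PM (PC (-1)) (psub sr q))).
  rewrite /pv /= -!/(pv _ _) mulN1r => h; apply/eqP; rewrite -subr_eq0; apply/eqP.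
  have <- : pv v (psub (trunc n) p) = pv (k x) p by apply: pv_trunc => j nj; [rewrite kx|rewrite kn].
  have <- : pv v (psub sr q) = pv (l z) q by rewrite pv_sub; apply: pv_ext => j; rewrite lz.
  apply: h => y [Uy Vy]; rewrite -!/(pv _ _) mulN1r srE (@pv_trunc n _ (k y)).
  - by rewrite -pE // -qE // subrr.
  - by move=> j; exact: kk'.
  - by move=> j; exact: kn.
exists x; first by split=> //=; rewrite dx.
move=> i; rewrite /k'; case: ltnP => ni; first exact: kx.
by rewrite dx lz subnK.
Qed.

Lemma chart_morphism X Z (A : set Z) l m (f : X -> Z) (U : set X) : affine_chart A l m ->
  open U -> (forall x, U x -> A (f x)) -> (forall i, reg U (fun x => l (f x) i)) ->
  (forall V, open V -> open (U `&` f @^-1` V)) /\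
  forall V g, open V -> reg V g -> reg (U `&` f @^-1` V) (g \o f).
Proof.
move=> [oA lr lm lA fA] oU UA rU.
have near V x : open V -> U x -> V (f x) -> exists b, pv (l (f x)) b != 0 /\
    forall y, U y -> pv (l (f y)) b != 0 -> V (f y).
  move=> oV Ux Vx; have [[b bx bV] _] := lA (f x) V (UA _ Ux) oV Vx.
  by exists b; split=> // y /UA; exact: bV.
have oD b : open (U `&` [set x | pv (l (f x)) b != 0]).
  exact: (@pv_neq0_open X U (fun x => l (f x)) b oU rU).
have oP V : open V -> open (U `&` f @^-1` V).
  move=> oV; apply: open_near => x [Ux Vx]; have [b [bx bV]] := near V x oV Ux Vx.
  exists (U `&` [set x | pv (l (f x)) b != 0]); split=> // y [Uy yb].
  by split=> //; exact: bV.
split=> // V g oV rg; have S := space_sheaf X.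
apply: (sheaf_glue S) => [|x [Ux Vx]]; first exact: oP.
have [_ /(_ g rg)[a [b [bx gE]]]] := lA (f x) V (UA _ Ux) oV Vx.
exists (U `&` [set x | pv (l (f x)) b != 0]), (fun x => pv (l (f x)) a * (pv (l (f x)) b)^-1); split=> //.
  apply: (sheaf_mul S) => //; last first.
    by apply: (sheaf_inv S oU); exact: (@reg_pv _ X U (fun x => l (f x)) b oU rU).
  apply: (reg_res (oD b) oU) => [y []//|].
  exact: (@reg_pv _ X U (fun x => l (f x)) a oU rU).
by move=> y [Uy _] [_ yb]; rewrite /= gE //; exact: UA.
Qed.

Lemma chart_fun_morphism X Z l m (f : X -> Z) : affine_chart [set: Z] l m ->
  (forall i, reg setT (fun x => l (f x) i)) -> fun_morphism f.
Proof.
move=> ch rf; have [|h1 h2] := chart_morphism ch (U := setT) openT _ rf; first by [].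
have E V : setT `&` f @^-1` V = f @^-1` V by rewrite setTI.
split; first by apply/continuousP => V oV; rewrite -E; exact: h1.
by move=> V g oV rg; rewrite -E; exact: h2.
Qed.

Lemma sub_morphism X Z (B : set Z) (g : X -> subsp B) : fun_morphism (val \o g : X -> Z) -> fun_morphism g.
Proof.
move=> [cg rg]; split.
  apply/continuousP => _ [V oV <-]; rewrite -comp_preimage.
  by move/continuousP: cg; apply.
move=> W h [V oV VE] rh; have S := space_sheaf X.
have oP U : open U -> open ((val \o g) @^-1` U : set X) by move=> oU; move/continuousP: cg; apply.
apply: (sheaf_glue S) => [|x Wx]; first by rewrite -VE -comp_preimage; exact: oP.
have [V' [h' [oV' V'x rh' hE]]] := rh (g x) Wx.
exists ((val \o g) @^-1` V'), (h' \o (val \o g)); split=> //.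
- exact: oP.
- exact: rg.
- by move=> y Wy V'y; exact: hE.
Qed.

Lemma embeddingI X Z (f : X -> Z) : fun_morphism f -> injective f ->
  (forall U x, open U -> U x -> exists V, [/\ open V, V (f x) & forall y, V (f y) -> U y]) ->
  (forall U h x, open U -> reg U h -> U x -> exists V g, [/\ open V, V (f x), reg V g &
    forall y, U y -> V (f y) -> h y = g (f y)]) -> embedding f.
Proof.
move=> mf inj hU hr.
have rf x : f x \in range f by apply/mem_set; exists x.
pose g x : subsp (range f) := exist (fun z => z \in range f) (f x) (rf x).
have /choice[d dE] : forall z : subsp (range f), exists x, f x = val z.
  by move=> z; have [x _ xz] := set_mem (valP z); exists x.
have gK : cancel g d by move=> x; apply: inj; rewrite dE.
have dK : cancel d g by move=> z; apply: val_inj; rewrite /= dE.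
exists g => //; split; first by apply: sub_morphism; exact: mf.
exists d; split=> //.
have oP U : open U -> open (d @^-1` U).
  move=> oU; apply: open_near => z Uz; have [V [oV Vz VU]] := hU U (d z) oU Uz.
  exists ((val : subsp (range f) -> Z) @^-1` V); split; first by exists V.
    by rewrite /= -dE.
  by move=> w Vw; apply: VU; rewrite dE.
split; first by apply/continuousP; exact: oP.
move=> U h oU rh z Uz; have [V [g' [oV Vz rg' hE]]] := hr U h (d z) oU rh Uz.
exists V, g'; split=> //; first by rewrite -dE.
by move=> w Uw Vw; rewrite /= hE // dE.
Qed.

Lemma open_sub_embedding X (A : set X) : open A -> open_embedding (val : subsp A -> X).
Proof.
move=> oA; have rA : range (val : subsp A -> X) = A.
  apply/seteqP; split=> [_ [x _ <-]|x Ax]; first exact: (set_mem (valP x)).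
  by exists (exist (fun y => y \in A) x (mem_set Ax)).
split; first by rewrite rA.
apply: embeddingI.
- split; first by apply/continuousP => V oV; exists V.
  move=> V h oV rh x Vx; exists V, h; split=> //.
- exact: val_inj.
- by move=> _ x [V oV <-] Vx; exists V.
- move=> _ h x [V oV <-] rh Vx; have [V' [g [oV' V'x rg hE]]] := rh x Vx.
  by exists V', g.
Qed.

Lemma open_embedding_chart X Z (f : X -> Z) (A : set X) k n : open_embedding f -> affine_chart A k n ->
  exists k', affine_chart (f @` A) k' n /\ forall x, k' (f x) = k x.
Proof.
move=> [orf ef] [oA kr kn lA fA].
have [g [_ [d [_ gK _]]] gE] := ef.
have inj : injective f by move=> x y xy; apply: (can_inj gK); apply: val_inj; rewrite !gE.
have [cf rf] := embedding_morphism ef.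
have /choice[k' k'P] : forall z, exists k', (forall x, f x = z -> k' = k x) /\ (~ range f z -> k' = fun=> 0).
  move=> z; have [[x _ <-]|nz] := pselect (range f z).
    by exists (k x); split=> [y /inj ->//|nz]; case: nz; exists x.
  by exists (fun=> 0); split=> // x xz; case: nz; exists x.
have k'E x : k' (f x) = k x by apply: (k'P (f x)).1.
have oI U : open U -> open (f @` U).
  move=> oU; apply: open_near => _ [x Ux <-].
  have [V [oV Vx VU _]] := embedding_local 0 ef oU Ux.
  exists (V `&` range f); split; [exact: openI|by split=> //; exists x|].
  by move=> z [Vz [y _ yE]]; exists y => //; apply: VU; rewrite yE.
have loc U h x : open U -> reg U h -> U x -> exists V g, [/\ open V, V (f x), reg V g &
    forall y, U y -> V (f y) -> h y = g (f y)].
  by move=> oU rh Ux; have [_ [_ _ _ /(_ rh)]] := embedding_local h ef oU Ux.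
exists k'; split=> //; split.
- exact: oI.
- move=> i; apply: (sheaf_glue (space_sheaf Z)) => [|_ [x Ax <-]]; first exact: oI.
  have [V [h [oV Vx rh hE]]] := loc A (k^~ i) x oA (kr i) Ax.
  exists V, h; split=> // _ [y Ay <-] Vy; rewrite k'E; exact: hE.
- move=> z i ni; have [[x _ <-]|nz] := pselect (range f z); first by rewrite k'E kn.
  by rewrite (k'P z).2.
- move=> _ U [x Ax <-] oU Ux; have oP : open (f @^-1` U) by move/continuousP: cf; apply.
  have [[b bx bU] gU] := lA x _ Ax oP Ux.
  split; first by exists b; rewrite ?k'E // => _ [y Ay <-]; rewrite k'E; exact: bU.
  move=> h rh; have [a [c [cx hE]]] := gU _ (rf _ _ oU rh).
  by exists a, c; rewrite k'E; split=> // _ [y Ay <-]; rewrite k'E; exact: hE.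
- move=> v hv; have [|x Ax kx] := fA v.
    by move=> e he; apply: hv => _ [x Ax <-]; rewrite k'E; exact: he.
  by exists (f x) => [|i]; [exists x|rewrite k'E].
Qed.

Lemma sub_chart X (A : set X) k n : affine_chart A k n ->
  affine_chart [set: subsp A] (fun x => k (val x)) n.
Proof.
move=> [oA kr kn lA fA]; split=> //.
- exact: openT.
- move=> i x _; exists A, (k^~ i); split=> //; exact: (set_mem (valP x)).
- by move=> x i; exact: kn.
- move=> x _ _ [V oV <-] Vx; have Ax := set_mem (valP x).
  have [[b bx bV] _] := lA _ _ Ax oV Vx.
  split; first by exists b => // y _; apply: bV; exact: (set_mem (valP y)).
  move=> f rf; have [V' [g [oV' V'x rg fE]]] := rf x Vx.
  have [[c cx cV'] gg] := lA _ _ Ax oV' V'x; have [a [d [dx gE]]] := gg g rg.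
  exists (PM a (PM b c)), (PM d (PM b c)); split; first by rewrite /pv /= !mulf_neq0.
  move=> y _; rewrite /pv /= !mulf_eq0 !negb_or => /and3P[dy by0 cy].
  have Ay := set_mem (valP y).
  rewrite fE; [|exact: bV|exact: cV'].
  rewrite gE // -mulf_div -!/(pv _ _) divff ?mulr1 //.
  by rewrite mulf_neq0.
- move=> v hv; have [|x Ax kx] := fA v.
    by move=> e he; apply: hv => x _; apply: he; exact: (set_mem (valP x)).
  by exists (exist (fun y => y \in A) x (mem_set Ax)).
Qed.

Lemma chart_affine X k n : affine_chart [set: X] k n -> (forall x y, k x =1 k y -> x = y) -> affine X.
Proof.
move=> ch inj; have [_ kr kn lX fX] := ch.
pose f x : affsp K n := \row_(i < n) k x i.
have fE x : rowf (f x : 'rV[K]_n) =1 k x.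
  move=> i; have [ni|ni] := ltnP i n; last by rewrite rowf0 // kn.
  by have := rowfE (f x : 'rV[K]_n) (Ordinal ni); rewrite mxE.
have [_ rr _ lr _] := affsp_chart K n.
have oD b : open [set z : affsp K n | pv (rowf (z : 'rV[K]_n)) b != 0].
  rewrite -[X in open X]setTI; apply: (@pv_neq0_open (affsp K n) setT (@rowf K n)) => //.
  exact: openT.
exists n, f; split.
  rewrite -openC; apply: open_near => z nz.
  have [e [he ze]] : exists e, (forall x, pv (k x) e = 0) /\ pv (rowf (z : 'rV[K]_n)) e != 0.
    apply: contrapT => h; have [|x _ kx] := fX (rowf (z : 'rV[K]_n)).
      move=> e he; apply/eqP; apply: contrapT => /negP ze; apply: h; exists e; split=> // x.
      exact: he.
    apply: nz; exists x => //; apply/rowP => i.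
    by rewrite -!rowfE fE kx.
  exists [set z : affsp K n | pv (rowf (z : 'rV[K]_n)) e != 0]; split=> //.
  by move=> w /= we [x _ xw]; move/eqP: we; apply; rewrite -xw (pv_ext e (fE x)).
apply: embeddingI.
- apply: (chart_fun_morphism (affsp_chart K n)) => i.
  by apply: (reg_eq openT _ (kr i)) => x _; exact: fE.
- by move=> x y xy; apply: inj => i; rewrite -!fE xy.
- move=> U x oU Ux; have [[b bx bU] _] := lX x U Logic.I oU Ux.
  exists [set z : affsp K n | pv (rowf (z : 'rV[K]_n)) b != 0]; split=> //=; rewrite ?(pv_ext b (fE _)) //.
  by move=> y; rewrite (pv_ext b (fE y)); exact: bU.
- move=> U h x oU rh Ux; have [_ /(_ h rh)[a [b [bx hE]]]] := lX x U Logic.I oU Ux.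
  exists (setT `&` [set z : affsp K n | pv (rowf (z : 'rV[K]_n)) b != 0]),
    (fun z : affsp K n => pv (rowf (z : 'rV[K]_n)) a * (pv (rowf (z : 'rV[K]_n)) b)^-1).
  have oT : open [set: affsp K n] by exact: openT.
  split.
  + by rewrite setTI; exact: oD.
  + by split=> //=; rewrite (pv_ext b (fE _)).
  + apply: (sheaf_mul (space_sheaf (affsp K n))); first by rewrite setTI; exact: oD.
      apply: (reg_res _ oT) => [||]; [by rewrite setTI; exact: oD|by move=> z []|].
      exact: (@reg_pv _ (affsp K n) setT (@rowf K n) a oT rr).
    apply: (sheaf_inv (space_sheaf (affsp K n)) oT).
    exact: (@reg_pv _ (affsp K n) setT (@rowf K n) b oT rr).
  + by move=> y Uy [_ /=]; rewrite !(pv_ext _ (fE y)); exact: hE.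
Qed.

Lemma affine_has_chart X : affine X -> exists k n, affine_chart [set: X] k n /\ forall x y, k x =1 k y -> x = y.
Proof.
move=> [n [f [cf ef]]]; exists (@rowf K n \o f), n; split; first exact: (embedding_chart cf ef (affsp_chart K n)).
have [g [_ [d [_ gK _]]] gE] := ef.
move=> x y xy; apply: (can_inj gK); apply: val_inj; rewrite !gE.
by apply/rowP => i; rewrite -!rowfE; exact: xy.
Qed.

Lemma affine_open_chart X (U : set X) : affine_open U ->
  exists k n, affine_chart U k n /\ forall x y, U x -> U y -> k x =1 k y -> x = y.
Proof.
move=> [oU /affine_has_chart[k [n [ch inj]]]].
have oe := open_sub_embedding oU.
have [k' [ch' k'E]] := open_embedding_chart oe ch.
have UE : val @` [set: subsp U] = U.
  apply/seteqP; split=> [_ [x _ <-]|x Ux]; first exact: (set_mem (valP x)).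
  by exists (exist (fun y => y \in U) x (mem_set Ux)).
exists k', n; rewrite -{1}UE; split=> // x y Ux Uy xy.
pose x' : subsp U := exist (fun y => y \in U) x (mem_set Ux).
pose y' : subsp U := exist (fun y => y \in U) y (mem_set Uy).
have := inj x' y'; rewrite -!k'E => /(_ xy) e.
by have := congr1 val e.
Qed.

Lemma chart_affine_open X (U : set X) k n : affine_chart U k n ->
  (forall x y, U x -> U y -> k x =1 k y -> x = y) -> affine_open U.
Proof.
move=> ch inj; split; first by case: ch.
apply: (chart_affine (sub_chart ch)) => x y xy; apply: val_inj.
by apply: inj => //; [exact: (set_mem (valP x))|exact: (set_mem (valP y))].
Qed.

(** For a filter without cluster points, the expressions vanishing on some member of the filter form
    an ideal without common zeros. Then 1 vanishes on a member, which is nonempty. *)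
Lemma chart_compactness X k n : affine_chart [set: X] k n -> compact [set: X].
Proof.
move=> ch; have [_ kr kn lX fX] := ch => F FF _; apply: contrapT => nc.
pose J : set (pexp K) := [set e | exists2 B, F B & forall x, B x -> pv (k x) e = 0].
have [B FB B1] : J (PC 1).
  apply: (affine_null ch) => [e e' ee' [B FB hB]|a b [B FB hB] [B' FB' hB']|a b [B FB hB]||x _].
  - by exists B => // x Bx; rewrite -ee' //; exact: hB.
  - exists (B `&` B'); first exact: filterI.
    by move=> x [Bx B'x]; rewrite /pv /= -!/(pv _ _) hB // hB' // addr0.
  - by exists B => // x Bx; rewrite /pv /= -!/(pv _ _) hB // mulr0.
  - by exists setT; first exact: filterT.
  apply: contrapT => h; apply: nc; exists x; split=> // B U FB; rewrite nbhsE => -[V [oV Vx] VU].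
  apply: contrapT => BU; apply: h; have [[b bx bV] _] := lX x V Logic.I oV Vx.
  exists b => //; exists B => // y By; apply/eqP; apply: contrapT => /negP yb.
  by apply: BU; exists y; split=> //; apply: VU; exact: bV.
have [x Bx] := filter_ex FB; have /eqP := B1 x Bx.
by rewrite /pv /= oner_eq0.
Qed.

End AffineCharts.

Lemma In_nth (T : Type) (d : T) s f : List.In f s -> exists2 i, (i < size s)%N & nth d s i = f.
Proof.
elim: s => //= a s IH [->|/IH[i si <-]]; first by exists 0%N.
by exists i.+1.
Qed.

(** * Gluing of charts *)

Section GlueCharts.
Context (K : closedFieldType) (X : fspace K) (W : set X) (r : nat) (hs cs : nat -> X -> K).
Context (oW : open W) (rh : forall i, (i < r)%N -> reg W (hs i)) (rc : forall i, (i < r)%N -> reg W (cs i)).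
Context (h1 : forall x, W x -> \sum_(i < r) cs i x * hs i x = 1).
Context (ks : nat -> X -> nat -> K) (ns : nat -> nat).
Local Notation WW i := (W `&` [set x | hs i x != 0]).
Context (ch : forall i, (i < r)%N -> affine_chart (WW i) (ks i) (ns i)).
Let S := space_sheaf X.

Lemma glue_cover x : W x -> exists2 i, (i < r)%N & WW i x.
Proof.
move=> Wx; apply: contrapT => h; have := h1 Wx; rewrite big1 => [/eqP|i _].
  by rewrite eq_sym oner_eq0.
apply/eqP; rewrite mulf_eq0; apply/orP; right; apply: contrapT => /negP hi.
by apply: h; exists (nat_of_ord i).
Qed.

Lemma reg_exp f N : reg W f -> reg W (fun x => f x ^+ N).
Proof.
move=> rf; elim: N => [|N IH]; first by apply: (reg_eq oW _ (sheaf_cst S 1 oW)) => x _; rewrite expr0.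
by apply: (reg_eq oW _ (sheaf_mul S oW rf IH)) => x _; rewrite exprS.
Qed.

(** On each of the finitely many charts some power of hs_i times g is a polynomial in the
    coordinates; one exponent serves all charts. *)
Lemma extend_by_zero i g : (i < r)%N -> reg (WW i) g -> exists N,
  reg W (fun x => if hs i x == 0 then 0 else hs i x ^+ N * g x).
Proof.
move=> ir rg; have open_WW j : (j < r)%N -> open (WW j) by move=> /ch[].
have /choice[N /choice[e Ne]] : forall j, exists N e, (j < r)%N -> forall x, WW j x -> hs i x != 0 ->
    g x * hs i x ^+ N = pv (ks j x) e.
  move=> j; have [jr|] := ltnP j r; last by exists 0%N, (PC 0).
  have [b bE] := chart_reg_poly (ch jr) (reg_res (open_WW j jr) oW (@subIsetl _ _ _) (rh ir)).
  have [|N [e h]] := @chart_reg_fraction _ _ _ _ _ b g (ch jr).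
    have oV : open (WW j `&` [set x | pv (ks j x) b != 0]).
      by have [o kr _ _ _] := ch jr; exact: pv_neq0_open.
    apply: (reg_res oV (open_WW i ir)) rg => x [Wx /= xb].
    by split; [exact: Wx.1|rewrite /= bE].
  by exists N, e => _ x Wx hx; rewrite bE // h // -bE.
pose M := (\sum_(j < r) N j)%N.
exists M.+1; apply: (sheaf_glue S) => // x Wx; have [j jr Wjx] := glue_cover Wx.
have NM : (N j <= M)%N by rewrite /M (bigD1 (Ordinal jr)) //= leq_addr.
have [oj kr _ _ _] := ch jr.
(* The exponent stays positive even if N j = M, so this function vanishes with hs_i, as the
   extension by zero does. *)
exists (WW j), (fun x => hs i x ^+ (M - N j).+1 * pv (ks j x) (e j)); split=> //.
  apply: (sheaf_mul S oj); last exact: reg_pv.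
  by apply: (reg_res oj oW (@subIsetl _ _ _)); exact: (reg_exp _ (rh ir)).
move=> y Wy Wjy; case: eqVneq => [->|hy]; first by rewrite exprS !mul0r.
by rewrite -(Ne j jr) // mulrA [LHS]mulrC [hs i y ^+ _ * g y]mulrC -mulrA -exprD addSn subnK.
Qed.

(** The criterion that W is affine if regular functions hs_i generate the unit ideal and their
    nonvanishing loci are affine. The coordinates are the hs_i, the cs_i and the coordinates of the
    charts, the last multiplied by powers of hs_i so as to extend to W. *)
Lemma chart_glue : exists k n, affine_chart W k n.
Proof.
have /choice[M Mc] : forall p : nat * nat, exists M, (p.1 < r)%N -> (p.2 < ns p.1)%N ->
    reg W (fun x => if hs p.1 x == 0 then 0 else hs p.1 x ^+ M * ks p.1 x p.2).
  move=> [i l] /=; have [ir|] := ltnP i r; last by exists 0%N.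
  have [_ kr _ _ _] := ch ir; have [M hM] := extend_by_zero ir (kr l); by exists M.
pose c i l x := if hs i x == 0 then 0 else hs i x ^+ M (i, l) * ks i x l.
pose fs := List.app [seq hs i | i <- iota 0 r] (List.app [seq cs i | i <- iota 0 r]
  (flatten [seq [seq c i l | l <- iota 0 (ns i)] | i <- iota 0 r])).
have In_map T (f : nat -> T) m i : (i < m)%N -> List.In (f i) [seq f i | i <- iota 0 m].
  move=> im; have : i \in iota 0 m by rewrite mem_iota.
  elim: (iota 0 m) => //= a s IH; rewrite inE => /predU1P[->|/IH]; by [left|right].
have inv_map T (f : nat -> T) m g : List.In g [seq f i | i <- iota 0 m] -> exists2 i, (i < m)%N & g = f i.
  have : forall i, i \in iota 0 m -> (i < m)%N by move=> i; rewrite mem_iota.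
  elim: (iota 0 m) => //= a s IH h [<-|/IH]; first by exists a => //; apply: h; rewrite mem_head.
  by apply=> i si; apply: h; rewrite inE si orbT.
have In_h i : (i < r)%N -> List.In (hs i) fs by move=> ir; apply/List.in_app_iff; left; exact: In_map.
have In_a i : (i < r)%N -> List.In (cs i) fs.
  by move=> ir; apply/List.in_app_iff; right; apply/List.in_app_iff; left; exact: In_map.
have In_flat T (s : nat -> seq T) m f i : (i < m)%N -> List.In f (s i) -> List.In f (flatten [seq s i | i <- iota 0 m]).
  move=> im fi; have : i \in iota 0 m by rewrite mem_iota.
  elim: (iota 0 m) => //= a s' IH; rewrite inE => /predU1P[e|/IH h]; apply/List.in_app_iff.
    by left; rewrite -e.
  by right.
have In_c i l : (i < r)%N -> (l < ns i)%N -> List.In (c i l) fs.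
  move=> ir li; apply/List.in_app_iff; right; apply/List.in_app_iff; right.
  by apply: (In_flat _ _ _ _ i ir); exact: In_map.
have fsr f : List.In f fs -> reg W f.
  move=> /List.in_app_iff[h|/List.in_app_iff[h|]].
  - by have [i ir ->] := inv_map _ _ _ _ h; exact: rh.
  - by have [i ir ->] := inv_map _ _ _ _ h; exact: rc.
  have : forall i, i \in iota 0 r -> (i < r)%N by move=> i; rewrite mem_iota.
  elim: (iota 0 r) => //= i s IH h /List.in_app_iff[hf|].
    have [l li ->] := inv_map _ _ _ _ hf.
    by apply: (Mc (i, l)) => //=; apply: h; rewrite mem_head.
  by apply: IH => j js; apply: h; rewrite inE js orbT.
pose k (x : X) i := nth (fun=> 0) fs i x.
have /choice[jh jhE] : forall i, exists j, (i < r)%N -> forall x, k x j = hs i x.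
  move=> i; have [ir|] := ltnP i r; last by exists 0%N.
  have [j _ jE] := In_nth (fun=> 0) (In_h i ir); exists j => _ x; by rewrite /k jE.
have /choice[ja jaE] : forall i, exists j, (i < r)%N -> forall x, k x j = cs i x.
  move=> i; have [ir|] := ltnP i r; last by exists 0%N.
  have [j _ jE] := In_nth (fun=> 0) (In_a i ir); exists j => _ x; by rewrite /k jE.
have /choice[jc jcE] : forall p : nat * nat, exists j, (p.1 < r)%N -> (p.2 < ns p.1)%N ->
    forall x, k x j = c p.1 p.2 x.
  move=> [i l] /=; have [ir|] := ltnP i r; last by exists 0%N.
  have [li|] := ltnP l (ns i); last by exists 0%N.
  have [j _ jE] := In_nth (fun=> 0) (In_c i l ir li); exists j => _ _ x; by rewrite /k jE.
pose num i l : pexp K := if (l < ns i)%N then PV (jc (i, l)) else PC 0.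
pose wi i u l := pv u (num i l) / pv u (PV (jh i)) ^+ M (i, l).
have wik i x : (i < r)%N -> WW i x -> wi i (k x) =1 ks i x.
  move=> ir [Wx /= hx] l; rewrite /wi /num {2}/pv /= jhE //; case: ltnP => li; last first.
    by have [_ _ kn _ _] := ch ir; rewrite kn // /pv /= mul0r.
  by rewrite /pv /= jcE //= /c (negbTE hx) mulrC mulKf // expf_neq0.
have clr i e : exists N E, forall u, u (jh i) != 0 -> pv (wi i u) e * u (jh i) ^+ N = pv u E.
  exact: (clear_denominators (num i) (fun l => M (i, l)) (PV (jh i)) e).
have px j a u d : pv u (iter j (PM d) a) = pv u d ^+ j * pv u a.
  by elim: j => [|j IH]; rewrite ?mul1r //= /pv /= -!/(pv _ _) IH exprS mulrA.
have kr i : reg W (fun x => k x i).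
  have [il|il] := ltnP i (size fs); last first.
    by apply: (reg_eq oW _ (sheaf_cst S 0 oW)) => x _; rewrite /k nth_default.
  have : List.In (nth (fun=> 0) fs i) fs by elim: (fs) i il => //= f s IH [|i] il; [left|right; exact: IH].
  exact: fsr.
exists k, (size fs); split=> //.
- by move=> x i si; rewrite /k nth_default.
- move=> x U Wx oU Ux; have [i ir Wix] := glue_cover Wx.
  have [oi _ kn li _] := ch ir; have hx : k x (jh i) != 0 by rewrite jhE //; exact: Wix.2.
  have nb b : pv (ks i x) b != 0 -> chart_nbhd W k x (WW i `&` [set y | pv (ks i y) b != 0]).
    move=> bx; have [N [E NE]] := clr i b.
    exists (PM E (PV (jh i))).
      rewrite /pv /= -/(pv _ _) -NE // (pv_ext b (wik i x ir Wix)).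
      by rewrite !mulf_neq0 // expf_neq0.
    move=> y Wy; rewrite /pv /= -/(pv _ _) mulf_eq0 negb_or => /andP[Ey hy].
    have Wiy : WW i y by split=> //; rewrite /= -jhE.
    split=> //=; move: Ey; rewrite -NE // (pv_ext b (wik i y ir Wiy)).
    by rewrite mulf_eq0 negb_or => /andP[].
  have nW : chart_nbhd W k x (WW i).
    by exists (PV (jh i)) => // y Wy; rewrite /pv /= jhE.
  have gm e : chart_germ W k x (fun y => pv (ks i y) e).
    have [N [E NE]] := clr i e.
    exists (PM E (PV (jh i))), (iter N (PM (PV (jh i))) (PV (jh i))).
    have vh y : pv (k y) (PV (jh i)) = k y (jh i) by [].
    rewrite px vh mulf_neq0 ?expf_neq0 //; split=> // y Wy.
    rewrite px vh mulf_eq0 negb_or => /andP[_ hy].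
    have Wiy : WW i y by split=> //; rewrite /= -jhE.
    have vm : pv (k y) (PM E (PV (jh i))) = pv (k y) E * k y (jh i) by [].
    rewrite vm -NE // (pv_ext e (wik i y ir Wiy)) -[_ * _ * k y (jh i)]mulrA mulfK //.
    by rewrite mulf_neq0 ?expf_neq0.
  have [[b bx bU] gU] := li x U Wix oU Ux; split.
    by apply: chart_nbhd_sub (nb b bx) => y [Wy yb]; exact: bU.
  move=> f /gU[a [d [dx fE]]].
  apply: (@chart_germ_eq _ X W k x f (fun y => pv (ks i y) a * (pv (ks i y) d)^-1)).
    by apply: chart_nbhd_sub (nb d dx) => y [Wy yd]; exact: fE.
  by apply: chart_germ_mul => //; exact: chart_germ_inv.
- move=> v hv.
  (* The expression e encodes the relation sum cs_i hs_i = 1 and vanishes on W, so at a K-point the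
     hs_i cannot all be 0. The point is then looked for in the i-th chart. *)
  have [i ir vi] : exists2 i, (i < r)%N & v (jh i) != 0.
    apply: contrapT => h; pose e : pexp K := foldr (fun i e => PA (PM (PV (ja i)) (PV (jh i))) e) (PC (-1)) (iota 0 r).
    have eE u : pv u e = (\sum_(i <- iota 0 r) u (ja i) * u (jh i)) - 1.
      rewrite /e; elim: (iota 0 r) => [|j s IH]; first by rewrite big_nil add0r.
      by rewrite big_cons /pv /= -!/(pv _ _) IH addrA.
    have := hv e; rewrite eE big1_seq => [|j /andP[_]]; last first.
      rewrite mem_iota /= add0n => jr; apply/eqP; rewrite mulf_eq0; apply/orP; right.
      by apply: contrapT => /negP vj; apply: h; exists j.
    rewrite add0r => h0; have /eqP : -1 = 0 :> K.
      apply: h0 => x Wx; rewrite eE -(h1 Wx) -{1}[r]subn0 -/(index_iota 0 r) big_mkord.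
      apply/eqP; rewrite subr_eq0; apply/eqP; apply: eq_bigr => j _.
      by rewrite jaE // jhE.
    by rewrite oppr_eq0 oner_eq0.
  have [oi kri kn li fi] := ch ir.
  have [|x Wix kx] := fi (wi i v).
    move=> e he; have [N [E NE]] := clr i e.
    have : pv v (PM E (PV (jh i))) = 0.
      apply: hv => x Wx; rewrite /pv /= -/(pv _ _); have [->|hx] := eqVneq (k x (jh i)) 0.
        by rewrite mulr0.
      have Wix : WW i x by split=> //; rewrite /= -jhE.
      by rewrite -NE // (pv_ext e (wik i x ir Wix)) he // !mul0r.
    rewrite /pv /= -/(pv _ _) -NE // => /eqP; rewrite !mulf_eq0 expf_eq0 (negbTE vi) andbF !orbF.
    by move/eqP.
  exists x; first exact: Wix.1.
  move=> j; have [p pE] := chart_reg_poly (ch ir) (reg_res oi oW (@subIsetl _ _ _) (kr j)).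
  have [N [E NE]] := clr i p.
  rewrite pE // (pv_ext p kx); apply: (mulIf (expf_neq0 N vi)); rewrite NE //.
  have := hv (PM (PA E (PM (PC (-1)) (iter N (PM (PV (jh i))) (PV j)))) (PV (jh i))).
  rewrite /pv /= -!/(pv _ _) px mulN1r => h; have /eqP : (pv v E - v (jh i) ^+ N * v j) * v (jh i) = 0.
    apply: h => y Wy; rewrite -!/(pv _ _) px mulN1r; have [->|hy] := eqVneq (k y (jh i)) 0.
      by rewrite mulr0.
    have Wiy : WW i y by split=> //; rewrite /= -jhE.
    by rewrite -NE // (pv_ext p (wik i y ir Wiy)) -pE // /pv /= mulrC [k y j * _]mulrC subrr mulr0.
  by rewrite mulf_eq0 (negbTE vi) orbF subr_eq0 mulrC => /eqP ->; rewrite mulrC.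
Qed.

End GlueCharts.

(** E is irreducible and, by maximality, contained in no other prime divisor, so it is not covered
    by finitely many others. *)
Lemma prime_generic (K : closedFieldType) (Y : integral_space K) (P : prime_divisor Y -> Prop)
    (E : prime_divisor Y) : finite_set [set E' | P E'] -> ~ P E ->
  exists2 z, val E z & forall E', P E' -> ~ val E' z.
Proof.
move=> /finite_seqP[s sE] PE.
have sP E' : E' \in s <-> P E'.
  by split=> h; [have : [set` s] E' by []; rewrite -sE|have : [set E' | P E'] E' by []; rewrite sE].
have [z [Ez zs]] : val E `&` [set y | forall E', E' \in s -> ~ val E' y] !=set0; last first.
  by exists z => // E' /sP; exact: zs.
have : forall E', E' \in s -> E' != E by move=> E' /sP PE'; apply/eqP => e; apply: PE; rewrite -e.
have [_ [Ene Eirr] ET Emax] := prime_divisorP E.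
have fs (l : seq (prime_divisor Y)) : open [set y | forall E', E' \in l -> ~ val E' y].
  by have [] := @primes_avoid _ Y (fun E' => E' \in l) (finite_seq l).
elim: s {sE sP} => [|E1 s IH] hs.
  by have [z Ez] := Ene; exists z.
have [c1 i1 T1 _] := prime_divisorP E1.
have [||z [Ez [z1 zs]]] := Eirr (~` val E1) _ (closed_openC c1) (fs s).
- apply: contrapT => h; have /(Emax _ c1 i1)[e|//] : val E `<=` val E1.
    by move=> y Ey; apply: contrapT => ny; apply: h; exists y.
  by have /eqP := hs E1 (mem_head _ _); apply; apply: val_inj.
- by apply: IH => E' E's; apply: hs; rewrite inE E's orbT.
by exists z; split=> // E'; rewrite inE => /predU1P[->|/zs].
Qed.

Lemma eventually_ge0 (a c : rat) : 0 <= a -> (a = 0 -> 0 <= c) ->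
  exists N, forall k, (N <= k)%N -> 0 <= a *+ k + c.
Proof.
move=> a0 ac; have [a1|a1] := eqVneq a 0.
  by exists 0%N => k _; rewrite a1 mul0rn add0r ac.
have {a0}a0 : 0 < a by rewrite lt0r a1.
exists (Num.bound (`|c| / a)) => k Nk; rewrite -[c]opprK subr_ge0 -mulr_natr mulrC -ler_pdivrMr //.
have le1 : - c / a <= `|c| / a by rewrite ler_pM2r ?invr_gt0 // -normrN ler_norm.
apply: le_trans le1 _.
apply: le_trans (ltW (archi_boundP _)) _; last by rewrite ler_nat.
by rewrite divr_ge0 // ltW.
Qed.

(** * Faces of pp-divisors *)

Section MinkowskiSums.
Context (n : nat).
Implicit Types (A B sigma : set 'rV[rat]_n) (w : 'cV[rat]_n).

Lemma pairing0 w : pairing w 0 = 0.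
Proof. by rewrite /pairing mul0mx mxE. Qed.

Lemma pairingNl w v : pairing (- w) v = - pairing w v.
Proof. by rewrite /pairing mulmxN mxE. Qed.

Definition constant_on w A : Prop := forall a b, A a -> A b -> pairing w a = pairing w b.

Lemma minkowski_constant w A B : A !=set0 -> B !=set0 -> constant_on w (minkowski A B) ->
  constant_on w A /\ constant_on w B.
Proof.
move=> [a Aa] [b Bb] h; split=> x y hx hy.
  have : pairing w (x + b) = pairing w (y + b) by apply: h; [exists x => //; exists b|exists y => //; exists b].
  by rewrite !pairingD => /addIr.
have : pairing w (a + x) = pairing w (a + y) by apply: h; [exists a => //; exists x|exists a => //; exists y].
by rewrite !pairingD => /addrI.
Qed.

(** A linear form that is constant on a Minkowski sum of nonempty sets is constant on each
    summand. *)
Lemma minkowski_big_constant (T : eqType) (s : seq T) (B : T -> set 'rV[rat]_n) sigma w :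
  sigma !=set0 -> (forall E, E \in s -> B E !=set0) ->
  constant_on w (\big[@minkowski n/sigma]_(E <- s) B E) ->
  constant_on w sigma /\ forall E, E \in s -> constant_on w (B E).
Proof.
move=> s0; elim: s => [|E s IH] B0; first by rewrite big_nil.
rewrite big_cons => /minkowski_constant[||cE].
- exact/B0/mem_head.
- have : forall E, E \in s -> B E !=set0 by move=> E' E's; apply: B0; rewrite inE E's orbT.
  elim: (s) => [|E1 l IHl] h; first by rewrite big_nil.
  have [a Ba] := h E1 (mem_head _ _); have [|b Bb] := IHl.
    by move=> E' E'l; apply: h; rewrite inE E'l orbT.
  by rewrite big_cons; exists (a + b), a => //; exists b.
move=> /IH[|cs ch]; first by move=> E' E's; apply: B0; rewrite inE E's orbT.
by split=> // E'; rewrite inE => /predU1P[->|/ch].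
Qed.

Lemma minkowski_tail sigma B : pointed_cone sigma -> B = set0 \/ sigma_polyhedron sigma B ->
  minkowski B sigma = B.
Proof.
move=> ps [->|[k [s ->]]]; first by apply/seteqP; split=> x //; case=> a [].
apply/seteqP; split=> [_ [_ [a ca [b sb <-]] [c sc <-]]|_ [a ca [b sb <-]]].
  exists a => //; exists (b + c); last by rewrite addrA.
  have [[k' [s' e]] _] := ps; move: sb sc; rewrite e => -[x x0 <-] [y y0 <-].
  by exists (x + y); [move=> i; rewrite mxE addr_ge0|rewrite mulmxDl].
exists (a + b); first by exists a => //; exists b.
by exists 0; [exact: cone0|rewrite addr0].
Qed.

Lemma min_onMn sigma B w k : pointed_cone sigma -> dual_cone sigma w ->
  B = set0 \/ sigma_polyhedron sigma B -> min_on B (w *+ k) = min_on B w *+ k.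
Proof.
move=> ps dw [->|pB]; first by rewrite !min_on_set0 mul0rn.
have [[v Bv ve] hv] := polyhedron_min ps dw pB.
apply: min_onE; split; first by exists v; rewrite // pairingMnl ve.
by move=> v' Bv'; rewrite pairingMnl lerMn2r hv ?orbT.
Qed.

End MinkowskiSums.

Section GoodSections.
Context (K : closedFieldType) (Y : integral_space K) (nY : normal_variety Y).
Local Notation F := (funfield Y).
Context (cov : forall y : Y, exists A (r : nat -> F) n, fchart A r n /\ A y).
Context (ofin : forall a : F, a != 0 -> finite_set [set E : prime_divisor Y | ord E a != 0]).
Context (n : nat).
Implicit Types (D : poldiv Y n) (E : prime_divisor Y) (u v w : 'cV[int]_n) (f g : F).

Lemma ppdiv_coef D E : ppdiv D -> pointed_cone (tail D) /\
  (coef D E = set0 \/ sigma_polyhedron (tail D) (coef D E)).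
Proof. by move=> [[pt cD _] _ _ _]. Qed.

Lemma meets_Loc D E : ppdiv D -> coef D E <> set0 -> meets_div (Loc D) E.
Proof.
move=> pD E0; have [z Ez zL] : exists2 z, val E z & forall E', coef D E' = set0 -> ~ val E' z.
  apply: (@prime_generic _ Y (fun E' => coef D E' = set0)) => //.
  have [[_ _ fD] _ _ _] := pD; apply: sub_finite_set fD => E'; exact: coef_tail_neq0.
by exists z; split.
Qed.

Lemma coef_neq0 D E y : Loc D y -> val E y -> coef D E <> set0.
Proof. by move=> Ly Ey E0; exact: (Ly E E0). Qed.

(* The nonvanishing locus of such an f in X(D) lies in the image of X(D'). *)
Definition good D' D w f : Prop := [/\ f != 0, grpart D w f,
  face (tail D) (ratv w) `<=` tail D' &
  forall E, meets_div (Loc D) E -> (ord E f)%:~R + evaluation D (ratv w) E = 0 ->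
    face (coef D E) (ratv w) `<=` coef D' E].

Lemma good_order D w f E : f != 0 -> grpart D w f -> meets_div (Loc D) E ->
  0 <= (ord E f)%:~R + evaluation D (ratv w) E.
Proof. by move=> f0 [_ [e|sf]] mE; [rewrite e eqxx in f0|exact: sf]. Qed.

(** For each generator x of a coefficient of D one needs k (ord f + w(x)) + (ord g + u(x)) >= 0 for
    large k. The first bracket is nonnegative; if it is 0, then x lies in the face, hence in the
    coefficient of D', where the second bracket is nonnegative. The tail cone is treated in the same
    way, and almost all coefficients equal it. *)
Lemma good_power D' D w f u g : ppdiv D' -> ppdiv D -> refines D' D -> good D' D w f -> grpart D' u g ->
  exists k0, forall k, (k0 <= k)%N -> grpart D (u + w *+ k) (f ^+ k * g).
Proof.
move=> pD' pD [_ _ tt cc] [f0 gf ft fE] [du sg].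
have [[pt cD fD] _ _ _] := pD; have [[pt' cD' fD'] _ _ _] := pD'.
have pairE k (v : 'rV[rat]_n) : pairing (ratv (u + w *+ k)) v = pairing (ratv w) v *+ k + pairing (ratv u) v.
  by rewrite ratvD ratvMn pairingDl pairingMnl addrC.
have [vs [vsS hvs]] := dual_cone_gens pt.
have [k1 hk1] : exists k1, forall x, x \in vs -> forall k, (k1 <= k)%N -> 0 <= pairing (ratv (u + w *+ k)) x.
  apply: finite_bound => [v /vsS sv|v N N' NN h k hk]; last exact: h (leq_trans NN hk).
  have [|N hN] := @eventually_ge0 (pairing (ratv w) v) (pairing (ratv u) v) (gf.1 v sv).
    move=> e; apply: du; apply: ft; split=> // v' sv'; rewrite e; exact: gf.1.
  by exists N => k /hN; rewrite pairE.
have dk k : (k1 <= k)%N -> dual_cone (tail D) (ratv (u + w *+ k)).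
  by move=> hk; apply: hvs => v vvs; exact: hk1.
have [g0|g0] := eqVneq g 0.
  by exists k1 => k hk; rewrite g0 mulr0; apply: grpart0 => //; exact: dk.
have /finite_seqP[s sE] : finite_set [set E | coef D E <> tail D \/ coef D' E <> tail D'].
  by rewrite -[[set E | _]]/([set E | coef D E <> tail D] `|` [set E | coef D' E <> tail D']) finite_setU.
have ordE E k : meets_div (Loc D) E -> (ord E (f ^+ k * g))%:~R = (ord E f)%:~R *+ k + (ord E g)%:~R :> rat.
  by move=> _; rewrite (ordM nY cov) ?expf_neq0 // (ordX nY cov) // rmorphD /= rmorphMn.
have [k2 hk2] : exists k2, forall E, E \in s -> forall k, (k2 <= k)%N -> (k1 <= k)%N -> meets_div (Loc D) E ->
    0 <= (ord E (f ^+ k * g))%:~R + evaluation D (ratv (u + w *+ k)) E.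
  apply: finite_bound => [E _|E N N' NN h k hk]; last exact: h (leq_trans NN hk).
  have [[z [Ez Lz]]|nm] := pselect (meets_div (Loc D) E); last by exists 0%N.
  have mE : meets_div (Loc D) E by exists z.
  have [E0|pE] := cD E; first by case: (Lz E E0 Ez).
  have [xs [xs0 xsB hxs]] := polyhedron_vertices pt pE.
  have [N hN] : exists N, forall x, x \in xs -> forall k, (N <= k)%N ->
      0 <= ((ord E f)%:~R + pairing (ratv w) x) *+ k + ((ord E g)%:~R + pairing (ratv u) x).
    apply: finite_bound => [x xxs|x N N' NN h k hk]; last exact: h (leq_trans NN hk).
    have [_ hw] := polyhedron_min pt gf.1 pE.
    have le1 : (ord E f)%:~R + evaluation D (ratv w) E <= (ord E f)%:~R + pairing (ratv w) x.
      by rewrite lerD2l; apply: hw; exact: xsB.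
    have ge0 := good_order f0 gf mE.
    apply: eventually_ge0; first exact: le_trans le1.
    move=> e; have e0 : (ord E f)%:~R + evaluation D (ratv w) E = 0 by apply/le_anti; rewrite ge0 -e le1.
    (* Vanishing at x means that x attains the minimum of w and that E is not in the divisor of f,
       which is the situation covered by [good]. *)
    have D'x : coef D' E x.
      apply: (fE E mE e0); split; first exact: xsB.
      move=> x' Dx'; apply: le_trans (hw x' Dx').
      by rewrite -(lerD2l (ord E f)%:~R) e -/(evaluation D (ratv w) E) e0.
    have [e'|pE'] := cD' E; first by move: D'x; rewrite e'.
    have mE' : meets_div (Loc D') E by apply: meets_Loc => // e'; move: D'x; rewrite e'.
    apply: le_trans (good_order g0 (conj du sg) mE') _.
    by rewrite lerD2l; apply: (polyhedron_min pt' du pE').2.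
  exists N => k Nk k1k _; rewrite ordE //.
  have [x xxs xmin] := seq_argmin (pairing (ratv (u + w *+ k))) xs0.
  rewrite /evaluation (min_onE (hxs _ x (dk k k1k) xxs xmin)) pairE.
  by have := hN x xxs k Nk; rewrite mulrnDl addrACA.
exists (k1 + k2)%N => k hk.
have hk1' : (k1 <= k)%N := leq_trans (leq_addr _ _) hk.
have hk2' : (k2 <= k)%N := leq_trans (leq_addl _ _) hk.
split; first exact: dk.
right=> E mE; have [Es|Es] := boolP (E \in s); first exact: hk2.
have [c1 c2] : coef D E = tail D /\ coef D' E = tail D'.
  split; apply: contrapT => h; have : [set E | coef D E <> tail D \/ coef D' E <> tail D'] E.
  - by left.
  - by rewrite sE /= (negbTE Es).
  - by right.
  - by rewrite sE /= (negbTE Es).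
rewrite ordE // /evaluation c1 (min_on_tail pt (dk k hk1')) addr0.
have := good_order f0 gf mE; rewrite /evaluation c1 (min_on_tail pt gf.1) addr0 => of0.
have mE' : meets_div (Loc D') E.
  by apply: meets_Loc => //; rewrite c2 => e; have := cone0 pt'; rewrite e.
have := good_order g0 (conj du sg) mE'; rewrite /evaluation c2 (min_on_tail pt' du) addr0 => og0.
by apply: addr_ge0 => //; exact: mulrn_wge0.
Qed.

(** Orders and minima enter as nonnegative summands. If the total is 0 at a point v of the face of w
    + w', then both summands are, so v attains the minimum of w and of w' and lies in both
    coefficients. *)
Lemma good_mul D' D'' D w f w' f' : ppdiv D -> good D' D w f -> good D'' D w' f' ->
  good (cap D' D'') D (w + w') (f * f').
Proof.
move=> pD [f0 gf ft fE] [f0' gf' ft' fE']; have [[pt cD fD] _ _ _] := pD.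
have dd : dual_cone (tail D) (ratv w + ratv w') by apply: dual_coneD; [exact: gf.1|exact: gf'.1].
split.
- by rewrite mulf_neq0.
- exact: (grpartM nY cov pD).
- rewrite ratvD => v [tv hv].
  have := hv 0 (cone0 pt); rewrite pairing0 pairingDl => le0.
  have p1 := gf.1 v tv; have p2 := gf'.1 v tv.
  have [e1 e2] : pairing (ratv w) v = 0 /\ pairing (ratv w') v = 0 by split; lra.
  by split; [apply: ft|apply: ft']; split=> // v' tv'; rewrite ?e1 ?e2; [exact: gf.1|exact: gf'.1].
move=> E mE; rewrite (ordM nY cov) // rmorphD /= ratvD => e0.
have h1 := good_order f0 gf mE; have h2 := good_order f0' gf' mE.
have h3 := evaluation_superadd pD E gf.1 gf'.1.
have [E0|pE] := cD E; first by rewrite E0 => v [].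
have [_ m1] := polyhedron_min pt gf.1 pE; have [_ m2] := polyhedron_min pt gf'.1 pE.
have [[v0 Dv0 ev0] m3] := polyhedron_min pt dd pE.
move=> v [Dv hv].
have := hv v0 Dv0; rewrite ev0 pairingDl -/(evaluation D _ E) => l1.
have := m1 v Dv; rewrite -/(evaluation D _ E) => l2.
have := m2 v Dv; rewrite -/(evaluation D _ E) => l3.
split; [apply: (fE E mE)|apply: (fE' E mE)]; try by lra.
  split=> // v' Dv'; apply: le_trans (m1 v' Dv'); rewrite -/(evaluation D _ E); lra.
split=> // v' Dv'; apply: le_trans (m2 v' Dv'); rewrite -/(evaluation D _ E); lra.
Qed.

Lemma fiber_polyE D y : ppdiv D -> exists s : seq (prime_divisor Y),
  [/\ uniq s, forall E, E \in s <-> val E y /\ coef D E <> tail D &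
      fiber_poly D y = \big[@minkowski n/tail D]_(E <- s) coef D E].
Proof.
move=> [[pt cD fD] _ _ _]; rewrite /fiber_poly.
set s := finite_support _ _ _; exists s; split=> // [|E]; first exact: finite_support_uniq.
rewrite in_finite_support; first by rewrite inE.
by apply: sub_finite_set fD => E' [].
Qed.

Lemma fiber_poly_tail D y : ppdiv D -> general D y -> fiber_poly D y = tail D.
Proof.
move=> pD gy; have [[|E s] [us sP ->]] := fiber_polyE y pD; first by rewrite big_nil.
by have /sP[Ey /gy/(_ Ey)] := mem_head E s.
Qed.

Lemma fiber_poly_single D E y : ppdiv D -> val E y ->
  (forall E', val E' y -> coef D E' <> tail D -> E' = E) -> fiber_poly D y = coef D E.
Proof.
move=> pD Ey hy; have [pt cE] := ppdiv_coef E pD.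
have [s [us sP ->]] := fiber_polyE y pD.
have [cE'|cE'] := pselect (coef D E = tail D).
  case: s us sP => [|E' s] us sP; first by rewrite big_nil.
  by have /sP[E'y ne] := mem_head E' s; case: (ne); rewrite (hy E' E'y ne).
have -> : s = [:: E].
  have Es : E \in s by apply/sP.
  have sE E' : E' \in s -> E' = E by move=> /sP[E'y /(hy E' E'y)].
  case: s us Es sE {sP} => // E1 [|E2 s] us Es sE; first by rewrite (sE E1 (mem_head _ _)).
  move: us; rewrite /= inE (sE E1 (mem_head _ _)) (sE E2) ?eqxx // inE mem_head orbT //.
by rewrite big_cons big_nil minkowski_tail.
Qed.

(** On Loc(D) no summand of the fiber polyhedron is empty, so [minkowski_big_constant] applies. *)
Lemma fiber_poly_constant D (w : 'cV[rat]_n) y : ppdiv D -> Loc D y -> constant_on w (fiber_poly D y) ->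
  constant_on w (tail D) /\ forall E, val E y -> constant_on w (coef D E).
Proof.
move=> pD Ly; have [[pt cD _] _ _ _] := pD; have [s [us sP ->]] := fiber_polyE y pD.
move=> /minkowski_big_constant[||ct cs].
- by exists 0; exact: cone0.
- move=> E /sP[Ey _]; have [e|[k [m ->]]] := cD E; first by case: (Ly E e Ey).
  exists (row ord0 m + 0); exists (row ord0 m); last by exists 0; [exact: cone0|].
  exists (delta_mx 0 ord0); last by rewrite -rowE.
  split=> [j|]; first by rewrite mxE eqxx ler0n.
  rewrite (bigD1 ord0) //= big1 ?mxE ?eqxx ?addr0 // => j ji.
  by rewrite mxE (negbTE ji).
split=> // E Ey; have [->//|ne] := pselect (coef D E = tail D).
by apply: cs; apply/sP.
Qed.

(* A general point of Y gives the condition on the tail cones, general points of the prime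
   divisors give the conditions on the coefficients. *)
Lemma face_good D' D w f : ppdiv D' -> ppdiv D -> f != 0 -> grpart D w f ->
  (forall z, ~ supp (Loc D) (fun E => (ord E f)%:~R + evaluation D (ratv w) E) z ->
    face (fiber_poly D' z) (ratv w) = face (fiber_poly D z) (ratv w)) -> good D' D w f.
Proof.
move=> pD' pD f0 gf hf; have [[pt cD fD] _ _ _] := pD; have [[pt' cD' fD'] _ _ _] := pD'.
pose S E := (ord E f)%:~R + evaluation D (ratv w) E <> 0.
have fS : finite_set [set E | S E \/ coef D E <> tail D \/ coef D' E <> tail D'].
  rewrite -[[set E | _]]/([set E | S E] `|` ([set E | coef D E <> tail D] `|` [set E | coef D' E <> tail D'])).
  rewrite !finite_setU; split=> //.
  apply: (@sub_finite_set _ _ ([set E | ord E f != 0] `|` [set E | evaluation D (ratv w) E != 0])).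
    move=> E; rewrite /S /=; have [e|] := eqVneq (ord E f) 0; last by left.
    by right; apply/eqP => e'; rewrite e e' addr0 in H.
  by rewrite finite_setU; split; [exact: ofin|exact: (evaluation_finite pD gf.1)].
split=> //.
  have [_ [z hz]] := primes_avoid fS.
  have -> : face (tail D) (ratv w) = face (tail D') (ratv w).
    rewrite -(fiber_poly_tail pD (y := z)) => [|E h]; last by apply: hz; right; left.
    rewrite -(fiber_poly_tail pD' (y := z)) => [|E h]; last by apply: hz; right; right.
    by rewrite hf // => -[E [_ /eqP h Ez]]; apply: (hz E) => //; left.
  by move=> v [].
move=> E mE e0.
have [z Ez hz] : exists2 z, val E z & forall E', (S E' \/ coef D E' <> tail D \/ coef D' E' <> tail D') /\ E' <> E -> ~ val E' z.
  apply: (@prime_generic _ Y (fun E' => (S E' \/ coef D E' <> tail D \/ coef D' E' <> tail D') /\ E' <> E)) => [|[]//].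
  by apply: sub_finite_set fS => E' [].
have oE E' : val E' z -> (S E' \/ coef D E' <> tail D \/ coef D' E' <> tail D') -> E' = E.
  by move=> E'z h; apply: contrapT => ne; exact: (hz E').
have -> : face (coef D E) (ratv w) = face (coef D' E) (ratv w).
  rewrite -(fiber_poly_single pD Ez) => [|E' E'z h]; last by apply: oE => //; right; left.
  rewrite -(fiber_poly_single pD' Ez) => [|E' E'z h]; last by apply: oE => //; right; right.
  rewrite hf // => -[E' [_ /eqP h E'z]]; have e := oE E' E'z (or_introl h).
  by move: h; rewrite e.
by move=> v [].
Qed.

Lemma face_constant (A : set 'rV[rat]_n) (w : 'cV[rat]_n) : constant_on w (face A w).
Proof. by move=> a b [Aa ha] [Ab hb]; apply/le_anti; rewrite ha ?hb. Qed.

(** Semiampleness of D'(-w) is available because w is constant on the fiber polyhedron of D' over y.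
    The order of f^k h then vanishes along every prime divisor through y, so its value at y is
    nonzero; this value is also the product of x(f)^k and x(h). *)
Lemma good_exists D' D (x : ppspace D') : ppdiv D' -> ppdiv D -> refines D' D -> face_of D' D ->
  (exists p m z t A, @proj_data K Y (Loc D') p m z t A) ->
  exists w f, good D' D w f /\ val x w f != 0.
Proof.
move=> pD' pD rD [_ fD] [p [m [z [t [A pd]]]]].
have [oL L0] := Loc_open pD'.
have gl0 a : global (Loc D') a -> grpart D' 0 a.
  move=> Oa; split; first by move=> b _; rewrite ratv0 /pairing mulmx0 mxE.
  have [->|sa] := global_sections nY cov Oa; first by left.
  by right=> E mE; rewrite ratv0 /evaluation min0; exact: sa.
have [||||y Ly yx] := @global_point _ _ _ _ _ _ _ _ pd (val x 0) L0.
- exact: point1.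
- by move=> a b /gl0 ga /gl0 gb; exact: (pointD nY cov).
- by move=> c a /gl0 ga; exact: (pointZ nY cov pD').
- by move=> a b /gl0 ga /gl0 gb; rewrite -[0 in LHS]addr0 (pointM nY cov pD').
have [w [_ [dw [f [f0 sf] ->] ny fy ff]]] := fD y Ly.
have gf : grpart D w f by split.
have gd : good D' D w f by exact: face_good.
exists w, f; split=> //; have [_ _ _ fE] := gd.
have LD E : val E y -> meets_div (Loc D') E by move=> Ey; exists y.
have [[pt1' cD' _] _ _ _] := pD'.
have nE E : val E y -> coef D' E <> set0 by exact: coef_neq0.
have mD E : val E y -> meets_div (Loc D) E.
  move=> Ey; apply: meets_Loc => // e; apply: (nE E Ey); apply/seteqP; split=> // v.
  by have [_ _ _ cc] := rD => /cc; rewrite e.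
have oy E : val E y -> (ord E f)%:~R + evaluation D (ratv w) E = 0.
  move=> Ey; apply/eqP; apply: contrapT => /negP h; apply: ny; exists E; split=> //.
  exact: mD.
(* The fiber polyhedron of D' at y is a face for w, so w is constant on it and therefore 0 on the
   tail cone of D'; hence -w is in the dual cone too. *)
have [cw cwE] : constant_on (ratv w) (tail D') /\ forall E, val E y -> constant_on (ratv w) (coef D' E).
  by apply: fiber_poly_constant pD' Ly _; rewrite fy; exact: face_constant.
have gf' : grpart D' w f by exact: grpart_refines gf.
have dw' : dual_cone (tail D') (- ratv w).
  by move=> v tv; rewrite pairingNl (cw v 0 tv (cone0 pt1')) pairing0 oppr0.
(* As y is not in the divisor of f, the face of the coefficient of D lies in that of D', so both
   have the same minimum of w; on the coefficient of D' the form w is constant. *)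
have evE E : val E y -> evaluation D' (ratv w) E = evaluation D (ratv w) E /\
    evaluation D' (- ratv w) E = - evaluation D' (ratv w) E.
  move=> Ey; have [pt [e|pE]] := ppdiv_coef E pD; first by case: (mD E Ey) => q [Eq Lq]; case: (Lq E e Eq).
  have [_ [e'|pE']] := ppdiv_coef E pD'; first by case: (nE E Ey).
  have [[v Dv ve] hv] := polyhedron_min pt gf.1 pE.
  have D'v : coef D' E v.
    by apply: (fE E (mD E Ey) (oy E Ey)); split=> // v' Dv'; rewrite ve; exact: hv.
  have m1 : is_min (coef D' E) (ratv w) (pairing (ratv w) v).
    split; first by exists v.
    by move=> v' D'v'; rewrite (cwE E Ey v v').
  rewrite /evaluation (min_onE m1) ve; split=> //; apply: min_onE; split.
    by exists v => //; rewrite pairingNl ve.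
  by move=> v' D'v'; rewrite pairingNl -(cwE E Ey v v') // ve.
have [_ _ saD' _] := pD'.
have [k k0 bpf] := (saD' _ dw').2.
have [_ [h [h0 sh] ->] nh] := bpf y Ly.
have gh : grpart D' (- (w *+ k)) h.
  have rE : ratv (- (w *+ k)) = (- ratv w) *+ k by rewrite ratvN ratvMn mulNrn.
  split.
    rewrite rE => v tv; rewrite pairingMnl; apply: mulrn_wge0; exact: dw'.
  case: sh => [->|sh]; first by left.
  right=> E mE; rewrite rE /evaluation (min_onMn k pt1' dw' (cD' E)); exact: sh.
have ga : grpart D' 0 (f ^+ k * h).
  by rewrite -(subrr (w *+ k)); apply: (grpartM nY cov pD') => //; exact: (grpartX nY cov pD').
have a0 : f ^+ k * h != 0 by rewrite mulf_neq0 ?expf_neq0.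
have Oa : global (Loc D') (f ^+ k * h).
  apply: (sections_global nY cov); have [_ [e|sa]] := ga; first by left.
  by right=> E mE; have := sa E mE; rewrite ratv0 /evaluation min0.
(* Along E through y, f has order -D(w) and h has order -k D'(-w) = k D(w), by the choice of both
   sections at y. *)
have ya : ev y (f ^+ k * h) != 0.
  apply/eqP => /(ev_eq0_ord nY cov a0 (Oa y Ly))[E Ey]; rewrite -(ltr0z rat).
  rewrite (ordM nY cov) ?expf_neq0 // (ordX nY cov) // rmorphD /= rmorphMn /=.
  have := oy E Ey => /eqP; rewrite addr_eq0 => /eqP ->.
  have -> : (ord E h)%:~R = - (evaluation D' (- ratv w) E *+ k) :> rat.
    apply/eqP; rewrite -addr_eq0; apply/eqP; apply: contrapT => /eqP ne; apply: nh.
    by exists E; split=> //; exact: LD.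
  by have [e1 e2] := evE E Ey; rewrite e2 e1 subrr ltxx.
apply: contraNneq ya => e; rewrite (yx _ Oa).
have := @pointM _ _ nY cov _ _ pD' x (w *+ k) (- (w *+ k)) (f ^+ k) h (grpartX nY cov pD' k gf') gh.
by rewrite subrr => ->; rewrite (pointX nY cov pD') // e expr0n gtn_eqF // mul0r.
Qed.

End GoodSections.

(** * Canonical maps *)

Section Morphisms.
Context (K : closedFieldType).
Implicit Types (X Z P Q : fspace K).

Lemma comp_morphism X Z P (g : Z -> P) (f : X -> Z) : fun_morphism g -> fun_morphism f -> fun_morphism (g \o f).
Proof.
move=> [cg rg] [cf rf]; have oP V : open V -> open (g @^-1` V) by move=> oV; move/continuousP: cg; apply.
split; first by apply/continuousP => V oV; rewrite comp_preimage; move/continuousP: cf; apply; exact: oP.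
by move=> V h oV rh; exact: (rf (g @^-1` V) (h \o g) (oP V oV) (rg V h oV rh)).
Qed.

Lemma morphism_open X Z (f : X -> Z) V : fun_morphism f -> open V -> open (f @^-1` V).
Proof. by move=> [cf _] oV; move/continuousP: cf; apply. Qed.

Lemma embedding_inj X Z (f : X -> Z) : embedding f -> injective f.
Proof.
move=> [g [_ [d [_ gK _]]] gE] x y xy.
by apply: (can_inj gK); apply: val_inj; rewrite !gE.
Qed.

Lemma open_embedding_open X Z (f : X -> Z) U : open_embedding f -> open U -> open (f @` U).
Proof.
move=> [orf ef] oU; apply: open_near => _ [x Ux <-].
have [V [oV Vx VU _]] := embedding_local 0 ef oU Ux.
exists (V `&` range f); split; [exact: openI|by split=> //; exists x|].
by move=> z [Vz [y _ yE]]; exists y => //; apply: VU; rewrite yE.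
Qed.

Lemma prod_box_open P Q (U : set P) (V : set Q) : open U -> open V -> open (U `*` V : set (prod_space P Q)).
Proof.
move=> oU oV; apply/gen_openP => p UVp; exists (U `*` V), (fun=> 1); split => //.
- by exists U, V.
- exact: subalg_cst.
- exact: oner_neq0.
Qed.

Lemma pr1_reg P Q (U : set P) (V : set Q) g : open U -> open V -> reg U g ->
  reg (U `*` V : set (prod_space P Q)) (g \o fst).
Proof.
move=> oU oV rg p UVp; exists (U `*` V), (g \o fst), (fun=> 1); split => //.
- by exists U, V.
- by apply: subalg_gen; exists U, V; split=> //; left; exists g.
- exact: subalg_cst.
- by split=> [|q _ _ _]; rewrite ?oner_neq0 // divr1.
Qed.

Lemma pr2_reg P Q (U : set P) (V : set Q) g : open U -> open V -> reg V g ->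
  reg (U `*` V : set (prod_space P Q)) (g \o snd).
Proof.
move=> oU oV rg p UVp; exists (U `*` V), (g \o snd), (fun=> 1); split => //.
- by exists U, V.
- by apply: subalg_gen; exists U, V; split=> //; right; exists g.
- exact: subalg_cst.
- by split=> [|q _ _ _]; rewrite ?oner_neq0 // divr1.
Qed.

Lemma prod_morphism X P Q (f : X -> P) (g : X -> Q) : fun_morphism f -> fun_morphism g ->
  fun_morphism (fun x => (f x, g x) : prod_space P Q).
Proof.
move=> mf mg; pose h x : prod_space P Q := (f x, g x); have S := space_sheaf X.
have oW U V : open U -> open V -> open (h @^-1` (U `*` V)).
  by move=> oU oV; apply: (openI (morphism_open mf oU) (morphism_open mg oV)).
have rW W b : (prod_gens P Q).(gdom) W -> subalg ((prod_gens P Q).(gens) W) b ->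
    open (h @^-1` W) /\ reg (h @^-1` W) (b \o h).
  move=> [U [V [oU oV ->]]]; split; first exact: oW.
  have oUV := oW U V oU oV.
  elim: H => [b' [U' [V' [oU' oV' E]]]|c|b1 b2 _ r1 _ r2|b1 b2 _ r1 _ r2].
  - rewrite E; have oUV' := oW U' V' oU' oV'.
    move=> [[k rk ->]|[k rk ->]].
      apply: (reg_res oUV' (morphism_open mf oU')) => [x []//|].
      by have [_ r] := mf; exact: r.
    apply: (reg_res oUV' (morphism_open mg oV')) => [x []//|].
    by have [_ r] := mg; exact: r.
  - exact: (sheaf_cst S).
  - exact: (sheaf_add S oUV r1 r2).
  - exact: (sheaf_mul S oUV r1 r2).
have oP (V : set (prod_space P Q)) : open V -> open (h @^-1` V).
  move=> oV; apply: open_near => x Vx; have [W [b [dW ab Wx bx WV]]] := oV _ Vx.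
  have [oh rh] := rW W b dW ab.
  exists (h @^-1` W `&` [set x | b (h x) != 0]); split; first exact: (sheaf_nz S oh rh).
    by split.
  by move=> y [Wy yb]; exact: WV.
split; first by apply/continuousP.
move=> V k oV rk; apply: (sheaf_glue S) => [|x Vx]; first exact: oP.
have [W [a [b [dW aa ab Wx [bx kE]]]]] := rk _ Vx.
have [oh rb] := rW W b dW ab; have [_ ra] := rW W a dW aa.
have ob := sheaf_nz S oh rb.
exists (h @^-1` W `&` [set x | b (h x) != 0]), (fun x => a (h x) * (b (h x))^-1); split=> //.
  apply: (sheaf_mul S ob _ (sheaf_inv S oh rb)).
  by apply: (reg_res ob oh) ra => y [].
by move=> y Vy [Wy yb]; exact: kE.
Qed.

Lemma tchar_reg n u : reg [set: torus K n] (tchar u).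
Proof.
have S := space_sheaf (torus K n); have oT : open [set: torus K n] by exact: openT.
have rc i : reg [set: torus K n] (fun t => tcoord t 0 i).
  have [_ rr _ _ _] := affsp_chart K n.
  move=> t _; exists setT, (fun y => rowf (y : 'rV[K]_n) i); split=> //; first exact: openT.
  by move=> s _ _; rewrite rowfE.
have rX f k : reg [set: torus K n] f -> reg [set: torus K n] (fun t => f t ^+ k).
  move=> rf; elim: k => [|k IH]; first by apply: (reg_eq oT _ (sheaf_cst S 1 oT)) => t _; rewrite expr0.
  by apply: (reg_eq oT _ (sheaf_mul S oT rf IH)) => t _; rewrite exprS.
have rz i (z : int) : reg [set: torus K n] (fun t => tcoord t 0 i ^ z).
  case: z => k; first by apply: (reg_eq oT _ (rX _ k (rc i))) => t _; rewrite exprnP.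
  have E : setT `&` [set t : torus K n | tcoord t 0 i ^+ k.+1 != 0] = setT.
    by apply/seteqP; split=> t // _; split=> //=; rewrite expf_neq0 // tcoord_neq0.
  have := sheaf_inv S oT (rX _ k.+1 (rc i)); rewrite E => h.
  by apply: (reg_eq oT _ h) => t _; rewrite NegzE -exprnN.
rewrite /tchar; elim: (index_enum _) => [|i l IH].
  by apply: (reg_eq oT _ (sheaf_cst S 1 oT)) => t _; rewrite big_nil.
by apply: (reg_eq oT _ (sheaf_mul S oT (rz i (u i 0)) IH)) => t _; rewrite big_cons.
Qed.

End Morphisms.

Section Canonical.
Context (K : closedFieldType) (Y : integral_space K) (nY : normal_variety Y).
Local Notation F := (funfield Y).
Context (cov : forall y : Y, exists A (r : nat -> F) n, fchart A r n /\ A y).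
Context (ofin : forall a : F, a != 0 -> finite_set [set E : prime_divisor Y | ord E a != 0]).
Context (n : nat).
Context (locd : forall D : poldiv Y n, ppdiv D -> exists p m z t A, @proj_data K Y (Loc D) p m z t A).
Implicit Types (D : poldiv Y n) (u v w : 'cV[int]_n) (f g : F) (t : torus K n).

Lemma generators D : ppdiv D -> exists gl : seq ('cV[int]_n * F),
  (forall p, p \in gl -> grpart D p.1 p.2) /\ forall u f, grpart D u f -> galg (ffc Y) gl u f.
Proof.
move=> pD; have [p [m [z [t [A pd]]]]] := locd pD.
exact: (grpart_generated nY cov ofin pD pd (Loc_open pD).2).
Qed.

Lemma ppspace_affine_variety D : ppdiv D -> affine_variety (ppspace D).
Proof.
move=> pD; have [gl [glP glG]] := generators pD; split.
  by apply: (chart_affine (pp_chart nY cov pD glP glG)) => x y; exact: (pp_coord_inj nY cov pD glP glG).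
exact: (ppspace_irreducible nY cov pD glP glG).
Qed.

Lemma ppact_torus_action D : ppdiv D -> torus_action (fun t (x : ppspace D) => ppact t x).
Proof.
move=> pD; have [gl [glP glG]] := generators pD; split.
- apply: (chart_fun_morphism (pp_chart nY cov pD glP glG)) => i.
  set p := nth (0, 0) gl i; have S := space_sheaf (prod_space (torus K n) (ppspace D)).
  have oT : open [set: prod_space (torus K n) (ppspace D)] by exact: openT.
  have r1 := pr1_reg openT openT (tchar_reg p.1 : reg [set: torus K n] _) (Q := ppspace D).
  have r2 := pr2_reg openT openT (@point_reg _ _ _ D p.1 p.2 setT openT) (P := torus K n).
  rewrite setXTT in r1 r2.
  exact: (sheaf_mul S oT r1 r2).
- move=> x; apply: point_ext => u f _ /=; rewrite /tchar big1 ?mul1r // => i _.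
  by rewrite /tcoord /= mxE exp1rz.
- move=> s t x; apply: point_ext => u f _ /=; rewrite mulrA; congr (_ * _).
  by rewrite /tchar -big_split; apply: eq_bigr => i _; rewrite {1}/tcoord /= mxE expfzMl.
Qed.

Lemma canonE D' D (r : refines D' D) (x : ppspace D') u f : grpart D u f ->
  val (canonical_map r x) u f = val x u f.
Proof. by move=> gf; rewrite /= asboolT. Qed.

Lemma canon_ppact D' D (r : refines D' D) t (x : ppspace D') : ppdiv D ->
  canonical_map r (ppact t x) = ppact t (canonical_map r x).
Proof. by move=> pD; apply: point_ext => u f gf; rewrite /= asboolT. Qed.

Lemma canon_comp D1 D2 D3 (r12 : refines D1 D2) (r23 : refines D2 D3) (r13 : refines D1 D3) x :
  ppdiv D3 -> canonical_map r23 (canonical_map r12 x) = canonical_map r13 x.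
Proof.
move=> p3; apply: point_ext => u f gf; rewrite !canonE //.
exact: grpart_refines gf.
Qed.

Section Pair.
Context (D' D : poldiv Y n) (r : refines D' D) (pD' : ppdiv D') (pD : ppdiv D).

Lemma canon_morphism : fun_morphism (canonical_map r).
Proof.
have [gl [glP glG]] := generators pD.
apply: (chart_fun_morphism (pp_chart nY cov pD glP glG)) => i; rewrite /pp_coord.
set p := nth (0, 0) gl i; have [gp|np] := pselect (grpart D p.1 p.2).
  by apply: (reg_eq openT _ (point_reg p.1 p.2 openT)) => x _; rewrite canonE.
apply: (reg_eq openT _ (sheaf_cst (space_sheaf (ppspace D')) 0 openT)) => x _.
by rewrite /= asboolF.
Qed.

(** If f does not vanish at x, the homomorphism x extends to A' by sending g to x(f^k g) / x(f)^k
    for any large k, since f^k g is in A by [good_power]. *)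
Lemma good_range w f (x : ppspace D) : good D' D w f -> val x w f != 0 -> range (canonical_map r) x.
Proof.
move=> gd xf; have [f0 gf _ _] := gd.
have /choice[k hk] : forall p : 'cV[int]_n * F, exists k0, grpart D' p.1 p.2 ->
    forall k, (k0 <= k)%N -> grpart D (p.1 + w *+ k) (f ^+ k * p.2).
  move=> [u g]; have [gg|ng] := pselect (grpart D' u g); last by exists 0%N.
  by have [k0 h] := good_power nY cov pD' pD r gd gg; exists k0.
pose X u g := if `[< grpart D' u g >] then val x (u + w *+ k (u, g)) (f ^+ k (u, g) * g) / val x w f ^+ k (u, g) else 0.
(* The value does not depend on k once k is large, so sums and products can be compared with a
   common exponent. *)
have XE u g j : grpart D' u g -> (k (u, g) <= j)%N -> X u g = val x (u + w *+ j) (f ^+ j * g) / val x w f ^+ j.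
  move=> gg; rewrite /X asboolT // => /subnKC <-; elim: (j - _)%N => [|i IH]; first by rewrite addn0.
  have gi : grpart D (u + w *+ (k (u, g) + i)) (f ^+ (k (u, g) + i) * g) by apply: (hk (u, g)) => //; exact: leq_addr.
  rewrite IH addnS !exprS mulrS addrCA -(mulrA f) (pointM nY cov pD x gf gi).
  by rewrite -mulf_div divff // mul1r.
have isX : is_point D' X.
  split.
  - have g1 := grpart_cst nY cov D' 1; rewrite rmorph1 in g1.
    rewrite (XE _ _ _ g1 (leqnn _)) add0r mulr1 (pointX nY cov pD) // divff // expf_neq0 //.
  - move=> u g h gg gh ggh; pose j := (k (u, g) + k (u, h) + k (u, g + h)%R)%N.
    have [h1 h2 h3] : [/\ (k (u, g) <= j)%N, (k (u, h) <= j)%N & (k (u, g + h)%R <= j)%N] by rewrite /j; split; lia.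
    rewrite (XE _ _ j gg h1) (XE _ _ j gh h2) (XE _ _ j ggh h3) mulrDr (pointD nY cov) ?mulrDl //.
    + exact: (hk (u, g)).
    + exact: (hk (u, h)).
  - move=> u c g gg gcg; pose j := (k (u, g) + k (u, ff_cst Y c * g)%R)%N.
    rewrite (XE _ _ j gg) ?(XE _ _ j gcg) ?leq_addr ?leq_addl // mulrCA -[ff_cst Y c]/(ffc Y c).
    rewrite (pointZ nY cov pD) ?mulrA //.
    by apply: (hk (u, g)) => //; exact: leq_addr.
  - move=> u v g h gg gh ggh; pose j := (k (u, g) + k (u + v, g * h)%R)%N.
    pose i := (k (v, h) + k (u + v, g * h)%R)%N.
    rewrite (XE _ _ j gg) ?(XE _ _ i gh) ?(XE _ _ (j + i)%N ggh) ?leq_addr //; last first.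
      by rewrite /j -addnA addnCA leq_addr.
    rewrite mulf_div -exprD; congr (_ / _).
    rewrite -(pointM nY cov pD); [|by apply: (hk (u, g)) => //; exact: leq_addr|by apply: (hk (v, h)) => //; exact: leq_addr].
    by rewrite exprD mulrnDr addrACA mulrACA.
  - by move=> u g ng; rewrite /X asboolF.
exists (exist (fun z => z \in points D') X (mem_set isX)) => //.
apply: point_ext => u g gg; rewrite canonE //=.
have gg' := grpart_refines r gg; rewrite (XE _ _ _ gg' (leqnn _)).
have := @pointM _ _ nY cov _ _ pD x (w *+ k (u, g)) u (f ^+ k (u, g)) g (grpartX nY cov pD _ gf) gg.
by rewrite addrC => ->; rewrite (pointX nY cov pD) // mulrAC divff ?mul1r // expf_neq0.
Qed.

Context (fD : face_of D' D).

Lemma canon_good (x : ppspace D') : exists w f, good D' D w f /\ val x w f != 0.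
Proof. exact: (good_exists nY cov ofin x pD' pD r fD (locd pD')). Qed.

Lemma canon_fraction w f (x : ppspace D') u g k : good D' D w f -> grpart D' u g ->
  grpart D (u + w *+ k) (f ^+ k * g) -> val x w f != 0 ->
  val x u g = val (canonical_map r x) (u + w *+ k) (f ^+ k * g) * (val (canonical_map r x) w f)^-1 ^+ k.
Proof.
move=> gd gg gk xf; have [f0 gf _ _] := gd; have gf' := grpart_refines r gf.
rewrite !canonE // addrC (pointM nY cov pD') //; last exact: (grpartX nY cov pD').
by rewrite (pointX nY cov pD') // exprVn mulrAC divff ?mul1r // expf_neq0.
Qed.

Lemma canon_inj : injective (canonical_map r).
Proof.
move=> x y xy; have [w [f [gd xf]]] := canon_good x; have [f0 gf _ _] := gd.
have yf : val y w f != 0 by rewrite -(canonE r y gf) -xy canonE.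
apply: point_ext => u g gg; have [k hk] := good_power nY cov pD' pD r gd gg.
by rewrite !(canon_fraction (k := k) gd gg) ?xy //; exact: hk.
Qed.

(** The image is open because it is covered by the nonvanishing loci of good sections. On such a
    locus the coordinates of X(D') are fractions x(f^k g) / x(f)^k of functions on X(D), so germs
    and neighbourhoods come from X(D). *)
Lemma canon_open_embedding : open_embedding (canonical_map r).
Proof.
have [gl [glP glG]] := generators pD'; have [_ _ _ lf _] := pp_chart nY cov pD' glP glG.
have S := space_sheaf (ppspace D).
split.
  apply: open_near => _ [x _ <-]; have [w [f [gd xf]]] := canon_good x; have [f0 gf _ _] := gd.
  have cx : val (canonical_map r x) w f != 0 by rewrite canonE.
  exists (setT `&` [set z : ppspace D | val z w f != 0]); split.
  - by apply: (sheaf_nz S openT); exact/point_reg/openT.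
  - by split=> //; exact: cx.
  - by move=> z [_ zf]; exact: good_range gd zf.
(* Functions c near the image of x that restrict to the coordinates of X(D'). *)
have chart x : exists (V0 : set (ppspace D)) (c : ppspace D -> nat -> K),
    [/\ open V0, V0 (canonical_map r x), forall i, reg V0 (fun z => c z i) &
        forall y, V0 (canonical_map r y) -> c (canonical_map r y) =1 pp_coord gl y].
  have [w [f [gd xf]]] := canon_good x; have [f0 gf _ _] := gd.
  have gi i : grpart D' (nth (0, 0) gl i).1 (nth (0, 0) gl i).2.
    have [il|il] := ltnP i (size gl); first by apply: glP; rewrite mem_nth.
    by rewrite nth_default //= -(rmorph0 (ffc Y)); exact: (grpart_cst nY cov D' 0).
  have /choice[k hk] : forall i, exists k, grpart D ((nth (0, 0) gl i).1 + w *+ k) (f ^+ k * (nth (0, 0) gl i).2).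
    by move=> i; have [k hk] := good_power nY cov pD' pD r gd (gi i); exists k; exact: hk.
  pose V0 := setT `&` [set z : ppspace D | val z w f != 0].
  have rf : reg setT (fun z : ppspace D => val z w f) by exact/point_reg/openT.
  have oV : open V0 by exact: (sheaf_nz S openT rf).
  have cx : val (canonical_map r x) w f != 0 by rewrite canonE.
  exists V0, (fun z i => val z ((nth (0, 0) gl i).1 + w *+ k i) (f ^+ k i * (nth (0, 0) gl i).2) * (val z w f)^-1 ^+ k i).
  split=> //.
  - move=> i; apply: (sheaf_mul S oV); first exact: point_reg.
    exact: (reg_exp oV (k i) (sheaf_inv S openT rf)).
  - move=> y [_ yf] i; rewrite /pp_coord (canon_fraction (k := k i) gd (gi i) (hk i)) //.
    by rewrite -(canonE r y gf).
have cE x c e y : (forall i, c (canonical_map r y) i = pp_coord gl y i) -> pv (c (canonical_map r y)) e = pv (pp_coord gl y) e :> K.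
  by move=> h; exact: pv_ext.
apply: embeddingI.
- exact: canon_morphism.
- exact: canon_inj.
- move=> U x oU Ux; have [[b bx bU] _] := lf x U Logic.I oU Ux.
  have [V0 [c [oV Vx rc cc]]] := chart x.
  exists (V0 `&` [set z | pv (c z) b != 0]); split.
  + exact: (pv_neq0_open b oV rc).
  + by split=> //=; rewrite (pv_ext b (cc x Vx)).
  + by move=> y [Vy] /=; rewrite (pv_ext b (cc y Vy)); exact: bU.
- move=> U h x oU rh Ux; have [_ /(_ h rh)[a [b [bx hE]]]] := lf x U Logic.I oU Ux.
  have [V0 [c [oV Vx rc cc]]] := chart x.
  have oW := pv_neq0_open b oV rc.
  exists (V0 `&` [set z | pv (c z) b != 0]), (fun z => pv (c z) a * (pv (c z) b)^-1); split=> //.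
  + by split=> //=; rewrite (pv_ext b (cc x Vx)).
  + apply: (sheaf_mul S oW); last exact: (sheaf_inv S oV (reg_pv b oV rc)).
    by apply: (reg_res oW oV) => [z []//|]; exact: reg_pv.
  + by move=> y Uy [Vy /=]; rewrite !(pv_ext _ (cc y Vy)); exact: hE.
Qed.

End Pair.

End Canonical.

Lemma fun_morphism_eq (K : fieldType) (X Z : fspace K) (f g : X -> Z) : f =1 g -> fun_morphism f -> fun_morphism g.
Proof. by move=> /funext ->. Qed.

(** * The glued space *)

Section Gluing.
Context (K : closedFieldType) (Y : integral_space K) (nY : normal_variety Y).
Local Notation F := (funfield Y).
Context (cov : forall y : Y, exists A (r : nat -> F) n, fchart A r n /\ A y).
Context (ofin : forall a : F, a != 0 -> finite_set [set E : prime_divisor Y | ord E a != 0]).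
Context (n : nat).
Context (locd : forall D : poldiv Y n, ppdiv D -> exists p m z t A, @proj_data K Y (Loc D) p m z t A).
Context (I : Type) (D : I -> poldiv Y n) (fanD : divisorial_fan D).
Local Notation X i := (ppspace (D i)).
Local Notation el := (eta_l fanD).
Local Notation er := (eta_r fanD).

Lemma fan_ppdiv i : ppdiv (D i). Proof. exact: fanD.1. Qed.

Lemma fan_cap_ppdiv i j : ppdiv (cap (D i) (D j)).
Proof. by have [_ /(_ i j)[_ _ [k <-]]] := fanD; exact: fan_ppdiv. Qed.

Lemma eta_l_open_embedding i j : open_embedding (el i j).
Proof.
have [_ /(_ i j)[f _ _]] := fanD.
exact: (canon_open_embedding nY cov ofin locd (fan_refines_l fanD i j) (fan_cap_ppdiv i j) (fan_ppdiv i) f).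
Qed.

Lemma eta_r_open_embedding i j : open_embedding (er i j).
Proof.
have [_ /(_ i j)[_ f _]] := fanD.
exact: (canon_open_embedding nY cov ofin locd (fan_refines_r fanD i j) (fan_cap_ppdiv i j) (fan_ppdiv j) f).
Qed.

Lemma eta_l_inj i j : injective (el i j).
Proof. by have [_ e] := eta_l_open_embedding i j; exact: embedding_inj. Qed.

Definition fan_rel i j (x : X i) (y : X j) : Prop := exists2 z, el i j z = x & er i j z = y.

(** The intersections taken in either order are equal only propositionally, so their spaces of
    points are different types; substitution of the equality identifies them. *)
Lemma canon_transport (D1 D2 D3 D4 : poldiv Y n) (r : refines D1 D3) (r' : refines D2 D3)
    (s : refines D1 D4) (s' : refines D2 D4) z : D1 = D2 ->
  exists2 z', canonical_map r' z' = canonical_map r z & canonical_map s' z' = canonical_map s z.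
Proof. by move=> e; subst D2; exists z; rewrite ?(Prop_irrelevance r' r) ?(Prop_irrelevance s' s). Qed.

Lemma canon_id (D1 D2 : poldiv Y n) (r : refines D1 D2) x : D1 = D2 -> exists z, canonical_map r z = x.
Proof.
move=> e; subst D2; exists x; apply: point_ext => u f gf; exact: canonE.
Qed.

Lemma fan_relC i j (x : X i) (y : X j) : fan_rel x y -> fan_rel y x.
Proof.
move=> [z <- <-].
have [z' h1 h2] := canon_transport (fan_refines_l fanD i j) (fan_refines_r fanD j i)
  (fan_refines_r fanD i j) (fan_refines_l fanD j i) z (capC (D i) (D j)).
by exists z'.
Qed.

Lemma fan_rel_refl i (x : X i) : fan_rel x x.
Proof.
have e : cap (D i) (D i) = D i.
  by rewrite /cap setIid; case: (D i) => s c /=; congr PolDiv; apply/funext => E; rewrite setIid.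
have [z zx] := canon_id (fan_refines_l fanD i i) x e.
by exists z => //; rewrite /eta_r (Prop_irrelevance (fan_refines_r fanD i i) (fan_refines_l fanD i i)).
Qed.

Lemma fan_rel_fun i j (x : X i) (y y' : X j) : fan_rel x y -> fan_rel x y' -> y = y'.
Proof. by move=> [z zx <-] [z' z'x <-]; congr er; apply: (@eta_l_inj i j); rewrite zx. Qed.

(** The product of good sections for the intersections i j and i k does not vanish at x, so x comes
    from a point e over the threefold intersection. Mapping e into X(D^j n D^k) connects y and z. *)
Lemma fan_rel_trans i j k (x : X i) (y : X j) (z : X k) : fan_rel x y -> fan_rel x z -> fan_rel y z.
Proof.
move=> [a ax <-] [b bx <-].
have [_ /(_ i j)[fij _ [l lE]]] := fanD; have [_ /(_ i k)[fik _ [m mE]]] := fanD.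
have pij := fan_cap_ppdiv i j; have pik := fan_cap_ppdiv i k; have pjk := fan_cap_ppdiv j k.
have [w [f [gd xf]]] := canon_good nY cov ofin locd (fan_refines_l fanD i j) pij (fan_ppdiv i) fij a.
have [w' [f' [gd' xf']]] := canon_good nY cov ofin locd (fan_refines_l fanD i k) pik (fan_ppdiv i) fik b.
have [[_ gf _ _] [_ gf' _ _]] := (gd, gd').
set E := cap (cap (D i) (D j)) (cap (D i) (D k)).
(* Both intersections are members of the fan, so their intersection is a member as well. *)
have pE : ppdiv E by rewrite /E -lE -mE; exact: fan_cap_ppdiv.
have mk D' : ppdiv D' -> tail E `<=` tail D' -> (forall P, coef E P `<=` coef D' P) -> refines E D'.
  by move=> [pD' _ _ _]; have [pE' _ _ _] := pE.
have ri : refines E (D i) by apply: mk => [||P]; [exact: fan_ppdiv|move=> v [[] ]|move=> v [[]]].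
have rj : refines E (D j) by apply: mk => [||P]; [exact: fan_ppdiv|move=> v [[] ]|move=> v [[]]].
have rk : refines E (D k) by apply: mk => [||P]; [exact: fan_ppdiv|move=> v [_ []]|move=> v [_ []]].
have rij : refines E (cap (D i) (D j)) by apply: mk => // [|P]; move=> v [].
have rik : refines E (cap (D i) (D k)) by apply: mk => // [|P]; move=> v [].
have rjk : refines E (cap (D j) (D k)) by apply: mk => // [|P]; move=> v [[? ?] [? ?]].
have xff : val (el i j a) (w + w') (f * f') != 0.
  rewrite (pointM nY cov (fan_ppdiv i)) // mulf_neq0 //.
    by rewrite [val _ _ _](canonE (fan_refines_l fanD i j)).
  by rewrite ax -bx [val _ _ _](canonE (fan_refines_l fanD i k)).
have [e _ ex] := good_range nY cov ri pE (fan_ppdiv i) (good_mul nY cov (fan_ppdiv i) gd gd') xff.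
have ea : canonical_map rij e = a.
  apply: (@eta_l_inj i j); rewrite -ex; exact: (canon_comp rij (fan_refines_l fanD i j) ri e (fan_ppdiv i)).
have eb : canonical_map rik e = b.
  apply: (@eta_l_inj i k); rewrite bx -ax -ex; exact: (canon_comp rik (fan_refines_l fanD i k) ri e (fan_ppdiv i)).
exists (canonical_map rjk e).
  rewrite -ea [LHS](canon_comp rjk (fan_refines_l fanD j k) rj e (fan_ppdiv j)).
  by rewrite [RHS](canon_comp rij (fan_refines_r fanD i j) rj e (fan_ppdiv j)).
rewrite -eb [LHS](canon_comp rjk (fan_refines_r fanD j k) rk e (fan_ppdiv k)).
by rewrite [RHS](canon_comp rik (fan_refines_r fanD i k) rk e (fan_ppdiv k)).
Qed.

Lemma fan_rel_phi i j (x : subsp (fan_chart fanD i j)) : fan_rel (val x) (val (fan_phi fanD i j x)).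
Proof. by rewrite /fan_phi /=; case: cid2 => z /= _ zx; exists z. Qed.

Lemma fan_rel_phiE i j (x : subsp (fan_chart fanD i j)) y : fan_rel (val x) y -> val (fan_phi fanD i j x) = y.
Proof. by move=> xy; apply: fan_rel_fun xy; exact: fan_rel_phi. Qed.

Lemma fan_rel_chart i j (x : X i) (y : X j) : fan_rel x y -> fan_chart fanD i j x.
Proof. by move=> [z zx _]; exists z. Qed.

Lemma fan_phi_morphism i j : fun_morphism (fan_phi fanD i j).
Proof.
apply: sub_morphism; have [_ [g [_ [d [md gK dK]]] gE]] := eta_l_open_embedding i j.
have [_ /embedding_morphism mr] := eta_r_open_embedding i j.
apply: (fun_morphism_eq _ (comp_morphism mr md)) => x /=.
by apply/esym/fan_rel_phiE; exists (d x) => //; rewrite -gE dK.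
Qed.

Lemma fan_gluing_data : gluing_data (fan_phi fanD).
Proof.
split.
- by move=> i j; have [] := eta_l_open_embedding i j.
- move=> i j; split; first exact: fan_phi_morphism.
  exists (fan_phi fanD j i); split; first exact: fan_phi_morphism.
    by move=> x; apply/val_inj/fan_rel_phiE/fan_relC/fan_rel_phi.
  by move=> x; apply/val_inj/fan_rel_phiE/fan_relC/fan_rel_phi.
- move=> i j k; apply/seteqP; split.
    move=> _ [x [z _ zx] <-]; split; first exact: (set_mem (valP (fan_phi fanD i j x))).
    apply: (@fan_rel_chart _ _ _ (er i k z)); apply: (fan_rel_trans (fan_rel_phi x)).
    by exists z.
  move=> y [[a _ ay] [b _ bY]].
  have yx : fan_rel y (er j i a) by exists a.
  have yz : fan_rel y (er j k b) by exists b.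
  have xy := fan_relC yx; have xz := fan_rel_trans yx yz.
  exists (exist (fun y => y \in fan_chart fanD i j) _ (mem_set (fan_rel_chart xy))).
    exact: fan_rel_chart xz.
  exact: fan_rel_phiE.
- move=> i j k x y z xy zx; apply: fan_rel_phiE; rewrite zx.
  by apply: (fan_rel_trans (fan_rel_phi x)); rewrite xy; exact: fan_rel_phi.
Qed.

(** [fan_rel] is already an equivalence relation on the disjoint union, so the relation generated by
    the gluing maps is no larger. *)
Lemma fan_inE i j (x : X i) (y : X j) : fan_in fanD i x = fan_in fanD j y <-> fan_rel x y.
Proof.
split.
  move=> /quot_piP h.
  pose R (p q : coprod (fun i => ppspace (D i))) := @fan_rel (projT1 p) (projT1 q) (projT2 p) (projT2 q).
  suff : R (@coprod_in K I (fun i => X i) i x) (@coprod_in K I (fun i => X i) j y) by [].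
  elim: h => [_ _ [i' [j' [x' [-> ->]]]]|p|p q _ pq|p q s _ pq _ qs].
  - exact: fan_rel_phi.
  - exact: fan_rel_refl.
  - exact: fan_relC.
  - exact: fan_rel_trans (fan_relC pq) qs.
move=> xy; apply/quot_piP/Relation_Operators.rst_step.
exists i, j, (exist (fun y => y \in fan_chart fanD i j) _ (mem_set (fan_rel_chart xy))).
by split=> //; rewrite (fan_rel_phiE (y := y)).
Qed.

Lemma fan_in_inj i : injective (fan_in fanD i).
Proof. by move=> x y /fan_inE; apply: fan_rel_fun; exact: fan_rel_refl. Qed.

Lemma fan_openP (U : set (fan_space fanD)) : open U <-> forall i, open (fan_in fanD i @^-1` U).
Proof. by rewrite quot_openE; split=> [/sigT_openP oU i|oU]; [exact: oU|apply/sigT_openP => i; exact: oU]. Qed.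

Lemma fan_cover (q : fan_space fanD) : exists i (x : X i), q = fan_in fanD i x.
Proof. by have [[i x] ->] := quot_pi_surj q; exists i, x. Qed.

Lemma fan_in_open i (U : set (X i)) : open U -> open (fan_in fanD i @` U).
Proof.
move=> oU; apply/fan_openP => j; have [oe er'] := (eta_l_open_embedding i j, eta_r_open_embedding i j).
have -> : fan_in fanD j @^-1` (fan_in fanD i @` U) = er i j @` (el i j @^-1` U).
  apply/seteqP; split=> y /=.
    by move=> [x Ux /fan_inE[z zx zy]]; exists z => //=; rewrite zx.
  by move=> [z Uz zy]; exists (el i j z) => //; apply/fan_inE; exists z.
apply: open_embedding_open => //; apply: morphism_open oU.
by have [_ /embedding_morphism] := oe.
Qed.

Lemma fan_in_morphism i : fun_morphism (fan_in fanD i).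
Proof.
split; first by apply/continuousP => V /fan_openP; exact.
by move=> V g _ rg; exact: (rg i).
Qed.

(** A regular function h on an open subset of X_i is carried to the image. Its pullback to X_j is
    regular because on the overlap it is h transported along the two open embeddings of X(D^i n
    D^j). *)
Lemma fan_in_open_embedding i : open_embedding (fan_in fanD i).
Proof.
split; first exact: fan_in_open openT.
apply: embeddingI; [exact: fan_in_morphism|exact: fan_in_inj| |].
  move=> U x oU Ux; exists (fan_in fanD i @` U); split; [exact: fan_in_open|by exists x|].
  by move=> y [x' Ux' /fan_in_inj <-].
move=> U h x oU rh Ux.
(* The function g takes the values of h on V and is 0 outside. *)
pose V := fan_in fanD i @` U; have oV : open V by exact: fan_in_open.
have /choice[g gE] : forall q, exists c, forall y, U y -> fan_in fanD i y = q -> c = h y.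
  move=> q; have [[y Uy yq]|nq] := pselect (V q); last by exists 0 => y Uy yq; case: nq; exists y.
  by exists (h y) => y' _; rewrite -yq => /fan_in_inj ->.
exists V, g; split=> //; [by exists x| |by move=> y Uy _; rewrite (gE _ y)].
move=> j; have [oe er'] := (eta_l_open_embedding i j, eta_r_open_embedding i j).
have ml : fun_morphism (el i j) by have [_ /embedding_morphism] := oe.
have oU' := morphism_open ml oU.
have rh' : reg (el i j @^-1` U) (h \o el i j) by exact: ml.2.
apply: (sheaf_glue (space_sheaf (X j))); first by move/fan_openP: oV; exact.
move=> y [x' Ux' /fan_inE[z zx zy]].
have [_ [_ _ _ /(_ rh')[V' [g' [oV' V'z rg' gh]]]]] : exists V, [/\ open V, V (er i j z), (forall y, V (er i j y) -> (el i j @^-1` U) y) &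
  reg (el i j @^-1` U) (h \o el i j) -> exists V' g, [/\ open V', V' (er i j z), reg V' g &
      forall y, (el i j @^-1` U) y -> V' (er i j y) -> (h \o el i j) y = g (er i j y)]].
  by apply: embedding_local => //; [exact: er'.2|rewrite /= zx].
have oW := openI oV' (open_embedding_open er' oU').
exists (V' `&` er i j @` (el i j @^-1` U)), g'; split=> //.
- by split; [rewrite -zy|exists z => //=; rewrite zx].
- by apply: (reg_res oW oV') rg' => q [].
- move=> y' _ [V'y [z' Uz' z'y]].
  have gy : g (fan_in fanD j y') = h (el i j z') by apply: gE => //; apply/fan_inE; exists z'.
  by rewrite [LHS]gy -z'y -gh // z'y.
Qed.

End Gluing.

Lemma nth_In (T : Type) (d : T) s i : (i < size s)%N -> List.In (nth d s i) s.
Proof. by elim: s i => //= a s IH [|i] si; [left|right; exact: IH]. Qed.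

(* If V is an affine open set covered by the U i x U j and every U i meets every
   U j in an affine set, then 1 is a combination of functions b on V with D(b)
   contained in some U i x U j; the preimages of the D(b) under the diagonal are
   affine because the graph of the inclusion of a chart is closed in a product of
   charts, and chart_glue puts them together. *)
Section AffineDiagonal.
Context (K : closedFieldType) (X : fspace K) (I : Type) (U : I -> set X).
Local Notation XX := (prod_space X X).
Context (Uch : forall i, exists k n, affine_chart (U i) k n /\
  forall x y, U i x -> U i y -> k x =1 k y -> x = y).
Context (Ucov : forall x, exists i, U i x).
Context (UIch : forall i j, exists k n, affine_chart (U i `&` U j) k n).

Lemma diag_morphism : fun_morphism (@diag_map K X).
Proof. by apply: (@prod_morphism K X X X id id); split=> // x. Qed.

Lemma affine_diagonal : affine_morphism (@diag_map K X).
Proof.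
split=> [|V aV]; first exact: diag_morphism.
have [l [m [chV injV]]] := affine_open_chart aV; have [oV lr lm lV fV] := chV.
pose d : X -> XX := @diag_map K X; have md : fun_morphism d := diag_morphism.
pose W := d @^-1` V; have oW : open W := morphism_open md oV.
pose B b := exists i j, V `&` [set p | pv (l p) b != 0] `<=` U i `*` U j.
pose J : set (pexp K) := [set e | exists2 s : seq (pexp K * pexp K), (forall q, List.In q s -> B q.2) &
  forall x, V x -> pv (l x) e = \sum_(q <- s) pv (l x) q.1 * pv (l x) q.2].
have [s sB s1] : J (PC 1).
  apply: (affine_null chV) => [e e' ee' [s sB se]|a b [s sB sa] [s' sB' sb]|a b [s sB sb]||p Vp].
  - by exists s => // x Vx; rewrite -ee' // se.
  - exists (s ++ s') => [q /List.in_app_iff[]|x Vx]; [exact: sB|exact: sB'|].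
    by rewrite big_cat -sa // -sb.
  - exists [seq (PM a q.1, q.2) | q <- s] => [q /List.in_map_iff[q' [<- /sB]]|x Vx] //.
    rewrite -[LHS]/(pv (l x) a * pv (l x) b) sb // mulr_sumr big_map; apply: eq_bigr => q _.
    by rewrite mulrA.
  - by exists [::] => // x _; rewrite big_nil.
  - have [[i xi] [j xj]] := (Ucov p.1, Ucov p.2).
    have oU k : open (U k) by have [c [N [[] ]]] := Uch k.
    have oB : open (U i `*` U j : set XX) by exact: prod_box_open.
    have [[b bp bB] _] := lV p _ Vp oB (conj xi xj).
    exists b => //; exists [:: (PC 1, b)] => [q [<-|//]|x Vx].
      by exists i, j => x [Vx xb]; exact: bB.
    by rewrite big_cons big_nil addr0 /= mul1r.
pose r := size s; pose c0 : pexp K * pexp K := (PC 0, PC 0).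
pose hs i x := pv (l (d x)) (nth c0 s i).2; pose cs i x := pv (l (d x)) (nth c0 s i).1.
have rp e : reg W (fun x => pv (l (d x)) e) by exact: (md.2 V _ oV (reg_pv e oV lr)).
have /choice[kn knP] : forall i, exists kn : (X -> nat -> K) * nat, (i < r)%N ->
    affine_chart (W `&` [set x | hs i x != 0]) kn.1 kn.2.
  move=> i; have [ir|] := ltnP i r; last by exists ((fun _ _ => 0), 0%N).
  have [i1 [i2 bU]] := sB _ (nth_In c0 ir).
  have [k [N chU]] := UIch i1 i2.
  have [k1 [N1 [ch1 inj1]]] := Uch i1; have [k2 [N2 [ch2 inj2]]] := Uch i2.
  have chB := prod_chart ch1 ch2; have chb := principal_chart (nth c0 s i).2 chV.
  (* The diagonal preimage of the b-locus is the part of U i1 n U i2 mapped into it; the separated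
     ambient chart required by [graph_chart] is the product of U i1 and U i2. *)
  have := graph_chart md chU chB _ _ chb bU; set A := (X in affine_chart X _ _) => h.
  have -> : W `&` [set x | hs i x != 0] = A.
    by apply/seteqP; split=> x; [move=> Wx; have [] := bU _ Wx|move=> [_]].
  eexists (_, _) => _; apply: h => [p q [p1 p2] [q1 q2] pq|x []] //.
  have e1 : p.1 = q.1.
    apply: inj1 => // t; have [tN|Nt] := ltnP t N1; last by have [_ _ z _ _] := ch1; rewrite !z.
    by have := pq t; rewrite /prod_coord tN.
  have e2 : p.2 = q.2.
    apply: inj2 => // t; have := pq (N1 + t)%N.
    by rewrite /prod_coord ltnNge leq_addr /= addKn.
  by case: p q e1 e2 {p1 p2 q1 q2 pq} => ? ? [? ?] /= -> ->.
have [|||k [N ch]] := @chart_glue K X W r hs cs oW _ _ _ (fun i => (kn i).1) (fun i => (kn i).2) knP.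
- by move=> i _; exact: rp.
- by move=> i _; exact: rp.
- by move=> x Wx; have := s1 (d x) Wx; rewrite (big_nth c0) big_mkord => <-.
suff inj x y : W x -> W y -> k x =1 k y -> x = y by have [] := chart_affine_open ch inj.
move=> Wx Wy xy.
suff : d x = d y by case.
apply: injV => // i; have [e eE] := chart_reg_poly ch (rp (PV i)).
by rewrite -[LHS]/(pv (l (d x)) (PV i)) eE // (pv_ext e xy) -eE.
Qed.

End AffineDiagonal.

Section FanSpace.
Context (K : closedFieldType) (Y : integral_space K) (nY : normal_variety Y).
Local Notation F := (funfield Y).
Context (cov : forall y : Y, exists A (r : nat -> F) n, fchart A r n /\ A y).
Context (ofin : forall a : F, a != 0 -> finite_set [set E : prime_divisor Y | ord E a != 0]).
Context (n : nat).
Context (locd : forall D : poldiv Y n, ppdiv D -> exists p m z t A, @proj_data K Y (Loc D) p m z t A).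
Context (I : Type) (D : I -> poldiv Y n) (fanD : divisorial_fan D).
Local Notation X i := (ppspace (D i)).
Local Notation el := (eta_l fanD).
Local Notation er := (eta_r fanD).
Local Notation XS := (fan_space fanD).
Local Notation U i := (range (fan_in fanD i)).

Lemma fan_in_chart i : exists gl k, affine_chart (U i) k (size gl) /\ forall x, k (fan_in fanD i x) = pp_coord gl x.
Proof.
have [gl [glP glG]] := generators nY cov ofin locd (fan_ppdiv fanD i).
have [k [ch kE]] := open_embedding_chart (fan_in_open_embedding nY cov ofin locd fanD i)
  (pp_chart nY cov (fan_ppdiv fanD i) glP glG).
by exists gl, k.
Qed.

Lemma fan_in_chart_inj i : exists k m, affine_chart (U i) k m /\
  forall x y, U i x -> U i y -> k x =1 k y -> x = y.
Proof.
have [gl [glP glG]] := generators nY cov ofin locd (fan_ppdiv fanD i).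
have [k [ch kE]] := open_embedding_chart (fan_in_open_embedding nY cov ofin locd fanD i)
  (pp_chart nY cov (fan_ppdiv fanD i) glP glG).
exists k, (size gl); split=> // _ _ [x _ <-] [y _ <-] xy; congr fan_in.
by apply: (pp_coord_inj nY cov (fan_ppdiv fanD i) glP glG) => j; rewrite -!kE.
Qed.

Lemma fan_in_meet i j z : fan_in fanD i (el i j z) = fan_in fanD j (er i j z).
Proof. by apply/(fan_inE nY cov ofin locd); exists z. Qed.

Lemma fan_meet_chart i j : exists k m, affine_chart (U i `&` U j) k m.
Proof.
have pij := fan_cap_ppdiv fanD i j.
have [gl [glP glG]] := generators nY cov ofin locd pij.
have [k [ch _]] := open_embedding_chart (eta_l_open_embedding nY cov ofin locd fanD i j) (pp_chart nY cov pij glP glG).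
have [k' [ch' _]] := open_embedding_chart (fan_in_open_embedding nY cov ofin locd fanD i) ch.
exists k', (size gl); have -> // : U i `&` U j = fan_in fanD i @` range (el i j).
apply/seteqP; split=> q.
  by move=> [[x _ <-] [y _ /esym/(fan_inE nY cov ofin locd)[z zx _]]]; exists x => //; exists z.
by move=> [_ [z _ <-] <-]; split; [exists (el i j z)|exists (er i j z) => //; rewrite fan_in_meet].
Qed.

Lemma fan_in_cover q : exists i, U i q.
Proof. by have [i [x ->]] := fan_cover q; exists i, x. Qed.

(** The intersection of X_i and X_j is a nonempty open set, being the image of X(D^i n D^j). Given V
    meeting X_i and V' meeting X_j, irreducibility of X_i moves V into the overlap, and
    irreducibility of X_j makes it meet V'. *)
Lemma fan_prevariety : prevariety XS.
Proof.
have irr (D' : poldiv Y n) (pD : ppdiv D') : irreducible [set: ppspace D'].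
  by have [_] := ppspace_affine_variety nY cov ofin locd pD.
split; last first.
  move=> q; have [i Uq] := fan_in_cover q; exists (U i) => //.
  by have [k [m [ch inj]]] := fan_in_chart_inj i; exact: chart_affine_open ch inj.
move=> V V' /fan_openP oV /fan_openP oV' [p [_ Vp]] [q [_ Vq]].
have [[i [x px]] [j [y qy]]] := (fan_cover p, fan_cover q).
have [o _] := eta_l_open_embedding nY cov ofin locd fanD i j.
have [[z0 _] _] := irr _ (fan_cap_ppdiv fanD i j).
have [_ hi] := irr _ (fan_ppdiv fanD i); have [_ hj] := irr _ (fan_ppdiv fanD j).
have [||x' [_ [Vx' [z _ zE]]]] := hi _ _ (oV i) o; first by exists x; rewrite /= -px.
  by exists (el i j z0); split=> //; exists z0.
have [||y' [_ [Vy Vy']]] := hj _ _ (oV j) (oV' j).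
- by exists (er i j z); split=> //; rewrite /= -fan_in_meet zE.
- by exists y; rewrite /= -qy.
by exists (fan_in fanD j y').
Qed.

Lemma fan_compact : finite_set [set: I] -> compact [set: XS].
Proof.
move=> /(@finite_seqP {classic I})[s sI].
have -> : [set: XS] = \big[setU/set0]_(i <- s) (U (i : I)).
  rewrite -bigcup_seq; apply/seteqP; split=> // q _; have [i Uq] := fan_in_cover q.
  by exists i => //; have : [set: {classic I}] i by []; rewrite sI.
apply: bigsetU_compact => i _; apply: continuous_compact; last first.
  have [gl [glP glG]] := generators nY cov ofin locd (fan_ppdiv fanD i).
  exact: chart_compactness (pp_chart nY cov (fan_ppdiv fanD i) glP glG).
by apply: continuous_subspaceT; exact: (fan_in_morphism fanD i).1.
Qed.

Lemma fan_affine_diagonal : affine_morphism (@diag_map K XS).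
Proof. exact: (affine_diagonal fan_in_chart_inj fan_in_cover fan_meet_chart). Qed.

Lemma eta_l_ppact i j t z : el i j (ppact t z) = ppact t (el i j z).
Proof. exact: canon_ppact (fan_ppdiv fanD i). Qed.

Lemma eta_r_ppact i j t z : er i j (ppact t z) = ppact t (er i j z).
Proof. exact: canon_ppact (fan_ppdiv fanD j). Qed.

(** The actions on the X_i are compatible because the eta maps are equivariant, and they determine
    the action since the X_i cover. That the action is a morphism is checked over the affine charts
    U i. *)
Lemma fan_action : exists! act : torus K n -> XS -> XS, torus_action act /\
  forall i t (x : X i), act t (fan_in fanD i x) = fan_in fanD i (ppact t x).
Proof.
have /choice[a aE] : forall p : torus K n * XS, exists q, forall i (x : X i), p.2 = fan_in fanD i x ->
    q = fan_in fanD i (ppact p.1 x).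
  move=> [t q] /=; have [i [x qx]] := fan_cover q; exists (fan_in fanD i (ppact t x)) => j y.
  rewrite qx => /(fan_inE nY cov ofin locd)[z zx zy]; apply/(fan_inE nY cov ofin locd).
  by exists (ppact t z); rewrite ?eta_l_ppact ?eta_r_ppact ?zx ?zy.
pose act t q := a (t, q).
have actE i t (x : X i) : act t (fan_in fanD i x) = fan_in fanD i (ppact t x) by exact: aE.
exists act; split; last first.
  move=> act' [_ act'E]; apply/funext => t; apply/funext => q.
  by have [i [x ->]] := fan_cover q; rewrite actE act'E.
split=> //; pose f (p : prod_space (torus K n) XS) := act (pr1 p) (pr2 p).
have loc i : exists Z : set (prod_space (torus K n) XS), [/\ open Z, forall p, Z p <-> U i p.2,
    forall V, open V -> open (Z `&` f @^-1` V) &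
    forall V g, open V -> reg V g -> reg (Z `&` f @^-1` V) (g \o f)].
  have [gl [k [ch kE]]] := fan_in_chart i; have [oU kr _ _ _] := ch.
  pose Z : set (prod_space (torus K n) XS) := setT `*` U i.
  have oZ : open Z by exact: prod_box_open openT oU.
  have fZ p : Z p -> U i (f p) by move=> [_ [x _ xp]]; exists (ppact p.1 x) => //; rewrite -actE xp.
  (* The j-th coordinate is homogeneous, so the action multiplies it by the character of its
     degree. *)
  have rZ j : reg Z (fun p => k (f p) j).
    have r1 := pr1_reg openT oU (tchar_reg (nth (0, 0) gl j).1 : reg [set: torus K n] _).
    have r2 := pr2_reg (openT : open [set: torus K n]) oU (kr j).
    apply: (reg_eq oZ _ (sheaf_mul (space_sheaf _) oZ r1 r2)) => p [_ [x _ xp]] /=.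
    by rewrite /f /pr1 /pr2 -xp actE !kE.
  have [h1 h2] := chart_morphism ch oZ fZ rZ.
  by exists Z; split=> // p; split=> [[]|].
have oP V : open V -> open (f @^-1` V).
  move=> oV; apply: open_near => p Vp; have [i Ui] := fan_in_cover p.2.
  have [Z [oZ ZE h1 h2]] := loc i.
  by exists (Z `&` f @^-1` V); split; [exact: h1|split=> //; exact/ZE|move=> q []].
split.
- split; first exact/continuousP.
  move=> V g oV rg; apply: (sheaf_glue (space_sheaf _)) => [|p Vp]; first exact: oP.
  have [i Ui] := fan_in_cover p.2; have [Z [oZ ZE h1 h2]] := loc i.
  by exists (Z `&` f @^-1` V), (g \o f); split=> //; [exact: h1|split=> //; exact/ZE|exact: h2].
- move=> q; have [i [x ->]] := fan_cover q; rewrite actE.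
  by have [_ -> _] := ppact_torus_action nY cov ofin locd (fan_ppdiv fanD i).
- move=> s t q; have [i [x ->]] := fan_cover q; rewrite !actE.
  by have [_ _ ->] := ppact_torus_action nY cov ofin locd (fan_ppdiv fanD i).
Qed.

End FanSpace.

Theorem theorem5p3 (K : closedFieldType) (n : nat) (Y : integral_space K)
    (Y_variety : variety Y) (Y_normal : normal_variety Y) (Y_semiproj : semiprojective Y)
    (I : Type) (D : I -> poldiv Y n) (fanD : divisorial_fan D) :
  [/\ (* the X_i are affine T-varieties *)
      forall i, affine_variety (ppspace (D i)) /\
                torus_action (fun t (x : ppspace (D i)) => ppact t x),
      (* eta_ij and eta_ji are T-equivariant open embeddings *)
      forall i j,
        [/\ open_embedding (eta_l fanD i j), open_embedding (eta_r fanD i j),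
            forall t z, eta_l fanD i j (ppact t z) = ppact t (eta_l fanD i j z) &
            forall t z, eta_r fanD i j (ppact t z) = ppact t (eta_r fanD i j z)],
      gluing_data (fan_phi fanD),
      (* X is a prevariety with affine diagonal, of finite type if I is finite *)
      [/\ prevariety (fan_space fanD),
          finite_set [set: I] -> compact [set: fan_space fanD] &
          affine_morphism (@diag_map K (fan_space fanD))] &
      exists! act : torus K n -> fan_space fanD -> fan_space fanD,
        torus_action act /\
        forall i t (x : ppspace (D i)),
          act t (fan_in fanD i x) = fan_in fanD i (ppact t x)].
Proof.
have [p [m [z [t [A pd]]]]] := semiprojective_data Y_semiproj.
have cov y : exists (A : set Y) (r : nat -> funfield Y) l, fchart A r l /\ A y.
  have [k km Ay] := pd_cover pd (y := y) Logic.I.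
  by have [|_ ch] := pd_chart pd km; [exists y|exists (A k), (proj_env p z t k), (p + m)%N].
have ofin (a : funfield Y) : a != 0 -> finite_set [set E : prime_divisor Y | ord E a != 0].
  apply: (@ord_finite K Y Y_normal m A (proj_env p z t) (fun=> (p + m)%N)) => [y|k km A0].
    exact: (pd_cover pd (y := y) Logic.I).
  by have [] := pd_chart pd km A0.
(* The complement of Loc(D') is the support of an effective semiample divisor by definition of a
   pp-divisor with empty coefficients, so [locus_data] applies. *)
have locd D' : ppdiv D' -> exists p m z t A, @proj_data K Y (@Loc K Y n D') p m z t A.
  move=> [_ [G [fG eG sG LG]] _ _]; have [p' [z' [A' h]]] := locus_data Y_normal cov ofin pd fG eG sG LG.
  by exists p', m, z', t, A'.
split.
- by move=> i; split; [exact: (ppspace_affine_variety Y_normal cov ofin locd (fan_ppdiv fanD i))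
    |exact: (ppact_torus_action Y_normal cov ofin locd (fan_ppdiv fanD i))].
- move=> i j; split; [exact: eta_l_open_embedding|exact: eta_r_open_embedding|
    exact: eta_l_ppact|exact: eta_r_ppact].
- exact: fan_gluing_data.
- by split; [exact: fan_prevariety|exact: fan_compact|exact: fan_affine_diagonal].
- exact: fan_action.
Qed.
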